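(* There is a fully polynomial-time randomized approximation scheme (FPRAS) for the following counting problem: given a Stable Marriage instance $\mathcal{I}=(U,W,\mathcal{P})$, an integer $\ell$ and a matching $M$, compute the number $S^*$ of preference profiles $\mathcal{P}'$ such that $(U,W,\mathcal{P}')$ is at swap distance exactly $\ell$ from $\mathcal{I}$ and $M$ is unstable in $(U,W,\mathcal{P}')$. That is, there is a randomized algorithm that, given additionally $\varepsilon>0$, runs in time polynomial in the input size and $1/\varepsilon$ and outputs a value $S$ with $\Pr(|S-S^*|\le \varepsilon S^* )\ge 3/4$.
   Context: A Stable Marriage (SM) instance $\mathcal{I}=(U,W,\mathcal{P})$ consists of a set $U$ of men and a set $W$ of women; each man has a strict complete order over $W$ and each woman a strict complete order over $U$. A matching is a set of man–woman pairs in which each agent appears at most once. A pair $\{u,w\}$ blocks a matching $M$ if ($u$ prefers $w$ to his partner in $M$ or is unassigned) and ($w$ prefers $u$ to her partner in $M$ or is unassigned); $M$ is stable if no pair blocks it and unstable otherwise. A swap exchanges two neighboring agents in one agent's preference list; the swap distance between $(U,W,\mathcal{P})$ and $(U,W,\mathcal{P}')$ is the minimum number of swaps transforming $\mathcal{P}$ into $\mathcal{P}'$. *)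

(* Defs.v *)
From HB Require Import structures.
From mathcomp Require Import all_boot all_order all_algebra all_fingroup.
Set Implicit Arguments. Unset Strict Implicit. Unset Printing Implicit Defensive.
Import Order.TTheory GRing.Theory Num.Theory.

(* Men are 'I_m, women are 'I_n.  A preference profile gives, for each *)
(* man u, a permutation (P.1 u) : position -> woman (position 0 = most *)
(* preferred), and likewise for each woman.                            *)

Definition profile (m n : nat) : finType :=
  ({ffun 'I_m -> {perm 'I_n}} * {ffun 'I_n -> {perm 'I_m}})%type.

Definition rank_m m n (P : profile m n) (u : 'I_m) (w : 'I_n) : nat :=
  ((P.1 u)^-1)%g w.
Definition rank_w m n (P : profile m n) (w : 'I_n) (u : 'I_m) : nat :=
  ((P.2 w)^-1)%g u.

Definition is_matching m n (M : {set 'I_m * 'I_n}) : Prop :=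
  forall p q, p \in M -> q \in M -> (p.1 = q.1 \/ p.2 = q.2) -> p = q.

(* {u,w} blocks M in profile P: u prefers w to his partner (or is
   unassigned) and w prefers u to her partner (or is unassigned). *)
Definition blocking m n (P : profile m n) (M : {set 'I_m * 'I_n})
    (u : 'I_m) (w : 'I_n) : bool :=
  [forall w' : 'I_n, ((u, w') \in M) ==> (rank_m P u w < rank_m P u w')] &&
  [forall u' : 'I_m, ((u', w) \in M) ==> (rank_w P w u < rank_w P w u')].

Definition unstable m n (P : profile m n) (M : {set 'I_m * 'I_n}) : bool :=
  [exists u, exists w, blocking P M u w].

Definition swap_step m n (P Q : profile m n) : bool :=
  [exists u : 'I_m, exists i : 'I_n, exists j : 'I_n,
     (j == i.+1 :> nat) &&
     (Q.1 == [ffun v => if v == u then (tperm i j * P.1 u)%g else P.1 v]) &&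
     (Q.2 == P.2)]
  ||
  [exists w : 'I_n, exists i : 'I_m, exists j : 'I_m,
     (j == i.+1 :> nat) &&
     (Q.2 == [ffun v => if v == w then (tperm i j * P.2 w)%g else P.2 v]) &&
     (Q.1 == P.1)].

Fixpoint reach m n (k : nat) (P Q : profile m n) : bool :=
  match k with
  | 0 => P == Q
  | k'.+1 => [exists R : profile m n, reach k' P R && swap_step R Q]
  end.

Definition swap_dist_eq m n (P Q : profile m n) (l : nat) : bool :=
  reach l P Q && [forall k : 'I_l, ~~ reach k P Q].

Definition Sstar m n (P : profile m n) (l : nat) (M : {set 'I_m * 'I_n}) : nat :=
  #|[set Q : profile m n | swap_dist_eq P Q l && unstable Q M]|.

(* Computation model: single-tape randomized Turing machines.          *)
(* Tape alphabet 'I_4 : 0, 1 (bits), 2 (separator #), 3 (blank).      *)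
(* At each step the machine reads the symbol under the head and one    *)
(* fresh random bit.  States 'I_k.+1; state 0 is initial, state k      *)
(* (ord_max) is the halting state.  Moves 'I_3: 0 left, 1 stay, 2 right*)

Definition sym := 'I_4.
Definition s0 : sym := inord 0.
Definition s1 : sym := inord 1.
Definition ssep : sym := inord 2.
Definition sblank : sym := inord 3.

Record RTM := {
  nstates : nat;
  delta : {ffun 'I_nstates.+1 * sym * bool -> 'I_nstates.+1 * sym * 'I_3}
}.

Record config (A : RTM) := Config {
  cstate : 'I_(nstates A).+1;
  chead : int;
  ctape : int -> sym
}.

Definition step (A : RTM) (c : config A) (b : bool) : config A :=
  if cstate c == ord_max then c else
  let: (q, s, mv) := delta A (cstate c, ctape c (chead c), b) in
  Config q (chead c + ((mv : nat)%:Z - 1))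
         (fun i => if i == chead c then s else ctape c i).

Fixpoint run (A : RTM) (t : nat) (r : nat -> bool) (c : config A) : config A :=
  match t with
  | 0 => c
  | t'.+1 => step (run t' r c) (r t')
  end.

(* binary encoding of naturals, most significant bit first *)
Definition bin (x : nat) : seq sym :=
  let k := (trunc_log 2 x).+1 in
  [seq (if odd (x %/ 2 ^ (k.-1 - i)) then s1 else s0) | i <- iota 0 k].
Definition enc_nat (x : nat) : seq sym := bin x ++ [:: ssep].
Definition enc_nats (s : seq nat) : seq sym := flatten (map enc_nat s).

(* input encoding: m, n, l, a, b (epsilon = a/b), the preference lists of
   all men then all women, the number of pairs of M and its pairs *)
Definition encode m n (P : profile m n) (l : nat) (M : {set 'I_m * 'I_n})
    (a b : nat) : seq sym :=
  enc_nats ([:: m; n; l; a; b]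
    ++ flatten [seq [seq (nat_of_ord (P.1 u i)) | i <- enum 'I_n] | u <- enum 'I_m]
    ++ flatten [seq [seq (nat_of_ord (P.2 w i)) | i <- enum 'I_m] | w <- enum 'I_n]
    ++ [:: #|M|]
    ++ flatten [seq [:: nat_of_ord p.1; nat_of_ord p.2] | p <- enum M]).

Definition init_config (A : RTM) (x : seq sym) : config A :=
  Config ord0 0%Z
    (fun i => match i with Posz k => nth sblank x k | Negz _ => sblank end).

(* output: the maximal non-blank word starting at the head, read in a
   window of length B (chosen large enough to contain all written cells) *)
Definition read_out (A : RTM) (c : config A) (B : nat) : seq sym :=
  let w := [seq ctape c (chead c + (i%:Z)) | i <- iota 0 B] in
  take (index sblank w) w.

Definition is_bits (s : seq sym) : bool := all (fun c : sym => (c : nat) < 2) s.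
Definition bits_val (s : seq sym) : nat := foldl (fun acc (c : sym) => acc * 2 + c) 0 s.

(* an output word  bin(p) # bin(q) #  denotes the rational p/q *)
Definition decode (s : seq sym) : option (nat * nat) :=
  let i := index ssep s in
  let rest := drop i.+1 s in
  let j := index ssep rest in
  if [&& i < size s, j.+1 == size rest, is_bits (take i s) & is_bits (take j rest)]
  then Some (bits_val (take i s), bits_val (take j rest)) else None.

Definition rext (T : nat) (r : {ffun 'I_T -> bool}) : nat -> bool :=
  fun i => if insub i is Some j then r j else false.

Definition halts_within (A : RTM) (x : seq sym) (T : nat) (r : nat -> bool) : bool :=
  cstate (run T r (init_config A x)) == ord_max.

Definition good_run (A : RTM) (x : seq sym) (T : nat) (r : {ffun 'I_T -> bool})
    (eps : rat) (S : nat) : bool :=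
  let c := run T (rext r) (init_config A x) in
  (cstate c == ord_max) &&
  match decode (read_out c (size x + 2 * T + 1)) with
  | Some (p, q) => (0 < q)%N && (`|p%:Q / q%:Q - S%:Q| <= eps * S%:Q)%R
  | None => false
  end.

(* Main.v *)
Require Import Defs.
From HB Require Import structures.
From mathcomp Require Import all_boot all_order all_algebra all_fingroup.
From mathcomp Require Import zify ring lra.
From Stdlib Require Import FunctionalExtensionality.
Set Implicit Arguments. Unset Strict Implicit. Unset Printing Implicit Defensive.
Import Order.TTheory GRing.Theory Num.Theory.

(** The swap distance of two profiles is the total number of inversions between
    their preference lists.  For a fixed pair [(u, w)], the profiles at distance
    [l] that [(u, w)] blocks are those in which [u] and [w] respect at most one
    order constraint each, between the other one and their partner.  The lists
    of an agent arise by inserting its alternatives one by one, starting with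
    those between the two constrained ones in the original order, so that each
    insertion has a cost depending on its position only, except for one joint
    insertion of the constrained alternatives.  Hence these profiles are counted
    by dynamic programming over the cost, and sampled by unranking.  The unstable
    profiles are the union of these [m * n] sets, whose size is estimated by the
    method of Karp and Luby: draw a pair [(u, w)] and a profile it blocks, with
    total weight [Sigma <= m * n * Sstar], and accept if [(u, w)] is the first
    blocking pair of the profile; Chebyshev's inequality bounds the error.

    The algorithm runs on a Turing machine because it is an expression of a
    total first-order language on binary trees whose only iteration is the fold
    over a list: such an expression takes polynomial time as long as the values
    passed through folds have polynomial size. *)

(** * Structured tape programs and their compilation to machines *)

(** All random bits are drawn in one pass, at times that depend on the input alone. The rest of the
    run is a deterministic function of these bits, so probabilities over random tapes become counts
    of bit strings. The number of bits is thus fixed in advance, which excludes sampling by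
    unbounded rejection: each sample reduces a uniform [W]-bit number modulo [Sigma], and the
    resulting small bias enters the error analysis. With [s] the input length, [W = s * s] makes
    [2 ^ W] exceed every count and every accumulated total. The precision is about [1 / K], where
    [K] is a power of two with [b < a * K] found by doubling. As [4 * m * n <= s], the ratio of
    [Sigma] to the count is at most [s / 4], and [N = 64 * s * K * K] samples bring the failure
    probability given by Chebyshev's inequality down to [1 / 32]. Folds iterate over lists, so
    parameters that steer them are needed in unary although the input is binary. Each is capped on
    conversion: [l] at [W], where no profile is left to count, and the others at [s]. *)

(* A program state is a one-symbol register kept in the finite control, the
   head position and the tape. *)
Definition mstate := (sym * int * (int -> sym))%type.

(* Register, scanned symbol and random bit to new register, written symbol, move. *)
Definition act := sym -> sym -> bool -> sym * sym * 'I_3.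
Definition tst := sym -> sym -> bool.

Inductive cmd :=
| Act of act
| Seq of cmd & cmd
| If of tst & cmd & cmd
| While of tst & cmd.

Definition upd (tp : int -> sym) (h : int) (s : sym) : int -> sym :=
  fun i => if i == h then s else tp i.

Definition do_act (g : act) (s : mstate) (b : bool) : mstate :=
  let: (f, h, tp) := s in
  let: (f', w, mv) := g f (tp h) b in
  (f', (h + ((mv : nat)%:Z - 1))%R, upd tp h w).

Definition tests (p : tst) (s : mstate) : bool :=
  let: (f, h, tp) := s in p f (tp h).

(** Time is absolute, since an action at time [t] consumes the bit [r t]. Each test costs one step,
    which the compiled machine spends on a change of state that leaves head and tape as they are. *)
Inductive exec (r : nat -> bool) :
    cmd -> nat -> mstate -> nat -> mstate -> Prop :=
| ExAct g t s : exec r (Act g) t s t.+1 (do_act g s (r t))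
| ExSeq a b t s t1 s1 t2 s2 :
    exec r a t s t1 s1 -> exec r b t1 s1 t2 s2 -> exec r (Seq a b) t s t2 s2
| ExIfT p a b t s t' s' :
    tests p s -> exec r a t.+1 s t' s' -> exec r (If p a b) t s t' s'
| ExIfF p a b t s t' s' :
    ~~ tests p s -> exec r b t.+1 s t' s' -> exec r (If p a b) t s t' s'
| ExWhileF p a t s : ~~ tests p s -> exec r (While p a) t s t.+1 s
| ExWhileT p a t s t1 s1 t2 s2 :
    tests p s -> exec r a t.+1 s t1 s1 -> exec r (While p a) t1 s1 t2 s2 ->
    exec r (While p a) t s t2 s2.

Fixpoint st (c : cmd) : finType :=
  match c with
  | Act _ => unit
  | Seq a b => (st a + st b)%type
  | If _ a b => option (st a + st b)
  | While _ a => option (st a)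
  end.

Fixpoint start (c : cmd) : st c :=
  match c return st c with
  | Act _ => tt
  | Seq a b => inl (start a)
  | If _ a b => None
  | While _ a => None
  end.

Definition stay : 'I_3 := inord 1.
Definition left3 : 'I_3 := inord 0.
Definition right3 : 'I_3 := inord 2.

(** A result state [None] means that the program is finished. For [If] and [While] the state [None]
    of their own state type is the test, so the exit [None] of a loop body, wrapped into
    [Some None], is a jump back to the test. *)
Fixpoint dlt (c : cmd) :
    st c -> sym -> sym -> bool -> option (st c) * (sym * sym * 'I_3) :=
  match c return st c -> sym -> sym -> bool -> option (st c) * (sym * sym * 'I_3) with
  | Act g => fun _ f x b => (None, g f x b)
  | Seq a b => fun q f x rb =>
      match q with
      | inl q1 => let: (o, w) := dlt q1 f x rb in
                  (Some (if o is Some q' then inl q' else inr (start b)), w)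
      | inr q2 => let: (o, w) := dlt q2 f x rb in (omap inr o, w)
      end
  | If p a b => fun q f x rb =>
      match q with
      | None => (Some (Some (if p f x then inl (start a) else inr (start b))),
                 (f, x, stay))
      | Some (inl q1) => let: (o, w) := dlt q1 f x rb in
                         (omap (fun q' => Some (inl q')) o, w)
      | Some (inr q2) => let: (o, w) := dlt q2 f x rb in
                         (omap (fun q' => Some (inr q')) o, w)
      end
  | While p a => fun q f x rb =>
      match q with
      | None => (if p f x then Some (Some (start a)) else None, (f, x, stay))
      | Some q1 => let: (o, w) := dlt q1 f x rb in (Some o, w)
      end
  end.

Definition fstep (c : cmd) (q : st c) (s : mstate) (b : bool) :
    option (st c) * mstate :=
  let: (f, h, tp) := s in
  let: (o, (f', w, mv)) := dlt q f (tp h) b in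
  (o, (f', (h + ((mv : nat)%:Z - 1))%R, upd tp h w)).

Inductive runs (c : cmd) (r : nat -> bool) :
    nat -> option (st c) * mstate -> nat -> option (st c) * mstate -> Prop :=
| Runs0 t x : runs r t x t x
| RunsS t q s t' y : runs r t.+1 (fstep q s (r t)) t' y ->
    runs r t (Some q, s) t' y.

Lemma runs_trans c r t x t1 y t2 (z : option (st c) * mstate) :
  runs r t x t1 y -> runs r t1 y t2 z -> runs r t x t2 z.
Proof. by elim=> // {}t q s t' {}y _ IH /IH; apply: RunsS. Qed.

(** Embeds a run of a subprogram into the surrounding program. The map [k] acts on optional states
    so that the exit of the subprogram can become the entry of what follows it. *)
Lemma runs_map (c d : cmd) (k : option (st c) -> option (st d)) r
    (Hk : forall q s b, exists2 q', k (Some q) = Some q' &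
       fstep q' s b = (k (fstep q s b).1, (fstep q s b).2)) t x t' y :
  runs r t x t' y -> runs r t (k x.1, x.2) t' (k y.1, y.2).
Proof.
elim=> [{}t {}x|{}t q s {}t' {}y _ IH]; first exact: Runs0.
have [q' /= -> E] := Hk q s (r t).
by apply: RunsS; rewrite E.
Qed.

Lemma upd_same tp h : upd tp h (tp h) = tp.
Proof. by apply: functional_extensionality => i; rewrite /upd; case: eqP => [->|]. Qed.

Lemma stayE (h : int) : (h + (((inord 1 : 'I_3) : nat)%:Z - 1) = h)%R.
Proof. by rewrite inordK //; lia. Qed.

Lemma fstep_stay c (q : st c) s b o :
  (forall f x, dlt q f x b = (o f x, (f, x, stay))) ->
  fstep q s b = (o s.1.1 (s.2 s.1.2), s).
Proof. by case: s => [[f h] tp] E; rewrite /fstep E stayE upd_same. Qed.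

Lemma exec_runs r c t s t' s' : exec r c t s t' s' ->
  runs r t (Some (start c), s) t' (None, s').
Proof.
elim=> {c t s t' s'}.
- move=> g t [[f h] tp]; apply: RunsS; rewrite /fstep /=.
  by case: (g f (tp h) (r t)) => [[f' w] mv]; apply: Runs0.
- move=> a b t s t1 s1 t2 s2 _ R1 _ R2; apply: runs_trans.
    apply: (@runs_map a (Seq a b)
      (fun o => Some (if o is Some q then inl q else inr (start b))) _ _ _ _ _ _ R1).
    move=> q [[f h] tp] rb; eexists; first by [].
    by rewrite /fstep /=; case: dlt => o [[f' w] mv].
  apply: (@runs_map b (Seq a b) (omap inr) _ _ _ _ _ _ R2).
  move=> q [[f h] tp] rb; eexists; first by [].
  by rewrite /fstep /=; case: dlt => o [[f' w] mv].
- move=> p a b t [[f h] tp] t' s' /= Hp _ R; apply: RunsS.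
  rewrite (@fstep_stay (If p a b) None _ _
    (fun f x => Some (Some (if p f x then inl (start a) else inr (start b))))) //= Hp.
  apply: (@runs_map a (If p a b) (omap (fun q => Some (inl q))) _ _ _ _ _ _ R).
  move=> q [[f1 h1] tp1] rb; eexists; first by [].
  by rewrite /fstep /=; case: dlt => o [[f' w] mv].
- move=> p a b t [[f h] tp] t' s' /= /negbTE Hp _ R; apply: RunsS.
  rewrite (@fstep_stay (If p a b) None _ _
    (fun f x => Some (Some (if p f x then inl (start a) else inr (start b))))) //= Hp.
  apply: (@runs_map b (If p a b) (omap (fun q => Some (inr q))) _ _ _ _ _ _ R).
  move=> q [[f1 h1] tp1] rb; eexists; first by [].
  by rewrite /fstep /=; case: dlt => o [[f' w] mv].
- move=> p a t [[f h] tp] /= /negbTE Hp; apply: RunsS.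
  rewrite (@fstep_stay (While p a) None _ _
    (fun f x => if p f x then Some (Some (start a)) else None)) //= Hp.
  exact: Runs0.
- move=> p a t [[f h] tp] t1 s1 t2 s2 /= Hp _ R1 _ R2; apply: RunsS.
  rewrite (@fstep_stay (While p a) None _ _
    (fun f x => if p f x then Some (Some (start a)) else None)) //= Hp.
  apply: runs_trans R2.
  apply: (@runs_map a (While p a) (fun o => Some o) _ _ _ _ _ _ R1).
  move=> q [[f1 h1] tp1] rb; eexists; first by [].
  by rewrite /fstep /=; case: dlt => o [[f' w] mv].
Qed.

(* The initial state of the compiled machine is a fresh one that steps left
   into the program. *)
Section Machine.
Variable c : cmd.
Let Q : finType := (st c * sym)%type.
(** Code 0 is kept for the initial state and the largest code for halting, hence the shift by one.
    The register becomes part of the finite state. *)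
Definition mcode (q : option (st c)) (f : sym) : 'I_(#|Q|.+1).+1 :=
  if q is Some q' then inord (enum_rank (q', f)).+1 else ord_max.

Definition mdelta (x : 'I_(#|Q|.+1).+1 * sym * bool) :
    'I_(#|Q|.+1).+1 * sym * 'I_3 :=
  let: (i, y, b) := x in
  if (i : nat) is j.+1 then
    if insub j is Some k then
      let: (q, f) := enum_val (k : 'I_#|Q|) in
      let: (o, (f', w, mv)) := dlt q f y b in (mcode o f', w, mv)
    else (ord_max, y, stay)
  else (mcode (Some (start c)) sblank, y, left3).

Definition machine : RTM := {| nstates := #|Q|.+1; delta := [ffun x => mdelta x] |}.

Definition mconf (x : option (st c) * mstate) : config machine :=
  let: (q, (f, h, tp)) := x in @Config machine (mcode q f) h tp.

Lemma mcode_neq q f : (mcode (Some q) f == ord_max) = false.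
Proof.
apply/eqP => /(congr1 val) /=; rewrite inordK; last first.
  by rewrite !ltnS; apply: ltnW; apply: ltn_ord.
by move=> [E]; have := ltn_ord (enum_rank (q, f)); rewrite E ltnn.
Qed.

Lemma mconf_step q s b :
  step (mconf (Some q, s)) b = mconf (fstep q s b).
Proof.
case: s => [[f h] tp]; rewrite /step mcode_neq /= ffunE /mdelta.
have lt := ltn_ord (enum_rank (q, f)).
rewrite /mcode.
have -> : (inord (enum_rank (q, f)).+1 : 'I_(#|Q|.+1).+1) = (enum_rank (q, f)).+1 :> nat.
  by rewrite inordK // !ltnS ltnW.
rewrite valK enum_rankK /=.
by case: dlt => o [[f' w] mv].
Qed.

Lemma runs_run r t x t' y : runs r t x t' y -> forall cf : config machine,
  run t r cf = mconf x -> run t' r cf = mconf y.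
Proof.
elim=> // {}t q s {}t' {}y _ IH cf E; apply: IH.
by rewrite /= E mconf_step.
Qed.

Lemma run_halted r t k (cf : config machine) :
  cstate (run t r cf) == ord_max -> run (t + k) r cf = run t r cf.
Proof. by move=> H; elim: k => [|k IH]; rewrite ?addn0 // addnS /= IH /step H. Qed.

Lemma machine_run r x t' f h tp :
  exec r c 1 (sblank, (-1)%R, ctape (init_config machine x)) t' (f, h, tp) ->
  run t' r (init_config machine x) = @Config machine ord_max h tp.
Proof.
move/exec_runs => R; apply: (runs_run R (cf := init_config machine x)).
rewrite /= /step /=.
rewrite ffunE /= inordK //; congr Config.
exact: (@upd_same (ctape (init_config machine x)) 0%R).
Qed.
End Machine.

(** * Five stacks on one tape *)

Inductive track := TA | TB | TC | TD.
Definition tn (k : track) : nat :=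
  match k with TA => 1 | TB => 2 | TC => 3 | TD => 4 end.

(* Stacks are listed top first, except [wR], whose top is its last symbol. *)
Record sigma := Sig { wR : seq sym; wA : seq sym; wB : seq sym;
                      wC : seq sym; wD : seq sym }.
Definition get (k : track) (s : sigma) :=
  match k with TA => wA s | TB => wB s | TC => wC s | TD => wD s end.
Definition set (k : track) (v : seq sym) (s : sigma) : sigma :=
  let: Sig r a b c d := s in
  match k with
  | TA => Sig r v b c d | TB => Sig r a v c d
  | TC => Sig r a b v d | TD => Sig r a b c v end.
Definition setR (v : seq sym) (s : sigma) : sigma :=
  let: Sig r a b c d := s in Sig v a b c d.

(* Cell -1 is the blank home cell.  The word [wR] lies at cells 0, 1, ...; cell
   -2 carries the only separator among the cells -2 - 5i, and cell
   -2 - 5i - [tn k] carries the i-th symbol (from the bottom) of stack [k]. *)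
Record rep (s : sigma) (tp : int -> sym) : Prop := Rep {
  repR : forall i, tp (Posz i) = nth sblank (wR s) i;
  repH : tp (Negz 0) = sblank;
  repS : tp (Negz 1) = ssep;
  repM : forall i, tp (Negz (5 * i.+1).+1) = sblank;
  repK : forall k i, tp (Negz (5 * i + tn k).+1) = nth sblank (rev (get k s)) i;
  repRb : sblank \notin wR s;
  repKb : forall k, sblank \notin get k s }.

(** This makes [n.+1] moves: the recursion has to end in an action, as there is no empty command. *)
Fixpoint mv (d : 'I_3) (n : nat) : cmd :=
  let a := Act (fun f x _ => (f, x, d)) in
  if n is n'.+1 then Seq a (mv d n') else a.

Arguments mv : simpl never.

Lemma symE : (s0 : nat) = 0 /\ (s1 : nat) = 1 /\ (ssep : nat) = 2 /\ (sblank : nat) = 3.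
Proof. by rewrite !inordK. Qed.

Lemma left3E (h : int) : (h + ((left3 : nat)%:Z - 1) = h - 1)%R.
Proof. by rewrite inordK //; lia. Qed.
Lemma right3E (h : int) : (h + ((right3 : nat)%:Z - 1) = h + 1)%R.
Proof. by rewrite inordK //; lia. Qed.

Lemma exec_actE r g t f h tp t' s' :
  t' = t.+1 -> s' = do_act g (f, h, tp) (r t) -> exec r (Act g) t (f, h, tp) t' s'.
Proof. by move=> -> ->; apply: ExAct. Qed.

Lemma exec_mvl r n t f h tp :
  exec r (mv left3 n) t (f, h, tp) (t + n.+1) (f, (h - n.+1%:Z)%R, tp).
Proof.
elim: n t h => [|n IH] t h.
  by apply: exec_actE; rewrite ?addn1 //= left3E upd_same.
apply: ExSeq; first exact: ExAct.
rewrite /= left3E upd_same; have := IH t.+1 (h - 1)%R.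
by rewrite addSnnS; congr exec; congr (_, _, _); lia.
Qed.

Lemma exec_mvr r n t f h tp :
  exec r (mv right3 n) t (f, h, tp) (t + n.+1) (f, (h + n.+1%:Z)%R, tp).
Proof.
elim: n t h => [|n IH] t h.
  by apply: exec_actE; rewrite ?addn1 //= right3E upd_same.
apply: ExSeq; first exact: ExAct.
rewrite /= right3E upd_same; have := IH t.+1 (h + 1)%R.
by rewrite addSnnS; congr exec; congr (_, _, _); lia.
Qed.

Definition nonblank : tst := fun _ x => x != sblank.
Definition nonsep : tst := fun _ x => x != ssep.

(** A stack grows leftwards from its bottom, so its top is found by following its track, one cell in
    five, up to the first blank. With [rc] the register records each symbol passed and ends with the
    top of the stack. *)
Definition walk (rc : bool) : cmd :=
  While nonblank (Seq (Act (fun f x _ => (if rc then x else f, x, left3))) (mv left3 3)).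

Lemma exec_walk r rc j S i t f tp :
  (forall n, tp (Negz (5 * (i + n) + j).+1) = nth sblank S n) ->
  sblank \notin S ->
  exec r (walk rc) t (f, Negz (5 * i + j).+1, tp) (t + 6 * size S + 1)
    (if rc then last f S else f, Negz (5 * (i + size S) + j).+1, tp).
Proof.
elim: S i t f => [|x S IH] i t f H nb.
  rewrite /= !addn0 addn1 if_same; apply: ExWhileF.
  by have := H 0; rewrite /= addn0 /nonblank => ->; rewrite eqxx.
move: nb; rewrite inE negb_or => /andP [nx nb].
have Hx : tp (Negz (5 * i + j).+1) = x by have := H 0; rewrite addn0.
apply: ExWhileT; first by rewrite /= /nonblank Hx eq_sym.
  apply: ExSeq; first exact: ExAct.
  rewrite /= left3E upd_same Hx; exact: exec_mvl.
have := IH i.+1 (t.+2 + 4) (if rc then x else f) _ nb.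
have -> : (Negz (5 * i + j).+1 - 1 - 4 = Negz (5 * i.+1 + j).+1)%R by lia.
rewrite /= (addSnnS i).
have -> : t.+2 + 4 + 6 * size S + 1 = t + 6 * (size S).+1 + 1 by lia.
have -> : (if rc then last (if rc then x else f) S else if rc then x else f)
  = if rc then last x S else f by case: (rc).
by apply=> n; rewrite addSnnS; apply: H.
Qed.

(** The cells [-2 - 5i] form a return lane on which cell [-2] alone carries a separator. The head
    thus finds its way back from any distance without knowing the height of a stack. *)
Definition back : cmd := While nonsep (mv right3 4).

Lemma exec_back r s i t f tp : rep s tp ->
  exec r back t (f, Negz (5 * i).+1, tp) (t + 6 * i + 1) (f, Negz 1, tp).
Proof.
move=> R; elim: i t => [|i IH] t.
  by rewrite !addn0 addn1; apply: ExWhileF; rewrite /= /nonsep (repS R) eqxx.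
apply: ExWhileT; first by rewrite /= /nonsep (repM R) -val_eqE /= !inordK.
  exact: exec_mvr.
have := IH (t.+1 + 5).
have -> : (Negz (5 * i.+1).+1 + 5%:Z = Negz (5 * i).+1)%R by lia.
by have -> : t.+1 + 5 + 6 * i + 1 = t + 6 * i.+1 + 1 by lia.
Qed.

(* [c] takes register [f] and stacks [s] to [f'] and [s'] in at most [n] steps,
   the number of steps being independent of the random bits. *)
Definition T1 c f s f' s' n := forall t tp, rep s tp -> exists t' tp',
  [/\ t' <= t + n, rep s' tp' &
      forall r, exec r c t (f, Negz 0, tp) t' (f', Negz 0, tp')].

Lemma T1_seq a b f s f1 s1 f2 s2 n1 n2 :
  T1 a f s f1 s1 n1 -> T1 b f1 s1 f2 s2 n2 -> T1 (Seq a b) f s f2 s2 (n1 + n2).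
Proof.
move=> Ha Hb t tp R; have [t1 [tp1 [le1 R1 E1]]] := Ha t tp R.
have [t2 [tp2 [le2 R2 E2]]] := Hb t1 tp1 R1.
exists t2, tp2; split=> //; first by lia.
by move=> r; apply: ExSeq; eauto.
Qed.

Lemma T1_le c f s f' s' n n' : T1 c f s f' s' n -> n <= n' -> T1 c f s f' s' n'.
Proof.
move=> H le t tp R; have [t1 [tp1 [le1 R1 E1]]] := H t tp R.
by exists t1, tp1; split=> //; lia.
Qed.

Definition onflag (p : sym -> bool) : tst := fun f _ => p f.

Lemma T1_ift (p : sym -> bool) a b f s f' s' n : p f ->
  T1 a f s f' s' n -> T1 (If (onflag p) a b) f s f' s' n.+1.
Proof.
move=> pf H t tp R; have [t1 [tp1 [le1 R1 E1]]] := H t.+1 tp R.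
exists t1, tp1; split=> //; first by lia.
by move=> r; apply: ExIfT.
Qed.

Lemma T1_iff (p : sym -> bool) a b f s f' s' n : ~~ p f ->
  T1 b f s f' s' n -> T1 (If (onflag p) a b) f s f' s' n.+1.
Proof.
move=> pf H t tp R; have [t1 [tp1 [le1 R1 E1]]] := H t.+1 tp R.
exists t1, tp1; split=> //; first by lia.
by move=> r; apply: ExIfF.
Qed.

Lemma T1_while0 (p : sym -> bool) a f s : ~~ p f ->
  T1 (While (onflag p) a) f s f s 1.
Proof.
move=> pf t tp R; exists t.+1, tp; split=> //; first by lia.
by move=> r; apply: ExWhileF.
Qed.

Lemma T1_whileS (p : sym -> bool) a f s f1 s1 f2 s2 n1 n2 : p f ->
  T1 a f s f1 s1 n1 -> T1 (While (onflag p) a) f1 s1 f2 s2 n2 ->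
  T1 (While (onflag p) a) f s f2 s2 (n1 + n2).+1.
Proof.
move=> pf Ha Hb t tp R; have [t1 [tp1 [le1 R1 E1]]] := Ha t.+1 tp R.
have [t2 [tp2 [le2 R2 E2]]] := Hb t1 tp1 R1.
exists t2, tp2; split=> //; first by lia.
by move=> r; apply: ExWhileT; eauto.
Qed.

Definition setf (w : sym -> sym) : cmd := Act (fun f x _ => (w f, x, stay)).

Lemma T1_setf w f s : T1 (setf w) f s (w f) s 1.
Proof.
move=> t tp R; exists t.+1, tp; split=> //; first by lia.
by move=> r; apply: exec_actE; rewrite //= stayE upd_same.
Qed.

Definition push (k : track) (w : sym -> sym) : cmd :=
  Seq (mv left3 (tn k)) (Seq (walk false)
    (Seq (Act (fun f _ _ => (f, w f, stay)))
      (Seq (mv right3 (tn k).-1) (Seq back (mv right3 0))))).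

(** The register is blanked before the walk, so that it stays blank exactly when the stack is empty;
    in that case there is no cell to erase. *)
Definition pop (k : track) : cmd :=
  Seq (mv left3 (tn k)) (Seq (setf (fun _ => sblank)) (Seq (walk true)
    (Seq (If (onflag (pred1 sblank)) (setf id)
             (Seq (mv right3 4) (Act (fun f _ _ => (f, sblank, stay)))))
      (Seq (mv right3 (tn k).-1) (Seq back (mv right3 0)))))).

Lemma get_set k k' v s : get k' (set k v s) =
  if tn k' == tn k then v else get k' s.
Proof. by case: s => r a b c d; case: k; case: k'. Qed.
Lemma wR_set k v s : wR (set k v s) = wR s.
Proof. by case: s => r a b c d; case: k. Qed.

Lemma tn_bnd k : 1 <= tn k <= 4. Proof. by case: k. Qed.

Lemma rep_set k v s tp n x : rep s tp -> sblank \notin v ->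
  (forall i, nth sblank (rev v) i = if i == n then x else nth sblank (rev (get k s)) i) ->
  rep (set k v s) (upd tp (Negz (5 * n + tn k).+1) x).
Proof.
move=> R nb H; have := tn_bnd k => bk; split.
- by move=> i; rewrite /upd /= wR_set (repR R).
- by rewrite /upd /= (repH R).
- rewrite /upd; case: eqP => [E|_]; last exact: (repS R).
  by lia.
- move=> i; rewrite /upd; case: eqP => [E|_]; last exact: (repM R).
  by lia.
- move=> k' i; rewrite /upd get_set; have := tn_bnd k' => bk'; case: eqP => [E|E].
    have [-> ->] : tn k' = tn k /\ i = n by lia.
    by rewrite eqxx H eqxx.
  rewrite (repK R); case: eqP => // E2.
  have -> : get k' s = get k s by move: E2; case: (k); case: (k').
  by rewrite H; case: eqP => // E3; case: E; rewrite E2 E3.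
- by rewrite wR_set; apply: repRb R.
by move=> k'; rewrite get_set; case: eqP => // _; apply: repKb R _.
Qed.

Lemma T1_push k w f s : w f != sblank ->
  T1 (push k w) f s f (set k (w f :: get k s) s) (24 * (size (get k s)).+1).
Proof.
move=> nb t tp R; have := tn_bnd k => bk.
set n := size (get k s).
have R' : rep (set k (w f :: get k s) s) (upd tp (Negz (5 * n + tn k).+1) (w f)).
  apply: rep_set => //.
    by rewrite inE negb_or (repKb R) eq_sym nb.
  move=> i; rewrite rev_cons nth_rcons size_rev -/n.
  case: ltngtP => // ni; rewrite nth_default //.
  by rewrite size_rev ltnW.
exists (t + (tn k).+1 + (6 * n + 1) + 1 + (tn k) + (6 * n + 1) + 1),
  (upd tp (Negz (5 * n + tn k).+1) (w f)).
split=> //; first by lia.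
move=> r; apply: ExSeq; first exact: exec_mvl.
have -> : (Negz 0 - (tn k).+1%:Z = Negz (5 * 0 + tn k).+1)%R by lia.
apply: ExSeq.
  apply: (@exec_walk r false (tn k) (rev (get k s)) 0).
    by move=> i; rewrite add0n (repK R).
  by rewrite mem_rev; apply: (repKb R).
rewrite /= size_rev add0n -/n; apply: ExSeq.
  by apply: exec_actE; [by []|rewrite /= stayE].
apply: ExSeq; first exact: exec_mvr.
rewrite prednK; last by case/andP: bk.
have -> : (Negz (5 * n + tn k).+1 + (tn k)%:Z = Negz (5 * n).+1)%R by lia.
apply: ExSeq; first by apply: exec_back; apply: R'.
have -> : t + (tn k).+1 + (6 * n + 1) + 1 + tn k + (6 * n + 1) + 1 =
  (t + (tn k).+1 + 6 * n + 1).+1 + tn k + 6 * n + 1 + 1 by lia.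
have -> : Negz 0 = (Negz 1 + 1%:Z)%R by lia.
exact: exec_mvr.
Qed.

Lemma T1_pop k f s :
  T1 (pop k) f s (head sblank (get k s)) (set k (behead (get k s)) s)
    (24 * (size (get k s)).+1).
Proof.
move=> t tp R; have := tn_bnd k => bk.
have E0 r t0 f0 : exec r (setf (fun=> sblank)) t0 (f0, Negz (tn k).+1, tp) t0.+1
    (sblank, Negz (tn k).+1, tp).
  by apply: exec_actE; rewrite //= stayE upd_same.
have E1 r t0 f0 h : exec r (setf id) t0 (f0, h, tp) t0.+1 (f0, h, tp).
  by apply: exec_actE; rewrite //= stayE upd_same.
case E: (get k s) => [|x S].
  exists (t + (tn k).+1 + 1 + 1 + 2 + tn k + 1 + 1), tp; split; first by rewrite /=; lia.
    suff -> : set k (behead [::]) s = s by [].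
    by case: (s) E => ? ? ? ? ?; case: (k) => //= ->.
  move=> r; apply: ExSeq; first exact: exec_mvl.
  have -> : (Negz 0 - (tn k).+1%:Z = Negz (5 * 0 + tn k).+1)%R by lia.
  apply: ExSeq; first exact: E0.
  apply: ExSeq.
    apply: (@exec_walk r true (tn k) [::] 0) => //.
    by move=> i; rewrite add0n (repK R) E.
  rewrite /=; apply: ExSeq.
    apply: ExIfT; first by rewrite /= /onflag /= eqxx.
    exact: E1.
  apply: ExSeq; first exact: exec_mvr.
  rewrite prednK; last by case/andP: bk.
  have -> : (Negz (5 * (0 + 0) + tn k).+1 + (tn k)%:Z = Negz (5 * 0).+1)%R by lia.
  apply: ExSeq; first by apply: exec_back; apply: R.
  have -> : Negz 0 = (Negz 1 + 1%:Z)%R by lia.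
  have -> : t + (tn k).+1 + 1 + 1 + 2 + tn k + 1 + 1 =
    (((t + (tn k).+1).+1 + 6 * 0 + 1).+2 + tn k + 6 * 0 + 1) + 1 by lia.
  exact: exec_mvr.
have nb : sblank \notin x :: S by rewrite -E; apply: repKb R _.
move: (nb); rewrite inE negb_or => /andP [nx nS].
set n := size S.
have R' : rep (set k S s) (upd tp (Negz (5 * n + tn k).+1) sblank).
  apply: rep_set => // i; rewrite E rev_cons nth_rcons size_rev -/n.
  case: ltngtP => // ni; rewrite nth_default // size_rev ?ni ?leqnn //.
  exact: ltnW.
exists (t + (tn k).+1 + 1 + (6 * n.+1 + 1) + 1 + 5 + 1 + (tn k) + (6 * n + 1) + 1),
  (upd tp (Negz (5 * n + tn k).+1) sblank).
split=> //; first by rewrite /= -/n; lia.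
move=> r; apply: ExSeq; first exact: exec_mvl.
have -> : (Negz 0 - (tn k).+1%:Z = Negz (5 * 0 + tn k).+1)%R by lia.
apply: ExSeq; first exact: E0.
apply: ExSeq.
  apply: (@exec_walk r true (tn k) (rev (get k s)) 0).
    by move=> i; rewrite add0n (repK R).
  by rewrite mem_rev; apply: (repKb R).
rewrite E rev_cons last_rcons size_rcons size_rev -/n add0n; apply: ExSeq.
  apply: ExIfF; first by rewrite /= /onflag /= eq_sym.
  apply: ExSeq; first exact: exec_mvr.
  have -> : (Negz (5 * n.+1 + tn k).+1 + 5%:Z = Negz (5 * n + tn k).+1)%R by lia.
  by apply: exec_actE; [by []|rewrite /= stayE].
apply: ExSeq; first exact: exec_mvr.
rewrite prednK; last by case/andP: bk.
have -> : (Negz (5 * n + tn k).+1 + (tn k)%:Z = Negz (5 * n).+1)%R by lia.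
apply: ExSeq; first by apply: exec_back; apply: R'.
have -> : t + (tn k).+1 + 1 + (6 * n.+1 + 1) + 1 + 5 + 1 + tn k + (6 * n + 1) + 1 =
  (((t + (tn k).+1).+1 + 6 * n.+1 + 1).+1 + 5).+1 + tn k + 6 * n + 1 + 1 by lia.
have -> : Negz 0 = (Negz 1 + 1%:Z)%R by lia.
exact: exec_mvr.
Qed.

Definition bsym (b : bool) : sym := if b then s1 else s0.

Definition walkR (rc : bool) : cmd :=
  While nonblank (Act (fun f x _ => (if rc then x else f, x, right3))).
Definition backR : cmd := While nonblank (mv left3 0).

Lemma exec_walkR r rc S i t f tp :
  (forall n, tp (Posz (i + n)) = nth sblank S n) -> sblank \notin S ->
  exec r (walkR rc) t (f, Posz i, tp) (t + 2 * size S + 1)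
    (if rc then last f S else f, Posz (i + size S), tp).
Proof.
elim: S i t f => [|x S IH] i t f H nb.
  rewrite /= !addn0 addn1 if_same; apply: ExWhileF.
  by have := H 0; rewrite /= addn0 /nonblank => ->; rewrite eqxx.
move: nb; rewrite inE negb_or => /andP [nx nb].
have Hx : tp (Posz i) = x by have := H 0; rewrite addn0.
apply: ExWhileT; first by rewrite /= /nonblank Hx eq_sym.
  exact: ExAct.
rewrite /= right3E upd_same Hx.
have := IH i.+1 t.+2 (if rc then x else f) _ nb.
have -> : (Posz i + 1 = Posz i.+1)%R by lia.
rewrite (addSnnS i).
have -> : t.+2 + 2 * size S + 1 = t + 2 * (size S).+1 + 1 by lia.
have -> : (if rc then last (if rc then x else f) S else if rc then x else f)
  = if rc then last x S else f by case: (rc).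
by apply=> n; rewrite addSnnS; apply: H.
Qed.

Lemma exec_backR r s n t f tp : rep s tp -> n <= size (wR s) ->
  exec r backR t (f, (Posz n - 1)%R, tp) (t + 2 * n + 1) (f, Negz 0, tp).
Proof.
move=> R; elim: n t => [|n IH] t le.
  rewrite !addn0 addn1; have -> : (0%:Z - 1 = Negz 0)%R by lia.
  by apply: ExWhileF; rewrite /= /nonblank (repH R) eqxx.
have -> : (n.+1%:Z - 1 = Posz n)%R by lia.
apply: ExWhileT.
- rewrite /= /nonblank (repR R); apply/negP => /eqP E.
  by have := repRb R; rewrite -E mem_nth.
- exact: exec_mvl.
have := IH (t.+1 + 1) (ltnW le).
by have -> : t.+1 + 1 + 2 * n + 1 = t + 2 * n.+1 + 1 by lia.
Qed.

Lemma get_setR k v s : get k (setR v s) = get k s.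
Proof. by case: s => ? ? ? ? ?; case: k. Qed.
Lemma wR_setR v s : wR (setR v s) = v.
Proof. by case: s. Qed.

Lemma rep_setR v s tp n x : rep s tp -> sblank \notin v ->
  (forall i, nth sblank v i = if i == n then x else nth sblank (wR s) i) ->
  rep (setR v s) (upd tp (Posz n) x).
Proof.
move=> R nb H; split.
- move=> i; rewrite /upd wR_setR H; case: eqP => [[->]|E]; first by rewrite eqxx.
  by rewrite (repR R); case: eqP => // E2; case: E; rewrite E2.
- exact: repH R.
- exact: repS R.
- exact: repM R.
- by move=> k i; rewrite /upd get_setR; apply: repK R k i.
- by rewrite wR_setR.
by move=> k; rewrite get_setR; apply: repKb R k.
Qed.

Definition pushR (w : sym -> sym) : cmd :=
  Seq (mv right3 0) (Seq (walkR false)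
    (Seq (Act (fun f _ _ => (f, w f, left3))) backR)).
Definition popR : cmd :=
  Seq (mv right3 0) (Seq (setf (fun _ => sblank)) (Seq (walkR true)
    (Seq (mv left3 0) (If (onflag (pred1 sblank)) (setf id)
       (Seq (Act (fun f _ _ => (f, sblank, left3))) backR))))).

Lemma T1_pushR w f s : w f != sblank ->
  T1 (pushR w) f s f (setR (rcons (wR s) (w f)) s) (24 * (size (wR s)).+1).
Proof.
move=> nb t tp R; set n := size (wR s).
have R' : rep (setR (rcons (wR s) (w f)) s) (upd tp (Posz n) (w f)).
  apply: rep_setR => //.
    by rewrite mem_rcons inE negb_or (repRb R) eq_sym nb.
  move=> i; rewrite nth_rcons -/n.
  by case: ltngtP => // ni; rewrite nth_default // ltnW.
exists (t + 1 + (2 * n + 1) + 1 + (2 * n + 1)), (upd tp (Posz n) (w f)).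
split=> //; first by lia.
move=> r; apply: ExSeq; first exact: exec_mvr.
have -> : (Negz 0 + 1%:Z = Posz 0)%R by lia.
apply: ExSeq.
  apply: (@exec_walkR r false (wR s) 0); first by move=> i; rewrite add0n (repR R).
  exact: repRb R.
rewrite add0n -/n; apply: ExSeq.
  by apply: exec_actE; [by []|rewrite /= left3E].
have -> : t + 1 + (2 * n + 1) + 1 + (2 * n + 1) = (t + 1 + 2 * n + 1).+1 + 2 * n + 1 by lia.
by apply: (exec_backR _ _ _ R'); rewrite wR_setR size_rcons.
Qed.

Lemma T1_popR0 f s : wR s = [::] -> T1 popR f s sblank s 24.
Proof.
move=> E t tp R; exists (t + 6), tp; split=> //; first by lia.
move=> r; apply: ExSeq; first exact: exec_mvr.
have -> : (Negz 0 + 1%:Z = Posz 0)%R by lia.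
apply: ExSeq.
  by apply: (exec_actE (s' := (sblank, Posz 0, tp))); rewrite //= stayE upd_same.
apply: ExSeq.
  apply: (@exec_walkR r true [::] 0) => //.
  by move=> i; rewrite add0n (repR R) E.
apply: ExSeq; first exact: exec_mvl.
have -> : (Posz (0 + size ([::] : seq sym)) - 1%:Z = Negz 0)%R by rewrite /=; lia.
apply: ExIfT; first by rewrite /= /onflag /= eqxx.
by apply: exec_actE => /=; [lia|rewrite stayE upd_same].
Qed.

Lemma T1_popR f s S x : wR s = rcons S x ->
  T1 popR f s x (setR S s) (24 * (size S).+1).
Proof.
move=> E t tp R; set n := size S.
have nb : sblank \notin rcons S x by rewrite -E; apply: repRb R.
move: (nb); rewrite mem_rcons inE negb_or => /andP [nx nS].
have R' : rep (setR S s) (upd tp (Posz n) sblank).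
  apply: rep_setR => // i; rewrite E nth_rcons -/n.
  by case: ltngtP => // ni; rewrite nth_default // -/n ?ni // ltnW.
exists (t + 1 + 1 + (2 * n.+1 + 1) + 1 + 1 + 1 + (2 * n + 1)), (upd tp (Posz n) sblank).
split=> //; first by lia.
move=> r; apply: ExSeq; first exact: exec_mvr.
have -> : (Negz 0 + 1%:Z = Posz 0)%R by lia.
apply: ExSeq.
  by apply: (exec_actE (s' := (sblank, Posz 0, tp))); rewrite //= stayE upd_same.
apply: ExSeq.
  apply: (@exec_walkR r true (wR s) 0); first by move=> i; rewrite add0n (repR R).
  exact: repRb R.
rewrite E last_rcons size_rcons -/n add0n.
apply: ExSeq; first exact: exec_mvl.
have -> : (Posz n.+1 - 1%:Z = Posz n)%R by lia.
apply: ExIfF; first by rewrite /= /onflag /= eq_sym.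
apply: ExSeq.
  by apply: exec_actE; [by []|rewrite /= left3E].
have -> : t + 1 + 1 + (2 * n.+1 + 1) + 1 + 1 + 1 + (2 * n + 1) =
   ((t + 1).+1 + 2 * n.+1 + 1 + 1).+2 + 2 * n + 1 by lia.
by apply: (exec_backR _ _ _ R'); rewrite wR_setR.
Qed.

(** [TB] holds as many symbols as random bits are wanted, and each is overwritten by a fresh bit.
    One round of the loop takes six time units, so the bits come from distinct times fixed by the
    starting time. *)
Definition fill : cmd :=
  Seq (mv left3 (tn TB)) (Seq
    (While nonblank (Seq (Act (fun f _ b => (f, bsym b, left3))) (mv left3 3)))
      (Seq (mv right3 (tn TB).-1) (Seq back (mv right3 0)))).

Lemma exec_fillwalk r S i t f tp :
  (forall n, tp (Negz (5 * (i + n) + 2).+1) = nth sblank S n) ->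
  sblank \notin S ->
  exists2 tp', exec r (While nonblank
      (Seq (Act (fun f _ b => (f, bsym b, left3))) (mv left3 3)))
    t (f, Negz (5 * i + 2).+1, tp) (t + 6 * size S + 1)
    (f, Negz (5 * (i + size S) + 2).+1, tp')
  & (forall n, n < size S -> tp' (Negz (5 * (i + n) + 2).+1) = bsym (r (t + 1 + 6 * n)))
  /\ (forall p, (forall n, n < size S -> p != Negz (5 * (i + n) + 2).+1) -> tp' p = tp p).
Proof.
elim: S i t tp => [|x S IH] i t tp H nb.
  exists tp => //; rewrite /= !addn0 addn1; apply: ExWhileF.
  by have := H 0; rewrite /= addn0 /nonblank => ->; rewrite eqxx.
move: nb; rewrite inE negb_or => /andP [nx nb].
have Hx : tp (Negz (5 * i + 2).+1) = x by have := H 0; rewrite addn0.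
have [n|tp' E [V1 V2]] := IH i.+1 (t.+2 + 4) (upd tp (Negz (5 * i + 2).+1) (bsym (r t.+1))) _ nb.
  rewrite -[nth _ S n]/(nth sblank (x :: S) n.+1) -(H n.+1) addSnnS /upd.
  by case: eqP => // E; lia.
exists tp'; last split.
- apply: ExWhileT; first by rewrite /= /nonblank Hx eq_sym.
    apply: ExSeq; first exact: ExAct.
    rewrite /= left3E; exact: exec_mvl.
  have -> : (Negz (5 * i + 2).+1 - 1 - 4 = Negz (5 * i.+1 + 2).+1)%R by lia.
  move: E; rewrite (addSnnS i).
  by have -> : t.+2 + 4 + 6 * size S + 1 = t + 6 * (size S).+1 + 1 by lia.
- move=> [_|n ln].
    rewrite addn0 muln0 addn0 V2 /upd ?eqxx ?addn1 // => n _; apply/eqP; lia.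
  by rewrite -(addSnnS i) V1 //; congr (bsym (r _)); lia.
move=> p Hp; rewrite V2.
  by rewrite /upd -[X in _ * X + 2]addn0 (negbTE (Hp 0 _)).
by move=> n ln; rewrite addSnnS; apply: Hp.
Qed.

(** [T1] does not apply, as the final tape depends on [r]; the end time is nevertheless chosen
    before [r]. The first bit is read at time [t + 4], after three moves to the track and one
    test. *)
Lemma exec_fill s t f tp : rep s tp ->
  exists2 t', t' <= t + 24 * (size (wB s)).+1 & forall r, exists2 tp',
    rep (set TB (rev [seq bsym (r (t + 4 + 6 * i)) | i <- iota 0 (size (wB s))]) s) tp'
  & exec r fill t (f, Negz 0, tp) t' (f, Negz 0, tp').
Proof.
move=> R; set n := size (wB s).
exists (t + 3 + (6 * n + 1) + 2 + (6 * n + 1) + 1); first by lia.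
move=> r.
have [|| tp' E [V1 V2]] := @exec_fillwalk r (rev (wB s)) 0 (t + 3) f tp.
- by move=> i; rewrite add0n; apply: (repK R TB).
- by rewrite mem_rev; apply: (repKb R TB).
rewrite size_rev -/n in E V1 V2.
have R' : rep (set TB (rev [seq bsym (r (t + 4 + 6 * i)) | i <- iota 0 n]) s) tp'.
  split.
  - by move=> i; rewrite wR_set -(repR R) V2.
  - by rewrite V2 ?(repH R).
  - by rewrite V2 ?(repS R) // => j lj; apply/eqP; lia.
  - move=> i; rewrite V2 ?(repM R) // => j lj; apply/eqP; lia.
  - move=> k i; rewrite get_set.
    have [ek|nk] := eqVneq (tn k) (tn TB).
      have -> : k = TB by case: (k) ek.
      rewrite revK; case: (ltnP i n) => ni.
        by rewrite -[5 * i]/(5 * (0 + i)) V1 // (nth_map 0) ?size_iota // nth_iota //; congr (bsym (r _)); lia.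
      rewrite nth_default ?size_map ?size_iota // V2.
        rewrite (repK R TB) nth_default // size_rev //.
      by move=> j lj; apply/eqP => /=; lia.
    rewrite -(repK R); apply: V2 => j lj; apply/eqP.
    by have := tn_bnd k; move: nk => /= /eqP; lia.
  - by rewrite wR_set; apply: repRb R.
  move=> k; rewrite get_set; case: eqP => _; last exact: repKb R k.
  rewrite mem_rev; apply/mapP => -[j _]; case: (r _) => /(congr1 val) /=; by rewrite !inordK.
exists tp' => //; apply: ExSeq; first exact: exec_mvl.
have -> : (Negz 0 - (tn TB).+1%:Z = Negz (5 * 0 + 2).+1)%R by [].
apply: ExSeq; first exact: E.
apply: ExSeq; first exact: exec_mvr.
have -> : (Negz (5 * (0 + n) + 2).+1 + (tn TB).-1.+1%:Z = Negz (5 * n).+1)%R by rewrite /=; lia.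
apply: ExSeq; first by apply: exec_back; apply: R'.
have -> : t + 3 + (6 * n + 1) + 2 + (6 * n + 1) + 1 =
  t + 3 + 6 * n + 1 + (tn TB).-1.+1 + 6 * n + 1 + 1 by rewrite /=; lia.
have -> : Negz 0 = (Negz 1 + 1%:Z)%R by lia.
exact: exec_mvr.
Qed.

(* From home, install the separator of cell -2. *)
Definition prelude : cmd :=
  Seq (mv left3 0) (Seq (Act (fun f _ _ => (f, ssep, stay))) (mv right3 0)).

Lemma exec_prelude (x : seq sym) t f A : sblank \notin x -> exists2 tp',
  rep (Sig x [::] [::] [::] [::]) tp' & forall r,
  exec r prelude t (f, Negz 0, ctape (init_config A x)) (t + 3) (f, Negz 0, tp').
Proof.
move=> nb; exists (upd (ctape (init_config A x)) (Negz 1) ssep).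
  split=> //; rewrite /upd.
  - by move=> k i; case: eqP => [E|_]; [have := tn_bnd k; lia|case: k; rewrite /= nth_nil].
  by case.
move=> r; apply: ExSeq; first exact: exec_mvl.
apply: ExSeq; first by apply: exec_actE; [by []|rewrite /= stayE].
have -> : (Negz 0 = Negz 0 - 1%:Z + 1%:Z)%R by lia.
have -> : t + 3 = (t + 1).+1 + 1 by lia.
exact: exec_mvr.
Qed.

(** * Binary trees on a stack *)

Inductive tree := Lf | Nd of tree & tree.

(* In this prefix code, a stack holding the codes of [a] and [b] becomes one
   holding the code of [Nd a b] by pushing a single symbol. *)
Fixpoint code (d : tree) : seq sym :=
  if d is Nd a b then s1 :: code a ++ code b else [:: s0].
Fixpoint sz (d : tree) : nat := if d is Nd a b then (sz a + sz b).+1 else 1.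
Definition codes (ds : seq tree) : seq sym := flatten (map code ds).

Lemma size_code d : size (code d) = sz d.
Proof. by elim: d => //= a IHa b IHb; rewrite size_cat IHa IHb. Qed.
Lemma sz_gt0 d : 0 < sz d. Proof. by case: d. Qed.

Lemma s0_blank : s0 != sblank. Proof. by rewrite -val_eqE /= !inordK. Qed.
Lemma s1_blank : s1 != sblank. Proof. by rewrite -val_eqE /= !inordK. Qed.
Lemma s0_s1 : s0 != s1. Proof. by rewrite -val_eqE /= !inordK. Qed.

Lemma code_blank d : sblank \notin code d.
Proof.
elim: d => [|a IHa b IHb] /=; first by rewrite inE eq_sym s0_blank.
by rewrite inE mem_cat !negb_or eq_sym s1_blank IHa.
Qed.

Definition live : sym -> bool := fun f => f != sblank.

(** A node replaces one pending tree by two and a leaf completes one. Two pushes or none, followed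
    by one pop, realize this balance on [TC]; the pop leaves a blank in the register when no tree is
    pending, which ends the loop. *)
Definition mbody (tb td : bool) : cmd :=
  Seq (pop TA) (Seq (if tb then push TB id else setf id)
    (Seq (if td then push TD id else setf id)
      (Seq (If (onflag (pred1 s1)) (Seq (push TC (fun _ => s1)) (push TC (fun _ => s1)))
              (setf id)) (pop TC)))).

(* Removes the top tree of [TA], copying it to [TB] and/or [TD]; the height of
   [TC] is the number of trees that remain to be read after the current one. *)
Definition mval (tb td : bool) : cmd :=
  Seq (setf (fun _ => s1)) (While (onflag live) (mbody tb td)).

Definition addif (t : bool) (u v : seq sym) := if t then u ++ v else v.

Lemma T1_conv c f s f' s' n f0 s0 f0' s0' n0 :
  T1 c f0 s0 f0' s0' n0 -> f0 = f -> s0 = s -> f0' = f' -> s0' = s' -> n0 <= n ->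
  T1 c f s f' s' n.
Proof. by move=> H <- <- <- <-; apply: T1_le H. Qed.

Opaque T1.

Lemma T1_optB (t : bool) f w a b c d M : f != sblank -> size b <= M ->
  T1 (if t then push TB id else setf id) f (Sig w a b c d) f
     (Sig w a (addif t [:: f] b) c d) (24 * M.+1).
Proof.
move=> nf le; case: t.
  by apply: T1_conv (@T1_push TB id f (Sig w a b c d) nf) _ _ _ _ _ => //=; lia.
by apply: T1_conv (@T1_setf id f (Sig w a b c d)) _ _ _ _ _ => //=; lia.
Qed.

Lemma T1_optD (t : bool) f w a b c d M : f != sblank -> size d <= M ->
  T1 (if t then push TD id else setf id) f (Sig w a b c d) f
     (Sig w a b c (addif t [:: f] d)) (24 * M.+1).
Proof.
move=> nf le; case: t.
  by apply: T1_conv (@T1_push TD id f (Sig w a b c d) nf) _ _ _ _ _ => //=; lia.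
by apply: T1_conv (@T1_setf id f (Sig w a b c d)) _ _ _ _ _ => //=; lia.
Qed.

Lemma T1_mbody0 tb td (x : sym) (a b : seq sym) k d w M : x != s1 -> x != sblank ->
  size a + size b + size d + k <= M ->
  T1 (mbody tb td) s1 (Sig w (x :: a) b (nseq k s1) d)
    (head sblank (nseq k s1))
    (Sig w a (addif tb [:: x] b) (behead (nseq k s1)) (addif td [:: x] d))
    (150 * M.+2).
Proof.
move=> n1 nb le.
eapply T1_le.
  eapply T1_seq; first by eapply T1_pop.
  eapply T1_seq; first by apply: (@T1_optB _ x _ _ _ _ _ M) => //=; lia.
  eapply T1_seq; first by apply: (@T1_optD _ x _ _ _ _ _ M) => //=; lia.
  eapply T1_seq; first by apply: T1_iff => //; eapply (T1_setf id).
  by eapply (T1_pop TC).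
by rewrite /= ?size_nseq; lia.
Qed.

Lemma T1_mbody1 tb td a b k d w M :
  size a + size b + size d + k <= M ->
  T1 (mbody tb td) s1 (Sig w (s1 :: a) b (nseq k s1) d) s1
    (Sig w a (addif tb [:: s1] b) (nseq k.+1 s1) (addif td [:: s1] d))
    (200 * M.+2).
Proof.
move=> le.
eapply T1_le.
  eapply T1_seq; first by eapply T1_pop.
  eapply T1_seq; first by apply: (@T1_optB _ s1 _ _ _ _ _ M) => //=; [exact: s1_blank|lia].
  eapply T1_seq; first by apply: (@T1_optD _ s1 _ _ _ _ _ M) => //=; [exact: s1_blank|lia].
  eapply T1_seq.
    apply: T1_ift; first exact: eqxx.
    eapply T1_seq; first by eapply (T1_push _ s1_blank).
    by eapply (T1_push _ s1_blank).
  by eapply (T1_pop TC).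
by rewrite /= ?size_nseq; lia.
Qed.

Lemma addif_cat t u v x : addif t u (addif t v x) = addif t (u ++ v) x.
Proof. by case: t; rewrite /addif ?catA. Qed.
Lemma size_addif t u v : size (addif t u v) <= size u + size v.
Proof. by case: t; rewrite /= ?size_cat //; lia. Qed.

(** A single loop reads both subtrees of a node, so the induction on [v] needs a continuation form:
    the hypothesis is a bound for the remainder of the loop once [v] has been read. *)
Lemma T1_mloop tb td M w f2 s2 v : forall a b k d n,
  sz v + size a + size b + size d + k + sz v <= M ->
  T1 (While (onflag live) (mbody tb td)) (head sblank (nseq k s1))
    (Sig w a (addif tb (rev (code v)) b) (behead (nseq k s1))
       (addif td (rev (code v)) d)) f2 s2 n ->
  T1 (While (onflag live) (mbody tb td)) s1 (Sig w (code v ++ a) b (nseq k s1) d)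
    f2 s2 (n + 300 * M.+2 * sz v).
Proof.
elim: v => [|x IHx y IHy] a b k d n le H.
  apply: T1_le.
    apply: (@T1_whileS live) => //; first exact: s1_blank.
      by apply: (@T1_mbody0 tb td s0 a b k d w M) => //=; rewrite ?s0_s1 ?s0_blank //; move: le => /=; lia.
    exact: H.
  by rewrite /=; lia.
have hb t u := size_addif t [:: s1] u.
have sx := sz_gt0 x; have sy := sz_gt0 y.
rewrite /= in le.
have -> : code (Nd x y) ++ a = s1 :: code x ++ code y ++ a by rewrite /= catA.
apply: T1_le.
  apply: (@T1_whileS live) => //; first exact: s1_blank.
    apply: (@T1_mbody1 tb td (code x ++ code y ++ a) b k d w M).
    by rewrite !size_cat !size_code; lia.
  apply: (IHx (code y ++ a) _ k.+1).
    have := hb tb b; have := hb td d; rewrite /= !size_cat !size_code; lia.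
  rewrite /=; apply: IHy; last first.
    rewrite !addif_cat.
    have -> : (rev (code y) ++ rev (code x)) ++ [:: s1] = rev (code (Nd x y)).
      by rewrite /= rev_cons rev_cat -cats1.
    exact: H.
  have := size_addif tb (rev (code x)) (addif tb [:: s1] b).
  have := size_addif td (rev (code x)) (addif td [:: s1] d).
  have := hb tb b; have := hb td d; rewrite /= !size_rev !size_code; lia.
rewrite /= [_ * (_ + _).+1]mulnS [_ * (_ + _)]mulnDr; lia.
Qed.

Lemma T1_mval tb td M w f v a b d :
  2 * sz v + size a + size b + size d <= M ->
  T1 (mval tb td) f (Sig w (code v ++ a) b [::] d) sblank
    (Sig w a (addif tb (rev (code v)) b) [::] (addif td (rev (code v)) d))
    (302 * M.+2 * sz v).
Proof.
move=> le; apply: T1_le.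
  apply: T1_seq; first exact: T1_setf.
  apply: (@T1_mloop tb td M w _ _ v a b 0 d 1); first by lia.
  by apply: (@T1_while0 live); rewrite /live negbK.
have := sz_gt0 v; move: (sz v) le => k le; nia.
Qed.

Definition restore (k : track) : cmd :=
  Seq (pop k) (While (onflag live) (Seq (push TA id) (pop k))).

Lemma T1_restoreB M w f a (b d : seq sym) : sblank \notin b -> size a + size b <= M ->
  T1 (restore TB) f (Sig w a b [::] d) sblank (Sig w (rev b ++ a) [::] [::] d)
    (100 * M.+2 * (size b).+1).
Proof.
move=> nb le; eapply T1_le; first (eapply T1_seq; first by eapply T1_pop).
  rewrite /=; instantiate (1 := 76 * M.+2 * (size b).+1).
  elim: b a nb le => [|x b IH] a nb le.
    by apply: T1_le; [apply: (@T1_while0 live); rewrite /live negbK|lia].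
  move: nb; rewrite inE negb_or => /andP [nx nb]; rewrite /= in le.
  eapply T1_le.
    eapply (@T1_whileS live); first by rewrite /live eq_sym.
      eapply T1_seq; first by eapply (@T1_push TA id); rewrite eq_sym.
      by eapply (T1_pop TB).
    rewrite rev_cons -cats1 -catA; apply: (IH (x :: a)) => //=; lia.
  rewrite /= !mulnS; lia.
rewrite /=; nia.
Qed.

Lemma T1_restoreD M w f a (d : seq sym) : sblank \notin d -> size a + size d <= M ->
  T1 (restore TD) f (Sig w a [::] [::] d) sblank (Sig w (rev d ++ a) [::] [::] [::])
    (100 * M.+2 * (size d).+1).
Proof.
move=> nb le; eapply T1_le; first (eapply T1_seq; first by eapply T1_pop).
  rewrite /=; instantiate (1 := 76 * M.+2 * (size d).+1).
  elim: d a nb le => [|x d IH] a nb le.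
    by apply: T1_le; [apply: (@T1_while0 live); rewrite /live negbK|lia].
  move: nb; rewrite inE negb_or => /andP [nx nb]; rewrite /= in le.
  eapply T1_le.
    eapply (@T1_whileS live); first by rewrite /live eq_sym.
      eapply T1_seq; first by eapply (@T1_push TA id); rewrite eq_sym.
      by eapply (T1_pop TD).
    rewrite rev_cons -cats1 -catA; apply: (IH (x :: a)) => //=; lia.
  rewrite /= !mulnS; lia.
rewrite /=; nia.
Qed.

Fixpoint seqn (n : nat) (c k : cmd) : cmd := if n is n'.+1 then Seq c (seqn n' c k) else k.

(** The trees above the wanted one travel to [TB] and back. The wanted one goes to both [TB] and
    [TD], and the copy on [TD] is restored last, hence on top. *)
Definition copyv (i : nat) : cmd :=
  seqn i (mval true false) (Seq (mval true true) (Seq (restore TB) (restore TD))).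
Definition nip (k : nat) : cmd :=
  Seq (mval true false) (seqn k (mval false false) (restore TB)).
(* From the stack [acc', h, t, acc, ...] to [t, acc', ...]. *)
Definition foldtail : cmd :=
  Seq (mval true false) (Seq (mval false false) (Seq (mval false true)
    (Seq (mval false false) (Seq (restore TB) (restore TD))))).

Definition stA (w a : seq sym) : sigma := Sig w a [::] [::] [::].

Lemma codes_blank ds : sblank \notin codes ds.
Proof.
elim: ds => //= d ds IH; rewrite /codes /= mem_cat negb_or code_blank; exact: IH.
Qed.
Lemma codes_cons d ds : codes (d :: ds) = code d ++ codes ds. Proof. by []. Qed.
Lemma codes_cat ds es : codes (ds ++ es) = codes ds ++ codes es.
Proof. by rewrite /codes map_cat flatten_cat. Qed.

Lemma T1_skip (tb : bool) M w ds : forall f a b c f2 s2 n,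
  2 * size (codes ds) + size a + size b <= M ->
  T1 c (if ds is [::] then f else sblank)
     (Sig w a (addif tb (rev (codes ds)) b) [::] [::]) f2 s2 n ->
  T1 (seqn (size ds) (mval tb false) c) f (Sig w (codes ds ++ a) b [::] [::]) f2 s2
    (n + 302 * M.+2 * size (codes ds)).
Proof.
elim: ds => [|d ds IH] f a b c f2 s2 n le H /=.
  by apply: T1_le (leq_addr _ _); case: (tb) H.
move: le; rewrite codes_cons size_cat size_code => le.
eapply T1_le.
  eapply T1_seq.
    rewrite -catA; apply: (@T1_mval tb false M).
    by rewrite size_cat; move: le; rewrite /=; lia.
  apply: (IH _ a _ c f2 s2 n).
    by have := size_addif tb (rev (code d)) b; rewrite size_rev size_code; lia.
  move: H; rewrite addif_cat codes_cons rev_cat /=.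
  by case: (ds).
by rewrite [_ * (sz d + _)]mulnDr; lia.
Qed.

Lemma T1_copyv M w f vs i a : i < size vs ->
  2 * size (codes vs ++ a) <= M ->
  T1 (copyv i) f (stA w (codes vs ++ a)) sblank
     (stA w (code (nth Lf vs i) ++ codes vs ++ a)) (1000 * M.+2 * M.+2).
Proof.
move=> li le; set us := take i vs; set v := nth Lf vs i.
have E : vs = us ++ v :: drop i.+1 vs by rewrite -drop_nth // cat_take_drop.
have E2 : codes vs ++ a = codes us ++ code v ++ codes (drop i.+1 vs) ++ a.
  by rewrite {1}E codes_cat codes_cons !catA.
have si : i = size us by rewrite size_takel // ltnW.
move: le; rewrite E2; move: (codes (drop i.+1 vs) ++ a) => a' le {E E2}.
rewrite !size_cat !size_code in le.
eapply T1_le.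
  rewrite /copyv {1}si; apply: (@T1_skip true M).
    by rewrite size_cat size_code /=; lia.
  eapply T1_seq.
    apply: (@T1_mval true true M).
    by have := size_addif true (rev (codes us)) [::]; rewrite size_rev /=; lia.
  eapply T1_seq.
    apply: (@T1_restoreB M).
      by rewrite /= cats0 mem_cat !mem_rev negb_or code_blank codes_blank.
    by rewrite /= cats0 size_cat !size_rev size_code; lia.
  rewrite /= !cats0 rev_cat !revK -!catA.
  rewrite -[X in stA _ (X ++ _)]revK.
  apply: (@T1_restoreD M); first by rewrite mem_rev code_blank.
  by rewrite !size_cat size_rev !size_code; lia.
rewrite /= !cats0 !size_cat !size_rev !size_code.
move: (sz v) (size (codes us)) (size a') le => p q r0 le; nia.
Qed.

Lemma T1_nip M w f v us a : 2 * size (code v ++ codes us ++ a) <= M ->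
  T1 (nip (size us)) f (stA w (code v ++ codes us ++ a)) sblank
     (stA w (code v ++ a)) (1000 * M.+2 * M.+2).
Proof.
rewrite !size_cat size_code => le; eapply T1_le.
  eapply T1_seq; first by apply: (@T1_mval true false M); rewrite size_cat /=; lia.
  apply: (@T1_skip false M); first by rewrite /= cats0 size_rev size_code; lia.
  rewrite /= cats0 -[X in stA _ (X ++ _)]revK.
  have -> : (if us is [::] then sblank else sblank) = sblank by case: (us).
  apply: (@T1_restoreB M); first by rewrite mem_rev code_blank.
  by rewrite size_rev size_code; lia.
rewrite size_rev size_code.
move: (sz v) (size (codes us)) (size a) le => p q r0 le; nia.
Qed.

Lemma T1_foldtail M w f v h t u a :
  2 * size (code v ++ code h ++ code t ++ code u ++ a) <= M ->
  T1 foldtail f (stA w (code v ++ code h ++ code t ++ code u ++ a)) sblank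
     (stA w (code t ++ code v ++ a)) (1000 * M.+2 * M.+2).
Proof.
rewrite !size_cat !size_code => le; eapply T1_le.
  eapply T1_seq; first by apply: (@T1_mval true false M); rewrite !size_cat !size_code /=; lia.
  rewrite /= cats0.
  eapply T1_seq; first by apply: (@T1_mval false false M); rewrite !size_cat !size_rev !size_code /=; lia.
  eapply T1_seq; first by apply: (@T1_mval false true M); rewrite !size_cat !size_rev !size_code /=; lia.
  rewrite /= cats0.
  eapply T1_seq; first by apply: (@T1_mval false false M); rewrite !size_rev !size_code /=; lia.
  eapply T1_seq.
    apply: (@T1_restoreB M); first by rewrite mem_rev code_blank.
    by rewrite size_rev size_code; lia.
  rewrite revK -[X in stA _ (X ++ _)]revK.
  apply: (@T1_restoreD M); first by rewrite mem_rev code_blank.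
  by rewrite !size_cat size_rev !size_code; lia.
rewrite !size_rev !size_code.
move: (sz v) (sz h) (sz t) (sz u) (size a) le => p q p1 q1 r0 le; nia.
Qed.

(** * A total first-order language on trees *)

(* Variables are de Bruijn indices.  [Case e a b] binds head and tail in [b];
   [Fold l i b] is a left fold along the right spine of [l], and binds the
   element (0) and the accumulated value (1) in [b]; [Call f args] evaluates [f]
   in the environment consisting of [args] only. *)
Inductive expr :=
| Var of nat
| Nul
| Cns of expr & expr
| Case of expr & expr & expr
| Fold of expr & expr & expr
| Call of expr & seq expr.

Fixpoint foldD (f : tree -> tree -> tree) (d u : tree) : tree :=
  if d is Nd h t then foldD f t (f h u) else u.

Fixpoint eval (e : expr) (env : seq tree) : tree :=
  match e with
  | Var i => nth Lf env i
  | Nul => Lf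
  | Cns a b => Nd (eval a env) (eval b env)
  | Case c a b =>
      if eval c env is Nd h t then eval b (h :: t :: env) else eval a env
  | Fold l i b => foldD (fun h u => eval b (h :: u :: env)) (eval l env) (eval i env)
  | Call f args => eval f [seq eval a env | a <- args]
  end.

Fixpoint workD (f : tree -> tree -> tree) (g : tree -> tree -> nat) (d u : tree) : nat :=
  if d is Nd h t then (g h u + workD f g t (f h u)).+1 else 0.

(** Charging a variable the size of its value makes this measure dominate the sizes of results
    ([sz_eval]) as well as the number of operations. Added to the size of the initial stack, it
    bounds the stack throughout the evaluation. *)
Fixpoint work (e : expr) (env : seq tree) : nat :=
  match e with
  | Var i => (sz (nth Lf env i)).+1
  | Nul => 2
  | Cns a b => (work a env + work b env).+1
  | Case c a b => (work c env +
      (if eval c env is Nd h t then work b (h :: t :: env) else work a env)).+1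
  | Fold l i b => (work l env + work i env +
      workD (fun h u => eval b (h :: u :: env)) (fun h u => work b (h :: u :: env))
        (eval l env) (eval i env)).+1
  | Call f args => (sumn [seq work a env | a <- args] +
                    work f [seq eval a env | a <- args]).+1
  end.

Fixpoint wf (k : nat) (e : expr) : bool :=
  match e with
  | Var i => i < k
  | Nul => true
  | Cns a b => wf k a && wf k b
  | Case c a b => [&& wf k c, wf k a & wf k.+2 b]
  | Fold l i b => [&& wf k l, wf k i & wf k.+2 b]
  | Call f args => wf (size args) f && all (wf k) args
  end.

Definition pushes (k : nat) (rho : nat -> nat) : nat -> nat := fun i => rho i + k.

(** [rho] gives the depth of each variable on the stack of trees, which grows as temporaries are
    pushed. Popping the first symbol of a node leaves its two subtrees as stack entries, which
    directly become the bound variables of [Case]; [nip 2] removes them afterwards. Inside a fold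
    the stack is head, tail, accumulator, environment, whence the depths 0, 2 and [rho j + 3]. *)
Fixpoint compile (rho : nat -> nat) (e : expr) : cmd :=
  match e with
  | Var i => copyv (rho i)
  | Nul => push TA (fun _ => s0)
  | Cns a b => Seq (compile rho b) (Seq (compile (pushes 1 rho) a) (push TA (fun _ => s1)))
  | Case c a b => Seq (compile rho c) (Seq (pop TA)
      (If (onflag (pred1 s0)) (compile rho a)
        (Seq (compile (fun i => if i is j.+2 then rho j + 2 else i) b) (nip 2))))
  | Fold l i b => Seq (compile rho i) (Seq (compile (pushes 1 rho) l) (Seq (pop TA)
      (While (onflag (pred1 s1))
        (Seq (compile (fun i => match i with 0 => 0 | 1 => 2 | j.+2 => rho j + 3 end) b)
          (Seq foldtail (pop TA))))))
  | Call f args =>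
      Seq ((fix cargs (l : seq expr) : cmd :=
             if l is a :: l' then Seq (cargs l') (compile (pushes (size l') rho) a)
             else setf id) args)
        (Seq (compile id f) (nip (size args)))
  end.

Fixpoint cargs (rho : nat -> nat) (l : seq expr) : cmd :=
  if l is a :: l' then Seq (cargs rho l') (compile (pushes (size l') rho) a) else setf id.

Lemma comp_call rho f args :
  compile rho (Call f args) = Seq (cargs rho args) (Seq (compile id f) (nip (size args))).
Proof. by rewrite /=; congr Seq; elim: args => //= a l ->. Qed.

Fixpoint expr_size (e : expr) : nat :=
  match e with
  | Var _ | Nul => 1
  | Cns a b => (expr_size a + expr_size b).+1
  | Case c a b | Fold c a b => (expr_size c + expr_size a + expr_size b).+1
  | Call f args => (expr_size f + sumn (map expr_size args)).+1
  end.

(** The arguments of [Call] sit inside a list, and correctness needs induction hypotheses for them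
    too; induction on [expr_size] provides these. *)
Lemma expr_ind' (P : expr -> Prop) :
  (forall i, P (Var i)) -> P Nul -> (forall a b, P a -> P b -> P (Cns a b)) ->
  (forall c a b, P c -> P a -> P b -> P (Case c a b)) ->
  (forall l i b, P l -> P i -> P b -> P (Fold l i b)) ->
  (forall f args, P f -> (forall n, n < size args -> P (nth Nul args n)) -> P (Call f args)) ->
  forall e, P e.
Proof.
move=> HV HN HC HK HF HA e.
move: {2}(expr_size e) (leqnn (expr_size e)) => n; elim: n e => [|n IH] e; first by case: e => //= *; lia.
case: e => [i||a b|c a b|l i b|f args] /= le.
- exact: HV.
- exact: HN.
- by apply: HC; apply: IH; lia.
- by apply: HK; apply: IH; lia.
- by apply: HF; apply: IH; lia.
apply: HA; first by apply: IH; lia.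
move=> k lk; apply: IH; suff: expr_size (nth Nul args k) <= sumn (map expr_size args) by lia.
by elim: args k lk {le} => //= a args IHa [|k] lk /=; [lia|have := IHa k lk; lia].
Qed.

Lemma sz_eval e env : sz (eval e env) <= work e env.
Proof.
elim/expr_ind': e env => [i||a b IHa IHb|c a b IHc IHa IHb|l i b IHl IHi IHb|f args IHf _] env /=.
- by [].
- by [].
- by have := IHa env; have := IHb env; lia.
- case: (eval c env) => [|h t]; first by have := IHa env; lia.
  by have := IHb (h :: t :: env); lia.
- have H d u : sz (foldD (fun h u => eval b (h :: u :: env)) d u) <=
     sz u + workD (fun h u => eval b (h :: u :: env)) (fun h u => work b (h :: u :: env)) d u.
    elim: d u => [|h _ t IHt] u /=; first by lia.
    by have := IHt (eval b (h :: u :: env)); have := IHb (h :: u :: env); lia.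
  by have := H (eval l env) (eval i env); have := IHi env; lia.
by have := IHf [seq eval a env | a <- args]; lia.
Qed.

Definition cost (M : nat) : nat := 4000 * M.+2 * M.+2.

Definition agrees (rho : nat -> nat) (env stk : seq tree) :=
  forall i, i < size env -> rho i < size stk /\ nth Lf stk (rho i) = nth Lf env i.

Definition comp_ok (e : expr) := forall rho env stk a w M f,
  wf (size env) e -> agrees rho env stk ->
  2 * (size (codes stk ++ a) + work e env) <= M ->
  exists f', T1 (compile rho e) f (stA w (codes stk ++ a)) f'
    (stA w (code (eval e env) ++ codes stk ++ a)) (cost M * work e env).

Lemma agrees_push rho env stk us :
  agrees rho env stk -> agrees (pushes (size us) rho) env (us ++ stk).
Proof.
move=> H i /H [l1 l2]; rewrite /pushes size_cat nth_cat; split; first by lia.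
by rewrite ltnNge leq_addl /= addnK.
Qed.

Lemma T1_pushA (x : sym) f w a M : x != sblank -> size a <= M ->
  T1 (push TA (fun _ => x)) f (stA w a) f (stA w (x :: a)) (24 * M.+1).
Proof. by move=> nx le; apply: T1_le; [apply: (@T1_push TA (fun _ => x))|rewrite /=; lia]. Qed.

Lemma T1_popA (x : sym) f w a M : size a <= M ->
  T1 (pop TA) f (stA w (x :: a)) x (stA w a) (24 * M.+2).
Proof. by move=> le; eapply T1_le; [eapply T1_pop|rewrite /=; lia]. Qed.

(** Naming the quadratic factor [X] makes the later time bounds linear in products with [X]. *)
Lemma costE M : exists X, [/\ cost M = 4 * X, 1000 * M.+2 * M.+2 = X & 48 * M.+2 <= X].
Proof. by exists (1000 * M.+2 * M.+2); split=> //; rewrite /cost; nia. Qed.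

Lemma comp_correct e : comp_ok e.
Proof.
elim/expr_ind': e => [i||a b Ha Hb|c a b Hc Ha Hb|l i b Hl Hi Hb|g args Hg Hargs]
  rho env stk s w M f.
- move=> /= wi ag le; have [li <-] := ag _ wi.
  exists sblank; have [X [cX eX leX]] := costE M.
  apply: T1_le; first by apply: (@T1_copyv M) => //; lia.
  by rewrite eX cX; nia.
- move=> _ _ le; exists f; have [X [cX eX leX]] := costE M.
  apply: T1_le; first by apply: (@T1_pushA _ _ _ _ M s0_blank); lia.
  by rewrite cX /=; lia.
- move=> /= /andP [wa wb] ag le.
  have sb := sz_eval b env; have sa := sz_eval a env.
  have [|f1 H1] := Hb rho env stk s w M f wb ag; first by lia.
  have [||f2 H2] := Ha (pushes 1 rho) env (eval b env :: stk) s w M f1 wa.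
  + exact: (@agrees_push _ _ _ [:: _]).
  + by move: le; rewrite codes_cons -catA !size_cat !size_code; lia.
  exists f2; have [X [cX eX leX]] := costE M.
  eapply T1_le.
    eapply T1_seq; first exact: H1.
    rewrite codes_cons -catA in H2.
    eapply T1_seq; first exact: H2.
    rewrite /= -catA.
    apply: (@T1_pushA _ _ _ _ M s1_blank).
    by move: le; rewrite !size_cat !size_code; lia.
  rewrite cX [_ * (_ + _).+1]mulnS [4 * X * (_ + _)]mulnDr; lia.
- move=> /= /and3P [wc wa wb] ag le.
  have sc := sz_eval c env.
  have [|f1 H1] := Hc rho env stk s w M f wc ag; first by lia.
  have [X [cX eX leX]] := costE M.
  case E: (eval c env) H1 le sc => [|h t] /= H1 le sc.
    have [|f2 H2] := Ha rho env stk s w M s0 wa ag; first by lia.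
    exists f2; eapply T1_le.
      eapply T1_seq; first exact: H1.
      eapply T1_seq; first by apply: (@T1_popA _ _ _ _ M); lia.
      apply: T1_ift; [exact: eqxx|exact: H2].
    rewrite cX [_ * (_ + _).+1]mulnS [4 * X * (_ + _)]mulnDr; lia.
  have sb := sz_eval b (h :: t :: env).
  have [||f2 H2] := Hb (fun i => if i is j.+2 then rho j + 2 else i) (h :: t :: env)
    (h :: t :: stk) s w M s1 wb.
  + move=> [|[|i]] //= li; have [l1 l2] := ag i li; split; first by lia.
    by rewrite !addnS addn0 /=.
  + by move: le; rewrite !codes_cons -!catA !size_cat !size_code; lia.
  rewrite -[(code h ++ code t) ++ _]catA in H1.
  exists sblank; eapply T1_le.
    eapply T1_seq; first exact: H1.
    eapply T1_seq.
      apply: (@T1_popA _ _ _ _ M); rewrite !size_cat !size_code.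
      by move: le; rewrite !size_cat; lia.
    apply: T1_iff; first by rewrite /= eq_sym s0_s1.
    rewrite !codes_cons -!catA in H2.
    eapply T1_seq; first exact: H2.
    have := @T1_nip M w f2 (eval b (h :: t :: env)) [:: h; t] (codes stk ++ s).
    rewrite !codes_cons -!catA /=; apply.
    by move: le; rewrite !size_cat !size_code /=; lia.
  rewrite cX eX [_ * (_ + _).+1]mulnS [4 * X * (_ + _)]mulnDr; lia.
- move=> /= /and3P [wl wi wb] ag le.
  have sl := sz_eval l env; have si := sz_eval i env.
  have [|f1 H1] := Hi rho env stk s w M f wi ag; first by lia.
  have [||f2 H2] := Hl (pushes 1 rho) env (eval i env :: stk) s w M f1 wl.
  + exact: (@agrees_push _ _ _ [:: _]).
  + by move: le; rewrite codes_cons -catA !size_cat !size_code; lia.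
  have [X [cX eX leX]] := costE M.
  move: H1 H2 le sl si; set r3 := (fun i : nat => _).
  set F := (fun h u => eval b _); set G := (fun h u => work b _).
  move: (eval l env) (eval i env) (work l env) (work i env) => d u Wl Wi H1 H2 le sl si.
  rewrite codes_cons -catA in H2.
  (* Loop invariant: the first symbol of the remaining list has just been popped into the register,
     where it tells whether an element is left. If so, head, tail and accumulator are the three top
     trees. *)
  suff [f3 H3] : exists f3, T1
      (While (onflag (pred1 s1)) (Seq (compile r3 b) (Seq foldtail (pop TA)))) (head s0 (code d))
      (stA w (behead (code d) ++ code u ++ codes stk ++ s)) f3
      (stA w (code (foldD F d u) ++ codes stk ++ s)) (4 * X * workD F G d u + 1).
    exists f3; eapply T1_le.
      eapply T1_seq; first exact: H1.
      eapply T1_seq; first exact: H2.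
      eapply T1_seq; last exact: H3.
      have -> : code d = head s0 (code d) :: behead (code d) by case: (d).
      apply: (@T1_popA _ _ _ _ M); move: le; rewrite !size_cat size_behead !size_code; lia.
    rewrite cX [_ * (_ + _).+1]mulnS ![4 * X * (_ + _)]mulnDr; lia.
  have {le sl si} : 2 * (size (codes stk ++ s) + sz d + sz u + workD F G d u) <= M by lia.
  elim: d u f2 {H1 H2} => [|h _ t IHt] u f2 le.
    exists s0; apply: T1_le (leq_addl _ _).
    by apply: (@T1_while0 (pred1 s1)); rewrite /= s0_s1.
  rewrite /= in le.
  have su : sz (F h u) <= G h u by apply: sz_eval.
  have [||f3 H3] := Hb r3 (h :: u :: env) (h :: t :: u :: stk) s w M s1 wb.
  + move=> [|[|j]] //= lj; have [l1 l2] := ag j lj; split; first by lia.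
    by rewrite !addnS addn0 /=.
  + by move: le; rewrite !codes_cons -!catA !size_cat !size_code /G; lia.
  have [|f4 H4] := IHt (F h u) sblank; first by lia.
  rewrite !codes_cons -!catA -/(F h u) -/(G h u) cX in H3.
  exists f4; rewrite /= -catA; eapply T1_le.
    apply: (@T1_whileS (pred1 s1)); first exact: eqxx.
      eapply T1_seq; first exact: H3.
      eapply T1_seq.
        apply: (@T1_foldtail M); move: le; rewrite !size_cat !size_code; lia.
      have -> : code t = head s0 (code t) :: behead (code t) by case: (t).
      apply: (@T1_popA _ _ _ _ M); move: le; rewrite !size_cat size_behead !size_code; lia.
    exact: H4.
  rewrite eX [4 * X * (_ + _).+1]mulnS ![4 * X * (_ + _)]mulnDr; lia.
move=> wfc ag le; rewrite comp_call.
move: wfc le => /= /andP [wg wargs] le.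
have [X [cX eX leX]] := costE M.
have [f1 H1] : exists f1, T1 (cargs rho args) f (stA w (codes stk ++ s)) f1
    (stA w (codes [seq eval a env | a <- args] ++ codes stk ++ s))
    (4 * X * sumn [seq work a env | a <- args] + 1).
  have {le} : 2 * (size (codes stk ++ s) + sumn [seq work a env | a <- args]) <= M by lia.
  elim: args Hargs wargs {wg} => [|a l IHl] Hargs /= wargs le.
    by exists f; rewrite muln0; apply: (T1_setf id).
  case/andP: wargs => wa wl.
  have [n ln|//||f1 H1] := IHl; [exact: (Hargs n.+1)|by lia|].
  have le2 : size (codes [seq eval a env | a <- l]) <= sumn [seq work a env | a <- l].
    elim: (l) => //= a' l' IH; rewrite codes_cons size_cat size_code.
    by have := sz_eval a' env; lia.
  have [||f2 H2] := Hargs 0 isT (pushes (size l) rho) env ([seq eval a env | a <- l] ++ stk) s w M f1 wa.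
  + have := @agrees_push rho env stk [seq eval a env | a <- l] ag.
    by rewrite size_map.
  + by rewrite codes_cat -catA size_cat; move: le => /=; lia.
  exists f2; eapply T1_le.
    eapply T1_seq; first exact: H1.
    rewrite codes_cat -!catA in H2.
    rewrite codes_cons -!catA; exact: H2.
  rewrite cX /= ![4 * X * (_ + _)]mulnDr; lia.
have le2 : size (codes [seq eval a env | a <- args]) <= sumn [seq work a env | a <- args].
  elim: (args) => //= a' l' IH; rewrite codes_cons size_cat size_code.
  by have := sz_eval a' env; lia.
have sg := sz_eval g [seq eval a env | a <- args].
have [||| f2 H2] := Hg id [seq eval a env | a <- args] [seq eval a env | a <- args]
   (codes stk ++ s) w M f1.
- by rewrite size_map.
- by [].
- by rewrite size_cat; lia.
exists sblank; eapply T1_le.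
  eapply T1_seq; first exact: H1.
  eapply T1_seq; first exact: H2.
  rewrite -(size_map (eval^~ env)); apply: (@T1_nip M).
  by rewrite size_cat [size (_ ++ (_ ++ _))]size_cat size_code; lia.
rewrite cX eX [4 * X * (_ + _).+1]mulnS ![4 * X * (_ + _)]mulnDr; lia.
Qed.

Fixpoint okD (B : nat) (f : tree -> tree -> tree) (g : tree -> tree -> Prop) (d u : tree) : Prop :=
  sz u <= B /\ (if d is Nd h t then g h u /\ okD B f g t (f h u) else True).

(* All values passed through folds have size at most [B]; this is the only
   obstruction to polynomial running time, see [work_poly]. *)
Fixpoint ok (B : nat) (e : expr) (env : seq tree) : Prop :=
  match e with
  | Var _ | Nul => True
  | Cns a b => ok B a env /\ ok B b env
  | Case c a b => ok B c env /\
      (if eval c env is Nd h t then ok B b (h :: t :: env) else ok B a env)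
  | Fold l i b => [/\ ok B l env, ok B i env &
      okD B (fun h u => eval b (h :: u :: env)) (fun h u => ok B b (h :: u :: env))
        (eval l env) (eval i env)]
  | Call f args => ok B f [seq eval a env | a <- args] /\
      foldr (fun p q => p /\ q) True [seq ok B a env | a <- args]
  end.

Definition szs (env : seq tree) : nat := sumn (map sz env).

Lemma sz_nth env i : sz (nth Lf env i) <= (szs env).+1.
Proof. by elim: env i => [|d env IH] [|i] //=; rewrite /szs /=; [lia|have := IH i; rewrite /szs; lia]. Qed.

Lemma exp_sum N a b x y : 1 < N -> x <= N ^ a -> y <= N ^ b -> (x + y).+1 <= N ^ (a + b + 2).
Proof.
move=> N1 xa yb.
have : N ^ a <= N ^ (a + b) by rewrite leq_exp2l //; lia.
have : N ^ b <= N ^ (a + b) by rewrite leq_exp2l //; lia.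
have : 0 < N ^ (a + b) by rewrite expn_gt0; lia.
have : 4 <= N ^ 2 by nia.
rewrite [N ^ (a + b + 2)]expnD; nia.
Qed.

Lemma exp_add N a x y : 1 < N -> x <= N ^ a -> y <= N -> x + y <= N ^ (a + 3).
Proof. by move=> N1 xa yN; rewrite -[a + 3]/(a + (1 + 2)) addnA; apply: ltnW; apply: exp_sum; rewrite ?expn1. Qed.

Lemma exp_exp N a k x y : 1 < N -> x <= N ^ a -> y <= x ^ k -> y <= N ^ (a * k).
Proof.
move=> N1 xa yx; apply: leq_trans yx _; rewrite expnM.
case: k => // k; by rewrite leq_exp2r.
Qed.

Lemma exp_le N a b x : 1 < N -> x <= N ^ a -> a <= b -> x <= N ^ b.
Proof. by move=> N1 xa ab; apply: leq_trans xa _; rewrite leq_exp2l. Qed.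

(** Polynomial bounds add up along sequences and compose along bindings. A fold would compose them
    once per iteration, but [B] bounds the accumulator afresh each time, so all iterations of the
    body share one polynomial bound. *)
Lemma work_poly e : exists k, forall B env, ok B e env ->
  work e env <= (szs env + B + 2) ^ k.
Proof.
elim/expr_ind': e => [i||a b [ka Ha] [kb Hb]|c a b [kc Hc] [ka Ha] [kb Hb]
   |l i b [kl Hl] [ki Hi] [kb Hb]|g args [kg Hg] Hargs].
- exists 1 => B env _; rewrite expn1 /=; have := sz_nth env i; lia.
- by exists 1 => B env _; rewrite expn1 /=; lia.
- exists (ka + kb + 2) => B env /= [/Ha oa /Hb ob]; apply: exp_sum => //; lia.
- exists (kc + (ka + (kc + 3) * kb) + 2) => B env /= [oc].
  set N := _ + 2; have N2 : 1 < N by rewrite /N; lia.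
  have wc := Hc _ _ oc; have sc := sz_eval c env.
  case E: (eval c env) sc => [|h t] sc ob; apply: exp_sum => //.
    by apply: exp_le (Ha _ _ ob) _ => //; lia.
  have H : szs [:: h, t & env] + B + 2 <= N ^ (kc + 3).
    apply: leq_trans (exp_add N2 wc (leqnn N)).
    by move: sc; rewrite /szs /= /N /szs; lia.
  by apply: exp_le (exp_exp N2 H (Hb _ _ ob)) _ => //; lia.
- exists ((kl + ki + 2) + (kl + ((kl + 3 + 3) * kb + 0 + 2)) + 2) => B env /= [ol oi].
  set N := _ + 2; have N2 : 1 < N by rewrite /N; lia.
  have wl := Hl _ _ ol; have wi := Hi _ _ oi; have sl := sz_eval l env.
  set F := (fun h u => eval b _); set G := (fun h u => work b _) => oD.
  apply: exp_sum => //; first by apply: ltnW; apply: exp_sum.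
  apply: leq_trans (_ : sz (eval l env) * N ^ ((kl + 3 + 3) * kb + 0 + 2) <= _); last first.
    by rewrite [N ^ (kl + _)]expnD; apply: leq_mul => //; apply: leq_trans sl wl.
  have: sz (eval l env) <= N ^ kl by apply: leq_trans sl wl.
  elim: (eval l env) (eval i env) oD => [|h _ t IHt] u //= [uB [ob oD]] ld.
  have {oD} IHt : workD F G t (F h u) <= sz t * N ^ ((kl + 3 + 3) * kb + 0 + 2).
    by apply: IHt oD _; lia.
  have : (G h u + 0).+1 <= N ^ ((kl + 3 + 3) * kb + 0 + 2).
    apply: exp_sum => //; apply: exp_exp (Hb _ _ ob) => //.
    apply: leq_trans (_ : sz h + N + N <= _); first by rewrite /szs /= /N /szs; lia.
    apply: exp_add => //; apply: exp_add => //; lia.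
  move: IHt; move: (N ^ (_ + 2)) (workD _ _ _ _) (G h u) => Y Z g' IHt; nia.
have [k Hk] : exists k, forall B env, foldr (fun p q => p /\ q) True [seq ok B a env | a <- args] ->
    sumn [seq work a env | a <- args] <= (szs env + B + 2) ^ k.
  elim: args Hargs => [|a l IHl] Hargs; first by exists 0.
  have [n ln|k Hk] := IHl; first exact: (Hargs n.+1).
  have [ka Ha] := Hargs 0 isT.
  exists (ka + k + 2) => B env /= [/Ha oa /Hk ok].
  by apply: ltnW; apply: exp_sum => //; lia.
exists (k + (k + 3) * kg + 2) => B env /= [og /Hk ow].
set N := _ + 2 in ow *; have N2 : 1 < N by rewrite /N; lia.
apply: exp_sum => //; apply: exp_exp (Hg _ _ og) => //.
apply: leq_trans (exp_add N2 ow (leqnn N)).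
suff : szs [seq eval a env | a <- args] <= sumn [seq work a env | a <- args] by rewrite /N; lia.
elim: (args) => //= a' l' IH; rewrite /szs /= in IH *.
by have := sz_eval a' env; lia.
Qed.

(* [e] evaluates to [v], with all fold values of size at most [B]. *)
Definition E (B : nat) (env : seq tree) (e : expr) (v : tree) :=
  eval e env = v /\ ok B e env.

(** * Input, random bits and output *)

Definition encl (s : seq tree) : tree := foldr Nd Lf s.
Definition encn (k : nat) : tree := encl (nseq k Lf).
Definition encb (b : bool) : tree := encn b.

Lemma sz_encl s : sz (encl s) = (sumn [seq (sz d).+1 | d <- s]).+1.
Proof. by elim: s => //= d s ->; lia. Qed.
Lemma sz_encn k : sz (encn k) = (2 * k).+1.
Proof. by elim: k => //= k IH; rewrite -/(encn k) IH; lia. Qed.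
Lemma sz_encb b : sz (encb b) <= 3. Proof. by case: b. Qed.

Fixpoint pushs (l : seq sym) : cmd :=
  if l is x :: l' then Seq (pushs l') (push TA (fun _ => x)) else setf id.

Lemma T1_pushs (l : seq sym) M f w a b c d : sblank \notin l -> size l + size a <= M ->
  T1 (pushs l) f (Sig w a b c d) f (Sig w (l ++ a) b c d) (24 * M.+1 * (size l).+1).
Proof.
elim: l => [|x l IH] nb le /=.
  by apply: T1_le; [apply: (T1_setf id)|lia].
move: nb; rewrite inE negb_or => /andP [nx nb]; rewrite /= in le.
eapply T1_le.
  eapply T1_seq; first by apply: IH => //; lia.
  by apply: (@T1_push TA); rewrite eq_sym.
by rewrite /= size_cat; nia.
Qed.

Lemma T1_popR' f s : T1 popR f s (last sblank (wR s))
  (setR (take (size (wR s)).-1 (wR s)) s) (24 * (size (wR s)).+1).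
Proof.
case E: (wR s) / lastP => [|S x].
  have -> : setR (take (size ([::] : seq sym)).-1 [::]) s = s by case: (s) E => ? ? ? ? ? /= ->.
  exact: T1_popR0.
rewrite last_rcons size_rcons /= -cats1 take_size_cat //.
by apply: T1_le; [apply: T1_popR; rewrite E|lia].
Qed.

(** The code of a list with head [f] begins with this word, so that pushing it conses [f]. *)
Definition symcode (f : sym) : seq sym := s1 :: code (encn f).
Definition pushsym : cmd :=
  If (onflag (pred1 s0)) (pushs (symcode s0))
    (If (onflag (pred1 s1)) (pushs (symcode s1)) (pushs (symcode ssep))).

Lemma symcode_blank f : sblank \notin symcode f.
Proof. by rewrite inE negb_or code_blank eq_sym s1_blank. Qed.
Lemma size_symcode (f : sym) : f != sblank -> size (symcode f) <= 6.
Proof.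
have [_ [_ [_ Eb]]] := symE.
rewrite /= size_code sz_encn -val_eqE /= Eb => nf; have := ltn_ord f; lia.
Qed.

Lemma sym_cases (f : sym) : f != sblank -> [\/ f = s0, f = s1 | f = ssep].
Proof.
have [E0 [E1 [E2 Eb]]] := symE; rewrite -val_eqE /= Eb => nf.
case: f nf => -[|[|[|[|//]]]] i //= _.
- by apply: Or31; apply: val_inj; rewrite /= E0.
- by apply: Or32; apply: val_inj; rewrite /= E1.
by apply: Or33; apply: val_inj; rewrite /= E2.
Qed.
Lemma ssep_s0 : ssep != s0. Proof. by rewrite -val_eqE /= !inordK. Qed.
Lemma ssep_s1 : ssep != s1. Proof. by rewrite -val_eqE /= !inordK. Qed.
Lemma ssep_blank : ssep != sblank. Proof. by rewrite -val_eqE /= !inordK. Qed.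

Lemma T1_pushsym M (f : sym) w a b c d : f != sblank -> 6 + size a <= M ->
  T1 pushsym f (Sig w a b c d) f (Sig w (symcode f ++ a) b c d) (200 * M.+1).
Proof.
move=> nf le; have sf := size_symcode nf; have bf := symcode_blank f.
apply: (@T1_le _ _ _ _ _ (24 * M.+1 * (size (symcode f)).+1 + 2)); last by nia.
have [E|E|E] := sym_cases nf; rewrite /pushsym.
- apply: T1_le; first apply: T1_ift; first by rewrite /= E.
    by rewrite -{1}E; apply: (@T1_pushs _ M) => //; lia.
  by lia.
- apply: T1_le; first apply: T1_iff; first by rewrite /= E eq_sym s0_s1.
    apply: T1_ift; first by rewrite /= E.
    by rewrite -{1}E; apply: (@T1_pushs _ M) => //; lia.
  by lia.
apply: T1_le; first apply: T1_iff; first by rewrite /= E ssep_s0.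
  apply: T1_iff; first by rewrite /= E ssep_s1.
  by rewrite -{1}E; apply: (@T1_pushs _ M) => //; lia.
by lia.
Qed.

Definition encs (x : seq sym) : tree := encl [seq encn (f : nat) | f : sym <- x].

Lemma code_encs f x : code (encs (f :: x)) = symcode f ++ code (encs x).
Proof. by []. Qed.
Lemma sz_encs (x : seq sym) : sblank \notin x -> sz (encs x) <= 6 * size x + 1.
Proof.
elim: x => // f x IH; rewrite inE negb_or => /andP [nf /IH].
rewrite -!size_code code_encs size_cat; have := @size_symcode f.
rewrite eq_sym nf => /(_ isT) /=; lia.
Qed.

(** The top of [wR] is its last symbol, so consing the popped symbols rebuilds the word in its
    original order. *)
Definition readin : cmd :=
  Seq (push TA (fun _ => s0)) (Seq popR (While (onflag live) (Seq pushsym popR))).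

Lemma T1_readin (x : seq sym) f M : sblank \notin x -> 6 * size x + 10 <= M ->
  T1 readin f (Sig x [::] [::] [::] [::]) sblank (stA [::] (code (encs x)))
    (400 * M.+1 * (size x).+1).
Proof.
have loop (z y : seq sym) : sblank \notin z ++ y -> 6 * size (z ++ y) + 10 <= M ->
    T1 (While (onflag live) (Seq pushsym popR)) (last sblank z)
      (Sig (take (size z).-1 z) (code (encs y)) [::] [::] [::]) sblank
      (stA [::] (code (encs (z ++ y)))) (300 * M.+1 * size z + 1).
  elim/last_ind: z y => [|z c IH] y nb le.
    by rewrite muln0; apply: (@T1_while0 live); rewrite /live negbK.
  rewrite last_rcons size_rcons /= -{1}cats1 take_size_cat //.
  have nc : c != sblank.
    apply/eqP => Ec; move: nb; rewrite mem_cat negb_or mem_rcons inE Ec eqxx //.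
  rewrite cat_rcons in nb le *.
  have := sz_encs nb; have := sz_encs (x := y).
  have -> : sblank \notin y by move: nb; rewrite mem_cat inE !negb_or => /and3P [].
  move=> /(_ isT) sy sn; rewrite size_cat /= in le sn.
  eapply T1_le.
    apply: (@T1_whileS live) => //.
      eapply T1_seq.
        by apply: (@T1_pushsym M) => //; rewrite size_code; lia.
      exact: T1_popR'.
    rewrite /setR /wR -code_encs; apply: IH => //; rewrite size_cat /=; lia.
  by rewrite /=; nia.
move=> nb le; eapply T1_le.
  eapply T1_seq; first by apply: (@T1_push TA _ _ _ s0_blank).
  eapply T1_seq; first exact: T1_popR'.
  have := loop x [::]; rewrite cats0 => H; exact: H.
by rewrite /=; nia.
Qed.

Definition marks : cmd :=
  Seq (pop TA) (While (onflag (pred1 s1))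
    (Seq (pop TA) (Seq (push TB (fun _ => s0)) (pop TA)))).

Lemma T1_marks R w a f M : 2 * R + size a + 1 <= M ->
  T1 marks f (stA w (code (encn R) ++ a)) s0 (Sig w a (nseq R s0) [::] [::])
    (100 * M.+2 * R.+1).
Proof.
have loop k : 2 * k + size a + 1 <= M -> k <= R -> R <= M ->
    T1 (While (onflag (pred1 s1)) (Seq (pop TA) (Seq (push TB (fun _ => s0)) (pop TA))))
      (head s0 (code (encn k)))
      (Sig w (behead (code (encn k)) ++ a) (nseq (R - k) s0) [::] [::])
      s0 (Sig w a (nseq R s0) [::] [::]) (76 * M.+2 * k + 1).
  elim: k => [|k IH] le lk lR.
    by rewrite muln0 subn0; apply: (@T1_while0 (pred1 s1)); rewrite /= s0_s1.
  eapply T1_le.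
    apply: (@T1_whileS (pred1 s1)); first exact: eqxx.
      eapply T1_seq; first exact: T1_pop.
      eapply T1_seq; first by apply: (@T1_push TB _ _ _ s0_blank).
      exact: T1_pop.
    rewrite /=.
    have -> : s0 :: nseq (R - k.+1) s0 = nseq (R - k) s0 by rewrite -[R - k]prednK ?subnS //; lia.
    have -> : head sblank (code (encn k) ++ a) = head s0 (code (encn k)) by case: (k).
    have -> : behead (code (encn k) ++ a) = behead (code (encn k)) ++ a by case: (k).
    by apply: IH; lia.
  by rewrite /= !size_cat size_code -/(encn k) sz_encn size_nseq; nia.
move=> le; eapply T1_le.
  eapply T1_seq; first exact: T1_pop.
  have := loop R; rewrite subnn /=.
  have -> : head s0 (code (encn R)) = head sblank (code (encn R) ++ a) by case: (R).
  have -> : behead (code (encn R)) ++ a = behead (code (encn R) ++ a) by case: (R).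
  by apply; lia.
by rewrite /= size_cat size_code sz_encn; nia.
Qed.

Definition pushbit : cmd :=
  If (onflag (pred1 s0)) (pushs (s1 :: code (encb false))) (pushs (s1 :: code (encb true))).

Lemma T1_pushbit M (v : bool) w a b c d : 6 + size a <= M ->
  T1 pushbit (bsym v) (Sig w a b c d) (bsym v)
    (Sig w ((s1 :: code (encb v)) ++ a) b c d) (200 * M.+1).
Proof.
move=> le; apply: (@T1_le _ _ _ _ _ (24 * M.+1 * (size (s1 :: code (encb v))).+1 + 1)).
  case: v => /=; rewrite addn1.
    apply: T1_iff; first by rewrite /= eq_sym s0_s1.
    by apply: (@T1_pushs [:: s1; s1; s0; s0] M); rewrite ?inE ?negb_or ?[sblank == _]eq_sym ?s0_blank ?s1_blank //=; lia.
  apply: T1_ift; first by rewrite /=.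
  by apply: (@T1_pushs [:: s1; s0] M); rewrite ?inE ?negb_or ?[sblank == _]eq_sym ?s0_blank ?s1_blank //=; lia.
rewrite /= size_code; have := sz_encb v; nia.
Qed.

Definition randlist : cmd :=
  Seq (push TA (fun _ => s0)) (Seq (pop TB) (While (onflag live) (Seq pushbit (pop TB)))).

Lemma sz_bools (y : seq bool) : sz (encl (map encb y)) <= 4 * size y + 1.
Proof. by elim: y => //= b y IH; have := sz_encb b; lia. Qed.

Lemma T1_randlist bs w a f M : 5 * size bs + size a + 10 <= M ->
  T1 randlist f (Sig w a (map bsym bs) [::] [::]) sblank
    (stA w (code (encl (map encb (rev bs))) ++ a)) (400 * M.+2 * (size bs).+1).
Proof.
have loop z y : 5 * size z + 5 * size y + size a + 10 <= M ->
    T1 (While (onflag live) (Seq pushbit (pop TB))) (head sblank (map bsym z))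
      (Sig w (code (encl (map encb y)) ++ a) (behead (map bsym z)) [::] [::]) sblank
      (stA w (code (encl (map encb (catrev z y))) ++ a)) (300 * M.+2 * size z + 1).
  elim: z y => [|b z IH] y le.
    by rewrite muln0; apply: (@T1_while0 live); rewrite /live negbK.
  have sy := sz_bools y.
  rewrite /= in le; eapply T1_le.
    apply: (@T1_whileS live); first by case: (b); rewrite /= /live ?s0_blank ?s1_blank.
      eapply T1_seq; last exact: T1_pop.
      by apply: (@T1_pushbit M); rewrite size_cat size_code; lia.
    have := IH (b :: y); rewrite /= -catA; apply; rewrite /=; lia.
  by rewrite /= size_map; nia.
move=> le; eapply T1_le.
  eapply T1_seq; first by apply: (@T1_push TA _ _ _ s0_blank).
  eapply T1_seq; first exact: T1_pop.
  by apply: (loop bs [::]) => /=; lia.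
by rewrite /= size_map; nia.
Qed.

Definition outsym : cmd :=
  Seq (pop TA) (If (onflag (pred1 s0)) (pushR (fun _ => s0))
    (Seq (pop TA) (Seq (pop TA) (If (onflag (pred1 s0)) (pushR (fun _ => s1))
      (Seq (pop TA) (Seq (pop TA) (pushR (fun _ => ssep)))))))).

Lemma T1_outsym f0 (f : sym) w a M : f != sblank -> size w + size a + 6 <= M ->
  exists f', T1 outsym f0 (stA w (code (encn f) ++ a)) f' (stA (rcons w f) a) (200 * M.+1).
Proof.
have [E0 [E1 [E2 Eb]]] := symE.
move=> nf le; have [->|->|->] := sym_cases nf; rewrite ?E0 ?E1 ?E2 /=; eexists; eapply T1_le.
- eapply T1_seq; first exact: T1_pop.
  apply: T1_ift; first by rewrite /=.
  exact: (@T1_pushR (fun _ => s0) _ _ s0_blank).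
- by rewrite /=; lia.
- eapply T1_seq; first exact: T1_pop.
  apply: T1_iff; first by rewrite /= eq_sym s0_s1.
  eapply T1_seq; first exact: T1_pop.
  eapply T1_seq; first exact: T1_pop.
  apply: T1_ift; first by rewrite /=.
  exact: (@T1_pushR (fun _ => s1) _ _ s1_blank).
- by rewrite /=; lia.
- eapply T1_seq; first exact: T1_pop.
  apply: T1_iff; first by rewrite /= eq_sym s0_s1.
  eapply T1_seq; first exact: T1_pop.
  eapply T1_seq; first exact: T1_pop.
  apply: T1_iff; first by rewrite /= eq_sym s0_s1.
  eapply T1_seq; first exact: T1_pop.
  eapply T1_seq; first exact: T1_pop.
  exact: (@T1_pushR (fun _ => ssep) _ _ ssep_blank).
by rewrite /=; lia.
Qed.

Definition output : cmd :=
  Seq (pop TA) (While (onflag (pred1 s1)) (Seq outsym (pop TA))).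

Lemma T1_output f (x : seq sym) a M : sblank \notin x -> 6 * size x + size a + 10 <= M ->
  T1 output f (stA [::] (code (encs x) ++ a)) s0 (stA x a) (300 * M.+2 * (size x).+1).
Proof.
have loop (w z : seq sym) : sblank \notin z -> size w + 6 * size z + size a + 10 <= M ->
    T1 (While (onflag (pred1 s1)) (Seq outsym (pop TA))) (head s0 (code (encs z)))
      (stA w (behead (code (encs z)) ++ a)) s0 (stA (w ++ z) a) (250 * M.+2 * size z + 1).
  elim: z w => [|c z IH] w nb le.
    by rewrite cats0 muln0; apply: (@T1_while0 (pred1 s1)); rewrite /= s0_s1.
  move: nb; rewrite inE negb_or eq_sym => /andP [nc nb]; rewrite /= in le.
  have sy := sz_encs nb.
  have [|f' H] := @T1_outsym s1 c w (code (encs z) ++ a) M nc.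
    by rewrite size_cat size_code; lia.
  eapply T1_le.
    apply: (@T1_whileS (pred1 s1)); first exact: eqxx.
      rewrite /= -catA -/(encs z); eapply T1_seq; first exact: H.
      exact: T1_pop.
    rewrite /= -cat_rcons.
    have -> : head sblank (code (encs z) ++ a) = head s0 (code (encs z)) by case: (z).
    have -> : behead (code (encs z) ++ a) = behead (code (encs z)) ++ a by case: (z).
    by apply: IH => //; rewrite size_rcons; lia.
  by rewrite /= size_cat size_code; nia.
move=> nb le; have sx := sz_encs nb; eapply T1_le.
  eapply T1_seq; first exact: T1_pop.
  have := loop [::] x nb; rewrite /=.
  have -> : head s0 (code (encs x)) = head sblank (code (encs x) ++ a) by case: (x).
  have -> : behead (code (encs x)) ++ a = behead (code (encs x) ++ a) by case: (x).
  by apply; lia.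
by rewrite /= size_cat size_code; nia.
Qed.

Transparent T1.

(* [e1] computes in unary, from the input, the number of random bits; [e2]
   computes the output word from these bits and the input. *)
Definition prog (e1 e2 : expr) : cmd :=
  Seq prelude (Seq readin (Seq (compile id e1) (Seq marks (Seq fill (Seq randlist
    (Seq (compile id e2) (Seq output (mv right3 0)))))))).

Lemma exec_prog e1 e2 (x : seq sym) R (outf : seq bool -> seq sym) Y A :
  wf 1 e1 -> wf 2 e2 -> sblank \notin x ->
  eval e1 [:: encs x] = encn R ->
  (forall rho, size rho = R -> sblank \notin outf rho /\
    eval e2 [:: encl (map encb rho); encs x] = encs (outf rho)) ->
  2 <= Y -> size x <= Y -> work e1 [:: encs x] <= Y ->
  (forall rho, size rho = R -> work e2 [:: encl (map encb rho); encs x] <= Y) ->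
  exists2 t1, t1 + 6 * R + 4 < Y ^ 40 & forall r,
    let out := outf [seq r (t1 + 4 + 6 * i) | i <- iota 0 R] in
    exists t tp, [/\ t <= Y ^ 40, size out <= Y, forall i, tp (Posz i) = nth sblank out i &
      exists f, exec r (prog e1 e2) 1 (sblank, (-1)%R, ctape (init_config A x)) t (f, 0%R, tp)].
Proof.
move=> w1 w2 nx v1 v2 Y2 xY W1 W2.
set M := 100 * Y.
have RY : R <= Y.
  by have := sz_eval e1 [:: encs x]; rewrite v1 sz_encn; lia.
have sX := sz_encs nx.
(* A common bound for every phase of the program, [cost M] times the work of an expression being the
   largest; sixteen times [q] leaves room for all phases. *)
set q := 4000 * (101 * Y) * (101 * Y) * Y.
have qY : 16 * q <= Y ^ 40.
  (* As [2 <= Y], the powers [Y ^ 12], [Y ^ 7], [Y ^ 7] and [Y ^ 4] absorb the factors 4000, 101,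
     101 and 16. *)
  rewrite (_ : 40 = 12 + 7 + 7 + 4 + 7 + 3) // !(expnD Y).
  have P k : 2 ^ k <= Y ^ k by case: k => // k; rewrite leq_exp2r.
  have -> : 16 * q = 4000 * 101 * 101 * 16 * 1 * Y ^ 3.
    by rewrite /q !expnS expn0; lia.
  by repeat (apply: leq_mul => //); apply: leq_trans (P _).
have MY : M.+2 <= 101 * Y by rewrite /M; lia.
have c1 a b c : a <= 4000 -> b <= 101 * Y -> c <= 2 * Y -> a * b * c <= q.
  move=> ha hb hc; apply: leq_trans (leq_mul (leq_mul ha hb) hc) _.
  by rewrite /q -!mulnA !leq_mul //; nia.
have cM W : W <= Y -> cost M * W <= q.
  by move=> WY; rewrite /cost /q !leq_mul.
clearbody q.
have q1 : 24 * 1 * 1 <= q by apply: c1; lia.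
have [tp1 R1 E1] := @exec_prelude x 1 sblank A nx.
have [|t2 [tp2 [le2 R2 E2]]] := @T1_readin x sblank M nx _ 4 tp1 R1; first by rewrite /M; lia.
have [|||f3 H3] := @comp_correct e1 id [:: encs x] [:: encs x] [::] [::] M sblank.
- by [].
- by [].
- rewrite /codes /= !cats0 size_code /M; lia.
rewrite /codes /= !cats0 v1 in H3.
have [t3 [tp3 [le3 R3 E3]]] := H3 t2 _ R2.
have [|t4 [tp4 [le4 R4 E4]]] := @T1_marks R [::] (code (encs x)) f3 M _ t3 tp3 R3.
  by rewrite size_code /M; lia.
have [t5 le5 F5] := @exec_fill _ t4 s0 _ R4.
rewrite /= size_nseq in le5 F5.
have b1 : 400 * M.+1 * (size x).+1 <= q by apply: c1; lia.
have b2 : cost M * work e1 [:: encs x] <= q by apply: cM.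
have b3 : 100 * M.+2 * R.+1 <= q by apply: c1; lia.
have b4 : 24 * R.+1 <= q by rewrite -(muln1 24); apply: c1; lia.
have b6 : 400 * M.+2 * R.+1 <= q by apply: c1; lia.
have b8' y : y <= Y -> 300 * M.+2 * y.+1 <= q by move=> yY; apply: c1; lia.
exists t4.
  have b5 : 6 * 1 * R.+1 <= q by apply: c1; lia.
  lia.
move=> r /=; set rho := [seq r _ | i <- _].
have srho : size rho = R by rewrite size_map size_iota.
have [no ev] := v2 _ srho; have we := W2 _ srho.
have [tp5 R5 E5] := F5 r.
have so : size (outf rho) <= Y.
  have := sz_eval e2 [:: encl (map encb rho); encs x]; rewrite ev.
  have : 2 * size (outf rho) <= sz (encs (outf rho)); last by lia.
  by elim: (outf rho) => //= a l IH; rewrite -/(encs l) sz_encn; lia.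
have sb := sz_bools rho.
have [||t6 [tp6 [le6 R6 E6]]] := @T1_randlist (rev rho) [::] (code (encs x)) s0 M _ t5 tp5.
- by rewrite size_rev srho size_code /M; lia.
- move: R5; congr rep; congr Sig; rewrite map_rev; congr rev.
  by rewrite /rho -map_comp.
rewrite revK in R6.
have [|||f7 H7] := @comp_correct e2 id [:: encl (map encb rho); encs x]
  [:: encl (map encb rho); encs x] [::] [::] M sblank.
- by [].
- by [].
- by rewrite /codes /= !cats0 size_cat !size_code /M; lia.
rewrite /codes /= !cats0 ev in H7.
have [t7 [tp7 [le7 R7 E7]]] := H7 t6 _ R6.
have [|t8 [tp8 [le8 R8 E8]]] := @T1_output f7 (outf rho) (code (encl (map encb rho)) ++ code (encs x)) M no _ t7 tp7 R7.
- by rewrite size_cat !size_code /M; lia.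
rewrite size_rev srho in le6.
have b7 : cost M * work e2 [:: encl (map encb rho); encs x] <= q by apply: cM.
have b8 := b8' _ so.
exists (t8 + 1), tp8; split=> //.
- lia.
- exact: (repR R8).
exists s0.
apply: ExSeq; first exact: E1.
apply: ExSeq; first exact: E2.
apply: ExSeq; first exact: E3.
apply: ExSeq; first exact: E4.
apply: ExSeq; first exact: E5.
apply: ExSeq; first exact: E6.
apply: ExSeq; first exact: E7.
apply: ExSeq; first exact: E8.
have -> : 0%R = (Negz 0 + 1%:Z)%R by lia.
exact: exec_mvr.
Qed.

(** [tau i] is the time at which the [i]-th random bit is drawn. That [tau] is chosen before [r], is
    injective and stays below [T] is what makes the drawn bits uniform when [r] is uniform on [T]
    bits. *)
Theorem machine_spec e1 e2 : wf 1 e1 -> wf 2 e2 -> exists k,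
  forall (x : seq sym) R B (outf : seq bool -> seq sym), sblank \notin x ->
  E B [:: encs x] e1 (encn R) ->
  (forall rho, size rho = R -> sblank \notin outf rho /\
    E B [:: encl (map encb rho); encs x] e2 (encs (outf rho))) ->
  let T := (size x + B + 2) ^ k in
  exists tau : nat -> nat, [/\ injective tau, forall i, i < R -> tau i < T &
    forall r, let out := outf [seq r (tau i) | i <- iota 0 R] in
      exists t tp, [/\ t <= T, size out <= T, forall i, tp (Posz i) = nth sblank out i &
      run t r (init_config (machine (prog e1 e2)) x) =
        @Config (machine (prog e1 e2)) ord_max 0%R tp]].
Proof.
move=> w1 w2; have [k1 P1] := work_poly e1; have [k2 P2] := work_poly e2.
exists ((1 + (4 * k1 + 2) + ((4 * k1 + 9) * k2 + 2)) * 40) => x R B outf nx [v1 o1] H2 T.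
set N := (size x + B + 2) in T *; have N2 : 1 < N by rewrite /N; lia.
have sX := sz_encs nx.
have A1 : work e1 [:: encs x] <= N ^ (4 * k1).
  apply: exp_exp (P1 _ _ o1) => //.
  apply: (@leq_trans (8 * N)); first by rewrite /szs /= /N; lia.
  rewrite (expnD N 3 1) expn1 leq_mul2r; apply/orP; right.
  by rewrite -[8]/(2 ^ 3) leq_exp2r.
have RN : R <= N ^ (4 * k1).
  by have := sz_eval e1 [:: encs x]; rewrite v1 sz_encn; lia.
have A2 rho : size rho = R -> work e2 [:: encl (map encb rho); encs x] <= N ^ ((4 * k1 + 9) * k2).
  move=> sr; have [_ [_ o2]] := H2 _ sr; apply: exp_exp (P2 _ _ o2) => //.
  have sb := sz_bools rho.
  apply: (@leq_trans (4 * R + 8 * N)); first by rewrite /szs /= /N; lia.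
  have : 8 <= N ^ 3 by rewrite -[8]/(2 ^ 3) leq_exp2r.
  have : 0 < N ^ (4 * k1) by rewrite expn_gt0; lia.
  have : N <= N ^ 3 by rewrite -{1}(expn1 N) leq_exp2l.
  rewrite [N ^ (_ + 9)]expnD (expnD N 3 6) (expnD N 3 3); move: RN.
  move: (N ^ (4 * k1)) (N ^ 3) => Y0 Z RY NZ y0 Z8.
  have : Z * 64 <= Z * (Z * Z) by rewrite leq_mul2l; apply/orP; right; nia.
  by move: (Z * (Z * Z)) => V; nia.
set Y := N ^ (1 + (4 * k1 + 2) + ((4 * k1 + 9) * k2 + 2)).
have [|||||t1 tl H] := @exec_prog e1 e2 x R outf Y (machine (prog e1 e2)) w1 w2 nx v1.
- by move=> rho sr; have [no [ev _]] := H2 _ sr.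
- apply: (@leq_trans (N ^ 1)); first by rewrite expn1.
  by rewrite leq_exp2l //; lia.
- apply: (@leq_trans (N ^ 1)); first by rewrite expn1 /N; lia.
  by rewrite leq_exp2l //; lia.
- by apply: exp_le A1 _ => //; lia.
- by move=> rho sr; apply: exp_le (A2 _ sr) _ => //; lia.
have TY : T = Y ^ 40 by rewrite /T /Y -expnM.
exists (fun i => t1 + 4 + 6 * i); split.
- by move=> i j; lia.
- by move=> i lt; rewrite TY; lia.
move=> r; have [t [tp [lt so tpE [f ex]]]] := H r.
exists t, tp; split=> //; first by rewrite TY.
  by rewrite TY; apply: leq_trans so _; rewrite -{1}(expn1 Y) leq_exp2l //; apply: leq_trans N2 _; rewrite -{1}(expn1 N) leq_exp2l //; lia.
exact: machine_run ex.
Qed.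

(** * Evaluation rules *)

Lemma E_var B env i v : nth Lf env i = v -> E B env (Var i) v.
Proof. by []. Qed.
Lemma E_nul B env : E B env Nul Lf. Proof. by []. Qed.
Lemma E_cns B env a b u v : E B env a u -> E B env b v -> E B env (Cns a b) (Nd u v).
Proof. by move=> [<- oa] [<- ob]. Qed.
Lemma E_case B env c a b d v : E B env c d ->
  (if d is Nd h t then E B (h :: t :: env) b v else E B env a v) ->
  E B env (Case c a b) v.
Proof. by move=> [ec oc] H; rewrite /E /= ec; case: d {ec} H => [|h t] [-> ?]. Qed.

Inductive EA (B : nat) (env : seq tree) : seq expr -> seq tree -> Prop :=
| EA_nil : EA B env [::] [::]
| EA_cons a l v vs : E B env a v -> EA B env l vs -> EA B env (a :: l) (v :: vs).

Lemma E_call B env f args vs v : EA B env args vs -> E B vs f v -> E B env (Call f args) v.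
Proof.
move=> Ha [ef of'].
have [ev oa] : [seq eval a env | a <- args] = vs /\
    foldr (fun p q => p /\ q) True [seq ok B a env | a <- args].
  by elim: Ha {ef of'} => //= a l v' vs' [-> oa] _ [-> ol].
by rewrite /E /= ev.
Qed.

Lemma E_eq B env e v w : E B env e v -> v = w -> E B env e w.
Proof. by move=> H <-. Qed.

(** Transfers a left fold over encoded data to the language. Size bound and body are only required
    at states reached after a prefix of [s], where facts about partial folds are available. *)
Lemma E_fold (T U : Type) (eT : T -> tree) (eU : U -> tree) (F : U -> T -> U)
    B env l i b (s : seq T) (u0 : U) :
  E B env l (encl (map eT s)) -> E B env i (eU u0) ->
  (forall s1 s2, s = s1 ++ s2 -> sz (eU (foldl F u0 s1)) <= B) ->
  (forall s1 x s2, s = s1 ++ x :: s2 ->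
     E B (eT x :: eU (foldl F u0 s1) :: env) b (eU (F (foldl F u0 s1) x))) ->
  E B env (Fold l i b) (eU (foldl F u0 s)).
Proof.
move=> [El ol] [Ei oi] Hs Hb.
suff [H1 H2] : foldD (fun h u => eval b (h :: u :: env)) (encl (map eT s)) (eU u0) = eU (foldl F u0 s)
   /\ okD B (fun h u => eval b (h :: u :: env)) (fun h u => ok B b (h :: u :: env))
       (encl (map eT s)) (eU u0).
  by split; rewrite /= El Ei.
elim: s u0 {El ol Ei oi} Hs Hb => [|x s IH] u0 Hs Hb /=.
  by split=> //; split=> //; apply: (Hs [::] [::]).
have [ex ox] := Hb [::] x s erefl; rewrite /= in ex ox.
have [||e1 o1] := IH (F u0 x).
- by move=> s1 s2 E; apply: (Hs (x :: s1) s2); rewrite E.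
- by move=> s1 y s2 E; apply: (Hb (x :: s1) y s2); rewrite E.
rewrite ex; split=> //; split=> //.
exact: (Hs [::] (x :: s) erefl).
Qed.

Lemma E_iter (U : Type) (eU : U -> tree) (F : U -> U) B env l i b k (u0 : U) :
  E B env l (encn k) -> E B env i (eU u0) ->
  (forall j, j <= k -> sz (eU (iter j F u0)) <= B) ->
  (forall j, j < k -> E B (Lf :: eU (iter j F u0) :: env) b (eU (iter j.+1 F u0))) ->
  E B env (Fold l i b) (eU (iter k F u0)).
Proof.
have it j : iter j F u0 = foldl (fun u (_ : unit) => F u) u0 (nseq j tt).
  by elim: j u0 => //= j IH u0; rewrite -IH -iterS iterSr.
have sp j s2 : nseq k tt = nseq j tt ++ s2 -> j <= k.
  by move/(congr1 size); rewrite size_cat !size_nseq => ->; apply: leq_addr.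
have ns (s : seq unit) : s = nseq (size s) tt by elim: s => //= -[] s {1}->.
move=> Hl Hi Hs Hb; rewrite it.
apply: (@E_fold unit U (fun=> Lf)) => //.
- by rewrite map_nseq.
- by move=> s1 s2; rewrite (ns s1) -it => /sp; apply: Hs.
move=> s1 [] s2; rewrite (ns s1) -it => E.
apply: Hb; have := congr1 size E; rewrite size_cat !size_nseq /=; lia.
Qed.

(* Programs are written with Rocq binders: a term maps the number of enclosing
   binders to an expression, and a variable is a de Bruijn level. *)
Definition hx := nat -> expr.
Definition hvar (k : nat) : hx := fun d => Var (d - k.+1).
Definition hnul : hx := fun _ => Nul.
Definition hcns (a b : hx) : hx := fun d => Cns (a d) (b d).
Definition hcase (c a : hx) (b : hx -> hx -> hx) : hx :=
  fun d => Case (c d) (a d) (b (hvar d.+1) (hvar d) d.+2).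
Definition hfold (l i : hx) (b : hx -> hx -> hx) : hx :=
  fun d => Fold (l d) (i d) (b (hvar d.+1) (hvar d) d.+2).
Definition hcall (f : expr) (args : seq hx) : hx :=
  fun d => Call f (map (fun a : hx => a d) args).
Definition hif (c a b : hx) : hx := hcase c b (fun _ _ => a).
Definition hlet2 (c : hx) (b : hx -> hx -> hx) : hx := hcase c hnul b.
(** Binding a value is expressed as matching on a freshly built pair, so it introduces two
    binders. *)
Definition hlet (c : hx) (b : hx -> hx) : hx := hlet2 (hcns c hnul) (fun x _ => b x).
Definition hnat (k : nat) : hx := fun _ => iter k (Cns Nul) Nul.
Definition fn1 (b : hx -> hx) : expr := b (hvar 0) 1.
Definition fn2 (b : hx -> hx -> hx) : expr := b (hvar 1) (hvar 0) 2.
Definition fn3 (b : hx -> hx -> hx -> hx) : expr := b (hvar 2) (hvar 1) (hvar 0) 3.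
Definition fn4 (b : hx -> hx -> hx -> hx -> hx) : expr :=
  b (hvar 3) (hvar 2) (hvar 1) (hvar 0) 4.
Definition fn5 (b : hx -> hx -> hx -> hx -> hx -> hx) : expr :=
  b (hvar 4) (hvar 3) (hvar 2) (hvar 1) (hvar 0) 5.
Definition fn6 (b : hx -> hx -> hx -> hx -> hx -> hx -> hx) : expr :=
  b (hvar 5) (hvar 4) (hvar 3) (hvar 2) (hvar 1) (hvar 0) 6.

Definition fn8 (b : hx -> hx -> hx -> hx -> hx -> hx -> hx -> hx -> hx) : expr :=
  b (hvar 7) (hvar 6) (hvar 5) (hvar 4) (hvar 3) (hvar 2) (hvar 1) (hvar 0) 8.
Definition fn10 (b : hx -> hx -> hx -> hx -> hx -> hx -> hx -> hx -> hx -> hx -> hx) : expr :=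
  b (hvar 9) (hvar 8) (hvar 7) (hvar 6) (hvar 5) (hvar 4) (hvar 3) (hvar 2) (hvar 1) (hvar 0) 10.

Ltac hred t := eval cbv beta iota zeta delta
  [hvar hnul hcns hcase hfold hcall hif hlet hlet2 hnat iter fn1 fn2 fn3 fn4 fn5 fn6 fn8 fn10
   subn subn_rec Nat.sub map] in t.

Ltac ev1 :=
  lazymatch goal with
  | |- E _ _ (Var _) _ => apply: E_var; cbn [nth]; reflexivity
  | |- E _ _ Nul _ => exact: E_nul
  | |- E _ _ (Cns _ _) _ => eapply E_cns
  | |- EA _ _ [::] _ => exact: EA_nil
  | |- EA _ _ (_ :: _) _ => eapply EA_cons
  end.
Ltac ev := repeat ev1.
Ltac cas := eapply E_case; [by ev | rewrite /=].
Tactic Notation "cal" uconstr(L) := eapply E_call; [by ev | eapply L].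

(** * Lists *)

Definition ssz (s : seq tree) : nat := sumn [seq (sz d).+1 | d <- s].
Lemma sz_enclE s : sz (encl s) = (ssz s).+1. Proof. exact: sz_encl. Qed.
Lemma ssz_cons d s : ssz (d :: s) = (sz d).+1 + ssz s. Proof. by []. Qed.
Lemma ssz_cat s t : ssz (s ++ t) = ssz s + ssz t.
Proof. by rewrite /ssz map_cat sumn_cat. Qed.
Lemma ssz_rev s : ssz (rev s) = ssz s.
Proof. by rewrite /ssz map_rev sumn_rev. Qed.

Definition eRev : expr := ltac:(let t := hred (fn1 (fun s =>
  hfold s hnul (fun x u => hcns x u))) in exact t).
Definition eCatrev : expr := ltac:(let t := hred (fn2 (fun s t =>
  hfold s t (fun x u => hcns x u))) in exact t).
Definition eApp : expr := ltac:(let t := hred (fn2 (fun s t =>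
  hcall eCatrev [:: hcall eRev [:: s]; t])) in exact t).
Definition eHead : expr := ltac:(let t := hred (fn1 (fun s =>
  hcase s hnul (fun x _ => x))) in exact t).
Definition eTail : expr := ltac:(let t := hred (fn1 (fun s =>
  hcase s hnul (fun _ y => y))) in exact t).
Definition eDrop : expr := ltac:(let t := hred (fn2 (fun c s =>
  hfold c s (fun _ u => hcall eTail [:: u]))) in exact t).
Definition eSplit : expr := ltac:(let t := hred (fn2 (fun c s =>
  hfold c (hcns hnul s) (fun _ u => hlet2 u (fun f r =>
    hcase r u (fun h t => hcns (hcns h f) t))))) in exact t).

Lemma E_catrev B s t : ssz s + ssz t < B -> E B [:: encl s; encl t] eCatrev (encl (catrev s t)).
Proof.
move=> le; have -> : catrev s t = foldl (fun u x => x :: u) t s by elim: (s) (t) => //= x s' IH t'.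
rewrite -{1}(map_id s); apply: E_fold; try by ev.
move=> s1 s2 Es.
have -> : foldl (fun u x => x :: u) t s1 = rev s1 ++ t.
  by rewrite -catrevE; elim: (s1) (t) => //= x s' IH t'.
by rewrite sz_enclE ssz_cat ssz_rev; move: le; rewrite Es ssz_cat; lia.
Qed.

Lemma E_rev B s : ssz s < B -> E B [:: encl s] eRev (encl (rev s)).
Proof.
move=> le; have -> : rev s = foldl (fun u x => x :: u) [::] s.
  by rewrite /rev; elim: (s) [::] => //= x s' IH t'.
rewrite -{1}(map_id s); apply: (@E_fold _ _ id encl); try by ev.
move=> s1 s2 Es.
have -> : foldl (fun u x => x :: u) [::] s1 = rev s1.
  by rewrite /rev; elim: (s1) [::] => //= x s' IH t'.
by rewrite sz_enclE ssz_rev; move: le; rewrite Es ssz_cat; lia.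
Qed.

Lemma E_app B s t : ssz s + ssz t < B -> E B [:: encl s; encl t] eApp (encl (s ++ t)).
Proof.
move=> le; apply: E_call.
  apply: EA_cons; last by ev.
  apply: E_call; first by ev.
  by apply: E_rev; lia.
by rewrite -{2}(revK s) -catrevE; apply: E_catrev; rewrite ssz_rev.
Qed.

Lemma E_head B s : E B [:: encl s] eHead (head Lf s).
Proof. by apply: E_case; first ev; case: s => [|x s] /=; ev. Qed.
Lemma E_tail B s : E B [:: encl s] eTail (encl (behead s)).
Proof. by apply: E_case; first ev; case: s => [|x s] /=; ev. Qed.

Lemma ssz_drop k s : ssz (drop k s) <= ssz s.
Proof. by rewrite -{2}(cat_take_drop k s) ssz_cat leq_addl. Qed.
Lemma ssz_take k s : ssz (take k s) <= ssz s.
Proof. by rewrite -{2}(cat_take_drop k s) ssz_cat leq_addr. Qed.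

Lemma iter_behead T k (s : seq T) : iter k behead s = drop k s.
Proof. by elim: k => [|k IH]; rewrite ?drop0 //= IH; elim: (s) k {IH} => // x s' IH [|k] //=; rewrite drop0. Qed.

Lemma E_drop B k s : ssz s < B -> E B [:: encn k; encl s] eDrop (encl (drop k s)).
Proof.
move=> le; rewrite -iter_behead; apply: (@E_iter _ encl behead); try by ev.
  by move=> j _; rewrite iter_behead sz_enclE; have := ssz_drop j s; lia.
by move=> j _; apply: E_call; first ev; apply: E_tail.
Qed.

Lemma E_split B k s : ssz s + 4 <= B ->
  E B [:: encn k; encl s] eSplit (Nd (encl (rev (take k s))) (encl (drop k s))).
Proof.
move=> le.
pose F (u : seq tree * seq tree) := if u.2 is h :: t then (h :: u.1, t) else u.
have it j : iter j F ([::], s) = (rev (take j s), drop j s).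
  elim: j => [|j IH]; rewrite ?take0 ?drop0 //= IH /F /=.
  case: (ltnP j (size s)) => js.
    by rewrite (drop_nth Lf) // (take_nth Lf) // rev_rcons.
  by rewrite drop_oversize // !take_oversize // ?drop_oversize // leqW.
pose eU (u : seq tree * seq tree) := Nd (encl u.1) (encl u.2).
have -> : Nd (encl (rev (take k s))) (encl (drop k s)) = eU (iter k F ([::], s)) by rewrite it.
apply: (@E_iter _ eU F); try by ev.
  move=> j _; rewrite it /eU /= !sz_enclE ssz_rev.
  by have := ssz_cat (take j s) (drop j s); rewrite cat_take_drop; lia.
move=> j _; rewrite iterS; case: (iter j F _) => f r /=.
apply: E_case; first by ev.
apply: E_case; first by ev.
by case: r => [|h t]; ev.
Qed.

(** * Fixed-width binary numbers, least significant bit first *)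

Definition encB (x : seq bool) : tree := encl (map encb x).
Lemma ssz_bits x : ssz (map encb x) <= 4 * size x.
Proof. by elim: x => //= b x IH; rewrite ssz_cons; have := sz_encb b; lia. Qed.
Lemma sz_encB x : sz (encB x) <= 4 * size x + 1.
Proof. by rewrite sz_enclE; have := ssz_bits x; lia. Qed.

Definition eXor : expr := ltac:(let t := hred (fn2 (fun a b =>
  hif a (hif b hnul (hcns hnul hnul)) b)) in exact t).
Definition eMaj : expr := ltac:(let t := hred (fn3 (fun a b c =>
  hif a (hif b (hcns hnul hnul) c) (hif b c hnul))) in exact t).
Definition maj (a b c : bool) := if a then b || c else b && c.

Lemma E_xor B a b : E B [:: encb a; encb b] eXor (encb (a (+) b)).
Proof. by case: a b => -[]. Qed.
Lemma E_maj B a b c : E B [:: encb a; encb b; encb c] eMaj (encb (maj a b c)).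
Proof. by case: a b c => -[] []. Qed.

Definition eAddstep : expr := ltac:(let t := hred (fn5 (fun b yb c y res =>
  hcns (hcall eMaj [:: b; yb; c]) (hcns y
    (hcns (hcall eXor [:: b; hcall eXor [:: yb; c]]) res)))) in exact t).
Definition eAdder : expr := ltac:(let t := hred (fn4 (fun x y flip c =>
  hlet2 (hfold x (hcns c (hcns y hnul)) (fun b u =>
      hlet2 u (fun c' yr => hlet2 yr (fun y' res =>
        hcall eAddstep [:: b; hcall eXor [:: hcall eHead [:: y']; flip]; c';
                           hcall eTail [:: y']; res]))))
    (fun c' yr => hlet2 yr (fun _ res => hcns c' (hcall eRev [:: res]))))) in exact t).

Definition addst := (bool * (seq bool * seq bool))%type.
Definition addstep (flip : bool) (u : addst) (b : bool) : addst :=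
  let: (c, (y, res)) := u in
  let yb := head false y (+) flip in
  (maj b yb c, (behead y, (b (+) (yb (+) c)) :: res)).
(* The carry and the sum of [x] and [y], whose bits are inverted when [flip]. *)
Definition adder (x y : seq bool) (flip c : bool) : bool * seq bool :=
  let: (c', (_, res)) := foldl (addstep flip) (c, (y, [::])) x in (c', rev res).

Lemma E_headb B (y : seq bool) : E B [:: encB y] eHead (encb (head false y)).
Proof. by apply: E_eq (E_head B _) _; case: y. Qed.
Lemma E_tailb B (y : seq bool) : E B [:: encB y] eTail (encB (behead y)).
Proof. by apply: E_eq (E_tail B _) _; rewrite /encB behead_map. Qed.

Lemma addstep_size flip u x :
  size (foldl (addstep flip) u x).2.2 = size u.2.2 + size x /\
  size (foldl (addstep flip) u x).2.1 <= size u.2.1.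
Proof.
elim: x u => [|b x IH] [c [y res]] /=; first by split; lia.
have [-> le] := IH (addstep flip (c, (y, res)) b); rewrite /= size_behead in le *; split; lia.
Qed.
Lemma size_adder x y flip c : size (adder x y flip c).2 = size x.
Proof.
rewrite /adder; case E: foldl => [c' [y' res]] /=.
by have [] := addstep_size flip (c, (y, [::])) x; rewrite E /= size_rev.
Qed.

Lemma E_adder B x y flip c : 8 * (size x + size y) + 20 <= B ->
  E B [:: encB x; encB y; encb flip; encb c] eAdder
    (Nd (encb (adder x y flip c).1) (encB (adder x y flip c).2)).
Proof.
move=> le.
pose eU (u : addst) := Nd (encb u.1) (Nd (encB u.2.1) (encB u.2.2)).
apply: E_case.
  apply: (@E_fold _ _ encb eU (addstep flip) _ _ _ _ _ x (c, (y, [::]))); try by ev.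
    move=> s1 s2 Ex; have [e1 e2] := addstep_size flip (c, (y, [::])) s1.
    have := sz_encB (foldl (addstep flip) (c, (y, [::])) s1).2.1.
    have := sz_encB (foldl (addstep flip) (c, (y, [::])) s1).2.2.
    rewrite /eU /= e1 /=; have := sz_encb (foldl (addstep flip) (c, (y, [::])) s1).1.
    by rewrite /= in e2; move: le; rewrite Ex size_cat; lia.
  move=> s1 b s2 _; case: (foldl _ _ s1) => c' [y' res].
  apply: E_case; first by ev.
  apply: E_case; first by ev.
  apply: E_call.
    ev.
      eapply E_call; last by eapply E_xor.
      by ev; cal E_headb.
    by cal E_tailb.
  rewrite /eU /eAddstep /=; ev; first by cal E_maj.
  eapply E_call; last by eapply E_xor.
  by ev; cal E_xor.
rewrite /adder.
have [e1 _] := addstep_size flip (c, (y, [::])) x; move: e1.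
case: (foldl _ _ x) => c' [y' res] /= e1.
cas; ev; eapply E_call; first by ev.
rewrite /encB map_rev; apply: E_rev.
by have := ssz_bits res; lia.
Qed.

(** * The sampling algorithm on lists *)

Notation option2 := (option (nat * nat)).
(* A layer option has a cost and a list of instructions: [None] starts a new
   list, [Some (x, q)] inserts [x] at position [q] of the current one. *)
Definition lopt := (nat * seq option2)%type.
Definition layer := seq lopt.
Definition rowT := seq (seq bool).
Definition entry := (layer * rowT)%type.
Definition inst := (seq bool * ((nat * nat) * seq entry))%type.

Definition badd (x y : seq bool) : seq bool := (adder x y false false).2.
(* Two's complement: the final carry tells whether [y <= x]. *)
Definition bsub (x y : seq bool) : bool * seq bool := adder x y true true.

Definition splitstep (l : seq (nat * nat)) : seq (nat * nat) :=
  if l is (q, r) :: _ then (q.+1, r.-1) :: l else l.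
Definition splits (k : nat) : seq (nat * nat) := iter k splitstep [:: (0, k)].

(** With [hi], the element [x] follows all present ones in the original order, and inverts with the
    [k - q] elements placed behind it. Otherwise it precedes them all and inverts with the [q]
    elements placed ahead of it. *)
Definition mkopt (hi : bool) (x : nat) (p : nat * nat) : lopt :=
  (if hi then p.2 else p.1, [:: Some (x, p.1)]).
Definition mklayer (hi : bool) (k x : nat) : layer :=
  foldl (fun u p => mkopt hi x p :: u) [::] (splits k).
Definition addlayers (hi : bool) (items : seq nat) (st : nat * seq layer) :=
  foldl (fun u x => (u.1.+1, mklayer hi u.1 x :: u.2)) st items.
(** In the original order [x1] precedes and [x2] follows the [k] elements present, so [x1] at [p]
    costs [p] and then [x2] at [q] costs [k.+1 - q]. An option is kept when [p < q], the condition
    for [x1] to end up ahead of [x2], agrees with [first]. *)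
Definition merged (k x1 x2 : nat) (first : bool) : layer :=
  foldl (fun u pr => foldl (fun v qr =>
      if (pr.1 < qr.1) (+) first then v
      else (pr.1 + qr.2, [:: Some (x1, pr.1); Some (x2, qr.1)]) :: v) u (splits k.+1))
    [::] (splits k).
Definition cutstep (w w' : nat) (u : seq nat * seq nat) (x : nat) : seq nat * seq nat :=
  if u.2 is [::] then
    if (x == w) || (x == w') then (u.1, [:: x]) else (x :: u.1, [::])
  else (u.1, x :: u.2).
(** The prefix stays reversed: elements inserted below the present ones have to come nearest
    first. *)
Definition cut (w w' : nat) (L : seq nat) : seq nat * seq nat :=
  let: (pre, rest) := foldl (cutstep w w') ([::], [::]) L in (pre, rev rest).
(** Working outwards from the elements between the constrained ones keeps each new element extreme,
    in the original order, among those present. Later insertions do not alter the relative order of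
    earlier elements, so the joint layer alone decides the constraint. For [w == w'] the empty layer
    leaves no choice, as nobody strictly prefers a partner to that same partner. *)
Definition agentlay (lay : seq layer) (L : seq nat) (con : option2) : seq layer :=
  if con is Some (w, w') then
    if w == w' then [::] :: lay else
    let: (pre, rest) := cut w w' L in
    if rest is x1 :: rest1 then
      let: (mid, rest2) := cut w w' rest1 in
      if rest2 is x2 :: post then
        let: (k1, lay2) := addlayers true (rev mid) (0, lay) in
        (addlayers false pre (addlayers true post
           (k1.+2, merged k1 x1 x2 (x1 == w) :: lay2))).2
      else [::]
    else [::]
  else (addlayers true L (0, lay)).2.
Definition startlayer : layer := [:: (0, [:: None])].
(** [ps] lists the partners of an agent; in a matching there is at most one, and an unassigned agent
    gets no constraint. *)
Definition mkcon (w : nat) (ps : seq nat) : option2 :=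
  if ps is w' :: _ then Some (w, w') else None.
(** Agents are numbered with the men first, and [mw] stands for [m + w], the number of the woman in
    the pair. *)
Definition con (idx mw u w : nat) (pw pu : seq nat) : option2 :=
  if idx == u then mkcon w pw else if idx == mw then mkcon u pu else None.
Definition layers (prefs : seq (seq nat)) (mw u w : nat) (pw pu : seq nat) : seq layer :=
  (foldl (fun st L => (st.1.+1, agentlay (startlayer :: st.2) L (con st.1 mw u w pw pu)))
    (0, [::]) prefs).2.
Definition partw (M : seq (nat * nat)) (u : nat) : seq nat :=
  foldl (fun s p => if p.1 == u then p.2 :: s else s) [::] M.
Definition partu (M : seq (nat * nat)) (w : nat) : seq nat :=
  foldl (fun s p => if p.2 == w then p.1 :: s else s) [::] M.

Definition vecadd (a b : rowT) : rowT :=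
  rev (foldl (fun st x => (behead st.1, badd x (head [::] st.1) :: st.2)) (b, [::]) a).2.
(** Rows are indexed by the cost [e] spent so far. An option of cost [c] leads to entry [e + c] of
    the next row, hence the shift by [drop]; entries beyond the end of the row count as zero. *)
Definition newrow (z : seq bool) (L : layer) (rw : rowT) : rowT :=
  foldl (fun u (o : lopt) => vecadd u (drop o.1 rw)) (foldl (fun u _ => z :: u) [::] rw) L.
(** The computation runs from the last choice back to the first. Each layer is stored with the row
    of the layers after it, which is what is needed to weigh its options when unranking. *)
Definition table (z : seq bool) (lay : seq layer) (base : rowT) : rowT * seq entry :=
  foldl (fun st L => (newrow z L st.1, (L, st.1) :: st.2)) (base, [::]) lay.
Definition mkinst (prefs : seq (seq nat)) (M : seq (nat * nat)) (m : nat) (z : seq bool)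
    (base : rowT) (p : nat * nat) : inst :=
  let: (rw, tab) := table z (layers prefs (m + p.2) p.1 p.2 (partw M p.1) (partu M p.2)) base in
  (head [::] rw, (p, tab)).
Definition iotar (k : nat) : seq nat :=
  iter k (fun s => if s is h :: _ then h.+1 :: s else [:: 0]) [::].
Definition pairsr (m n : nat) : seq (nat * nat) :=
  foldl (fun s u => foldl (fun s' w => (u, w) :: s') s (iotar n)) [::] (iotar m).
Definition insts (prefs : seq (seq nat)) (M : seq (nat * nat)) (m : nat) (z : seq bool)
    (base : rowT) (pairs : seq (nat * nat)) : seq inst :=
  foldl (fun s p => mkinst prefs M m z base p :: s) [::] pairs.
Definition sumcount (z : seq bool) (ii : seq inst) : seq bool :=
  foldl (fun u (i : inst) => badd u i.1) z ii.

(** Weights are subtracted from the rank until one exceeds it; what is left is the rank within the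
    item selected. The first component is empty as long as nothing is selected. *)
Definition selstep (T : Type) (st : seq T * seq bool) (it : seq bool * T) : seq T * seq bool :=
  if st.1 is [::] then
    let: (c, d) := bsub st.2 it.1 in if c then ([::], d) else ([:: it.2], st.2)
  else st.
Definition select (T : Type) (its : seq (seq bool * T)) (r : seq bool) : seq T * seq bool :=
  foldl (@selstep T) ([::], r) its.
Definition ins (q x : nat) (L : seq nat) : seq nat := catrev (rev (take q L)) (x :: drop q L).
Definition atom (p : seq (seq nat)) (a : option2) : seq (seq nat) :=
  if a is Some (x, q) then (if p is L :: ps then ins q x L :: ps else [::]) else [::] :: p.
Definition atoms (s : seq option2) (p : seq (seq nat)) : seq (seq nat) := foldl atom p s.
(** The weight of an option is the number of completions after taking it, found at the cost spent so
    far plus its own. *)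
Definition weigh (e : nat) (rw : rowT) (L : layer) : seq (seq bool * lopt) :=
  foldl (fun s (o : lopt) => (head [::] (drop (e + o.1) rw), o) :: s) [::] L.
Definition urst := (nat * (seq bool * seq (seq nat)))%type.
Definition urstep (st : urst) (en : entry) : urst :=
  let: (e, (r, p)) := st in
  let: (f, r') := select (weigh e en.2 en.1) r in
  if f is o :: _ then (e + o.1, (r', atoms o.2 p)) else st.
Definition unrank (tab : seq entry) (r : seq bool) : seq (seq nat) :=
  (foldl urstep (0, (r, [::])) tab).2.2.

(** The empty list means undecided. Testing [w'] first makes the answer false for [w = w'], as with
    the strict comparison in [scanE]. *)
Definition scanstep (w w' : nat) (st : seq bool) (x : nat) : seq bool :=
  if st is [::] then if x == w' then [:: false] else if x == w then [:: true] else [::]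
  else st.
Definition scan (L : seq nat) (w w' : nat) : bool :=
  head false (foldl (scanstep w w') [::] L).
Definition prefers (L : seq nat) (w : nat) (ps : seq nat) : bool :=
  if ps is w' :: _ then scan L w w' else true.
Definition blocks (p : seq (seq nat)) (M : seq (nat * nat)) (m u w : nat) : bool :=
  if prefers (head [::] (drop u p)) w (partw M u)
  then prefers (head [::] (drop (m + w) p)) u (partu M w) else false.
Definition firstb (p : seq (seq nat)) (M : seq (nat * nat)) (m : nat)
    (pairs : seq (nat * nat)) : seq (nat * nat) :=
  foldl (fun f uw => if f is [::] then if blocks p M m uw.1 uw.2 then [:: uw] else [::] else f)
    [::] pairs.
Definition hit (ii : seq inst) (M : seq (nat * nat)) (m : nat) (pairs : seq (nat * nat))
    (x : seq bool) : bool :=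
  let: (f, r) := select ii x in
  if f is (p, tab) :: _ then
    if firstb (rev (unrank tab r)) M m pairs is p' :: _ then (p.1 == p'.1) && (p.2 == p'.2)
    else false
  else false.

Definition reduce (y sig : seq bool) : seq bool :=
  let: (c, d) := bsub y sig in if c then d else y.
(** Horner's rule modulo [sig]: one random bit is appended to the number and the result is reduced
    at once. *)
Definition sampstep (sig : seq bool) (st : seq bool * seq bool) : seq bool * seq bool :=
  (behead st.1, reduce (adder st.2 st.2 false (head false st.1)).2 sig).
Definition sample (W : nat) (sig z rho : seq bool) := iter W (sampstep sig) (rho, z).
Definition lst := (seq bool * (seq bool * seq bool))%type.
Definition loopstep (W : nat) (sig z one : seq bool) (h : seq bool -> bool) (st : lst) : lst :=
  let: (rho, (p, q)) := st in
  let: (rho', x) := sample W sig z rho in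
  (rho', (if h x then badd p sig else p, badd q one)).

Definition padstep (st : seq bool * seq bool) := (behead st.1, head false st.1 :: st.2).
Definition pad (W : nat) (x : seq bool) : seq bool := rev (iter W padstep (x, [::])).2.
(** The input has the most significant bit first, so consing yields the least significant bit first,
    as the adder requires. *)
Definition parsestep (st : seq bool * seq (seq bool)) (c : sym) :=
  match (c : nat) with
  | 0 => (false :: st.1, st.2) | 1 => (true :: st.1, st.2) | _ => ([::], st.1 :: st.2) end.
Definition parse_nums (x : seq sym) : seq (seq bool) :=
  rev (foldl parsestep ([::], [::]) x).2.
(** Taking the minimum at every step keeps the intermediate unary numbers short, while the binary
    number may be exponential in its length. *)
Definition tounary (cap : nat) (x : seq bool) : nat :=
  foldl (fun u (b : bool) => minn cap (b + (u + u))) 0 (rev x).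
(** Doubling finds a power of two [K] with [b < a * K] without any division. [K] is kept in unary,
    being linear in [b / a]. *)
Definition kstep (b : seq bool) (st : seq bool * nat) : seq bool * nat :=
  if (bsub b st.1).1 then (badd st.1 st.1, st.2 + st.2) else st.
Definition kfac (s : nat) (a b : seq bool) : nat := (iter s (kstep b) (a, 1)).2.
Definition groupstep (n : nat) (st : seq nat * seq (seq nat)) :=
  (drop n st.1, take n st.1 :: st.2).
Definition pairup (s : seq nat) : seq (nat * nat) :=
  (foldl (fun st x => if st.1 is u :: _ then ([::], (u, x) :: st.2) else ([:: x], st.2))
     ([::], [::]) s).2.

Definition kof (s W : nat) (nums : rowT) : nat :=
  kfac s (pad W (nth [::] nums 3)) (pad W (nth [::] nums 4)).
(** The bit length of the counts is quadratic in [m * n], which the input length exceeds by a factor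
    of four; see [pow_split]. *)
Definition getW (x : seq sym) : nat := size x * size x.
(** [K * K] stems from the square of the precision in Chebyshev's inequality, and [size x] from the
    bound [m * n] on the ratio of [Sigma] to the count; the constant 64 is explained in
    [approx_count]. *)
Definition getN (x : seq sym) : nat :=
  let K := kof (size x) (getW x) (parse_nums x) in 64 * (size x * (K * K)).

Definition outword (p q : seq bool) : seq sym :=
  rev (map bsym p) ++ ssep :: rev (map bsym q) ++ [:: ssep].

Definition runalg (W N m l : nat) (prefs : seq (seq nat)) (M : seq (nat * nat))
    (rho : seq bool) (pairs : seq (nat * nat)) : seq sym :=
  let z := pad W [::] in let one := pad W [:: true] in
  let ii := insts prefs M m z (iter l (cons z) [:: one]) pairs in
  let sig := sumcount z ii in
  let st := iter N (loopstep W sig z one (hit ii M m pairs)) (rho, (z, z)) in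
  outword st.2.1 st.2.2.

(** [g1] and [g2] cut the lists of the men and of the women off the flat input, and [behead] skips
    the number of pairs in [M]. The distance gets its own cap since relevant distances may exceed
    the input length. *)
Definition alg (x : seq sym) (rho : seq bool) : seq sym :=
  let nums := parse_nums x in
  let us := map (tounary (size x)) nums in
  let m := nth 0 us 0 in let n := nth 0 us 1 in
  let g1 := iter m (groupstep n) (drop 5 us, [::]) in
  let g2 := iter n (groupstep m) g1 in
  runalg (getW x) (getN x) m (tounary (getW x) (nth [::] nums 2)) (rev g2.2)
    (pairup (behead g2.1)) rho (pairsr m n).

(** * The sampling algorithm as an expression *)

Notation program t := (ltac:(let t' := hred t in exact t')) (only parsing).
Notation "'O1'" := (hcns hnul hnul) (only parsing).

Definition eLeq : expr := program (fn2 (fun a b =>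
  hif (hcall eDrop [:: b; a]) hnul O1)).
Definition eEq : expr := program (fn2 (fun a b =>
  hif (hcall eLeq [:: a; b]) (hcall eLeq [:: b; a]) hnul)).
Definition eAdd : expr := program (fn2 (fun x y =>
  hcall eTail [:: hcall eAdder [:: x; y; hnul; hnul]])).
Definition eSub : expr := program (fn2 (fun x y => hcall eAdder [:: x; y; O1; O1])).

Definition eSplits : expr := program (fn1 (fun k =>
  hfold k (hcns (hcns hnul k) hnul) (fun _ u => hcase u hnul (fun p _ => hlet2 p (fun q r =>
    hcns (hcns (hcns hnul q) (hcall eTail [:: r])) u))))).
Definition eMklayer : expr := program (fn3 (fun hi k x =>
  hfold (hcall eSplits [:: k]) hnul (fun p u => hlet2 p (fun q r =>
    hcns (hcns (hif hi r q) (hcns (hcns x q) hnul)) u)))).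
Definition eAddlayers : expr := program (fn3 (fun hi items st =>
  hfold items st (fun x u => hlet2 u (fun k lay =>
    hcns (hcns hnul k) (hcns (hcall eMklayer [:: hi; k; x]) lay))))).
Definition eMerged : expr := program (fn4 (fun k x1 x2 first =>
  hfold (hcall eSplits [:: k]) hnul (fun pr u => hlet2 pr (fun p _ =>
    hfold (hcall eSplits [:: hcns hnul k]) u (fun qr v => hlet2 qr (fun q r =>
      hif (hcall eXor [:: hcall eLeq [:: hcns hnul p; q]; first]) v
        (hcns (hcns (hcall eApp [:: p; r]) (hcns (hcns x1 p) (hcns (hcns x2 q) hnul))) v))))))).
Definition eCut : expr := program (fn3 (fun w w' L =>
  hlet2 (hfold L (hcns hnul hnul) (fun x u => hlet2 u (fun pre rest =>
    hcase rest
      (hif (hif (hcall eEq [:: x; w]) O1 (hcall eEq [:: x; w']))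
        (hcns pre (hcns x hnul)) (hcns (hcns x pre) hnul))
      (fun _ _ => hcns pre (hcns x rest)))))
  (fun pre rest => hcns pre (hcall eRev [:: rest])))).
Definition eAgent : expr := program (fn3 (fun lay L con =>
  hcase con (hcall eTail [:: hcall eAddlayers [:: O1; L; hcns hnul lay]]) (fun w w' =>
    hif (hcall eEq [:: w; w']) (hcns hnul lay)
    (hlet2 (hcall eCut [:: w; w'; L]) (fun pre rest => hlet2 rest (fun x1 rest1 =>
     hlet2 (hcall eCut [:: w; w'; rest1]) (fun mid rest2 => hlet2 rest2 (fun x2 post =>
     hlet2 (hcall eAddlayers [:: O1; hcall eRev [:: mid]; hcns hnul lay]) (fun k1 lay2 =>
       hcall eTail [:: hcall eAddlayers [:: hnul; pre; hcall eAddlayers [:: O1; post;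
         hcns (hcns hnul (hcns hnul k1))
           (hcns (hcall eMerged [:: k1; x1; x2; hcall eEq [:: x1; w]]) lay2)]]]))))))))).
Definition eMkcon : expr := program (fn2 (fun w ps => hcase ps hnul (fun w' _ => hcns w w'))).
Definition eCon : expr := program (fn6 (fun idx mw u w pw pu =>
  hif (hcall eEq [:: idx; u]) (hcall eMkcon [:: w; pw])
    (hif (hcall eEq [:: idx; mw]) (hcall eMkcon [:: u; pu]) hnul))).
Definition eLayers : expr := program (fn6 (fun prefs mw u w pw pu =>
  hcall eTail [:: hfold prefs (hcns hnul hnul) (fun L st => hlet2 st (fun idx lay =>
    hcns (hcns hnul idx) (hcall eAgent [:: hcns (hcns (hcns hnul (hcns hnul hnul)) hnul) lay;
       L; hcall eCon [:: idx; mw; u; w; pw; pu]])))])).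
Definition ePartw : expr := program (fn2 (fun M u => hfold M hnul (fun p s =>
  hlet2 p (fun a b => hif (hcall eEq [:: a; u]) (hcns b s) s)))).
Definition ePartu : expr := program (fn2 (fun M w => hfold M hnul (fun p s =>
  hlet2 p (fun a b => hif (hcall eEq [:: b; w]) (hcns a s) s)))).

Definition eVecadd : expr := program (fn2 (fun a b =>
  hcall eRev [:: hcall eTail [:: hfold a (hcns b hnul) (fun x st => hlet2 st (fun b' res =>
    hcns (hcall eTail [:: b']) (hcns (hcall eAdd [:: x; hcall eHead [:: b']]) res)))]])).
Definition eNewrow : expr := program (fn3 (fun z L rw =>
  hfold L (hfold rw hnul (fun _ u => hcns z u)) (fun o u => hlet2 o (fun c _ =>
    hcall eVecadd [:: u; hcall eDrop [:: c; rw]])))).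
Definition eTable : expr := program (fn3 (fun z lay base =>
  hfold lay (hcns base hnul) (fun L st => hlet2 st (fun rw tab =>
    hcns (hcall eNewrow [:: z; L; rw]) (hcns (hcns L rw) tab))))).
Definition eInst : expr := program (fn6 (fun prefs M m z base p =>
  hlet2 p (fun u w =>
  hlet2 (hcall eTable [:: z; hcall eLayers [:: prefs; hcall eApp [:: m; w]; u; w;
            hcall ePartw [:: M; u]; hcall ePartu [:: M; w]]; base]) (fun rw tab =>
    hcns (hcall eHead [:: rw]) (hcns p tab))))).
Definition eIotar : expr := program (fn1 (fun k =>
  hfold k hnul (fun _ s => hcase s (hcns hnul hnul) (fun h _ => hcns (hcns hnul h) s)))).
Definition ePairs : expr := program (fn2 (fun m n =>
  hfold (hcall eIotar [:: m]) hnul (fun u s =>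
    hfold (hcall eIotar [:: n]) s (fun w s' => hcns (hcns u w) s')))).
Definition eInsts : expr := program (fn6 (fun prefs M m z base pairs =>
  hfold pairs hnul (fun p s => hcns (hcall eInst [:: prefs; M; m; z; base; p]) s))).
Definition eSum : expr := program (fn2 (fun z ii =>
  hfold ii z (fun i u => hcall eAdd [:: u; hcall eHead [:: i]]))).

Definition eSelect : expr := program (fn2 (fun its r =>
  hfold its (hcns hnul r) (fun it st => hlet2 st (fun f r' =>
    hcase f (hlet2 it (fun cnt pl => hlet2 (hcall eSub [:: r'; cnt]) (fun c d =>
      hif c (hcns hnul d) (hcns (hcns pl hnul) r')))) (fun _ _ => st))))).
Definition eIns : expr := program (fn3 (fun q x L =>
  hlet2 (hcall eSplit [:: q; L]) (fun f r => hcall eCatrev [:: f; hcns x r]))).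
Definition eAtoms : expr := program (fn2 (fun s p =>
  hfold s p (fun a p' => hcase a (hcns hnul p') (fun x q =>
    hlet2 p' (fun L ps => hcns (hcall eIns [:: q; x; L]) ps))))).
Definition eWeigh : expr := program (fn3 (fun e rw L =>
  hfold L hnul (fun o s => hlet2 o (fun c _ =>
    hcns (hcns (hcall eHead [:: hcall eDrop [:: hcall eApp [:: e; c]; rw]]) o) s)))).
Definition eUnrank : expr := program (fn2 (fun tab r =>
  hcall eTail [:: hcall eTail [:: hfold tab (hcns hnul (hcns r hnul)) (fun en st =>
    hlet2 en (fun L rw => hlet2 st (fun e rp => hlet2 rp (fun r1 p =>
      hlet2 (hcall eSelect [:: hcall eWeigh [:: e; rw; L]; r1]) (fun f r2 =>
        hcase f st (fun o _ => hlet2 o (fun c s =>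
          hcns (hcall eApp [:: e; c]) (hcns r2 (hcall eAtoms [:: s; p])))))))))]])).

Definition eScan : expr := program (fn3 (fun L w w' =>
  hcall eHead [:: hfold L hnul (fun x st => hcase st
    (hif (hcall eEq [:: x; w']) (hcns hnul hnul)
      (hif (hcall eEq [:: x; w]) (hcns O1 hnul) hnul)) (fun _ _ => st))])).
Definition ePrefers : expr := program (fn3 (fun L w ps =>
  hcase ps O1 (fun w' _ => hcall eScan [:: L; w; w']))).
Definition eBlocks : expr := program (fn5 (fun p M m u w =>
  hif (hcall ePrefers [:: hcall eHead [:: hcall eDrop [:: u; p]]; w; hcall ePartw [:: M; u]])
    (hcall ePrefers [:: hcall eHead [:: hcall eDrop [:: hcall eApp [:: m; w]; p]]; u;
        hcall ePartu [:: M; w]]) hnul)).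
Definition eFirst : expr := program (fn4 (fun p M m pairs =>
  hfold pairs hnul (fun uw f => hcase f (hlet2 uw (fun u w =>
    hif (hcall eBlocks [:: p; M; m; u; w]) (hcns uw hnul) hnul)) (fun _ _ => f)))).
Definition eHit : expr := program (fn5 (fun ii M m pairs x =>
  hlet2 (hcall eSelect [:: ii; x]) (fun f r => hcase f hnul (fun pt _ =>
    hlet2 pt (fun p tab => hlet2 p (fun u w =>
    hcase (hcall eFirst [:: hcall eRev [:: hcall eUnrank [:: tab; r]]; M; m; pairs]) hnul
      (fun p' _ => hlet2 p' (fun u' w' =>
        hif (hcall eEq [:: u; u']) (hcall eEq [:: w; w']) hnul)))))))).

Definition eReduce : expr := program (fn2 (fun y sig =>
  hlet2 (hcall eSub [:: y; sig]) (fun c d => hif c d y))).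
Definition eSample : expr := program (fn4 (fun W sig z rho =>
  hfold W (hcns rho z) (fun _ st => hlet2 st (fun rho' x =>
    hcns (hcall eTail [:: rho']) (hcall eReduce [::
      hcall eTail [:: hcall eAdder [:: x; x; hnul; hcall eHead [:: rho']]]; sig]))))).
Definition eLoop : expr := program (fn10 (fun N W sig z one ii M m pairs rho =>
  hfold N (hcns rho (hcns z z)) (fun _ st => hlet2 st (fun r pq => hlet2 pq (fun p q =>
    hlet2 (hcall eSample [:: W; sig; z; r]) (fun r' x =>
      hcns r' (hcns
        (hif (hcall eHit [:: ii; M; m; pairs; x]) (hcall eAdd [:: p; sig]) p)
        (hcall eAdd [:: q; one])))))))).

Definition ePad : expr := program (fn2 (fun W x =>
  hcall eRev [:: hcall eTail [:: hfold W (hcns x hnul) (fun _ st => hlet2 st (fun y res =>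
    hcns (hcall eTail [:: y]) (hcns (hcall eHead [:: y]) res)))]])).
Definition eParse : expr := program (fn1 (fun x =>
  hcall eRev [:: hcall eTail [:: hfold x (hcns hnul hnul) (fun c st =>
    hlet2 st (fun cur nums => hcase c (hcns (hcns hnul cur) nums) (fun _ t =>
      hcase t (hcns (hcns O1 cur) nums) (fun _ _ => hcns hnul (hcns cur nums)))))]])).
Definition eTounary : expr := program (fn2 (fun cap x =>
  hfold (hcall eRev [:: x]) hnul (fun b u =>
    hcall eHead [:: hcall eSplit [:: cap; hcall eApp [:: b; hcall eApp [:: u; u]]]]))).
Definition eUnaries : expr := program (fn2 (fun cap nums =>
  hcall eRev [:: hfold nums hnul (fun x s => hcns (hcall eTounary [:: cap; x]) s)])).
Definition eMul : expr := program (fn2 (fun a b =>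
  hfold a hnul (fun _ u => hcall eApp [:: b; u]))).
Definition eK : expr := program (fn3 (fun s a b =>
  hcall eTail [:: hfold s (hcns a O1) (fun _ st => hlet2 st (fun ac u =>
    hlet2 (hcall eSub [:: b; ac]) (fun c _ =>
      hif c (hcns (hcall eAdd [:: ac; ac]) (hcall eApp [:: u; u])) st)))])).
Definition eGroups : expr := program (fn3 (fun k n st =>
  hfold k st (fun _ st' => hlet2 st' (fun s g => hlet2 (hcall eSplit [:: n; s]) (fun f r =>
    hcns r (hcns (hcall eRev [:: f]) g)))))).
Definition ePairup : expr := program (fn1 (fun s =>
  hcall eTail [:: hfold s (hcns hnul hnul) (fun x st => hlet2 st (fun f g =>
    hcase f (hcns (hcns x hnul) g) (fun u _ => hcns hnul (hcns (hcns u x) g))))])).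
Definition eNth : expr := program (fn2 (fun i s => hcall eHead [:: hcall eDrop [:: i; s]])).

Definition eSixtyfour : expr := Eval compute in iter 64 (Cns Nul) Nul.

Definition eLen : expr := program (fn1 (fun s => hfold s hnul (fun _ u => hcns hnul u))).
Definition eN : expr := program (fn3 (fun S W nums =>
  hlet (hcall eK [:: S; hcall ePad [:: W; hcall eNth [:: hnat 3; nums]];
                        hcall ePad [:: W; hcall eNth [:: hnat 4; nums]]]) (fun K =>
    hcall eMul [:: hcall eSixtyfour [::]; hcall eMul [:: S; hcall eMul [:: K; K]]]))).
Definition eBits : expr := program (fn1 (fun X =>
  hlet (hcall eLen [:: X]) (fun S => hlet (hcall eMul [:: S; S]) (fun W =>
    hcall eMul [:: hcall eN [:: S; W; hcall eParse [:: X]]; W])))).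

Definition eRun : expr := program (fn8 (fun W N m l prefs M rho pairs =>
  hlet (hcall ePad [:: W; hnul]) (fun z => hlet (hcall ePad [:: W; hcns O1 hnul]) (fun one =>
  hlet (hcall eInsts [:: prefs; M; m; z;
     hfold l (hcns one hnul) (fun _ u => hcns z u); pairs]) (fun ii =>
  hlet (hcall eSum [:: z; ii]) (fun sig =>
  hlet2 (hcall eLoop [:: N; W; sig; z; one; ii; M; m; pairs; rho]) (fun _ pq =>
  hlet2 pq (fun p q =>
    hcall eCatrev [:: p; hcns (hcns hnul O1) (hcall eCatrev [:: q;
       hcns (hcns hnul O1) hnul])])))))))).
Definition eMain : expr := program (fn2 (fun rho X =>
  hlet (hcall eLen [:: X]) (fun S => hlet (hcall eMul [:: S; S]) (fun W =>
  hlet (hcall eParse [:: X]) (fun nums => hlet (hcall eUnaries [:: S; nums]) (fun us =>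
  hlet (hcall eNth [:: hnul; us]) (fun m => hlet (hcall eNth [:: O1; us]) (fun n =>
  hlet2 (hcall eGroups [:: m; n; hcns (hcall eDrop [:: hnat 5; us]) hnul]) (fun rest g1 =>
  hlet2 (hcall eGroups [:: n; m; hcns rest g1]) (fun rest' g2 =>
    hcall eRun [:: W; hcall eN [:: S; W; nums]; m;
      hcall eTounary [:: W; hcall eNth [:: hnat 2; nums]];
      hcall eRev [:: g2]; hcall ePairup [:: hcall eTail [:: rest']]; rho;
      hcall ePairs [:: m; n]])))))))))).

(** * Correctness of the expressions *)

Lemma drop_nseq T k a (x : T) : drop k (nseq a x) = nseq (a - k) x.
Proof. by elim: a k => [|a IH] [|k] //=; rewrite IH. Qed.
Lemma ssz_nseq a : ssz (nseq a Lf) = 2 * a.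
Proof. by elim: a => //= a IH; rewrite ssz_cons IH /=; lia. Qed.
Lemma ssz_map (T : eqType) (f : T -> tree) c (s : seq T) :
  (forall x, x \in s -> sz (f x) <= c) -> ssz (map f s) <= size s * c.+1.
Proof.
elim: s => //= x s IH H; rewrite ssz_cons mulSn.
have := H x (mem_head _ _).
have := IH (fun y h => H y (@mem_behead _ (x :: s) y h)); lia.
Qed.

Lemma E_dropn B k a : 2 * a < B -> E B [:: encn k; encn a] eDrop (encn (a - k)).
Proof. by move=> le; apply: E_eq (E_drop k _) _; rewrite ?ssz_nseq // drop_nseq. Qed.
Lemma E_appn B a b : 2 * (a + b) < B -> E B [:: encn a; encn b] eApp (encn (a + b)).
Proof.
move=> le; apply: E_eq (E_app _) _; rewrite ?ssz_nseq; first by lia.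
by rewrite /encn nseqD.
Qed.
Lemma E_tailn B a : E B [:: encn a] eTail (encn a.-1).
Proof. by apply: E_eq (E_tail _ _) _; case: a. Qed.
Lemma E_snd B a b : E B [:: Nd a b] eTail b.
Proof. by cas; ev. Qed.
Lemma E_fst B a b : E B [:: Nd a b] eHead a.
Proof. by cas; ev. Qed.


Lemma E_leq B a b : 2 * a < B -> E B [:: encn a; encn b] eLeq (encb (a <= b)).
Proof.
move=> le; eapply E_case; first by cal E_dropn.
by rewrite -subn_eq0; case: (a - b) => [|k] /=; ev.
Qed.

Lemma E_eqn B a b : 2 * a < B -> 2 * b < B -> E B [:: encn a; encn b] eEq (encb (a == b)).
Proof.
move=> la lb; eapply E_case; first by cal E_leq.
rewrite eqn_leq; case: (a <= b) => /=; last by ev.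
by cal E_leq.
Qed.

Lemma E_add B x y : 8 * (size x + size y) + 20 <= B ->
  E B [:: encB x; encB y] eAdd (encB (badd x y)).
Proof.
move=> le; eapply E_call; last by eapply E_snd.
ev; eapply E_call; first by ev.
exact: (@E_adder B x y false false le).
Qed.
Lemma E_sub B x y : 8 * (size x + size y) + 20 <= B ->
  E B [:: encB x; encB y] eSub (Nd (encb (bsub x y).1) (encB (bsub x y).2)).
Proof.
move=> le; eapply E_call; first by ev.
exact: (@E_adder B x y true true le).
Qed.
Lemma size_badd x y : size (badd x y) = size x. Proof. exact: size_adder. Qed.
Lemma size_bsub x y : size (bsub x y).2 = size x. Proof. exact: size_adder. Qed.

(** * Encodings of the data of the algorithm and bounds on their sizes *)

Definition encP (p : nat * nat) : tree := Nd (encn p.1) (encn p.2).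
Definition encPs (s : seq (nat * nat)) : tree := encl (map encP s).
Definition encO (a : option2) : tree := if a is Some p then encP p else Lf.
Definition encopt (o : lopt) : tree := Nd (encn o.1) (encl (map encO o.2)).
Definition encLay (L : layer) : tree := encl (map encopt L).
Definition encLays (s : seq layer) : tree := encl (map encLay s).
Definition encRow (r : rowT) : tree := encl (map encB r).
Definition encEnt (x : entry) : tree := Nd (encLay x.1) (encRow x.2).
Definition encTab (s : seq entry) : tree := encl (map encEnt s).
Definition encNL (s : seq nat) : tree := encl (map encn s).
Definition encNLL (s : seq (seq nat)) : tree := encl (map encNL s).
Definition encInst (i : inst) : tree := Nd (encB i.1) (Nd (encP i.2.1) (encTab i.2.2)).
Definition encInsts (s : seq inst) : tree := encl (map encInst s).

(** The fourth power comes from the deepest data: lists of instances, whose tables are lists of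
    entries, each with a row of bit strings. *)
Lemma HB3 B Y : 100 * (Y * Y * Y * Y) <= B -> 9 < Y -> 100 * (Y * Y * Y) <= B.
Proof. by move=> HB Y1; apply: leq_trans HB; rewrite leq_mul2l /= leq_pmulr //; lia. Qed.
Lemma HB2 B Y : 100 * (Y * Y * Y * Y) <= B -> 9 < Y -> 100 * (Y * Y) <= B.
Proof. by move=> HB Y1; apply: leq_trans (HB3 HB Y1); rewrite leq_mul2l /= leq_pmulr //; lia. Qed.
Lemma HB1 B Y : 100 * (Y * Y * Y * Y) <= B -> 9 < Y -> 100 * Y <= B.
Proof. by move=> HB Y1; apply: leq_trans (HB2 HB Y1); rewrite leq_mul2l /= leq_pmulr //; lia. Qed.

(* The bounds are tracked through [Y]: lists have fewer than [Y] elements and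
   unary numbers are smaller than [Y]. *)
Section Bounds.
Variable Y : nat.
Hypothesis Y1 : 9 < Y.

Definition bNL (s : seq nat) := (size s < Y) && all (fun x => x < Y) s.
Definition bNLL (s : seq (seq nat)) := (size s < Y) && all bNL s.
Definition bP (p : nat * nat) := (p.1 < Y) && (p.2 < Y).
Definition bPs (s : seq (nat * nat)) := (size s < Y) && all bP s.
Definition bO (a : option2) := if a is Some p then bP p else true.
Definition bopt (o : lopt) := [&& o.1 < Y, size o.2 <= 2 & all bO o.2].
Definition blay (L : layer) := (size L < Y) && all bopt L.
Definition blays (s : seq layer) := (size s < Y) && all blay s.
Definition bbits (x : seq bool) := size x < Y.
Definition brow (r : rowT) := (size r < Y) && all bbits r.
Definition bent (x : entry) := blay x.1 && brow x.2.
Definition btab (s : seq entry) := (size s < Y) && all bent s.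
Definition binst (i : inst) := [&& bbits i.1, bP i.2.1 & btab i.2.2].
Definition binsts (s : seq inst) := (size s < Y) && all binst s.

Lemma sz_list (T : eqType) (f : T -> tree) (b : pred T) c (s : seq T) :
  0 < c -> (forall x, b x -> sz (f x) < c) -> (size s < Y) && all b s -> sz (encl (map f s)) <= Y * c.
Proof.
case: c => // c _ H /andP [ls /allP bs]; rewrite sz_enclE.
have := @ssz_map _ f c s (fun x h => H x (bs x h)); nia.
Qed.

Lemma szn x : x < Y -> sz (encn x) < 2 * Y.
Proof. by rewrite sz_encn; lia. Qed.
Lemma szB x : bbits x -> sz (encB x) < 4 * Y.
Proof. by rewrite /bbits => lx; have := sz_encB x; lia. Qed.
Lemma szP p : bP p -> sz (encP p) < 4 * Y.
Proof. by move=> /andP [/szn a /szn b]; rewrite /=; lia. Qed.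
Lemma szPs s : bPs s -> sz (encPs s) <= 4 * (Y * Y).
Proof. by move=> h; apply: leq_trans (sz_list _ szP h) _; nia. Qed.
Lemma szNL s : bNL s -> sz (encNL s) <= 2 * (Y * Y).
Proof. by move=> h; apply: leq_trans (sz_list _ szn h) _; nia. Qed.
Lemma szNLL s : bNLL s -> sz (encNLL s) <= 3 * (Y * Y * Y).
Proof.
move=> h; have H x : bNL x -> sz (encNL x) < 3 * (Y * Y) by move/szNL; nia.
by apply: leq_trans (sz_list _ H h) _; nia.
Qed.
Lemma szopt o : bopt o -> sz (encopt o) < 12 * Y.
Proof.
case: o => c s /= /and3P [/= /szn lc l2 ba].
have H a : bO a -> sz (encO a) <= 4 * Y by case: a => [p /szP|_] /=; lia.
have : sz (encl (map encO s)) <= 8 * Y + 3.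
  case: s l2 ba => [|a [|b []]] //= _; first by lia.
    by case/andP => /H; lia.
  by case/and3P => /H ha /H hb _; lia.
lia.
Qed.
Lemma szLay L : blay L -> sz (encLay L) <= 12 * (Y * Y).
Proof. by move=> h; apply: leq_trans (sz_list _ szopt h) _; nia. Qed.
Lemma szLays s : blays s -> sz (encLays s) <= 13 * (Y * Y * Y).
Proof.
move=> h; have H x : blay x -> sz (encLay x) < 13 * (Y * Y) by move/szLay; nia.
by apply: leq_trans (sz_list _ H h) _; nia.
Qed.
Lemma szRow r : brow r -> sz (encRow r) <= 4 * (Y * Y).
Proof. by move=> h; apply: leq_trans (sz_list _ szB h) _; nia. Qed.
Lemma szEnt x : bent x -> sz (encEnt x) < 18 * (Y * Y).
Proof. by case/andP => /szLay a /szRow b; rewrite /=; nia. Qed.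
Lemma szTab s : btab s -> sz (encTab s) <= 18 * (Y * Y * Y).
Proof. by move=> h; apply: leq_trans (sz_list _ szEnt h) _; nia. Qed.
Lemma szInst i : binst i -> sz (encInst i) < 30 * (Y * Y * Y).
Proof.
case/and3P => /szB a /szP b /szTab c; rewrite /= in b *.
have : Y <= Y * Y * Y by rewrite -{1}(mul1n Y) leq_mul2r; nia.
lia.
Qed.
Lemma szInsts s : binsts s -> sz (encInsts s) <= 30 * (Y * Y * Y * Y).
Proof. by move=> h; apply: leq_trans (sz_list _ szInst h) _; nia. Qed.
End Bounds.

(** The body evaluates correctly only while the sizes in the accumulator are under control, so the
    evaluation and the invariant [I], which counts the rounds, are established together. *)
Lemma E_foldI (T : eqType) (U : Type) (eT : T -> tree) (eU : U -> tree) (F : U -> T -> U)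
    (I : nat -> U -> Prop) k B env l i b (s : seq T) (u0 : U) :
  size s = k -> E B env l (encl (map eT s)) -> E B env i (eU u0) -> I 0 u0 ->
  (forall n u, n <= k -> I n u -> sz (eU u) <= B) ->
  (forall n u x, n < k -> x \in s -> I n u ->
     E B (eT x :: eU u :: env) b (eU (F u x)) /\ I n.+1 (F u x)) ->
  E B env (Fold l i b) (eU (foldl F u0 s)) /\ I k (foldl F u0 s).
Proof.
move=> <- El Ei I0 Hs Hb.
have H s1 : forall s2, s = s1 ++ s2 -> I (size s1) (foldl F u0 s1).
  elim/last_ind: s1 => [|s1 x IH] s2 // Es.
  rewrite foldl_rcons size_rcons; apply: (proj2 (Hb _ _ _ _ _ _)).
  - by rewrite Es size_cat size_rcons; lia.
  - by rewrite Es mem_cat mem_rcons mem_head.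
  by apply: (IH (x :: s2)); rewrite Es cat_rcons.
split; last by apply: (H s [::]); rewrite cats0.
apply: (@E_fold _ _ eT eU) => //.
  move=> s1 s2 Es; apply: Hs (H _ _ Es); by rewrite Es size_cat leq_addr.
move=> s1 x s2 Es; apply: (proj1 (Hb (size s1) _ _ _ _ _)).
- by rewrite Es size_cat /=; lia.
- by rewrite Es mem_cat mem_head orbT.
exact: H Es.
Qed.

Lemma E_iterI (U : Type) (eU : U -> tree) (F : U -> U)
    (I : nat -> U -> Prop) B env l i b k (u0 : U) :
  E B env l (encn k) -> E B env i (eU u0) -> I 0 u0 ->
  (forall n u, n <= k -> I n u -> sz (eU u) <= B) ->
  (forall n u, n < k -> I n u -> E B (Lf :: eU u :: env) b (eU (F u)) /\ I n.+1 (F u)) ->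
  E B env (Fold l i b) (eU (iter k F u0)) /\ I k (iter k F u0).
Proof.
move=> El Ei I0 Hs Hb.
have H j : j <= k -> I j (iter j F u0).
  by elim: j => // j IH lj; apply: (proj2 (Hb _ _ _ _)) => //; apply: IH; apply: ltnW.
split; last exact: H.
apply: (@E_iter _ eU) => //; first by move=> j lj; apply: Hs (H _ lj).
by move=> j lj; apply: (proj1 (Hb j _ lj _)); apply: H; apply: ltnW.
Qed.

Lemma E_ifb B env c a b (x : bool) v : E B env c (encb x) ->
  (x -> E B (Lf :: Lf :: env) a v) -> (~~ x -> E B env b v) ->
  E B env (Case c b a) v.
Proof. by move=> Hc Ha Hb; apply: E_case Hc _; case: x Ha Hb => /= Ha Hb; [apply: Ha|apply: Hb]. Qed.

Lemma E_caseI B env c a b d v (Q : Prop) : E B env c d ->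
  (if d is Nd h t then E B (h :: t :: env) b v /\ Q else E B env a v /\ Q) ->
  E B env (Case c a b) v /\ Q.
Proof. by move=> Hc; case: d Hc => [|h t] Hc [H HQ]; split=> //; apply: E_case Hc _. Qed.

Lemma E_wk (P Q R : Prop) : P /\ Q -> (Q -> R) -> P /\ R.
Proof. by case=> p q /(_ q). Qed.

(** Keeps only relations between natural numbers before calling [lia], since the contexts below are
    full of boolean facts that it would have to process. *)
Ltac nlia :=
  repeat match goal with H : ?T |- _ =>
    lazymatch T with
    | is_true (leq _ _) => fail | @eq nat _ _ => fail | nat => fail | _ => clear H
    end end; lia.

Section Correctness.
Variables B Y : nat.
Hypothesis HB : 100 * (Y * Y * Y * Y) <= B.
Hypothesis Y1 : 9 < Y.
Let hb1 : 100 * Y <= B := HB1 HB Y1.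
Let hb2 : 100 * (Y * Y) <= B := HB2 HB Y1.
Let hb3 : 100 * (Y * Y * Y) <= B := HB3 HB Y1.

Lemma all_lt (s : seq nat) x : all (fun x => x < Y) s -> x \in s -> x < Y.
Proof. by move/allP => H /H. Qed.

Lemma E_splits k : k.+1 < Y ->
  E B [:: encn k] eSplits (encPs (splits k)) /\
  (size (splits k) = k.+1 /\ {in splits k, forall p, p.1 + p.2 = k}).
Proof.
move=> lk.
pose I n (s : seq (nat * nat)) := [/\ size s = n.+1, {in s, forall p, p.1 + p.2 = k} &
  exists s', s = (n, k - n) :: s'].
have bI n s : n <= k -> I n s -> bPs Y s.
  move=> ln [ss sp _]; rewrite /bPs ss; apply/andP; split; first by lia.
  by apply/allP => p /sp E; rewrite /bP; lia.
suff [H [H1 H2 _]] : E B [:: encn k] eSplits (encPs (splits k)) /\ I k (splits k) by [].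
apply: (@E_iterI _ encPs splitstep I).
- by ev.
- by rewrite /encPs /encP /=; ev.
- by split=> //; [move=> p; rewrite inE => /eqP -> /=|exists [::]; rewrite subn0].
- by move=> n s ln /(bI _ _ ln) /(szPs Y1); lia.
move=> n s ln In; have [ss sp [s' Es]] := In; split; last first.
  rewrite Es /=; split.
  + by move: ss; rewrite Es /= => ->.
  + by move=> p; rewrite inE => /orP [/eqP -> /=|]; [lia|rewrite -Es; apply: sp].
  by exists ((n, k - n) :: s'); rewrite subnS.
rewrite Es /encPs /=; cas; cas; ev; cal E_tailn.
Qed.

Lemma E_mklayer hi k x : k.+1 < Y -> x < Y ->
  E B [:: encb hi; encn k; encn x] eMklayer (encLay (mklayer hi k x)) /\
  blay Y (mklayer hi k x).
Proof.
move=> lk lx; have [Es [ss sp]] := E_splits lk.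
pose I n (L : layer) := size L = n /\ all (bopt Y) L.
suff [H [H1 H2]] : E B [:: encb hi; encn k; encn x] eMklayer (encLay (mklayer hi k x))
    /\ I k.+1 (mklayer hi k x).
  by split=> //; rewrite /blay H1 H2; lia.
apply: (@E_foldI _ _ encP encLay _ I).
- exact: ss.
- by eapply E_call; [by ev|exact: Es].
- by ev.
- by [].
- move=> n L ln [sL aL].
  by apply: leq_trans (szLay Y1 _) _; [rewrite /blay sL aL; lia|lia].
move=> n L [q r] ln /sp /= E [sL aL]; split; last first.
  split; first by rewrite /= sL.
  by rewrite /= aL /bopt /= /bP /= lx; case: hi => /=; lia.
by cas; ev; case: hi => /=; cas; ev.
Qed.

Lemma E_addlayers hi items k lay : (k + size items).+1 < Y ->
  all (fun x => x < Y) items -> all (blay Y) lay -> size lay + size items < Y ->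
  let r := addlayers hi items (k, lay) in
  [/\ E B [:: encb hi; encNL items; Nd (encn k) (encLays lay)] eAddlayers
       (Nd (encn r.1) (encLays r.2)),
      r.1 = k + size items, size r.2 = size lay + size items & all (blay Y) r.2].
Proof.
move=> lk it la sl r.
pose I n (u : nat * seq layer) := [/\ u.1 = k + n, size u.2 = size lay + n & all (blay Y) u.2].
pose eU (u : nat * seq layer) := Nd (encn u.1) (encLays u.2).
suff [H [H1 H2 H3]] : E B [:: encb hi; encNL items; Nd (encn k) (encLays lay)] eAddlayers (eU r)
    /\ I (size items) r by [].
apply: (@E_foldI _ _ encn eU _ I).
- by [].
- by ev.
- by ev.
- by split=> //=; lia.
- move=> n u ln [u1 u2 u3].
  have h1 : sz (encLays u.2) <= 13 * (Y * Y * Y) by apply: szLays; rewrite // /blays u2 u3; lia.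
  have h2 : sz (encn u.1) < 2 * Y by apply: szn; lia.
  by rewrite /eU /=; lia.
move=> n [k' lay'] x ln xi [/= u1 u2 u3]; have lx := all_lt it xi.
have [|Em bm] := @E_mklayer hi k' x _ lx; first by lia.
split; last by split=> /=; rewrite ?bm //; lia.
cas; ev; eapply E_call; [by ev|exact: Em].
Qed.

Lemma E_merged k x1 x2 first : k.+1 * k.+2 < Y -> x1 < Y -> x2 < Y ->
  E B [:: encn k; encn x1; encn x2; encb first] eMerged (encLay (merged k x1 x2 first)) /\
  blay Y (merged k x1 x2 first).
Proof.
move=> lk l1 l2.
have [|Es [ss sp]] := @E_splits k; first by nia.
have [|Et [st tp]] := @E_splits k.+1; first by nia.
have kY : k.+2 + k < Y by nia.
pose I n (L : layer) := size L <= n /\ all (bopt Y) L.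
have bI n L : n <= k.+1 * k.+2 -> I n L -> sz (encLay L) <= B.
  by move=> ln [sL aL]; apply: leq_trans (szLay Y1 _) _; [rewrite /blay aL; lia|lia].
eapply E_wk; first apply: (@E_foldI _ _ encP encLay _ (fun n => I (n * k.+2))).
- exact: ss.
- by eapply E_call; [by ev|exact: Es].
- by ev.
- by [].
- by move=> n L ln; apply: bI; rewrite leq_mul2r ln orbT.
- move=> n L [p p'] ln /sp /= Ep IL.
  eapply E_caseI; first by ev.
  rewrite /=; eapply E_wk; first apply: (@E_foldI _ _ encP encLay _ (fun j => I (n * k.+2 + j))).
  + exact: st.
  + by eapply E_call; [by ev|exact: Et].
  + by ev.
  + by rewrite addn0.
  + by move=> j M lj; apply: bI; nia.
  + move=> j M [q q'] lj /tp /= Eq [sM aM].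
    have bo : bopt Y (p + q', [:: Some (x1, p); Some (x2, q)]).
      by rewrite /bopt /= /bP /= l1 l2; lia.
    split; last first.
      by case: ifP => _; split; rewrite /= ?aM ?bo //; lia.
    cas; eapply E_ifb.
    * eapply E_call; last by eapply E_xor.
      ev; eapply E_call; first by ev.
      by apply: (@E_leq B p.+1 q); lia.
    * move=> ->; by ev.
    * move=> /negbTE ->; rewrite /encLay /encopt /=; ev.
      eapply E_call; first by ev.
      apply: E_appn; lia.
  by case=> sM aM; split=> //; rewrite mulSn addnC.
by case=> sL aL; rewrite /blay aL andbT; apply: leq_ltn_trans sL lk.
Qed.

Lemma cutP w w' L : let c := cut w w' L in
  [/\ L = rev c.1 ++ c.2, all (fun x => (x != w) && (x != w')) c.1 &
      if c.2 is x :: _ then (x == w) || (x == w') else true].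
Proof.
rewrite /cut.
have H : forall s, let u := foldl (cutstep w w') ([::], [::]) s in
  [/\ s = rev u.1 ++ rev u.2, all (fun x => (x != w) && (x != w')) u.1 &
      if rev u.2 is x :: _ then (x == w) || (x == w') else true].
  elim/last_ind => [|s x] //=; rewrite foldl_rcons.
  case: (foldl _ _ s) => pre rest /= [-> aP hP].
  rewrite /cutstep /=; case: rest hP => [|y rest] hP /=.
    rewrite cats0 /=; case: ifP => h /=; first by rewrite -cats1; split.
    by rewrite aP rev_cons cats0 andbT -negb_or h.
  rewrite [rev (x :: _ :: _)]rev_cons -rcons_cat; split=> //.
  by move: hP; case E: (rev (y :: rest)) => [|z t] //; have := congr1 size E; rewrite size_rev.
by have := H L; case: (foldl _ _ L) => pre rest /=.
Qed.

Lemma bNL_cut w w' L : bNL Y L -> bNL Y (cut w w' L).1 /\ bNL Y (cut w w' L).2.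
Proof.
have [E _ _] := cutP w w' L; rewrite {1}E /bNL size_cat all_cat size_rev all_rev.
by move=> /and3P [h1 -> ->]; split; rewrite andbT; lia.
Qed.

Lemma E_cut w w' L : bNL Y L -> w < Y -> w' < Y ->
  E B [:: encn w; encn w'; encNL L] eCut
    (Nd (encNL (cut w w' L).1) (encNL (cut w w' L).2)).
Proof.
move=> /andP [sL aL] lw lw'.
pose eU (u : seq nat * seq nat) := Nd (encNL u.1) (encNL u.2).
pose I n (u : seq nat * seq nat) := [/\ size u.1 + size u.2 = n,
  all (fun x => x < Y) u.1 & all (fun x => x < Y) u.2].
have bI n u : n < Y -> I n u -> sz (encNL u.1) <= 2 * (Y * Y) /\ sz (encNL u.2) <= 2 * (Y * Y).
  by move=> ln [su a1 a2]; split; apply: szNL => //; rewrite /bNL ?a1 ?a2; lia.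
(* The fold inside [eCut] is extracted from its definition instead of being written out again. *)
have [Ef If] : E B [:: encn w; encn w'; encNL L] (ltac:(let t := eval cbv [eCut] in eCut in
     match t with Case ?f _ _ => exact f end)) (eU (foldl (cutstep w w') ([::], [::]) L)) /\
     I (size L) (foldl (cutstep w w') ([::], [::]) L).
  apply: (@E_foldI _ _ encn eU _ I).
  - by [].
  - by ev.
  - by ev.
  - by [].
  - by move=> n u ln In; have [|h1 h2] := bI n u _ In; [lia|rewrite /eU /=; lia].
  move=> n [pre rest] x ln xL [/= In a1 a2]; have lx := all_lt aL xL.
  split; last first.
    rewrite /cutstep /=; case: rest In a2 => [|y rest] /= In a2.
      by case: ifP => _; split; rewrite /= ?lx ?a1 //; lia.
    by split; rewrite /= ?lx ?a2 //; lia.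
  rewrite /eU /cutstep /=; cas; cas; case: rest In a2 => [|y rest] /= In a2; last by ev.
  eapply E_ifb.
  - instantiate (1 := (x == w) || (x == w')).
    eapply E_ifb; first by cal E_eqn; lia.
      by move=> ->; ev.
    by move=> /negbTE ->; cal E_eqn; lia.
  - by move=> ->; ev.
  by move=> /negbTE ->; ev.
eapply E_case; first exact: Ef.
rewrite /cut; case: (foldl _ _ L) If => pre rest If /=; ev.
eapply E_call; first by ev.
rewrite /encNL map_rev; apply: E_rev.
by have [_] := bI _ _ sL If; rewrite /= sz_enclE; lia.
Qed.

(** The quadratic requirement on [Y] accommodates the joint layer, whose options are pairs of
    positions. *)
Lemma E_agent lay L c : let k := size L in k.+1 * k.+2 < Y ->
  bNL Y L -> all (blay Y) lay -> size lay + k + 2 < Y -> bO Y c ->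
  E B [:: encLays lay; encNL L; encO c] eAgent (encLays (agentlay lay L c)) /\
  (all (blay Y) (agentlay lay L c) && (size (agentlay lay L c) <= size lay + k + 1)).
Proof.
move=> k lk bL al sl bc.
have kY : k.+2 < Y by apply: leq_ltn_trans lk; rewrite leq_pmull.
have [sL aL] := andP bL.
eapply E_caseI; first by ev.
case: c bc => [[w w'] /andP [/= lw lw']|_]; last first.
  have [||H1 H2 H3 H4] := @E_addlayers true L 0 lay _ aL al; [by nlia|by nlia|].
  split; last by rewrite /= H4; nlia.
  eapply E_call; last by eapply E_snd.
  by ev; eapply E_call; [by ev|exact: H1].
rewrite /=; eapply E_caseI; first by cal E_eqn; nlia.
case: (w == w').
  split; first by ev.
  by rewrite /= al /blay /=; nlia.
have Ec := E_cut bL lw lw'; have [EL _ _] := cutP w w' L; have [b1 b2] := bNL_cut w w' bL.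
eapply E_caseI; first by eapply E_call; [by ev|exact: Ec].
move: Ec b1 b2 EL; case: (cut w w' L) => pre rest /= Ec b1 b2 EL.
eapply E_caseI; first by ev.
case: rest Ec b2 EL => [|x1 rest1] /= Ec b2 EL; first by split; first by ev.
have {}b2 : (x1 < Y) && bNL Y rest1.
  by move: b2; rewrite /bNL /= => /and3P [h -> ->] /=; nlia.
have [lx1 br1] := andP b2.
have Ed := E_cut br1 lw lw'; have [ER _ _] := cutP w w' rest1; have [c1 c2] := bNL_cut w w' br1.
eapply E_caseI; first by eapply E_call; [by ev|exact: Ed].
move: Ed c1 c2 ER; case: (cut w w' rest1) => mid rest2 /= Ed c1 c2 ER.
eapply E_caseI; first by ev.
case: rest2 Ed c2 ER => [|x2 post] /= Ed c2 ER; first by split; first by ev.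
have {}c2 : (x2 < Y) && bNL Y post.
  by move: c2; rewrite /bNL /= => /and3P [h -> ->] /=; nlia.
have [lx2 bp] := andP c2.
have Ek : k = size pre + (size mid + size post + 2).
  by rewrite /k EL ER !size_cat /= !size_cat !size_rev /=; nlia.
have [sp ap] := andP bp; have [sm am] := andP c1; have [spr apr] := andP b1.
have [|||| H1 H2 H3 H4] := @E_addlayers true (rev mid) 0 lay.
- by rewrite size_rev; nlia.
- by rewrite all_rev.
- by [].
- by rewrite size_rev; nlia.
rewrite size_rev in H2 H3.
eapply E_caseI.
  eapply E_call; last exact: H1.
  ev; eapply E_call; first by ev.
  rewrite /encNL map_rev; apply: E_rev.
  by have := szNL Y1 c1; rewrite sz_enclE; nlia.
move: H1 H2 H3 H4; case: addlayers => k1 lay2 /= H1 H2 H3 H4.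
have [|Em bm] := @E_merged k1 x1 x2 (x1 == w) _ lx1 lx2.
  by apply: leq_ltn_trans lk; apply: leq_mul; nlia.
have [|||| G1 G2 G3 G4] := @E_addlayers true post k1.+2 (merged k1 x1 x2 (x1 == w) :: lay2).
- by rewrite H2; nlia.
- by [].
- by rewrite /= bm.
- by rewrite /=; nlia.
move: G1 G2 G3 G4; case: addlayers => k3 lay3 /= G1 G2 G3 G4.
have [|||| F1 F2 F3 F4] := @E_addlayers false pre k3 lay3.
- by rewrite G2 H2; nlia.
- by [].
- by [].
- by nlia.
split; last by rewrite F4 F3 G3 H3; nlia.
eapply E_call; last by eapply E_snd.
ev; eapply E_call; last exact: F1.
ev; eapply E_call; last exact: G1.
ev; eapply E_call; last exact: Em.
by ev; cal E_eqn; nlia.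
Qed.

Lemma E_mkcon w ps : w < Y -> bNL Y ps ->
  E B [:: encn w; encNL ps] eMkcon (encO (mkcon w ps)) /\ bO Y (mkcon w ps).
Proof.
move=> lw; case: ps => [|w' ps] /andP [_ /= h]; first by split=> //; cas; ev.
by split; [cas; ev|rewrite /bP /= lw; case/andP: h].
Qed.

Lemma E_con idx mw u w pw pu : idx < Y -> mw < Y -> u < Y -> w < Y -> bNL Y pw -> bNL Y pu ->
  E B [:: encn idx; encn mw; encn u; encn w; encNL pw; encNL pu] eCon
    (encO (con idx mw u w pw pu)) /\ bO Y (con idx mw u w pw pu).
Proof.
move=> li lm lu lw bw bu; rewrite /con.
have [Ew ow] := E_mkcon lw bw; have [Eu ou] := E_mkcon lu bu.
eapply E_caseI; first by cal E_eqn; lia.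
case: (idx == u) => /=; first by split=> //; eapply E_call; [by ev|exact: Ew].
eapply E_caseI; first by cal E_eqn; lia.
case: (idx == mw) => /=; first by split=> //; eapply E_call; [by ev|exact: Eu].
by split=> //; ev.
Qed.

Lemma blay_start : blay Y startlayer.
Proof. by rewrite /blay /startlayer /= /bopt /=; lia. Qed.

Lemma E_layers k prefs mw u w pw pu : k.+1 * k.+2 < Y -> size prefs * (k + 2) + k + 4 < Y ->
  bNLL Y prefs -> all (fun L => size L <= k) prefs ->
  mw < Y -> u < Y -> w < Y -> bNL Y pw -> bNL Y pu ->
  E B [:: encNLL prefs; encn mw; encn u; encn w; encNL pw; encNL pu] eLayers
    (encLays (layers prefs mw u w pw pu)) /\
  (blays Y (layers prefs mw u w pw pu) /\
   size (layers prefs mw u w pw pu) <= size prefs * (k + 2)).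
Proof.
move=> lk ls /andP [sp ap] sk lm lu lw bw bu.
pose I n (st : nat * seq layer) := [/\ st.1 = n, size st.2 <= n * (k + 2) & all (blay Y) st.2].
pose eU (st : nat * seq layer) := Nd (encn st.1) (encLays st.2).
have hn n : n <= size prefs -> n <= n * (k + 2) <= size prefs * (k + 2).
  by move=> ln; rewrite leq_mul2r ln orbT leq_pmulr // addn2.
have H : E B [:: encNLL prefs; encn mw; encn u; encn w; encNL pw; encNL pu] 
   (ltac:(let t := eval cbv [eLayers] in eLayers in
     match t with Call _ [:: ?f] => exact f end))
   (eU (foldl (fun st L => (st.1.+1, agentlay (startlayer :: st.2) L (con st.1 mw u w pw pu)))
    (0, [::]) prefs)) /\ I (size prefs) (foldl (fun st L => (st.1.+1, agentlay (startlayer :: st.2) L (con st.1 mw u w pw pu)))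
    (0, [::]) prefs).
  apply: (@E_foldI _ _ encNL eU _ I).
  - by [].
  - by ev.
  - by ev.
  - by [].
  - move=> n st ln [e1 s2 a2].
    have /andP [hn1 hn2] := hn _ ln.
    have h1 : sz (encLays st.2) <= 13 * (Y * Y * Y) by apply: szLays; rewrite // /blays a2; nlia.
    have h2 : sz (encn st.1) < 2 * Y by apply: szn; nlia.
    by rewrite /eU /=; nlia.
  move=> n [idx lay] L ln Lp [/= -> sl al].
  have bL := allP ap _ Lp; have kL := allP sk _ Lp; rewrite /= in kL.
  have /andP [hn1 hn2] := hn _ ln; rewrite mulSn in hn1 hn2; have nY : n < Y by nlia.
  have [Ec bc] := E_con nY lm lu lw bw bu.
  have [||||| Ea /andP [ba sa]] := @E_agent (startlayer :: lay) L (con n mw u w pw pu).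
  - by apply: leq_ltn_trans lk; apply: leq_mul; nlia.
  - by [].
  - by rewrite /= al blay_start.
  - by rewrite /=; nlia.
  - by [].
  split; last by split=> //=; rewrite /= in sa; rewrite mulSn; nlia.
  cas; ev; eapply E_call; last exact: Ea.
  by ev; eapply E_call; [by ev|exact: Ec].
case: H => H [i1 i2 i3]; split; last first.
  by rewrite /blays /layers i3 andbT; split=> //; apply: leq_ltn_trans i2 _; nlia.
eapply E_call; last by eapply E_snd.
by ev; exact: H.
Qed.

Lemma E_partw M u : bPs Y M -> u < Y ->
  E B [:: encPs M; encn u] ePartw (encNL (partw M u)) /\ bNL Y (partw M u).
Proof.
move=> /andP [sM aM] lu.
pose I n (s : seq nat) := size s <= n /\ all (fun x => x < Y) s.
eapply E_wk; first apply: (@E_foldI _ _ encP encNL _ I (size M)).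
- by [].
- by ev.
- by ev.
- by [].
- by move=> n s ln [h1 h2]; apply: leq_trans (szNL Y1 _) _; [rewrite /bNL h2; lia|lia].
- move=> n s [a b] ln /(allP aM) /andP [/= la lb] [h1 h2]; split; last first.
    by case: ifP => _; split; rewrite /= ?lb ?h2 //; lia.
  cas; eapply E_ifb; first by cal E_eqn; lia.
    by move=> ->; ev.
  by move=> /negbTE ->; ev.
by case=> h1 h2; rewrite /bNL h2 andbT; apply: leq_ltn_trans h1 sM.
Qed.

Lemma E_partu M w : bPs Y M -> w < Y ->
  E B [:: encPs M; encn w] ePartu (encNL (partu M w)) /\ bNL Y (partu M w).
Proof.
move=> /andP [sM aM] lu.
pose I n (s : seq nat) := size s <= n /\ all (fun x => x < Y) s.
eapply E_wk; first apply: (@E_foldI _ _ encP encNL _ I (size M)).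
- by [].
- by ev.
- by ev.
- by [].
- by move=> n s ln [h1 h2]; apply: leq_trans (szNL Y1 _) _; [rewrite /bNL h2; lia|lia].
- move=> n s [a b] ln /(allP aM) /andP [/= la lb] [h1 h2]; split; last first.
    by case: ifP => _; split; rewrite /= ?la ?h2 //; lia.
  cas; eapply E_ifb; first by cal E_eqn; lia.
    by move=> ->; ev.
  by move=> /negbTE ->; ev.
by case=> h1 h2; rewrite /bNL h2 andbT; apply: leq_ltn_trans h1 sM.
Qed.

Lemma E_headT T (f : T -> tree) x0 s : f x0 = Lf -> E B [:: encl (map f s)] eHead (f (head x0 s)).
Proof. by move=> f0; apply: E_eq (E_head _ _) _; case: s => //=. Qed.
Lemma E_tailT T (f : T -> tree) s : E B [:: encl (map f s)] eTail (encl (map f (behead s))).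
Proof. by apply: E_eq (E_tail _ _) _; rewrite behead_map. Qed.
Lemma E_dropT T (f : T -> tree) k s : sz (encl (map f s)) <= B ->
  E B [:: encn k; encl (map f s)] eDrop (encl (map f (drop k s))).
Proof. by rewrite sz_enclE => le; apply: E_eq (E_drop _ le) _; rewrite map_drop. Qed.
Lemma E_revT T (f : T -> tree) s : sz (encl (map f s)) <= B ->
  E B [:: encl (map f s)] eRev (encl (map f (rev s))).
Proof. by rewrite sz_enclE => le; apply: E_eq (E_rev le) _; rewrite map_rev. Qed.

Lemma brow_head rw : brow Y rw -> bbits Y (head [::] rw).
Proof. by case: rw => [|x rw] /andP [_ /= h]; [rewrite /bbits /=; lia|case/andP: h]. Qed.
Lemma brow_drop k rw : brow Y rw -> brow Y (drop k rw).
Proof.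
move=> /andP [h1 h2]; rewrite /brow size_drop; apply/andP; split; first by lia.
by rewrite -(cat_take_drop k rw) all_cat in h2; case/andP: h2.
Qed.
Lemma brow_behead rw : brow Y rw -> brow Y (behead rw).
Proof. by rewrite -drop1; apply: brow_drop. Qed.

Lemma E_addb x y : bbits Y x -> bbits Y y ->
  E B [:: encB x; encB y] eAdd (encB (badd x y)) /\ bbits Y (badd x y).
Proof. by rewrite /bbits => lx ly; split; [apply: E_add; lia|rewrite size_badd]. Qed.
Lemma E_subb x y : bbits Y x -> bbits Y y ->
  E B [:: encB x; encB y] eSub (Nd (encb (bsub x y).1) (encB (bsub x y).2)) /\
  bbits Y (bsub x y).2.
Proof. by rewrite /bbits => lx ly; split; [apply: E_sub; lia|rewrite size_bsub]. Qed.

Lemma E_vecadd a b : brow Y a -> brow Y b ->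
  E B [:: encRow a; encRow b] eVecadd (encRow (vecadd a b)) /\
  (size (vecadd a b) = size a /\ brow Y (vecadd a b)).
Proof.
move=> /andP [sa aa] bb.
pose I n (st : rowT * rowT) := [/\ brow Y st.1, size st.2 = n & all (bbits Y) st.2].
pose eU (st : rowT * rowT) := Nd (encRow st.1) (encRow st.2).
have [H [H1 H2 H3]] : E B [:: encRow a; encRow b] (ltac:(let t := eval cbv [eVecadd] in eVecadd in
     match t with Call _ [:: Call _ [:: ?f]] => exact f end))
    (eU (foldl (fun st x => (behead st.1, badd x (head [::] st.1) :: st.2)) (b, [::]) a)) /\
    I (size a) (foldl (fun st x => (behead st.1, badd x (head [::] st.1) :: st.2)) (b, [::]) a).
  apply: (@E_foldI _ _ encB eU _ I).
  - by [].
  - by ev.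
  - by ev.
  - by [].
  - move=> n st ln [h1 h2 h3]; rewrite /eU /=.
    have := szRow Y1 h1; have : sz (encRow st.2) <= 4 * (Y * Y); last by nlia.
    by apply: szRow => //; rewrite /brow h2 h3 andbT; apply: leq_ltn_trans sa.
  move=> n [b' res] x ln /(allP aa) bx [/= h1 h2 h3].
  have [Ea ba] := E_addb bx (brow_head h1).
  split; last by split; rewrite /= ?ba ?h3 ?h2 //; apply: brow_behead.
  cas; ev; first by cal E_tailT.
  eapply E_call; last exact: Ea.
  by ev; eapply E_call; [by ev|exact: (@E_headT _ encB [::])].
have br : brow Y (rev (foldl (fun st x => (behead st.1, badd x (head [::] st.1) :: st.2)) (b, [::]) a).2).
  by rewrite /brow size_rev all_rev H2 sa.
split; last by rewrite /vecadd size_rev H2.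
eapply E_call; last apply: (@E_revT _ encB).
  ev; eapply E_call; last by eapply E_snd.
  by ev; exact: H.
by apply: leq_trans (szRow Y1 _) _; [rewrite /brow H2 sa|nlia].
Qed.

Lemma E_newrow z L rw : bbits Y z -> blay Y L -> brow Y rw ->
  E B [:: encB z; encLay L; encRow rw] eNewrow (encRow (newrow z L rw)) /\
  (size (newrow z L rw) = size rw /\ brow Y (newrow z L rw)).
Proof.
move=> bz /andP [sL aL] br; have [sr ar] := andP br.
pose I (n : nat) (u : rowT) := size u = size rw /\ brow Y u.
have bI n u : I n u -> sz (encRow u) <= B by case=> _ /(szRow Y1); nlia.
eapply E_wk; first apply: (@E_foldI _ _ encopt encRow _ I (size L)); last by [].
- by [].
- by ev.
- eapply proj1; apply: (@E_foldI _ _ encB encRow _ (fun n u => size u = n /\ all (bbits Y) u) (size rw)).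
  + by [].
  + by ev.
  + by ev.
  + by [].
  + move=> n u ln [su au]; apply: leq_trans (szRow Y1 _) _; last by nlia.
    by rewrite /brow su au andbT; apply: leq_ltn_trans sr.
  move=> n u x ln _ [su au]; split; first by ev.
  by split; rewrite /= ?su ?bz.
- have H s : forall u : rowT, size (foldl (fun u (_ : seq bool) => z :: u) u s) = size s + size u /\
      (all (bbits Y) u -> all (bbits Y) (foldl (fun u (_ : seq bool) => z :: u) u s)).
    elim: s => [|x s IH] u //=; have [e1 e2] := IH (z :: u); rewrite e1 /= addnS; split=> //.
    by move=> h; apply: e2; rewrite /= bz.
  have [e1 e2] := H rw [::]; rewrite /I e1 addn0; split=> //.
  by rewrite /brow e1 addn0 sr e2.
- by move=> n u _; apply: bI.
move=> n u [c s] ln /(allP aL) bo [su bu].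
have [Ev [e1 e2]] := E_vecadd bu (brow_drop c br).
split; last by split; rewrite //= e1.
cas; eapply E_call; last exact: Ev.
by ev; eapply E_call; [by ev|apply: (@E_dropT _ encB); apply: leq_trans (szRow Y1 br) _; nlia].
Qed.

Lemma E_table z lay base : bbits Y z -> blays Y lay -> brow Y base ->
  let r := table z lay base in
  [/\ E B [:: encB z; encLays lay; encRow base] eTable (Nd (encRow r.1) (encTab r.2)),
      size r.1 = size base, brow Y r.1, size r.2 = size lay & btab Y r.2].
Proof.
move=> bz /andP [sl al] bb r.
pose I n (st : rowT * seq entry) := [/\ size st.1 = size base, brow Y st.1, size st.2 = n &
  all (bent Y) st.2].
pose eU (st : rowT * seq entry) := Nd (encRow st.1) (encTab st.2).
suff [H [H1 H2 H3 H4]] : E B [:: encB z; encLays lay; encRow base] eTable (eU r) /\ I (size lay) r.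
  by split=> //; rewrite /btab H3 sl.
apply: (@E_foldI _ _ encLay eU _ I).
- by [].
- by ev.
- by ev.
- by [].
- move=> n st ln [h1 h2 h3 h4]; rewrite /eU /=.
  have := szRow Y1 h2; have : sz (encTab st.2) <= 18 * (Y * Y * Y).
    by apply: szTab => //; rewrite /btab h3 h4 andbT; apply: leq_ltn_trans sl.
  nlia.
move=> n [rw tab] L ln /(allP al) bL [/= h1 h2 h3 h4].
have [En [e1 e2]] := E_newrow bz bL h2.
split; last by split; rewrite //= ?e1 ?h3 // /bent /= bL h2.
by cas; ev; eapply E_call; [by ev|exact: En].
Qed.

Lemma E_inst k prefs M m z base p : k.+1 * k.+2 < Y -> size prefs * (k + 2) + k + 4 < Y ->
  bNLL Y prefs -> all (fun L => size L <= k) prefs -> bPs Y M -> m + p.2 < Y -> bP Y p ->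
  bbits Y z -> brow Y base ->
  E B [:: encNLL prefs; encPs M; encn m; encB z; encRow base; encP p] eInst
    (encInst (mkinst prefs M m z base p)) /\
  (binst Y (mkinst prefs M m z base p) &&
   (size (mkinst prefs M m z base p).2.2 <= size prefs * (k + 2))).
Proof.
move=> lk ls bp sk bM lm bP' bz bb; have [l1 l2] := andP bP'.
have [Ew bw] := E_partw bM l1; have [Eu bu] := E_partu bM l2.
have [El [bl sl]] := E_layers lk ls bp sk lm l1 l2 bw bu.
have [Et e1 e2 e3 e4] := E_table bz bl bb.
rewrite /mkinst; case: p l1 l2 lm bP' Ew Eu El bl sl Et e1 e2 e3 e4 bw bu => u w /= l1 l2 lm bP' Ew Eu El bl sl.
case: table => rw tab /= Et e1 e2 e3 e4 bw bu.
split; last by rewrite /binst /= bP' e4 e3 sl !andbT; apply: brow_head.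
cas; eapply E_case.
  eapply E_call; last exact: Et.
  ev; eapply E_call; last exact: El.
  ev.
  - by eapply E_call; [by ev|apply: E_appn; nlia].
  - by eapply E_call; [by ev|exact: Ew].
  by eapply E_call; [by ev|exact: Eu].
rewrite /=; ev; eapply E_call; first by ev.
exact: (@E_headT _ encB [::]).
Qed.

Lemma iotarE k : iotar k = rev (iota 0 k).
Proof.
have R j : rev (iota 0 j.+1) = j :: rev (iota 0 j) by rewrite -addn1 iotaD rev_cat.
by rewrite /iotar; elim: k => // -[|k] IH //; rewrite iterS IH !R.
Qed.

Lemma E_iotar k : k < Y -> E B [:: encn k] eIotar (encNL (iotar k)).
Proof.
move=> lk; eapply proj1; apply: (@E_iterI _ encNL _ (fun n s => s = rev (iota 0 n))).
- by ev.
- by ev.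
- by [].
- move=> n s ln ->; apply: leq_trans (szNL Y1 _) _; last by nlia.
  rewrite /bNL size_rev size_iota; apply/andP; split; first by nlia.
  by apply/allP => x; rewrite mem_rev mem_iota; lia.
move=> n s ln ->; split; first by cas; case: (rev _) => [|h t] /=; ev.
have := iotarE n.+1; rewrite /iotar iterS => <-; by rewrite -/(iotar n) iotarE.
Qed.

Lemma E_pairs m n : m < Y -> n < Y -> m * n < Y ->
  E B [:: encn m; encn n] ePairs (encPs (pairsr m n)) /\ bPs Y (pairsr m n).
Proof.
move=> lm ln lmn.
have am k : k < Y -> forall x, x \in iotar k -> x < Y.
  by move=> lk x; rewrite iotarE mem_rev mem_iota; lia.
have sm k : size (iotar k) = k by rewrite iotarE size_rev size_iota.
pose I k (s : seq (nat * nat)) := size s = k /\ all (bP Y) s.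
have bI k s : k <= m * n -> I k s -> sz (encPs s) <= B.
  move=> lk [ss sa]; apply: leq_trans (szPs Y1 _) _; last by nlia.
  by rewrite /bPs ss sa; nlia.
eapply E_wk; first apply: (@E_foldI _ _ encn encPs _ (fun j => I (j * n)) m).
- exact: sm.
- by eapply E_call; [by ev|exact: E_iotar].
- by ev.
- by [].
- by move=> j s lj; apply: bI; rewrite leq_mul2r lj orbT.
- move=> j s u lj /(am _ lm) lu [ss sa].
  eapply E_wk; first apply: (@E_foldI _ _ encn encPs _ (fun i => I (j * n + i)) n).
  + exact: sm.
  + by eapply E_call; [by ev|exact: E_iotar].
  + by ev.
  + by rewrite addn0.
  + move=> i t li; apply: bI; have : j.+1 * n <= m * n by rewrite leq_mul2r lj orbT.
    by rewrite mulSn; nlia.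
  + move=> i t w li /(am _ ln) lw [st ta]; split; first by ev.
    by split; rewrite /= ?st ?addnS // /bP /= lu lw.
  by rewrite mulSn addnC.
by case=> ss sa; rewrite /bPs sa andbT; apply: leq_ltn_trans lmn; rewrite -ss.
Qed.

Lemma E_insts k prefs M m z base pairs : k.+1 * k.+2 < Y -> size prefs * (k + 2) + k + 4 < Y ->
  bNLL Y prefs -> all (fun L => size L <= k) prefs -> bPs Y M ->
  bPs Y pairs -> all (fun p => m + p.2 < Y) pairs -> bbits Y z -> brow Y base ->
  E B [:: encNLL prefs; encPs M; encn m; encB z; encRow base; encPs pairs] eInsts
    (encInsts (insts prefs M m z base pairs)) /\
  (binsts Y (insts prefs M m z base pairs) /\
   all (fun i : inst => size i.2.2 <= size prefs * (k + 2)) (insts prefs M m z base pairs)).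
Proof.
move=> lk ls bp sk bM /andP [sp ap] am bz bb.
pose I n (s : seq inst) := [/\ size s = n, all (binst Y) s &
  all (fun i : inst => size i.2.2 <= size prefs * (k + 2)) s].
eapply E_wk; first apply: (@E_foldI _ _ encP encInsts _ I (size pairs)).
- by [].
- by ev.
- by ev.
- by [].
- move=> n s ln [h1 h2 _]; apply: leq_trans (szInsts Y1 _) _; last by nlia.
  by rewrite /binsts h1 h2 andbT; apply: leq_ltn_trans sp.
- move=> n s p ln pp [h1 h2 h3].
  have [Ei /andP [bi si]] := @E_inst k prefs M m z base p lk ls bp sk bM (allP am _ pp) (allP ap _ pp) bz bb.
  split; last by split; rewrite /= ?h1 ?bi ?si.
  by ev; eapply E_call; [by ev|exact: Ei].
by case=> h1 h2 h3; split=> //; rewrite /binsts h2 andbT; apply: leq_ltn_trans sp; rewrite -h1.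
Qed.

Lemma E_sum z ii : bbits Y z -> binsts Y ii ->
  E B [:: encB z; encInsts ii] eSum (encB (sumcount z ii)) /\ bbits Y (sumcount z ii).
Proof.
move=> bz /andP [si ai].
apply: (@E_foldI _ _ encInst encB _ (fun _ u => bbits Y u) (size ii)).
- by [].
- by ev.
- by ev.
- by [].
- by move=> n u _ /szB; nlia.
move=> n u [c pt] _ /(allP ai) /and3P [/= bc _ _] bu.
have [Ea ba] := E_addb bu bc; split=> //.
eapply E_call; last exact: Ea.
by ev; cal E_fst.
Qed.

Definition encIt (T : Type) (eT : T -> tree) (it : seq bool * T) : tree := Nd (encB it.1) (eT it.2).

(** The payload is arbitrary because the same selection picks a pair [(u, w)] among the instances
    and an option within a layer. *)
Lemma E_select (T : eqType) (eT : T -> tree) c (its : seq (seq bool * T)) r :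
  (forall it, it \in its -> bbits Y it.1 /\ sz (eT it.2) <= c) -> c + 10 * Y <= B -> bbits Y r ->
  let s := select its r in
  E B [:: encl (map (encIt eT) its); encB r] eSelect (Nd (encl (map eT s.1)) (encB s.2)) /\
  (bbits Y s.2 /\ (forall x, x \in s.1 -> exists2 it, it \in its & x = it.2)).
Proof.
move=> bi cB br s.
pose I (n : nat) (st : seq T * seq bool) := [/\ bbits Y st.2, size st.1 <= 1 &
   forall x, x \in st.1 -> exists2 it, it \in its & x = it.2].
pose eU (st : seq T * seq bool) := Nd (encl (map eT st.1)) (encB st.2).
suff [H [H1 H2 H3]] : E B [:: encl (map (encIt eT) its); encB r] eSelect (eU s) /\ I (size its) s.
  by [].
apply: (@E_foldI _ _ (encIt eT) eU _ I).
- by [].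
- by ev.
- by ev.
- by [].
- move=> n st ln [/(szB Y1) h1 h2 h3]; rewrite /eU /=.
  case: st.1 h2 h3 => [|x []] //= _ h3; first by nlia.
  have [|it /bi [_ h] Ex] := h3 x; first by rewrite inE.
  have {}h : sz (eT x) <= c by rewrite Ex.
  by nlia.
move=> n [f r'] it ln iti [/= h1 h2 h3]; have [bc _] := bi _ iti.
have [Es bs] := E_subb h1 bc.
rewrite /eU /selstep /=; case: f h2 h3 => [|x f] h2 h3 /=; last first.
  by split=> //; cas; cas; ev.
split.
  cas; cas; cas; eapply E_case; first by eapply E_call; [by ev|exact: Es].
  by case: (bsub r' it.1) => c' d /=; cas; case: c' => /=; ev.
move: bs; case: (bsub r' it.1) => c' d /= bs; case: c'; split=> //=.
by move=> x; rewrite inE => /eqP ->; exists it.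
Qed.

(** [k] bounds both the number of lists and their lengths. A table entry executes at most two
    instructions, each raising either quantity by at most one, whence the factor 2 in [E_unrank]. *)
Definition bprof k (p : seq (seq nat)) :=
  (size p <= k) && all (fun L => (size L <= k) && all (fun x => x < Y) L) p.

Lemma bprof_le k k' p : k <= k' -> bprof k p -> bprof k' p.
Proof.
move=> le /andP [h1 h2]; apply/andP; split; first by lia.
by apply: sub_all h2 => L /andP [h3 ->]; rewrite (leq_trans h3 le).
Qed.
Lemma bprof_bNLL k p : k < Y -> bprof k p -> bNLL Y p.
Proof.
move=> lk /andP [h1 h2]; apply/andP; split; first by lia.
by apply: sub_all h2 => L /andP [h3 h4]; rewrite /bNL h4 andbT; lia.
Qed.

Lemma insE q x L : ins q x L = take q L ++ x :: drop q L.
Proof. by rewrite /ins catrevE revK. Qed.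

Lemma E_ins q x L : bNL Y L -> x < Y ->
  E B [:: encn q; encn x; encNL L] eIns (encNL (ins q x L)).
Proof.
move=> bL lx; have szL := szNL Y1 bL; have szx := szn Y1 lx.
have sL : ssz (map encn L) < 2 * (Y * Y) by rewrite -sz_enclE.
eapply E_case; first by eapply E_call; [by ev|apply: E_split; nlia].
rewrite /=; eapply E_call; first by ev.
rewrite -map_take -map_drop -map_rev /ins /encNL.
have -> : [seq encn i | i <- catrev (rev (take q L)) (x :: drop q L)] =
  catrev (map encn (rev (take q L))) (map encn (x :: drop q L)).
  by rewrite !catrevE map_cat map_rev.
apply: (@E_catrev B (map encn (rev (take q L))) (map encn (x :: drop q L))).
rewrite map_rev ssz_rev /= ssz_cons map_take map_drop.
by have := ssz_take q (map encn L); have := ssz_drop q (map encn L); nlia.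
Qed.

Lemma E_atoms k s p : bprof k p -> size s <= 2 -> k.+2 < Y -> all (bO Y) s ->
  E B [:: encl (map encO s); encNLL p] eAtoms (encNLL (atoms s p)) /\ bprof k.+2 (atoms s p).
Proof.
move=> bp s2 kY ao.
eapply E_wk; first apply: (@E_foldI _ _ encO encNLL _ (fun n => bprof (k + n)) (size s)).
- by [].
- by ev.
- by ev.
- by rewrite addn0.
- move=> n u ln /(bprof_bNLL _) bu; apply: leq_trans (szNLL Y1 (bu _)) _; first by nlia.
  by nlia.
- move=> n u a ln /(allP ao) ba bu; have [u1 u2] := andP bu; rewrite addnS.
  case: a ba => [[x q]|] /= ba; last first.
    split; first by cas; ev.
    apply/andP; split; first by rewrite /= ltnS.
    by have /andP [_ h] := bprof_le (leqnSn (k + n)) bu; rewrite /= h.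
  have [lx lq] := andP ba; eapply E_caseI; first by ev.
  rewrite /=; eapply E_caseI; first by ev.
  case: u bu u1 u2 => [|L ps] bu u1 u2 /=; first by split; first by ev.
  have /andP [/= sL al] : (size L <= k + n) && all (fun x => x < Y) L by case/andP: u2.
  split.
    ev; eapply E_call; first by ev.
    apply: E_ins => //; rewrite /bNL al andbT; nlia.
  have := bprof_le (leqnSn (k + n)) bu; rewrite {1}/bprof /= => /and3P [h1 _ h3].
  rewrite /bprof /= h1 h3 insE size_cat /= size_drop size_take_min all_cat /= lx.
  have : all (fun x => x < Y) (take q L ++ drop q L) by rewrite cat_take_drop.
  by rewrite all_cat => /andP [-> ->]; nlia.
by apply: bprof_le; nlia.
Qed.

Lemma E_weigh e rw L : e <= Y * Y -> brow Y rw -> blay Y L ->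
  E B [:: encn e; encRow rw; encLay L] eWeigh (encl (map (encIt encopt) (weigh e rw L))) /\
  (forall it, it \in weigh e rw L -> bbits Y it.1 /\ it.2 \in L).
Proof.
move=> le br bL; have [sL aL] := andP bL.
pose I n (s : seq (seq bool * lopt)) := size s = n /\
  forall it, it \in s -> bbits Y it.1 /\ it.2 \in L.
eapply E_wk; first apply: (@E_foldI _ _ encopt (fun s => encl (map (encIt encopt) s)) _ I (size L)).
- by [].
- by ev.
- by ev.
- by [].
- move=> n s ln [ss h].
  have bs : forall it, (bbits Y it.1 && (it.2 \in L)) -> sz (encIt encopt it) < 17 * Y.
    case=> y o /andP [/= /(szB Y1) h1 /(allP aL) /(szopt Y1) h2].
    have {}h2 : (sz (encB y) + sz (encopt o)).+1 < 17 * Y by nlia.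
    exact: h2.
  apply: leq_trans (sz_list Y1 _ bs _) _; first by nlia.
  + apply/andP; split; first by apply: leq_ltn_trans sL; rewrite ss.
    by apply/allP => it /h [-> ->].
  by nlia.
- move=> n s [c a] ln oL [ss h]; have /and3P [/= lc _ _] := allP aL _ oL.
  split; last first.
    split; first by rewrite /= ss.
    move=> it; rewrite inE => /orP [/eqP -> /=|/h //]; split=> //.
    by apply: brow_head; apply: brow_drop.
  cas; ev; eapply E_call; last by apply: (@E_headT _ encB [::]).
  ev; eapply E_call; last first.
    by apply: (@E_dropT _ encB); apply: leq_trans (szRow Y1 br) _; nlia.
  by ev; eapply E_call; [by ev|apply: E_appn; nlia].
by case.
Qed.

Lemma E_unrank tab r : btab Y tab -> 2 * size tab + 2 < Y -> bbits Y r ->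
  E B [:: encTab tab; encB r] eUnrank (encNLL (unrank tab r)) /\
  bprof (2 * size tab) (unrank tab r).
Proof.
move=> /andP [st at_] lt br.
pose I n (u : urst) := [/\ u.1 <= n * Y, bbits Y u.2.1 & bprof (2 * n) u.2.2].
pose eU (u : urst) := Nd (encn u.1) (Nd (encB u.2.1) (encNLL u.2.2)).
have [H [H1 H2 H3]] : E B [:: encTab tab; encB r] (ltac:(let t := eval cbv [eUnrank] in eUnrank in
     match t with Call _ [:: Call _ [:: ?f]] => exact f end))
    (eU (foldl urstep (0, (r, [::])) tab)) /\ I (size tab) (foldl urstep (0, (r, [::])) tab).
  apply: (@E_foldI _ _ encEnt eU _ I).
  - by [].
  - by ev.
  - by ev.
  - by [].
  - move=> n u ln [h1 /(szB Y1) h2 h3].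
    have h4 : u.1 <= Y * Y by apply: leq_trans h1 _; rewrite leq_mul2r; apply/orP; right; nlia.
    have h5 : sz (encNLL u.2.2) <= 3 * (Y * Y * Y).
      by apply: szNLL => //; apply: bprof_bNLL h3; nlia.
    by rewrite /eU /= sz_encn; nlia.
  move=> n [e [r1 p]] [L rw] ln /(allP at_) /andP [/= bL brw] [/= h1 h2 h3].
  have eY : e <= Y * Y by apply: leq_trans h1 _; rewrite leq_mul2r; apply/orP; right; nlia.
  have [Ew bw] := E_weigh eY brw bL.
  have [||| Es [bs si]] := @E_select _ encopt (12 * Y) (weigh e rw L) r1.
  - by move=> it /bw [-> /(allP (proj2 (andP bL))) /(szopt Y1) /ltnW].
  - by nlia.
  - by [].
  eapply E_caseI; first by ev.
  rewrite /=; eapply E_caseI; first by ev.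
  rewrite /=; eapply E_caseI; first by ev.
  rewrite /=; eapply E_caseI.
    eapply E_call; last exact: Es.
    by ev; eapply E_call; [by ev|exact: Ew].
  move: Es bs si; case: select => f r2 /= Es bs si.
  eapply E_caseI; first by ev.
  case: f Es si => [|[c a] f] Es si /=.
    split; first by ev.
    by split; rewrite //= ?mulSn; [nlia|apply: bprof_le h3; nlia].
  have [it /bw [_ h] Ei] := si _ (mem_head _ _).
  have /and3P [/= lc l2 ao] : bopt Y (c, a) by rewrite Ei; apply: (allP (proj2 (andP bL))).
  have [||||Ea ba] := @E_atoms (2 * n) a p; [by []|by []|by nlia|by []|].
  eapply E_caseI; first by ev.
  split; last by split; rewrite //= ?mulSn; [nlia|apply: bprof_le ba; nlia].
  rewrite /=; ev; first by eapply E_call; [by ev|apply: E_appn; nlia].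
  by eapply E_call; [by ev|exact: Ea].
split=> //; eapply E_call; last by eapply E_snd.
ev; eapply E_call; last by eapply E_snd.
by ev; exact: H.
Qed.

Lemma E_scan L w w' : bNL Y L -> w < Y -> w' < Y ->
  E B [:: encNL L; encn w; encn w'] eScan (encb (scan L w w')).
Proof.
move=> /andP [sL aL] lw lw'.
have [H _] : E B [:: encNL L; encn w; encn w'] (ltac:(let t := eval cbv [eScan] in eScan in
     match t with Call _ [:: ?f] => exact f end))
    (encB (foldl (scanstep w w') [::] L)) /\ size (foldl (scanstep w w') [::] L) <= 1.
  apply: (@E_foldI _ _ encn encB _ (fun _ u => size u <= 1) (size L)).
  - by [].
  - by ev.
  - by ev.
  - by [].
  - by move=> n u _ su; have := sz_encB u; nlia.
  move=> n u x _ /(all_lt aL) lx su; rewrite /scanstep.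
  case: u su => [|b u] su; last by split=> //; cas; ev.
  split; last by case: (x == w') => //; case: (x == w).
  cas; eapply E_ifb; first by cal E_eqn; nlia.
    by move=> ->; ev.
  move=> /negbTE ->; eapply E_ifb; first by cal E_eqn; nlia.
    by move=> ->; ev.
  by move=> /negbTE ->; ev.
eapply E_call; last by apply: (@E_headT _ encb false).
by ev; exact: H.
Qed.

Lemma E_prefers L w ps : bNL Y L -> w < Y -> bNL Y ps ->
  E B [:: encNL L; encn w; encNL ps] ePrefers (encb (prefers L w ps)).
Proof.
move=> bL lw /andP [_ ap]; cas; case: ps ap => [|w' ps] /= ap; first by ev.
by eapply E_call; [by ev|apply: E_scan => //; case/andP: ap].
Qed.

Lemma bNL_nth k p : bNLL Y p -> bNL Y (head [::] (drop k p)).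
Proof.
move=> /andP [_ /allP ap]; case E: (drop k p) => [|L s] /=.
  by rewrite /bNL /= (ltn_trans _ Y1).
by apply: ap; apply: (@mem_drop k); rewrite E mem_head.
Qed.

Lemma E_nthT T (f : T -> tree) x0 k s : f x0 = Lf -> sz (encl (map f s)) <= B ->
  E B [:: encn k; encl (map f s)] eNth (f (head x0 (drop k s))).
Proof.
move=> f0 le; eapply E_call; last by apply: E_headT.
by ev; cal E_dropT.
Qed.

Lemma E_blocks p M m u w : bNLL Y p -> bPs Y M -> u < Y -> w < Y -> m + w < Y ->
  E B [:: encNLL p; encPs M; encn m; encn u; encn w] eBlocks (encb (blocks p M m u w)).
Proof.
move=> bp bM lu lw lm.
have [Ew bw] := E_partw bM lu; have [Eu bu] := E_partu bM lw.
have sp : sz (encl (map encNL p)) <= B by apply: leq_trans (szNLL Y1 bp) _; nlia.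
eapply E_ifb.
- eapply E_call; last by apply: E_prefers; [exact: (bNL_nth u bp)|exact: lw|exact: bw].
  ev; last by eapply E_call; [by ev|exact: Ew].
  eapply E_call; last by apply: (@E_headT _ encNL [::]).
  by ev; cal E_dropT.
- rewrite /blocks => ->.
  eapply E_call; last by apply: E_prefers; [exact: (bNL_nth (m + w) bp)|exact: lu|exact: bu].
  ev; last by eapply E_call; [by ev|exact: Eu].
  eapply E_call; last by apply: (@E_headT _ encNL [::]).
  ev; eapply E_call; last by apply: (@E_dropT _ encNL).
  by ev; eapply E_call; [by ev|apply: E_appn; nlia].
by rewrite /blocks => /negbTE ->; ev.
Qed.

Lemma E_first p M m pairs : bNLL Y p -> bPs Y M -> bPs Y pairs ->
  all (fun uw => m + uw.2 < Y) pairs ->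
  E B [:: encNLL p; encPs M; encn m; encPs pairs] eFirst (encPs (firstb p M m pairs)) /\
  (size (firstb p M m pairs) <= 1 /\ all (bP Y) (firstb p M m pairs)).
Proof.
move=> bp bM /andP [spr apr] am.
apply: (@E_foldI _ _ encP encPs _ (fun _ f => size f <= 1 /\ all (bP Y) f) (size pairs)).
- by [].
- by ev.
- by ev.
- by [].
- move=> n f _ [sf af]; apply: leq_trans (szPs Y1 _) _; last by nlia.
  by rewrite /bPs af; nlia.
move=> n f [u w] _ uwp [sf af].
have buw := allP apr _ uwp; have [/= lu lw] := andP buw; have /= lm := allP am _ uwp.
case: f sf af => [|q f] sf af; last by split=> //; cas; ev.
split; last by case: ifP => _; split; rewrite //= buw.
cas; cas; eapply E_ifb; first by eapply E_call; [by ev|exact: E_blocks].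
  by move=> ->; ev.
by move=> /negbTE ->; ev.
Qed.

Lemma E_hit ii M m pairs x : binsts Y ii -> all (fun i : inst => 2 * size i.2.2 + 2 < Y) ii ->
  bPs Y M -> bPs Y pairs -> all (fun uw => m + uw.2 < Y) pairs -> bbits Y x ->
  E B [:: encInsts ii; encPs M; encn m; encPs pairs; encB x] eHit (encb (hit ii M m pairs x)).
Proof.
move=> /andP [sii aii] at_ bM bp am bx.
pose eT (pt : (nat * nat) * seq entry) := Nd (encP pt.1) (encTab pt.2).
have [||| Es [bs si]] := @E_select _ eT (30 * (Y * Y * Y)) ii x.
- move=> [c pt] /(allP aii) bi; have h : (sz (encB c) + sz (eT pt)).+1 < _ := szInst Y1 bi.
  by split; [case/and3P: bi|rewrite [(_, _).2]/=; nlia].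
- by nlia.
- by [].
rewrite /hit; eapply E_case; first by eapply E_call; [by ev|exact: Es].
move: Es bs si; case: select => f r /= Es bs si; cas.
case: f Es si => [|[p tab] f] Es si /=; first by ev.
have [[c pt] Hi /= Ei] := si _ (mem_head _ _); subst pt.
have /and3P [/= _ bp' bt] := allP aii _ Hi; have /= lt := allP at_ _ Hi.
cas; cas.
have [Eu bu] := E_unrank bt lt bs.
have bu' : bNLL Y (unrank tab r) by apply: bprof_bNLL bu; nlia.
have bru : bNLL Y (rev (unrank tab r)) by rewrite /bNLL size_rev all_rev.
have [Ef [sf af]] := E_first bru bM bp am.
eapply E_case.
  eapply E_call; last exact: Ef.
  ev; eapply E_call; last by apply: E_revT; apply: leq_trans (szNLL Y1 bu') _; nlia.
  by ev; eapply E_call; [by ev|exact: Eu].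
case: p {Es si Hi} bp' => u w /andP [/= lu lw].
case: firstb sf af => [|[u' w'] f'] /= sf af; first by ev.
have /andP [/= lu' lw'] : bP Y (u', w') by case/andP: af.
cas; eapply E_ifb; first by cal E_eqn; nlia.
  by move=> ->; cal E_eqn; nlia.
by move=> /negbTE ->; ev.
Qed.

Lemma E_reduce y sig : bbits Y y -> bbits Y sig ->
  E B [:: encB y; encB sig] eReduce (encB (reduce y sig)) /\ bbits Y (reduce y sig).
Proof.
move=> by' bs; have [Es b2] := E_subb by' bs; rewrite /reduce.
eapply E_caseI; first by eapply E_call; [by ev|exact: Es].
move: Es b2; case: bsub => c d /= Es b2.
by case: c Es => Es; (split; [cas; ev|]).
Qed.

Lemma E_sample W sig z rho : W < Y -> bbits Y sig -> bbits Y z -> bbits Y rho ->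
  let r := sample W sig z rho in
  E B [:: encn W; encB sig; encB z; encB rho] eSample (Nd (encB r.1) (encB r.2)) /\
  (bbits Y r.1 /\ bbits Y r.2).
Proof.
move=> lW bs bz br r.
pose eU (st : seq bool * seq bool) := Nd (encB st.1) (encB st.2).
apply: (@E_iterI _ eU _ (fun _ st => bbits Y st.1 /\ bbits Y st.2)).
- by ev.
- by ev.
- by [].
- by move=> n u _ [/(szB Y1) h1 /(szB Y1) h2]; rewrite /eU /=; nlia.
move=> n [rho' x] _ [/= b1 b2].
have ba : bbits Y (adder x x false (head false rho')).2 by rewrite /bbits size_adder.
have [Er b3] := E_reduce ba bs.
split; last by split=> //=; rewrite /bbits size_behead in b1 *; nlia.
cas; ev; first by cal E_tailb.
eapply E_call; last exact: Er.
ev; eapply E_call; last by eapply E_snd.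
ev; eapply E_call; last first.
  by apply: (@E_adder B x x false (head false rho')); rewrite /bbits in b2; nlia.
by ev; cal E_headb.
Qed.

Lemma E_loop N W sig z one ii M m pairs rho : N < Y -> W < Y -> bbits Y sig -> bbits Y z ->
  bbits Y one -> bbits Y rho ->
  binsts Y ii -> all (fun i : inst => 2 * size i.2.2 + 2 < Y) ii ->
  bPs Y M -> bPs Y pairs -> all (fun uw => m + uw.2 < Y) pairs ->
  let r := iter N (loopstep W sig z one (hit ii M m pairs)) (rho, (z, z)) in
  E B [:: encn N; encn W; encB sig; encB z; encB one; encInsts ii; encPs M; encn m; encPs pairs;
          encB rho] eLoop (Nd (encB r.1) (Nd (encB r.2.1) (encB r.2.2))) /\
  [/\ bbits Y r.1, bbits Y r.2.1 & bbits Y r.2.2].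
Proof.
move=> lN lW bs bz bo br bi at_ bM bp am r.
pose eU (st : lst) := Nd (encB st.1) (Nd (encB st.2.1) (encB st.2.2)).
apply: (@E_iterI _ eU _ (fun _ st => [/\ bbits Y st.1, bbits Y st.2.1 & bbits Y st.2.2])).
- by ev.
- by ev.
- by [].
- by move=> n u _ [/(szB Y1) h1 /(szB Y1) h2 /(szB Y1) h3]; rewrite /eU /=; nlia.
move=> n [rho' [p q]] _ [/= b1 b2 b3].
have [Es [c1 c2]] := E_sample lW bs bz b1.
rewrite /eU /loopstep; move: Es c1 c2; case: sample => r' x /= Es c1 c2.
have Eh := E_hit bi at_ bM bp am c2.
have [Ep bp'] := E_addb b2 bs; have [Eq bq] := E_addb b3 bo.
split; last by split=> //; case: ifP.
cas; cas; eapply E_case; first by eapply E_call; [by ev|exact: Es].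
rewrite /=; ev; last by eapply E_call; [by ev|exact: Eq].
eapply E_ifb; first by eapply E_call; [by ev|exact: Eh].
  by move=> ->; eapply E_call; [by ev|exact: Ep].
by move=> /negbTE ->; ev.
Qed.

Lemma size_pad W x : size (pad W x) = W.
Proof.
rewrite /pad size_rev; suff : forall st, size (iter W padstep st).2 = W + size st.2.
  by move=> ->; rewrite addn0.
by elim: W => //= W IH st; rewrite IH.
Qed.

Lemma E_pad W x : W < Y -> bbits Y x ->
  E B [:: encn W; encB x] ePad (encB (pad W x)) /\ bbits Y (pad W x).
Proof.
move=> lW bx; split; last by rewrite /bbits size_pad.
pose eU (st : seq bool * seq bool) := Nd (encB st.1) (encB st.2).
have [H [H1 H2]] : E B [:: encn W; encB x] (ltac:(let t := eval cbv [ePad] in ePad in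
     match t with Call _ [:: Call _ [:: ?f]] => exact f end)) (eU (iter W padstep (x, [::]))) /\
     (bbits Y (iter W padstep (x, [::])).1 /\ size (iter W padstep (x, [::])).2 = W).
  apply: (@E_iterI _ eU _ (fun n st => bbits Y st.1 /\ size st.2 = n)).
  - by ev.
  - by ev.
  - by [].
  - move=> n u ln [/(szB Y1) h1 h2]; have := sz_encB u.2; rewrite /eU /=; nlia.
  move=> n [y res] ln [/= h1 h2]; split.
    by cas; ev; [cal E_tailb|cal E_headb].
  by rewrite /bbits size_behead h2; split=> //; rewrite /bbits in h1; nlia.
eapply E_call; last first.
  apply: (@E_revT _ encb); apply: leq_trans (sz_encB (iter W padstep (x, [::])).2) _.
  by nlia.
ev; eapply E_call; last by eapply E_snd.
by ev; exact: H.
Qed.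

Lemma E_parse (x : seq sym) : size x < Y ->
  E B [:: encs x] eParse (encRow (parse_nums x)) /\ brow Y (parse_nums x).
Proof.
move=> lx.
pose eU (st : seq bool * rowT) := Nd (encB st.1) (encRow st.2).
pose I n (st : seq bool * rowT) := [/\ size st.1 <= n, size st.2 <= n &
  all (fun y => size y <= n) st.2].
pose R := foldl parsestep ([::], [::]) x.
have bI n r : n < Y -> size r <= n -> all (fun y : seq bool => size y <= n) r -> brow Y r.
  move=> ln h1 h2; apply/andP; split; first by nlia.
  by apply: sub_all h2 => y h; rewrite /bbits; nlia.
have [H [H1 H2 H3]] : E B [:: encs x] (ltac:(let t := eval cbv [eParse] in eParse in
     match t with Call _ [:: Call _ [:: ?f]] => exact f end)) (eU R) /\ I (size x) R.
  apply: (@E_foldI _ _ (fun c : sym => encn c) eU _ I).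
  - by [].
  - by ev.
  - by ev.
  - by [].
  - move=> n u ln [h1 h2 h3]; have lnY : n < Y by apply: leq_ltn_trans lx.
    have := szRow Y1 (bI _ _ lnY h2 h3); have := sz_encB u.1; rewrite /eU /=; nlia.
  move=> n [cur nums] c ln _ [/= h1 h2 h3].
  have h3' : all (fun y => size y <= n.+1) nums by apply: sub_all h3 => y h; nlia.
  rewrite /eU /parsestep; case: (c : nat) => [|[|k]] /=.
  - by split; [cas; cas; ev|split=> //=; nlia].
  - by split; [cas; cas; cas; ev|split=> //=; nlia].
  split; first by cas; cas; cas; ev.
  by split=> //=; rewrite ?h3' ?andbT; nlia.
have br : brow Y R.2 by apply: bI H2 H3.
split; last by rewrite /brow /parse_nums size_rev all_rev.
eapply E_call; last by apply: (@E_revT _ encB); apply: leq_trans (szRow Y1 br) _; nlia.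
ev; eapply E_call; last by eapply E_snd.
by ev; exact: H.
Qed.

Lemma E_tounary cap x : cap < Y -> bbits Y x ->
  E B [:: encn cap; encB x] eTounary (encn (tounary cap x)) /\ tounary cap x <= cap.
Proof.
move=> lc bx.
apply: (@E_foldI _ _ encb encn _ (fun _ u => u <= cap) (size (rev x))).
- by [].
- eapply E_call; last by apply: (@E_revT _ encb); apply: leq_trans (ltnW (szB Y1 bx)) _; nlia.
  by ev.
- by ev.
- by [].
- by move=> n u _ lu; rewrite sz_encn; nlia.
move=> n u b _ _ lu; split; last exact: geq_minl.
have lb : b + (u + u) <= 2 * Y by case: b; nlia.
eapply E_eq.
  eapply E_call; last by eapply E_fst.
  ev; eapply E_call; last by apply: (@E_split _ cap (nseq (b + (u + u)) Lf)); rewrite ssz_nseq; nlia.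
  ev; eapply E_call; last by apply: (@E_appn B b (u + u)); nlia.
  ev; eapply E_call; last by apply: (@E_appn B u u); nlia.
  by ev.
rewrite /encn; congr encl; elim: (b + (u + u)) (cap) => [|a IH] [|c] //=; rewrite ?take0 //.
by rewrite rev_cons IH minnSS -cats1 -[[:: Lf]]/(nseq 1 Lf) -nseqD addn1.
Qed.

Lemma foldl_rev_map (T U : Type) (f : T -> U) s t :
  foldl (fun u x => f x :: u) t s = rev (map f s) ++ t.
Proof. by elim: s t => //= x s IH t; rewrite IH rev_cons cat_rcons. Qed.

Lemma E_unaries cap nums : cap < Y -> brow Y nums ->
  E B [:: encn cap; encRow nums] eUnaries (encNL (map (tounary cap) nums)) /\
  bNL Y (map (tounary cap) nums).
Proof.
move=> lc /andP [sn an].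
have bn : bNL Y (map (tounary cap) nums).
  rewrite /bNL size_map sn all_map; apply/allP => x /(allP an) bx /=.
  by have [_ h] := E_tounary lc bx; nlia.
split=> //; have bnr : bNL Y (rev (map (tounary cap) nums)) by rewrite /bNL size_rev all_rev.
have -> : encNL (map (tounary cap) nums) = encl (map encn (rev (rev (map (tounary cap) nums)))).
  by rewrite revK.
eapply E_call; last by apply: E_revT; apply: leq_trans (szNL Y1 bnr) _; nlia.
ev; rewrite -(cats0 (rev _)) -foldl_rev_map -/(encNL _); eapply proj1.
apply: (@E_foldI _ _ encB encNL _ (fun n s => size s = n /\ all (fun x => x < Y) s) (size nums)).
- by [].
- by ev.
- by ev.
- by [].
- move=> n s ln [ss sa]; apply: leq_trans (szNL Y1 _) _; last by nlia.
  by rewrite /bNL ss sa andbT; apply: leq_ltn_trans sn.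
move=> n s x _ /(allP an) bx [ss sa]; have [Et ht] := E_tounary lc bx.
split; first by ev; eapply E_call; [by ev|exact: Et].
by split; rewrite /= ?ss ?sa ?andbT //; nlia.
Qed.

Lemma E_mul a b : a * b < Y -> b < Y -> E B [:: encn a; encn b] eMul (encn (a * b)).
Proof.
move=> lab lb.
have -> : a * b = iter a (addn b) 0 by rewrite iter_addn_0 mulnC.
eapply proj1; apply: (@E_iterI _ encn _ (fun n u => u = n * b)).
- by ev.
- by ev.
- by [].
- move=> n u ln ->; have : n * b <= a * b by rewrite leq_mul2r ln orbT.
  by rewrite sz_encn; nlia.
move=> n u ln ->; split; last by rewrite mulSn.
have : n.+1 * b <= a * b by rewrite leq_mul2r ln orbT.
rewrite mulSn => h; eapply E_call; first by ev.
by apply: E_appn; nlia.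
Qed.

Lemma E_K s a b : bbits Y a -> bbits Y b ->
  (forall n, n <= s -> (iter n (kstep b) (a, 1)).2 < Y) ->
  E B [:: encn s; encB a; encB b] eK (encn (kfac s a b)).
Proof.
move=> ba bb H.
pose eU (st : seq bool * nat) := Nd (encB st.1) (encn st.2).
have [G _] : E B [:: encn s; encB a; encB b] (ltac:(let t := eval cbv [eK] in eK in
     match t with Call _ [:: ?f] => exact f end)) (eU (iter s (kstep b) (a, 1))) /\
     (iter s (kstep b) (a, 1) = iter s (kstep b) (a, 1) /\ bbits Y (iter s (kstep b) (a, 1)).1).
  apply: (@E_iterI _ eU _ (fun n st => st = iter n (kstep b) (a, 1) /\ bbits Y st.1)).
  - by ev.
  - by rewrite /eU; ev.
  - by [].
  - move=> n u ln [-> /(szB Y1) h]; rewrite /eU -[sz (Nd _ _)]/((sz _ + sz _).+1) sz_encn.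
    by have := H n ln; nlia.
  move=> n [ac u] ln [Eu /= bac].
  have lu : u < Y by have := H n (ltnW ln); rewrite -Eu.
  have [Es _] := E_subb bb bac; have [Ea baa] := E_addb bac bac.
  split; last first.
    by split; [rewrite /= -Eu|rewrite /kstep /=; case: ifP].
  rewrite /kstep /eU /=; cas; eapply E_case; first by eapply E_call; [by ev|exact: Es].
  rewrite /=; eapply E_ifb; first by ev.
    move=> ->; ev; first by eapply E_call; [by ev|exact: Ea].
    by eapply E_call; [by ev|apply: E_appn; nlia].
  by move=> /negbTE ->; ev.
eapply E_call; last by eapply E_snd.
by ev; exact: G.
Qed.

Definition encGr (st : seq nat * seq (seq nat)) : tree := Nd (encNL st.1) (encNLL st.2).

Lemma E_groups k n s g : bNL Y s -> bNLL Y g -> k + size g < Y ->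
  let r := iter k (groupstep n) (s, g) in
  E B [:: encn k; encn n; encGr (s, g)] eGroups (encGr r) /\
  [/\ bNL Y r.1, bNLL Y r.2, size r.2 = k + size g &
      forall c, n <= c -> all (fun L => size L <= c) g -> all (fun L => size L <= c) r.2].
Proof.
move=> bs bg lk r.
pose I j (st : seq nat * seq (seq nat)) := [/\ bNL Y st.1, all (bNL Y) st.2,
  size st.2 = j + size g &
  forall c, n <= c -> all (fun L => size L <= c) g -> all (fun L => size L <= c) st.2].
eapply E_wk; first apply: (@E_iterI _ encGr _ I).
- by ev.
- by ev.
- by split=> //; case/andP: bg.
- move=> j u lj [h1 h2 h3 _].
  have := szNL Y1 h1; have : sz (encNLL u.2) <= 3 * (Y * Y * Y).
    by apply: szNLL => //; rewrite /bNLL h2 h3 andbT; nlia.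
  by rewrite /encGr /=; nlia.
- move=> j [s' g'] lj [/= h1 h2 h3 h4]; have [ss sa] := andP h1.
  have ta : all (fun x => x < Y) (take n s' ++ drop n s') by rewrite cat_take_drop.
  move: ta; rewrite all_cat => /andP [t1 t2].
  have bt : bNL Y (take n s') by rewrite /bNL t1 size_take_min andbT; nlia.
  split; last first.
    split=> //=; rewrite ?bt ?h3 //; first by rewrite /bNL t2 size_drop andbT; nlia.
    by move=> c nc /(h4 _ nc) ->; rewrite size_take_min andbT; apply: leq_trans (geq_minl _ _) nc.
  have ssz' : ssz (map encn s') < 2 * (Y * Y) by rewrite -sz_enclE; apply: szNL.
  rewrite /encGr /groupstep; cas; eapply E_case.
    by eapply E_call; [by ev|apply: E_split; nlia].
  rewrite /encNLL /= /encNL map_drop map_take; ev; eapply E_call; first by ev.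
  eapply E_eq; first apply: E_rev; last by rewrite revK.
  by rewrite ssz_rev; have := ssz_take n (map encn s'); nlia.
by case=> h1 h2 h3 h4; split=> //; rewrite /bNLL h2 h3 andbT; nlia.
Qed.

Lemma E_pairup s : bNL Y s -> E B [:: encNL s] ePairup (encPs (pairup s)) /\ bPs Y (pairup s).
Proof.
move=> /andP [ss sa].
pose F := fun (st : seq nat * seq (nat * nat)) x =>
  if st.1 is u :: _ then ([::], (u, x) :: st.2) else ([:: x], st.2).
pose eU (st : seq nat * seq (nat * nat)) := Nd (encNL st.1) (encPs st.2).
pose I n (st : seq nat * seq (nat * nat)) :=
  [/\ bNL Y st.1, size st.1 <= 1, size st.2 <= n & all (bP Y) st.2].
have [H [H1 H2 H3 H4]] : E B [:: encNL s] (ltac:(let t := eval cbv [ePairup] in ePairup in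
     match t with Call _ [:: ?f] => exact f end)) (eU (foldl F ([::], [::]) s)) /\
     I (size s) (foldl F ([::], [::]) s).
  apply: (@E_foldI _ _ encn eU _ I).
  - by [].
  - by ev.
  - by ev.
  - by split; rewrite // /bNL /=; nlia.
  - move=> n u ln [h1 h2 h3 h4]; have := szNL Y1 h1; have : sz (encPs u.2) <= 4 * (Y * Y).
      by apply: szPs => //; rewrite /bPs h4 andbT; apply: leq_ltn_trans ss; nlia.
    by rewrite /eU /=; nlia.
  move=> n [f g] x ln /(all_lt sa) lx [/= h1 h2 h3 h4].
  rewrite /F /eU /=; case: f h1 h2 => [|u f] h1 h2 /=.
    split; first by cas; cas; ev.
    by split=> //=; [rewrite /bNL /= lx; nlia|nlia].
  split; first by cas; cas; ev.
  have lu : u < Y by case/andP: h1 => _ /= /andP [].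
  by split=> //=; [rewrite /bNL /=; nlia|rewrite /bP /= lu lx].
split.
  eapply E_call; last by eapply E_snd.
  by ev; exact: H.
by rewrite /bPs H4 andbT; apply: leq_ltn_trans ss.
Qed.

Lemma E_len (x : seq sym) : size x < Y -> E B [:: encs x] eLen (encn (size x)).
Proof.
move=> lx.
have -> : size x = foldl (fun u (_ : sym) => u.+1) 0 x.
  have H u : foldl (fun u (_ : sym) => u.+1) u x = u + size x.
    by elim: (x) u => [|c s IH] u /=; rewrite ?addn0 // IH addnS.
  by rewrite H.
eapply proj1; apply: (@E_foldI _ _ (fun c : sym => encn c) encn _ (fun n u => u = n) (size x)).
- by [].
- by ev.
- by ev.
- by [].
- by move=> n u ln ->; rewrite sz_encn; nlia.
by move=> n u c ln _ ->; split=> //; ev.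
Qed.

Lemma head_drop T (x0 : T) k s : head x0 (drop k s) = nth x0 s k.
Proof. by rewrite -nth0 nth_drop addn0. Qed.

Lemma E_N s W nums : W < Y -> s < Y -> brow Y nums ->
  (forall n, n <= s -> (iter n (kstep (pad W (nth [::] nums 4)))
     (pad W (nth [::] nums 3), 1)).2 < Y) ->
  64 * (s * (kof s W nums * kof s W nums)) < Y -> 0 < s ->
  E B [:: encn s; encn W; encRow nums] eN (encn (64 * (s * (kof s W nums * kof s W nums)))).
Proof.
move=> lW ls bn Hk; set K := kof s W nums => lN s0'.
have srow : sz (encl (map encB nums)) <= B by apply: leq_trans (szRow Y1 bn) _; nlia.
have bh k : bbits Y (nth [::] nums k) by rewrite -head_drop; apply: brow_head; apply: brow_drop.
have KY : K < Y by apply: (Hk s).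
have [P1 b1] := E_pad lW (bh 3); have [P2 b2] := E_pad lW (bh 4).
have EKs := E_K b1 b2 Hk.
have KK : K * K <= s * (K * K) by rewrite leq_pmull.
have SK : s * (K * K) <= 64 * (s * (K * K)) by rewrite leq_pmull.
eapply E_case.
  ev; eapply E_call; last exact: EKs.
  ev.
    eapply E_call; last exact: P1.
    ev; eapply E_call; last by rewrite -head_drop; apply: (@E_nthT _ encB [::] 3).
    by ev.
  eapply E_call; last exact: P2.
  ev; eapply E_call; last by rewrite -head_drop; apply: (@E_nthT _ encB [::] 4).
  by ev.
rewrite -[encn (kfac _ _ _)]/(encn K) /=.
eapply E_call; last by apply: (@E_mul 64 (s * (K * K))); nlia.
ev; first by eapply E_call; [by ev|].
eapply E_call; last by apply: (@E_mul s (K * K)); nlia.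
by ev; eapply E_call; [by ev|apply: E_mul; nlia].
Qed.

Lemma E_bits (x : seq sym) : 0 < size x -> size x < Y -> getW x < Y -> getN x * getW x < Y ->
  (forall n, n <= size x -> (iter n (kstep (pad (getW x) (nth [::] (parse_nums x) 4)))
     (pad (getW x) (nth [::] (parse_nums x) 3), 1)).2 < Y) ->
  E B [:: encs x] eBits (encn (getN x * getW x)).
Proof.
move=> x0 lx lW lNW Hk.
have [Ep bp] := E_parse lx.
have W0 : 0 < getW x by rewrite muln_gt0 x0.
have lN : getN x < Y by apply: leq_ltn_trans lNW; rewrite leq_pmulr.
have EN := E_N lW lx bp Hk lN x0.
have EL := E_len lx.
eapply E_case; first by ev; eapply E_call; [by ev|exact: EL].
rewrite /=; eapply E_case; first by ev; eapply E_call; [by ev|apply: E_mul].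
rewrite /=; eapply E_call; last exact: (E_mul lNW lW).
ev; eapply E_call; last exact: EN.
by ev; eapply E_call; [by ev|exact: Ep].
Qed.

Lemma encn_bsym b : encn (bsym b : sym) = encb b.
Proof. by case: b; rewrite /= inordK. Qed.

Lemma E_run W N m l k prefs M rho pairs : 0 < W -> W < Y -> N < Y -> l.+1 < Y ->
  k.+1 * k.+2 < Y -> 2 * (size prefs * (k + 2)) + k + 4 < Y ->
  bNLL Y prefs -> all (fun L => size L <= k) prefs -> bPs Y M ->
  bPs Y pairs -> all (fun p => m + p.2 < Y) pairs -> bbits Y rho ->
  E B [:: encn W; encn N; encn m; encn l; encNLL prefs; encPs M; encB rho; encPs pairs] eRun
    (encs (runalg W N m l prefs M rho pairs)).
Proof.
move=> W0 lW lN ll lk ls bp sk bM bpr am br.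
have b1 : bbits Y [:: true] by rewrite /bbits /=; nlia.
have b0 : bbits Y [::] by rewrite /bbits /=; nlia.
have [Ez bz] := E_pad lW b0; have [Eo bo] := E_pad lW b1.
set z := pad W [::] in Ez bz *; set one := pad W [:: true] in Eo bo *.
set base := iter l (cons z) [:: one].
have bI n : n <= l -> size (iter n (cons z) [:: one]) = n.+1 /\ brow Y (iter n (cons z) [:: one]).
  elim: n => [|n IH] ln; first by rewrite /brow /= bo; split=> //; nlia.
  have [e1 /andP [_ e2]] := IH (ltnW ln); rewrite /= e1; split=> //.
  by rewrite /brow /= e1 bz e2 /= andbT; nlia.
have bb : brow Y base by have [] := bI l (leqnn l).
have ls' : size prefs * (k + 2) + k + 4 < Y by nlia.
have [Ei [bi si]] := E_insts lk ls' bp sk bM bpr am bz bb.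
set ii := insts _ _ _ _ _ _ in Ei bi si.
have [Es bs] := E_sum bz bi.
have ai : all (fun i : inst => 2 * size i.2.2 + 2 < Y) ii.
  by apply: sub_all si => i h; nlia.
have [El [b2 b3 b4]] := E_loop lN lW bs bz bo br bi ai bM bpr am.
eapply E_case; first by ev; eapply E_call; [by ev|exact: Ez].
rewrite /=; eapply E_case; first by ev; eapply E_call; [by ev|exact: Eo].
rewrite /=; eapply E_case.
  ev; eapply E_call; last exact: Ei.
  ev; eapply proj1; apply: (@E_iterI _ encRow (cons z) (fun n r => r = iter n (cons z) [:: one])).
  - by ev.
  - by ev.
  - by [].
  - by move=> n u ln ->; have [_ /(szRow Y1)] := bI n ln; nlia.
  by move=> n u ln ->; split=> //; ev.
rewrite /=; eapply E_case; first by ev; eapply E_call; [by ev|exact: Es].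
rewrite /=; eapply E_case; first by eapply E_call; [by ev|exact: El].
rewrite /=; cas.
rewrite /runalg -/z -/one -/base -/ii.
move: b3 b4 El; case: (iter N _ _) => r [p q] /= b3 b4 El.
have bs' y : map (fun f : sym => encn f) (rev (map bsym y)) = rev (map encb y).
  by rewrite map_rev -map_comp; congr rev; apply: eq_map => b; apply: encn_bsym.
have [_ [_ [e2 _]]] := symE.
have -> : encs (outword p q) = encl (catrev (map encb p) (encn 2 :: catrev (map encb q) [:: encn 2])).
  by rewrite /encs /outword !catrevE map_cat bs' /= map_cat bs' /= e2.
have sp := ssz_bits p; have sq := ssz_bits q; rewrite /bbits in b3 b4.
eapply E_call; last first.
  apply: (@E_catrev B (map encb p) (encn 2 :: catrev (map encb q) [:: encn 2])).
  by rewrite ssz_cons catrevE ssz_cat ssz_rev ssz_cons sz_encn -[ssz [::]]/0; nlia.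
ev; eapply E_call; last first.
  apply: (@E_catrev B (map encb q) [:: encn 2]).
  by rewrite ssz_cons sz_encn -[ssz [::]]/0; nlia.
by ev.
Qed.

Lemma pairsrE m n : pairsr m n = rev [seq (u, w) | u <- iotar m, w <- iotar n].
Proof.
rewrite /pairsr; set s := iotar m.
have H t : foldl (fun s u => foldl (fun s' w => (u, w) :: s') s (iotar n)) t s =
    rev [seq (u, w) | u <- s, w <- iotar n] ++ t.
  elim: s t => //= u s IH t.
  by rewrite IH (foldl_rev_map (fun w => (u, w))) rev_cat -catA.
by rewrite H cats0.
Qed.

Lemma mem_pairsr m n p : (p \in pairsr m n) = (p.1 < m) && (p.2 < n).
Proof.
rewrite pairsrE mem_rev; case: p => u w /=; apply/allpairsP/andP.
  by case=> -[u' w'] /=; rewrite !iotarE !mem_rev !mem_iota => -[h1 h2 [-> ->]].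
by move=> [h1 h2]; exists (u, w); rewrite /= !iotarE !mem_rev !mem_iota.
Qed.

Lemma pairsr_uniq m n : uniq (pairsr m n).
Proof.
rewrite pairsrE rev_uniq; apply: allpairs_uniq; rewrite ?iotarE ?rev_uniq ?iota_uniq //.
by case=> u w [u' w'] _ _ [-> ->].
Qed.

Lemma E_main (x : seq sym) rho : 0 < size x -> size x < Y -> getW x < Y -> getN x * getW x < Y ->
  (forall n, n <= size x -> (iter n (kstep (pad (getW x) (nth [::] (parse_nums x) 4)))
     (pad (getW x) (nth [::] (parse_nums x) 3), 1)).2 < Y) ->
  let s := size x in 4 * (s * (s + 2)) + s + 10 < Y -> getW x + 1 < Y ->
  bbits Y rho ->
  E B [:: encB rho; encs x] eMain (encs (alg x rho)).
Proof.
move=> x0 lx lW lNW Hk s ls lW' br.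
have [Ep bp] := E_parse lx.
have W0 : 0 < getW x by rewrite muln_gt0 x0.
have lN : getN x < Y by apply: leq_ltn_trans lNW; rewrite leq_pmulr.
have EN := E_N lW lx bp Hk lN x0.
have EL := E_len lx.
have [Eu bu] := E_unaries lx bp.
set us := map _ _ in Eu bu.
have cap i : nth 0 us i <= s.
  case: (ltnP i (size us)) => li; last by rewrite nth_default.
  rewrite (nth_map [::]) -?(size_map (tounary (size x))) //.
  apply: (proj2 (E_tounary lx _)); rewrite -head_drop; apply: brow_head; exact: brow_drop.
set m := nth 0 us 0; set n := nth 0 us 1; have ms := cap 0; have ns := cap 1.
rewrite -/m in ms; rewrite -/n in ns.
have sS : s <= s * (s + 2) by rewrite leq_pmulr // addn2.
have bd : bNL Y (drop 5 us).
  have [h1 h2] := andP bu; rewrite /bNL size_drop; apply/andP; split; first by nlia.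
  by apply/allP => y /mem_drop /(allP h2).
have b00 : bNLL Y [::] by rewrite /bNLL /=; nlia.
have [|G1 [g1 g2 g3 g4]] := @E_groups m n (drop 5 us) [::] bd b00; first by rewrite /=; nlia.
set r1 := iter m _ _ in G1 g1 g2 g3 g4; rewrite addn0 in g3.
have [| G2 [h1 h2 h3 h4]] := @E_groups n m r1.1 r1.2 g1 g2; first by nlia.
rewrite -surjective_pairing in G2 h1 h2 h3 h4.
set r2 := iter n _ _ in G2 h1 h2 h3 h4.
have bt : bNL Y (behead r2.1).
  have [q1 q2] := andP h1; rewrite -drop1 /bNL size_drop; apply/andP; split; first by nlia.
  by apply/allP => y /mem_drop /(allP q2).
have [EM bM] := E_pairup bt.
have mn : m * n < Y by apply: leq_ltn_trans (leq_mul ms ns) _; rewrite mulnDr in ls; nlia.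
have [|| EP bP'] := @E_pairs m n _ _ mn; [by nlia|by nlia|].
have b2 : bbits Y (nth [::] (parse_nums x) 2).
  by rewrite -head_drop; apply: brow_head; apply: brow_drop.
have [El ll] := E_tounary lW b2.
have ap : all (fun L => size L <= s) (rev r2.2).
  by rewrite all_rev; apply: h4 => //; apply: g4.
have am : all (fun p => m + p.2 < Y) (pairsr m n).
  by apply/allP => -[u w]; rewrite mem_pairsr /= => /andP [_ h]; nlia.
have bh2 : bNLL Y (rev r2.2) by rewrite /bNLL size_rev all_rev.
have ER := @E_run (getW x) (getN x) m (tounary (getW x) (nth [::] (parse_nums x) 2)) s
  (rev r2.2) (pairup (behead r2.1)) rho (pairsr m n) W0 lW lN _ _ _ bh2 ap bM bP' am br.
have srow : sz (encl (map encB (parse_nums x))) <= B by apply: leq_trans (szRow Y1 bp) _; nlia.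
have sus : sz (encl (map encn us)) <= B by apply: leq_trans (szNL Y1 bu) _; nlia.
have Enth i : E B [:: encn i; encNL us] eNth (encn (nth 0 us i)).
  by rewrite -head_drop; apply: (@E_nthT _ encn 0).
eapply E_case; first by ev; eapply E_call; [by ev|exact: EL].
rewrite /=; eapply E_case; first by ev; eapply E_call; [by ev|apply: E_mul].
rewrite /=; eapply E_case; first by ev; eapply E_call; [by ev|exact: Ep].
rewrite /=; eapply E_case; first by ev; eapply E_call; [by ev|exact: Eu].
rewrite /=; eapply E_case; first by ev; eapply E_call; [by ev|exact: (Enth 0)].
rewrite /=; eapply E_case; first by ev; eapply E_call; [by ev|exact: (Enth 1)].
rewrite /=; eapply E_case.
  eapply E_call; last exact: G1.
  ev; eapply E_call; last by apply: (@E_dropT _ encn 5).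
  by ev.
rewrite /=; eapply E_case.
  by eapply E_call; [by ev|exact: G2].
rewrite /=; eapply E_call; last apply: ER.
- ev.
  + by eapply E_call; [by ev|exact: EN].
  + eapply E_call; last exact: El.
    ev; eapply E_call; last by rewrite -head_drop; apply: (@E_nthT _ encB [::] 2).
    by ev.
  + by eapply E_call; [by ev|apply: E_revT; apply: leq_trans (szNLL Y1 h2) _; nlia].
  + eapply E_call; last exact: EM.
    by ev; cal E_tailT.
  by eapply E_call; [by ev|exact: EP].
- by nlia.
- by apply: leq_ltn_trans ls; clear; nlia.
- rewrite size_rev h3 g3.
  have : (n + m) * (s + 2) <= (s + s) * (s + 2) by rewrite leq_mul2r leq_add ?orbT.
  by rewrite mulnDl; nlia.
Qed.
End Correctness.

(** * Values of binary numbers *)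

Fixpoint bval (x : seq bool) : nat := if x is b :: x' then b + 2 * bval x' else 0.
Fixpoint bits (W r : nat) : seq bool := if W is W'.+1 then odd r :: bits W' r./2 else [::].

Lemma size_bits W r : size (bits W r) = W.
Proof. by elim: W r => //= W IH r; rewrite IH. Qed.
Lemma bval_lt x : bval x < 2 ^ size x.
Proof. by elim: x => //= b x IH; rewrite expnS; case: b => /=; lia. Qed.
Lemma bits_bval x : bits (size x) (bval x) = x.
Proof.
elim: x => //= b x IH; rewrite oddD mul2n odd_double addbF oddb.
by rewrite halfD odd_double andbF add0n doubleK; case: b; rewrite /= IH.
Qed.
Lemma bval_bits W r : r < 2 ^ W -> bval (bits W r) = r.
Proof.
elim: W r => [|W IH] r /=; first by case: r.
rewrite expnS => lt; rewrite IH; last by have := odd_double_half r; lia.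
by rewrite mul2n odd_double_half.
Qed.
Lemma bval_cat x y : bval (x ++ y) = bval x + 2 ^ size x * bval y.
Proof. by elim: x => [|b x IH] /=; rewrite ?expn0 ?mul1n ?expnS // IH; lia. Qed.
Lemma bval_nseq0 k : bval (nseq k false) = 0.
Proof. by elim: k => //= k ->. Qed.

Lemma adder_cons b x y flip c : adder (b :: x) y flip c =
  let yb := head false y (+) flip in
  let r := adder x (behead y) flip (maj b yb c) in (r.1, (b (+) (yb (+) c)) :: r.2).
Proof.
rewrite /adder /=.
have H s : forall c0 (y0 : seq bool) res, foldl (addstep flip) (c0, (y0, res)) s =
   let r := foldl (addstep flip) (c0, (y0, [::])) s in (r.1, (r.2.1, r.2.2 ++ res)).
  elim: s => [|a s IH] c0 y0 res //=.
  rewrite IH /= [in RHS]IH /=.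
  by rewrite -catA.
rewrite H; case: (foldl _ _ x) => c' [y' res'] /=.
by rewrite cats1 rev_rcons.
Qed.

(** Missing bits of [y] read as false before the inversion, so flipping complements all [size x]
    positions and turns [y] into [2 ^ size x - 1 - y]. *)
Lemma adderP x y flip c : size y <= size x ->
  bval (adder x y flip c).2 + 2 ^ size x * (adder x y flip c).1 =
  bval x + (if flip then 2 ^ size x - 1 - bval y else bval y) + c.
Proof.
elim: x y c => [|b x IH] y c.
  by case: y => // _; rewrite /adder /=; case: flip; lia.
move=> le; rewrite adder_cons /=.
have le' : size (behead y) <= size x by rewrite size_behead; move: le => /=; lia.
have := IH (behead y) (maj b (head false y (+) flip) c) le'.
have lty := bval_lt (behead y).
have : 2 ^ size (behead y) <= 2 ^ size x by rewrite leq_exp2l.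
have -> : bval y = head false y + 2 * bval (behead y) by case: (y).
rewrite expnS; move: (adder _ _ _ _) => [c' res] /=.
move: (bval (behead y)) (bval res) (bval x) (2 ^ size x) (2 ^ size (behead y)) lty.
move=> vy vr vx p q lty leq; rewrite /maj.
by case: (flip); case: (b); case: (head false y); case: (c) => /=; case: (c') => /=; lia.
Qed.

Lemma badd_val x y : size y <= size x -> bval x + bval y < 2 ^ size x ->
  bval (badd x y) = bval x + bval y.
Proof.
move=> le lt; have := adderP false false le; rewrite /badd /=.
by case: (adder _ _ _ _).1 => /=; lia.
Qed.

(** With complement and initial carry, the total is [2 ^ size x + x - y]; it produces a final carry
    exactly if [y <= x]. *)
Lemma bsubP x y : size y <= size x ->
  (bsub x y).1 = (bval y <= bval x) /\
  (bval y <= bval x -> bval (bsub x y).2 = bval x - bval y).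
Proof.
move=> le; have := adderP true true le; rewrite -/(bsub x y).
have := bval_lt (bsub x y).2; rewrite size_bsub.
have := bval_lt x; have := bval_lt y.
have : 2 ^ size y <= 2 ^ size x by rewrite leq_exp2l.
case: (bsub x y) => c d /=; case: c => /=; rewrite ?muln1 ?muln0; case: leqP => //; lia.
Qed.

Lemma double_val x (b : bool) : 2 * bval x + b < 2 ^ size x ->
  bval (adder x x false b).2 = 2 * bval x + b.
Proof.
move=> lt; have := adderP false b (leqnn (size x)).
by case: (adder _ _ _ _).1 => /=; lia.
Qed.

Lemma padE W x : size x <= W -> pad W x = x ++ nseq (W - size x) false.
Proof.
move=> le; rewrite /pad.
have H k : forall y t, (iter k padstep (y, t)).2 = rev (take k (y ++ nseq k false)) ++ t.
  elim: k => [|k IH] y t; first by rewrite take0.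
  rewrite iterSr IH /=; case: y => [|b y] /=.
    by rewrite rev_cons cat_rcons.
  rewrite rev_cons cat_rcons; congr (rev _ ++ _).
  have -> : false :: nseq k false = nseq k false ++ nseq 1 false by rewrite -nseqD addn1.
  rewrite catA [in RHS]take_cat size_cat size_nseq.
  case: ltnP => // lk; have/size0nil -> : size y = 0 by lia.
  by rewrite /= take_oversize ?size_nseq // subnn cats0.
rewrite H cats0 revK take_cat; case: ltnP => [|_]; first by lia.
by congr cat; apply/esym; rewrite take_nseq //; lia.
Qed.

Lemma pad_val W x : size x <= W -> bval (pad W x) = bval x.
Proof. by move=> le; rewrite padE // bval_cat bval_nseq0 muln0 addn0. Qed.

(** * Counting and unranking *)

Fixpoint gen (Ls : seq layer) (e : nat) (p : seq (seq nat)) : seq (nat * seq (seq nat)) :=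
  if Ls is L :: Ls' then flatten [seq gen Ls' (e + o.1) (atoms o.2 p) | o : lopt <- L]
  else [:: (e, p)].

(* The number of choices of total cost [l - e]. *)
Fixpoint cntc (l : nat) (Ls : seq layer) (e : nat) : nat :=
  if Ls is L :: Ls' then \sum_(o <- L) cntc l Ls' (e + o.1) else (e == l).

Lemma cntc_gen l Ls e p : cntc l Ls e = \sum_(x <- gen Ls e p | x.1 == l) 1.
Proof.
elim: Ls e p => [|L Ls IH] e p /=; first by rewrite big_mkcond big_seq1 /=; case: eqP.
rewrite big_flatten big_map; apply: eq_bigr => o _; exact: IH.
Qed.

Lemma cntc_gt l Ls e : l < e -> cntc l Ls e = 0.
Proof.
elim: Ls e => [|L Ls IH] e lt /=; first by case: eqP => // E; rewrite E ltnn in lt.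
by rewrite big1 // => o _; apply: IH; apply: ltn_addr.
Qed.

(** A layer multiplies the number of choices by at most its size, and a size [k] is below
    [2 ^ k]. *)
Lemma cntc_le l Ls e : cntc l Ls e <= 2 ^ sumn (map size Ls).
Proof.
elim: Ls e => [|L Ls IH] e /=; first by case: eqP.
rewrite expnD.
apply: (@leq_trans (\sum_(o <- L) 2 ^ sumn (map size Ls))); first exact: leq_sum.
rewrite big_const_seq count_predT iter_addn_0 mulnC leq_mul2r; apply/orP; right.
by apply: ltnW; apply: ltn_expl.
Qed.

Section Counting.
Variables W l : nat.

Lemma selstep_done (T : Type) (x : T) r its : foldl (@selstep T) ([:: x], r) its = ([:: x], r).
Proof. by elim: its. Qed.

Lemma selstep_bits (T : Type) (it : seq bool * T) r : size it.1 <= W -> r < 2 ^ W ->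
  selstep ([::], bits W r) it =
  if bval it.1 <= r then ([::], bits W (r - bval it.1)) else ([:: it.2], bits W r).
Proof.
move=> si lr; have le : size it.1 <= size (bits W r) by rewrite size_bits.
have [e1 e2] := bsubP le; rewrite bval_bits // in e1 e2.
have := size_bsub (bits W r) it.1; rewrite size_bits.
rewrite /selstep /=; case: (bsub _ _) e1 e2 => c d /= -> e2 sd.
by case: ifP => // /e2 <-; rewrite -sd bits_bval.
Qed.

Lemma select_ne (T : Type) (its : seq (seq bool * T)) r :
  all (fun it => size it.1 <= W) its -> r < 2 ^ W ->
  r < \sum_(it <- its) bval it.1 -> (select its (bits W r)).1 <> [::].
Proof.
rewrite /select; elim: its r => [|it its IH] r /=; first by rewrite big_nil.
move=> /andP [si ai] rW; rewrite big_cons selstep_bits // => lr.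
case: leqP => cr; last by rewrite selstep_done.
by apply: IH => //; lia.
Qed.

(** Selection cuts the range of ranks into consecutive blocks, one per item and as long as its
    weight, and renumbers each block from 0. *)
Lemma select_sum (T : Type) (its : seq (seq bool * T)) (G : seq T * seq bool -> nat) :
  all (fun it => size it.1 <= W) its -> \sum_(it <- its) bval it.1 <= 2 ^ W ->
  \sum_(r < \sum_(it <- its) bval it.1) G (select its (bits W r)) =
  \sum_(it <- its) \sum_(r < bval it.1) G ([:: it.2], bits W r).
Proof.
rewrite /select; elim: its => [|it its IH] /=; first by rewrite !big_nil big_ord0.
move=> /andP [si ai]; rewrite !big_cons => le.
rewrite big_split_ord /=; congr addn.
  apply: eq_bigr => r _; rewrite selstep_bits //; last by have := ltn_ord r; lia.
  by rewrite leqNgt ltn_ord /= selstep_done.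
rewrite -IH //; last by lia.
apply: eq_bigr => r _; rewrite selstep_bits //; last by have := ltn_ord r; lia.
by rewrite leq_addr addKn.
Qed.

Definition rowrep (Ls : seq layer) (rw : rowT) := [/\ size rw = l.+1,
  all (fun x => size x == W) rw &
  forall e, e <= l -> bval (nth [::] rw e) = cntc l Ls e].

Fixpoint tabrep (Ls : seq layer) (tab : seq entry) : Prop :=
  match Ls, tab with
  | [::], [::] => True
  | L :: Ls', (L', rw) :: tab' => [/\ L' = L, rowrep Ls' rw & tabrep Ls' tab']
  | _, _ => False
  end.

(** Beyond [l] the default entry is the empty bit string of value 0, which agrees with [cntc_gt]. *)
Lemma rowrep_nth Ls rw e : rowrep Ls rw ->
  bval (nth [::] rw e) = cntc l Ls e /\ size (nth [::] rw e) <= W.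
Proof.
move=> [sr ar H]; case: (ltnP e (size rw)) => le.
  by rewrite H; [split=> //; rewrite (eqP (all_nthP [::] ar e le))|lia].
by rewrite nth_default // cntc_gt //=; lia.
Qed.

(** Unranking is a bijection from ranks to choices of total cost [l]. The form with an arbitrary [F]
    is what the count of hits needs, and it passes through the induction layer by layer with
    [select_sum]. *)
Lemma unrank_sum Ls tab e p (F : seq (seq nat) -> nat) : tabrep Ls tab ->
  (forall Ls' e', cntc l (drop Ls' Ls) e' <= 2 ^ W) ->
  \sum_(r < cntc l Ls e) F (foldl urstep (e, (bits W r, p)) tab).2.2 =
  \sum_(x <- gen Ls e p | x.1 == l) F x.2.
Proof.
elim: Ls tab e p => [|L Ls IH] [|[L' rw] tab] e p //=.
  move=> _ _; rewrite [RHS]big_mkcond big_seq1 /=; case: eqP => _ /=; last by rewrite big_ord0.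
  by rewrite big_ord1.
move=> [-> rr tr] bd; set S := \sum_(o <- L) _.
have Hw : weigh e rw L = rev [seq (nth [::] rw (e + o.1), o) | o : lopt <- L].
  rewrite /weigh (foldl_rev_map (fun o : lopt => (head [::] (drop (e + o.1) rw), o))) cats0.
  by congr rev; apply: eq_map => o; rewrite head_drop.
have ES : S = \sum_(it <- weigh e rw L) bval it.1.
  rewrite Hw (perm_big _ (permEl (perm_rev _))) /= big_map.
  by apply: eq_bigr => o _; have [-> _] := rowrep_nth (e + o.1) rr.
have aw : all (fun it => size it.1 <= W) (weigh e rw L).
  rewrite Hw all_rev all_map; apply/allP => o _ /=.
  by have [_] := rowrep_nth (e + o.1) rr.
have SW : S <= 2 ^ W := bd 0 e.
(* The value 0 stands for a failed selection, which [select_ne] excludes for ranks below the total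
   weight. *)
pose G (fr : seq lopt * seq bool) := if fr.1 is o :: _
  then F (foldl urstep (e + o.1, (fr.2, atoms o.2 p)) tab).2.2 else 0.
transitivity (\sum_(r < S) G (select (weigh e rw L) (bits W r))).
  apply: eq_bigr => r _; have := @select_ne _ (weigh e rw L) r aw; rewrite -ES.
  have lr := ltn_ord r => /(_ (leq_trans lr SW) lr).
  by rewrite /G; case: (select _ _) => -[|o f] r'.
rewrite ES select_sum -?ES // Hw (perm_big _ (permEl (perm_rev _))) /= big_map.
rewrite big_flatten big_map; apply: eq_bigr => o _ /=.
have [-> _] := rowrep_nth (e + o.1) rr.
apply: IH => //; by move=> k e'; apply: (bd k.+1).
Qed.

Lemma vecadd_cons x a b : vecadd (x :: a) b = badd x (head [::] b) :: vecadd a (behead b).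
Proof.
pose F := fun (st : rowT * rowT) x => (behead st.1, badd x (head [::] st.1) :: st.2).
have H s : forall (b0 : rowT) res, (foldl F (b0, res) s).2 = (foldl F (b0, [::]) s).2 ++ res.
  by elim: s => [|y s IH] b0 res //=; rewrite IH [in RHS]IH -catA.
by rewrite /vecadd -/F /= (H a (behead b) [:: badd x (head [::] b)]) rev_cat.
Qed.

Lemma vecadd_nth a b i : i < size a -> nth [::] (vecadd a b) i = badd (nth [::] a i) (nth [::] b i).
Proof.
elim: a b i => [|x a IH] b [|i] //= lt; rewrite vecadd_cons //=.
by rewrite IH // nth_behead.
Qed.
Lemma size_vecadd a b : size (vecadd a b) = size a.
Proof. by elim: a b => // x a IH b; rewrite vecadd_cons /= IH. Qed.

Lemma newrow_rep z Ls L rw : size z = W -> bval z = 0 -> rowrep Ls rw ->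
  (forall e, cntc l (L :: Ls) e < 2 ^ W) -> rowrep (L :: Ls) (newrow z L rw).
Proof.
move=> sz0 vz rr bd; rewrite /newrow.
have [sr _ _] := rr.
have -> : foldl (fun u (_ : seq bool) => z :: u) [::] rw = nseq l.+1 z.
  have H s : forall k, foldl (fun u (_ : seq bool) => z :: u) (nseq k z) s = nseq (size s + k) z.
    by elim: s => [|y s IH] k //=; rewrite -[z :: _]/(nseq k.+1 z) IH addnS.
  by rewrite (H rw 0) addn0 sr.
have H t s : L = s ++ t -> let u := foldl (fun u (o : lopt) => vecadd u (drop o.1 rw)) (nseq l.+1 z) s in
   [/\ size u = l.+1, all (fun x => size x == W) u & 
    forall e, e <= l -> bval (nth [::] u e) = \sum_(o <- s) cntc l Ls (e + o.1)].
  elim/last_ind: s t => [|s o IH] t Es /=.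
    split; rewrite ?size_nseq //; first by rewrite all_nseq sz0 eqxx orbT.
    by move=> e le; rewrite -[z :: _]/(nseq l.+1 z) nth_nseq ltnS le vz big_nil.
  rewrite cat_rcons in Es; have [su au vu] := IH _ Es; rewrite foldl_rcons.
  set u := foldl _ _ _ in su au vu *.
  split; rewrite ?size_vecadd //.
    apply/(all_nthP [::]) => i; rewrite size_vecadd => li.
    by rewrite vecadd_nth // size_badd; apply: (all_nthP [::] au).
  move=> e le; rewrite vecadd_nth ?su // nth_drop addnC.
  have [v1 s1'] := rowrep_nth (e + o.1) rr.
  have su' : size (nth [::] u e) = W by apply/eqP; apply: (all_nthP [::] au); rewrite su.
  (* A partial sum over the options is at most the count for the whole layer, so the [W]-bit
     addition cannot overflow. *)
  have lt : bval (nth [::] u e) + bval (nth [::] rw (e + o.1)) < 2 ^ W.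
    rewrite v1 vu //; apply: leq_ltn_trans (bd e); rewrite /= Es big_cat big_cons /=.
    by rewrite addnA leq_addr.
  rewrite badd_val; [|by rewrite su'|by rewrite su'].
  by rewrite v1 vu // -cats1 big_cat big_seq1.
have [s1 a1 v1] := H [::] L (esym (cats0 L)).
by split.
Qed.

Lemma table_rep z Ls base : size z = W -> bval z = 0 -> rowrep [::] base ->
  (forall k e, cntc l (drop k Ls) e < 2 ^ W) ->
  rowrep Ls (table z (rev Ls) base).1 /\ tabrep Ls (table z (rev Ls) base).2.
Proof.
move=> sz0 vz rb; elim: Ls => [|L Ls IH] bd //.
have [r1 t1] := IH (fun k e => bd k.+1 e).
rewrite /table rev_cons foldl_rcons -/(table z (rev Ls) base) /=; split=> //.
by apply: newrow_rep => // e; apply: (bd 0).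
Qed.
End Counting.

(** * Layers enumerate permutations by number of inversions *)

Fixpoint invl (L t : seq nat) : nat :=
  if L is x :: L' then count (fun y => index y t < index x t) L' + invl L' t else 0.

Lemma invl_rcons L x t :
  invl (rcons L x) t = invl L t + count (fun y => index x t < index y t) L.
Proof.
elim: L => //= y L IH; rewrite IH -cats1 count_cat /=; lia.
Qed.

Lemma ltn_bump h i j : (bump h i < bump h j) = (i < j).
Proof. by rewrite /bump; lia. Qed.

Lemma index_ins_same q x t : x \notin t -> q <= size t -> index x (ins q x t) = q.
Proof.
move=> nx lq; rewrite insE index_cat /= eqxx addn0 size_takel //.
by case: ifP => // /mem_take xt; rewrite xt in nx.
Qed.

Lemma index_ins q x y t : y != x -> q <= size t -> index y (ins q x t) = bump q (index y t).
Proof.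
move=> ny lq; rewrite insE -{3}(cat_take_drop q t) !index_cat /= eq_sym (negbTE ny) /bump.
have st : size (take q t) = q by rewrite size_takel.
case: ifP => h; last by rewrite st; lia.
by have := h; rewrite -index_mem st; lia.
Qed.

Lemma ins_perm q x t : perm_eq (ins q x t) (x :: t).
Proof.
rewrite insE -{3}(cat_take_drop q t) -cat1s perm_catCA /=.
by rewrite perm_cons.
Qed.

Lemma ins_rem x t : x \in t -> ins (index x t) x (rem x t) = t.
Proof.
move=> xt; have lt : index x t < size t by rewrite index_mem.
rewrite insE remE.
have st : size (take (index x t) t) = index x t by rewrite size_takel // ltnW.
rewrite take_size_cat // drop_size_cat //.
by rewrite -{2}(nth_index 0 xt) -drop_nth // cat_take_drop.
Qed.

Lemma rem_ins q x t : x \notin t -> rem x (ins q x t) = t.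
Proof.
move=> nx; rewrite insE -{3}(cat_take_drop q t).
have : x \notin take q t by apply: contra nx; apply: mem_take.
elim: (take q t) => [|y s IH] /=; first by rewrite eqxx.
by rewrite inE negb_or eq_sym => /andP [/negbTE -> /IH ->].
Qed.

Lemma count_index_lt (t : seq nat) q : uniq t -> q <= size t -> count (fun y => index y t < q) t = q.
Proof.
move=> ut lq; rewrite -{2}(cat_take_drop q t) count_cat.
have /andP [h1 h2] : all (fun y => index y t < q) (take q t) && all (fun y => ~~ (index y t < q)) (drop q t).
  move: ut; rewrite -{1}(cat_take_drop q t) cat_uniq => /and3P [_ nd _].
  have st : size (take q t) = q by rewrite size_takel.
  apply/andP; split; apply/allP => y yt; rewrite -(cat_take_drop q t) index_cat st.
    by rewrite yt -{2}st index_mem.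
  case: ifP => h; last by rewrite -leqNgt leq_addr.
  by case/negP: nd; apply/hasP; exists y.
rewrite all_count in h1; rewrite (eqP h1) size_takel //.
by move: h2; rewrite all_predC has_count -eqn0Ngt => /eqP ->; rewrite addn0.
Qed.

(** An insertion moves the indices of the other elements by the monotone map [bump q]. *)
Lemma invl_ins S q x t : x \notin S -> q <= size t -> invl S (ins q x t) = invl S t.
Proof.
move=> nx lq; elim: S nx => //= y S IH; rewrite inE negb_or eq_sym => /andP [ny nx].
rewrite IH //; congr addn; apply: eq_in_count => z zS.
by rewrite !index_ins ?ltn_bump //; apply: contraNneq nx => <-.
Qed.

(** As [x] comes first in the reference order, it is inverted with exactly the [q] elements placed
    ahead of it. *)
Lemma invl_low S q x t : perm_eq t S -> uniq S -> x \notin S -> q <= size t ->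
  invl (x :: S) (ins q x t) = q + invl S t.
Proof.
move=> pt uS nx lq; rewrite /= invl_ins //; congr addn.
have nt : x \notin t by rewrite (perm_mem pt).
transitivity (count (fun y => index y t < q) t); last first.
  by apply: count_index_lt; rewrite ?(perm_uniq pt).
rewrite -(seq.permP pt); apply: eq_in_count => y yt; have ny : y != x by apply: contraNneq nt => <-.
by rewrite index_ins_same // index_ins // /bump; lia.
Qed.

Lemma invl_high S q x t : perm_eq t S -> uniq S -> x \notin S -> q <= size t ->
  invl (rcons S x) (ins q x t) = invl S t + (size t - q).
Proof.
move=> pt uS nx lq; rewrite invl_rcons invl_ins //; congr addn.
have nt : x \notin t by rewrite (perm_mem pt).
have := count_predC (fun y => index y t < q) t.
rewrite count_index_lt ?(perm_uniq pt) // => E.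
have -> : size t - q = count (predC (fun y => index y t < q)) t by lia.
rewrite -(seq.permP pt); apply: eq_in_count => y yt.
have ny : y != x by apply: contraNneq nt => <-.
by rewrite /= index_ins_same // index_ins // /bump; lia.
Qed.

Lemma splitsE k : splits k = rev [seq (q, k - q) | q <- iota 0 k.+1].
Proof.
have R j : rev [seq (q, k - q) | q <- iota 0 j.+1] = (j, k - j) :: rev [seq (q, k - q) | q <- iota 0 j].
  by rewrite -addn1 iotaD map_cat rev_cat.
have H j : j <= k -> iter j splitstep [:: (0, k)] = rev [seq (q, k - q) | q <- iota 0 j.+1].
  elim: j => [|j IH] lj; first by rewrite /= subn0.
  by rewrite iterS IH 1?ltnW // !R /= subnS.
exact: H.
Qed.

Lemma mem_splits k p : (p \in splits k) = (p.1 <= k) && (p.2 == k - p.1).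
Proof.
case: p => q r; rewrite splitsE mem_rev; apply/mapP/andP => [[j]|[lq /eqP E]].
  by rewrite mem_iota add0n ltnS => lj [-> ->].
by exists q; [rewrite mem_iota add0n ltnS|congr pair; exact: E].
Qed.
Lemma splits_uniq k : uniq (splits k).
Proof. by rewrite splitsE rev_uniq map_inj_uniq ?iota_uniq // => q q' [->]. Qed.

Definition gstep (L : layer) (G : seq (nat * seq (seq nat))) :=
  [seq (g.1 + o.1, atoms o.2 g.2) | g <- G, o : lopt <- L].
Definition genr (lay : seq layer) := foldr gstep [:: (0, [::])] lay.

(** [gen] recurses on the first choice, as unranking does, and [genr] on the last one, as suits
    adding an agent to an enumeration. *)
Lemma gen_genr lay : gen (rev lay) 0 [::] = genr lay.
Proof.
have H Ls : forall G, flatten [seq gen Ls g.1 g.2 | g <- G] = foldl (fun G L => gstep L G) G Ls.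
  elim: Ls => [|L Ls IH] G /=.
    by elim: G => //= -[c p] G ->.
  rewrite -IH /gstep; elim: G => //= g G ->.
  by rewrite map_cat flatten_cat -map_comp.
have := H (rev lay) [:: (0, [::])]; rewrite /= cats0 => ->.
by rewrite foldl_rev.
Qed.

(* [G] consists of the [(c + invl S t, t :: p)], each once, for [(c, p)] in [G0]
   and [t] a permutation of [S] satisfying [C]. *)
Definition AR (G0 G : seq (nat * seq (seq nat))) (S : seq nat) (C : pred (seq nat)) :=
  uniq G /\ forall c q, ((c, q) \in G) =
    if q is t :: p then [&& perm_eq t S, C t, invl S t <= c & (c - invl S t, p) \in G0]
    else false.

(** Reduces a layer to its action [ac] on the list under construction: the action must be injective,
    sound with the right cost, and exhaustive. *)
Lemma AR_step G0 G (S : seq nat) (C : pred (seq nat)) (L : layer) (S' : seq nat) (C' : pred (seq nat)) (ac : lopt -> seq nat -> seq nat) :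
  (forall o t p, o \in L -> atoms o.2 (t :: p) = ac o t :: p) -> uniq L ->
  (forall o t o' t', o \in L -> o' \in L -> perm_eq t S -> perm_eq t' S ->
      ac o t = ac o' t' -> o = o' /\ t = t') ->
  (forall o t, o \in L -> perm_eq t S -> C t ->
     [/\ perm_eq (ac o t) S', C' (ac o t) & invl S' (ac o t) = invl S t + o.1]) ->
  (forall t', perm_eq t' S' -> C' t' ->
     exists o t, [/\ o \in L, perm_eq t S, C t & ac o t = t']) ->
  AR G0 G S C -> AR G0 (gstep L G) S' C'.
Proof.
move=> Ha uL inj snd cpl [uG mG]; split.
  apply: allpairs_uniq => // x y /allpairsP [[g1 o1] [/= gG oL ->]].
  move=> /allpairsP [[g2 o2] [/= gG' oL' ->]] {x y} /=.
  case: g1 g2 gG gG' => [c1 [|t1 p1]] [c2 [|t2 p2]]; rewrite !mG // => /and4P [pt _ _ _] /and4P [pt' _ _ _].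
  rewrite /= !Ha // => -[Ec Et Ep]; have [E1 E2] := inj _ _ _ _ oL oL' pt pt' Et.
  by subst; have -> : c1 = c2 by lia.
move=> c q; apply/allpairsP/idP.
  case=> -[[c1 q1] o] /= [gG oL [-> ->]]; move: gG; rewrite mG; case: q1 => // t p.
  move=> /and4P [pt Ct li gG]; rewrite Ha //; have [-> -> ->] := snd _ _ oL pt Ct.
  by rewrite leq_add2r li subnDr gG.
case: q => // t' p /and4P [pt Ct li gG]; have [o [t [oL pt1 Ct1 E]]] := cpl _ pt Ct.
have [_ _ Ei] := snd _ _ oL pt1 Ct1; rewrite E in Ei.
rewrite Ei in li gG; have lo := leq_trans (leq_addl _ _) li.
exists ((c - o.1, t :: p), o); split=> //=.
  by rewrite mG pt1 Ct1 /= leq_subRL // addnC li -subnDA addnC.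
by rewrite Ha // E subnK.
Qed.

Lemma mem_mklayer hi k x o : (o \in mklayer hi k x) =
  [exists q : 'I_k.+1, o == (if hi then k - q else q : nat, [:: Some (x, q : nat)])].
Proof.
rewrite /mklayer foldl_rev_map cats0 mem_rev; apply/mapP/existsP.
  move=> [[q r]]; rewrite mem_splits /= => /andP [lq /eqP ->] ->.
  by exists (Ordinal (lq : q < k.+1)).
move=> [q /eqP ->]; exists (q : nat, k - q); rewrite ?mem_splits /= ?eqxx ?andbT //.
by rewrite -ltnS.
Qed.

Lemma mklayer_uniq hi k x : uniq (mklayer hi k x).
Proof.
rewrite /mklayer foldl_rev_map cats0 rev_uniq map_inj_in_uniq ?splits_uniq //.
move=> [q r] [q' r']; rewrite !mem_splits /= => /andP [_ /eqP ->] /andP [_ /eqP ->].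
by case=> _ ->.
Qed.

Definition posof (o : lopt) : nat := if o.2 is Some (_, q) :: _ then q else 0.

(** An arrangement arises from exactly one insertion: [q] is the index of [x] in it, and [t] is what
    remains without [x]. The hypothesis on [C'] says that the constraint does not see [x]. *)
Lemma AR_layer hi G0 G (S : seq nat) (C C' : pred (seq nat)) x : uniq S -> x \notin S ->
  (forall q t, q <= size t -> perm_eq t S -> C' (ins q x t) = C t) ->
  AR G0 G S C ->
  AR G0 (gstep (mklayer hi (size S) x) G) (if hi then rcons S x else x :: S) C'.
Proof.
move=> uS nx HC; apply: (@AR_step _ _ _ _ _ _ _ (fun o t => ins (posof o) x t)).
- by move=> o t p; rewrite mem_mklayer => /existsP [q /eqP ->].
- exact: mklayer_uniq.
- move=> o t o' t'; rewrite !mem_mklayer => /existsP [q /eqP ->] /existsP [q' /eqP ->] pt pt' /= E.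
  have nt : x \notin t by rewrite (perm_mem pt).
  have nt' : x \notin t' by rewrite (perm_mem pt').
  have lq : q <= size t by rewrite (perm_size pt) -ltnS.
  have lq' : q' <= size t' by rewrite (perm_size pt') -ltnS.
  have Eq : q = q' :> nat by have := congr1 (index x) E; rewrite !index_ins_same.
  by have := congr1 (rem x) E; rewrite !rem_ins // Eq.
- move=> o t; rewrite mem_mklayer => /existsP [q /eqP ->] pt Ct /=.
  have lq : q <= size t by rewrite (perm_size pt) -ltnS.
  split; last first.
  + by case: hi; [rewrite invl_high // (perm_size pt)|rewrite invl_low // addnC].
  + by rewrite HC.
  apply: perm_trans (ins_perm _ _ _) _.
  by case: hi; rewrite 1?[perm_eq _ (rcons _ _)]perm_sym 1?perm_rcons 1?perm_cons // perm_sym.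
move=> t' pt' Ct'.
have pt : perm_eq t' (x :: S).
  by apply: perm_trans pt' _; case: (hi) => //; rewrite perm_rcons.
have xt : x \in t' by rewrite (perm_mem pt) mem_head.
have pr : perm_eq (rem x t') S.
  by rewrite -(perm_cons x) perm_sym; apply: perm_trans (perm_to_rem xt); rewrite perm_sym.
have lq : index x t' < (size S).+1.
  by have := xt; rewrite -index_mem (perm_size pt).
exists (if hi then size S - index x t' else index x t', [:: Some (x, index x t')]), (rem x t').
split=> //; last exact: ins_rem.
  by rewrite mem_mklayer; apply/existsP; exists (Ordinal lq).
by rewrite -(HC (index x t')) ?ins_rem // (perm_size pr) -ltnS.
Qed.

Definition mopt (k x1 x2 p q : nat) : lopt := (p + (k.+1 - q), [:: Some (x1, p); Some (x2, q)]).

Lemma mergedE k x1 x2 first : merged k x1 x2 first =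
  rev [seq mopt k x1 x2 pr.1 qr.1 | pr <- splits k,
         qr <- [seq qr <- splits k.+1 | (pr.1 < qr.1) == first]].
Proof.
rewrite /merged.
have H1 (T U : eqType) (c : pred T) (f g : T -> U) s : {in s, f =1 g} -> forall u,
    foldl (fun v x => if c x then v else f x :: v) u s = rev [seq g x | x <- s & ~~ c x] ++ u.
  elim: s => //= x s IH fg u; rewrite IH; last by move=> y ys; apply: fg; rewrite inE ys orbT.
  by case: (c x) => //=; rewrite rev_cons cat_rcons fg ?mem_head.
have H2 (T U : Type) (g : T -> seq U) s : forall u,
    foldl (fun u a => rev (g a) ++ u) u s = rev (flatten (map g s)) ++ u.
  by elim: s => //= a s IH u; rewrite IH rev_cat catA.
rewrite -[RHS]cats0 -(H2 _ _ (fun pr => [seq mopt k x1 x2 pr.1 qr.1 |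
    qr <- [seq qr <- splits k.+1 | (pr.1 < qr.1) == first]])).
have H3 (T U : Type) (f g : T -> U -> T) (s : seq U) : (forall u a, f u a = g u a) ->
    forall u, foldl f u s = foldl g u s.
  by move=> E; elim: s => //= a s IH u; rewrite E IH.
apply: H3 => u pr; rewrite (H1 _ _ _ _ (fun qr => mopt k x1 x2 pr.1 qr.1)).
  by congr (rev (map _ _) ++ _); apply: eq_filter => qr; rewrite negb_add.
by move=> [q r]; rewrite mem_splits /= => /andP [_ /eqP ->].
Qed.

Lemma mem_merged k x1 x2 first o : o \in merged k x1 x2 first <->
  exists p q, [/\ p <= k, q <= k.+1, (p < q) = first & o = mopt k x1 x2 p q].
Proof.
rewrite mergedE mem_rev; split.
  move=> /allpairsPdep [[p r] [[q r'] [/=]]]; rewrite mem_filter !mem_splits /=.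
  by move=> /andP [lp _] /and3P [/eqP h lq _] ->; exists p, q.
move=> [p [q [lp lq h ->]]]; apply/allpairsPdep.
exists (p, k - p), (q, k.+1 - q); rewrite mem_filter !mem_splits /= lp lq h !eqxx.
by [].
Qed.

Lemma merged_uniq k x1 x2 first : uniq (merged k x1 x2 first).
Proof.
rewrite mergedE rev_uniq; apply: allpairs_uniq_dep; first exact: splits_uniq.
  by move=> pr _; apply: filter_uniq; apply: splits_uniq.
move=> u v /allpairsPdep [[p r] [[q r'] [+ + ->]]] /allpairsPdep [[p1 r1] [[q1 r1'] [+ + ->]]] /=.
rewrite !mem_filter !mem_splits /=.
move=> /andP [_ /eqP ->] /and3P [_ _ /eqP ->] /andP [_ /eqP ->] /and3P [_ _ /eqP ->].
by case=> _ -> ->.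
Qed.

Lemma AR_eq G0 G S (C C' : pred (seq nat)) : (forall t, perm_eq t S -> C t = C' t) ->
  AR G0 G S C -> AR G0 G S C'.
Proof.
move=> E [uG mG]; split=> // c [|t p]; rewrite mG //.
by case: (boolP (perm_eq t S)) => // /E ->.
Qed.

(** Since [x2] goes in last, it pushes [x1] back if [q <= p], so [x1] is ahead exactly if [p < q].
    Removing [x2] and then [x1] recovers both positions. *)
Lemma AR_merged G0 G (S : seq nat) x1 x2 first : uniq S -> x1 \notin S -> x2 \notin x1 :: S ->
  AR G0 G S xpredT ->
  AR G0 (gstep (merged (size S) x1 x2 first) G) (x1 :: rcons S x2)
    (fun t => (index x1 t < index x2 t) == first).
Proof.
move=> uS n1 n2.
have u1 : uniq (x1 :: S) by rewrite /= n1.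
have n21 : x2 != x1 by move: n2; rewrite inE negb_or => /andP [].
pose ac (o : lopt) (t : seq nat) :=
  if o.2 is [:: Some (_, p); Some (_, q)] then ins q x2 (ins p x1 t) else t.
have p1 p t : perm_eq t S -> perm_eq (ins p x1 t) (x1 :: S).
  by move=> pt; apply: perm_trans (ins_perm _ _ _) _; rewrite perm_cons.
have s1' p t : perm_eq t S -> size (ins p x1 t) = (size S).+1.
  by move=> /(p1 p) /perm_size.
have nt1 t : perm_eq t S -> x1 \notin t by move/perm_mem ->.
have nt2 p t : perm_eq t S -> x2 \notin ins p x1 t by move/(p1 p)/perm_mem ->.
apply: (@AR_step _ _ _ _ _ _ _ ac).
- by move=> o t p /mem_merged [p' [q [_ _ _ ->]]].
- exact: merged_uniq.
- move=> o t o' t' /mem_merged [p [q [lp lq _ ->]]] /mem_merged [p' [q' [lp' lq' _ ->]]] pt pt'.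
  rewrite /ac /= => E.
  have Eq : q = q' by have := congr1 (index x2) E; rewrite !index_ins_same ?nt2 ?s1'.
  have {}E : ins p x1 t = ins p' x1 t' by have := congr1 (rem x2) E; rewrite !rem_ins ?nt2.
  have Ep : p = p'.
    by have := congr1 (index x1) E; rewrite !index_ins_same ?nt1 ?(perm_size pt) ?(perm_size pt').
  by have := congr1 (rem x1) E; rewrite !rem_ins ?nt1 // Ep Eq.
- move=> o t /mem_merged [p [q [lp lq h ->]]] pt _.
  have -> : ac (mopt (size S) x1 x2 p q) t = ins q x2 (ins p x1 t) by [].
  have lp' : p <= size t by rewrite (perm_size pt).
  have lq' : q <= size (ins p x1 t) by rewrite s1'.
  split.
  + apply: perm_trans (ins_perm _ _ _) _; rewrite -rcons_cons perm_sym perm_rcons perm_cons.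
    by rewrite perm_sym; apply: p1.
  + rewrite index_ins_same ?nt2 // index_ins 1?eq_sym // index_ins_same ?nt1 // -h.
    by apply/eqP; rewrite /bump; lia.
  rewrite -rcons_cons invl_high ?p1 // s1' // invl_low //.
  by rewrite /mopt [(_, _).1]/=; lia.
move=> t' pt' /eqP h.
have pt2 : perm_eq t' (x2 :: x1 :: S) by apply: perm_trans pt' _; rewrite -rcons_cons perm_rcons.
have x2t : x2 \in t' by rewrite (perm_mem pt2) mem_head.
have pr2 : perm_eq (rem x2 t') (x1 :: S).
  by rewrite -(perm_cons x2) perm_sym; apply: perm_trans (perm_to_rem x2t); rewrite perm_sym.
have x1t : x1 \in rem x2 t' by rewrite (perm_mem pr2) mem_head.
set t1 := rem x2 t' in pr2 x1t; set t := rem x1 t1.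
have pt : perm_eq t S.
  by rewrite -(perm_cons x1) perm_sym; apply: perm_trans (perm_to_rem x1t); rewrite perm_sym.
have E1 : ins (index x1 t1) x1 t = t1 by apply: ins_rem.
have E2 : ins (index x2 t') x2 t1 = t' by apply: ins_rem.
have l1 : index x1 t1 <= size S by have := x1t; rewrite -index_mem (perm_size pr2).
have l2 : index x2 t' <= (size S).+1 by have := x2t; rewrite -index_mem (perm_size pt2).
exists (mopt (size S) x1 x2 (index x1 t1) (index x2 t')), t; split=> //.
  apply/mem_merged; exists (index x1 t1), (index x2 t'); split=> //.
  rewrite -h; have -> : index x1 t' = bump (index x2 t') (index x1 t1).
    by rewrite -{1}E2 index_ins 1?eq_sym // (perm_size pr2).
  by rewrite /bump; lia.
by rewrite /ac /= E1 E2.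
Qed.

Lemma AR_addhigh G0 items : forall (S : seq nat) (C : pred (seq nat)) lay, uniq (S ++ items) ->
  (forall x q t, x \in items -> q <= size t -> C (ins q x t) = C t) ->
  AR G0 (genr lay) S C ->
  AR G0 (genr (addlayers true items (size S, lay)).2) (S ++ items) C.
Proof.
elim: items => [|x items IH] S C lay uS HC A; first by rewrite cats0.
rewrite -cat_rcons in uS *; rewrite /addlayers /= -/(addlayers _ _ _) -[(size S).+1](size_rcons S x).
apply: IH => //; first by move=> y q t yi; apply: HC; rewrite inE yi orbT.
move: uS; rewrite cat_uniq rcons_uniq => /andP [/andP [nx u] _].
apply: (@AR_layer true) A => // q t lq _; apply: HC => //; exact: mem_head.
Qed.

Lemma AR_addlow G0 items : forall (S : seq nat) (C : pred (seq nat)) lay, uniq (rev items ++ S) ->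
  (forall x q t, x \in items -> q <= size t -> C (ins q x t) = C t) ->
  AR G0 (genr lay) S C ->
  AR G0 (genr (addlayers false items (size S, lay)).2) (rev items ++ S) C.
Proof.
elim: items => [|x items IH] S C lay uS HC A //.
rewrite rev_cons cat_rcons in uS *; rewrite /addlayers /= -/(addlayers _ _ _) -[(size S).+1]/(size (x :: S)).
apply: IH => //; first by move=> y q t yi; apply: HC; rewrite inE yi orbT.
move: uS; rewrite cat_uniq /= => /and3P [_ _ /andP [nx u]].
apply: (@AR_layer false) A => // q t lq _; apply: HC => //; exact: mem_head.
Qed.

Definition Cc (c : option2) (t : seq nat) : bool :=
  if c is Some (w, w') then index w t < index w' t else true.

Lemma AR_start lay : uniq (genr lay) -> AR (genr lay) (genr (startlayer :: lay)) [::] xpredT.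
Proof.
rewrite [genr (_ :: _)]/= => uG.
have -> : gstep startlayer (genr lay) = [seq (g.1, [::] :: g.2) | g <- genr lay].
  by rewrite /gstep /=; elim: (genr lay) => //= g G ->; rewrite addn0.
split; first by rewrite map_inj_uniq // => -[c p] [c' p'] [-> ->].
move=> c q; apply/mapP/idP => [[[c' p] gG [-> ->]]|].
  by rewrite /= subn0 gG.
case: q => // t p /and4P [pt _ _]; rewrite subn0 => gG; exists (c, p) => //=.
by congr (_, _ :: _); apply: perm_nilP.
Qed.

Lemma size_addlayers1 hi items k lay : (addlayers hi items (k, lay)).1 = k + size items.
Proof.
rewrite /addlayers; elim: items k lay => [|x items IH] k lay /=; first by rewrite addn0.
by rewrite IH addnS.
Qed.

Lemma AR_agent lay L c : uniq (genr lay) -> uniq L ->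
  (if c is Some (w, w') then (w \in L) && (w' \in L) else true) ->
  AR (genr lay) (genr (agentlay (startlayer :: lay) L c)) L (Cc c).
Proof.
move=> uG uL; have A := AR_start uG; case: c => [[w w'] /andP [wL wL']|_]; last first.
  exact: (@AR_addhigh _ L [::]).
rewrite /agentlay; case: (eqVneq w w') => [<-|ww'].
  have g0 G : gstep [::] G = [::] by rewrite /gstep; elim: G.
  have -> : genr ([::] :: startlayer :: lay) = [::] by apply: g0.
  by split=> // c [|t p] //; rewrite /Cc ltnn /= andbF.
have HC (S : seq nat) : w \notin S -> w' \notin S ->
    forall x q t, x \in S -> q <= size t -> Cc (Some (w, w')) (ins q x t) = Cc (Some (w, w')) t.
  move=> n1 n2 x q t xS lq; rewrite /Cc !index_ins ?ltn_bump //.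
    by apply: contraNneq n2 => ->.
  by apply: contraNneq n1 => ->.
have [EL aP hd] := cutP w w' L; case: (cut w w' L) EL aP hd => pre rest /= EL aP hd.
have np : w \notin pre /\ w' \notin pre.
  by split; apply/negP => /(allP aP); rewrite eqxx ?andbF.
have rw_ y : y \notin pre -> y \in L -> y \in rest by move=> h; rewrite EL mem_cat mem_rev (negbTE h).
have [np1 np2] := np; have wr := rw_ _ np1 wL; have wr' := rw_ _ np2 wL'.
case: rest EL hd wr wr' {rw_} => [//|x1 rest1] EL hd wr wr'.
have [ER aM hd2] := cutP w w' rest1; case: (cut w w' rest1) ER aM hd2 => mid rest2 /= ER aM hd2.
have [nm1 nm2] : w \notin mid /\ w' \notin mid.
  by split; apply/negP => /(allP aM); rewrite eqxx ?andbF.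
have u1 : uniq (x1 :: rest1) by move: uL; rewrite EL cat_uniq => /and3P [].
case: rest2 ER hd2 => [|x2 post] ER hd2.
  move: wr wr'; rewrite !inE ER cats0 !mem_rev (negbTE nm1) (negbTE nm2).
  by rewrite !orbF => /eqP E1 /eqP E2; rewrite E1 E2 eqxx in ww'.
have n12 : x1 != x2 by move: u1; rewrite /= ER mem_cat inE !negb_or => /andP [/and3P []].
have E1 := size_addlayers1 true (rev mid) 0 (startlayer :: lay).
have uM : uniq (rev mid).
  by move: u1; rewrite /= ER cat_uniq => /andP [_ /and3P []].
have A2 := @AR_addhigh _ (rev mid) [::] xpredT (startlayer :: lay) uM (fun _ _ _ _ _ => erefl) A.
rewrite /= in A2; case: addlayers E1 A2 => k1 lay2 /= -> A2.
rewrite add0n.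
have [nx1 nx2] : x1 \notin rev mid /\ x2 \notin x1 :: rev mid.
  move: u1; rewrite /= ER mem_cat negb_or => /andP [/andP [h1 h2]].
  rewrite -cat_rcons cat_uniq rcons_uniq => /and3P [/andP [h3 _] _ _].
  by split=> //; rewrite inE negb_or eq_sym n12.
have A3 := @AR_merged _ _ _ x1 x2 (x1 == w) uM nx1 nx2 A2.
(* [x1] and [x2] are [w] and [w'] in one order or the other, at different indices; comparing with
   [x1 == w] therefore says in both cases that [w] is ahead of [w']. *)
have {}A3 : AR (genr lay) (genr (merged (size (rev mid)) x1 x2 (x1 == w) :: lay2))
    (x1 :: rcons (rev mid) x2) (Cc (Some (w, w'))).
  apply: AR_eq A3 => t pt; rewrite /Cc.
  have m1 : x1 \in t by rewrite (perm_mem pt) mem_head.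
  have m2 : x2 \in t by rewrite (perm_mem pt) inE mem_rcons mem_head orbT.
  have ni : index x1 t != index x2 t.
    apply/eqP => E; case/eqP: n12.
    by rewrite -(nth_index 0 m1) E nth_index.
  case: (eqVneq x1 w) hd hd2 => [E /= _|n1 /= /eqP E].
    rewrite -E; case/orP => /eqP E'; first by rewrite E' E eqxx in n12.
    by rewrite E' eqb_id.
  case/orP => /eqP E'; last by rewrite E E' eqxx in n12.
  by rewrite -E -E' eqbF_neg -leqNgt leq_eqVlt eq_sym (negbTE ni).
have EL2 : L = rev pre ++ ((x1 :: rcons (rev mid) x2) ++ post).
  by rewrite EL ER /= cat_rcons.
have uL2 := uL; rewrite EL2 in uL2.
have npost : w \notin post /\ w' \notin post.
  have : uniq ((x1 :: rcons (rev mid) x2) ++ post) by move: uL2; rewrite cat_uniq => /and3P [].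
  rewrite cat_uniq => /and3P [_ /hasPn h _].
  have mm y : (y == x1) || (y == x2) -> y \in x1 :: rcons (rev mid) x2.
    by rewrite inE mem_rcons inE => /orP [->|->] //=; rewrite orbT.
  have hh y : (y == x1) || (y == x2) -> y \notin post.
    by move=> /mm h1; apply/negP => /h; rewrite h1.
  suff [h1 h2] : (w == x1) || (w == x2) /\ (w' == x1) || (w' == x2) by split; apply: hh.
  move: hd hd2 n12 => /orP [/eqP ->|/eqP ->] /orP [/eqP ->|/eqP ->]; rewrite ?eqxx ?orbT //.
have sz1 : (size (rev mid)).+2 = size (x1 :: rcons (rev mid) x2) by rewrite /= size_rcons.
rewrite sz1.
have A4 := @AR_addhigh _ post _ _ _ _ (HC post (proj1 npost) (proj2 npost)) A3.
have {}A4 := A4 ltac:(by move: uL2; rewrite cat_uniq => /and3P []).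
have := size_addlayers1 true post (size (x1 :: rcons (rev mid) x2))
   (merged (size (rev mid)) x1 x2 (x1 == w) :: lay2).
rewrite -size_cat; case: addlayers A4 => k3 lay3 /= A4 ->.
rewrite [X in AR _ _ X]EL2.
have := @AR_addlow _ pre ((x1 :: rcons (rev mid) x2) ++ post) _ lay3 uL2 (HC pre np1 np2) A4.
by [].
Qed.

(** * Swap distance is the number of inversions *)

Definition ninvs n (s : {perm 'I_n}) : {set 'I_n * 'I_n} :=
  [set p : 'I_n * 'I_n | (p.1 < p.2) && (s p.2 < s p.1)].
Definition ninv n (s : {perm 'I_n}) : nat := #|ninvs s|.

Lemma tperm_adj n (i j x : 'I_n) : j = i.+1 :> nat ->
  tperm i j x = (if x == i :> nat then i.+1 else if x == i.+1 :> nat then i else x) :> nat.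
Proof.
move=> E; rewrite permE /= -!val_eqE /= E; case: eqP => [_|_]; first by [].
by case: eqP.
Qed.

(** Exchanging two adjacent values affects the comparison of these two values only. *)
Lemma invset_tperm n (s : {perm 'I_n}) (i j : 'I_n) : j = i.+1 :> nat ->
  ninvs (s * tperm i j)%g \subset ((s^-1)%g i, (s^-1)%g j) |: ninvs s.
Proof.
move=> E; apply/subsetP => -[x y]; rewrite !inE /= !permM => /andP [lxy].
rewrite !(tperm_adj _ E) xpair_eqE lxy /= => h.
case: (ltnP (s y) (s x)) => le; first by rewrite orbT.
have ne : s x != s y :> nat by apply/eqP => /val_inj /perm_inj Exy; rewrite Exy ltnn in lxy.
have [e1 e2] : s x = i :> nat /\ s y = i.+1 :> nat.
  by move: h ne le; do ?[case: eqP => ?]; move=> *; split; lia.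
have -> : i = s x by apply: val_inj.
have -> : j = s y by apply: val_inj; rewrite /= E e2.
by rewrite !permK !eqxx.
Qed.

Lemma inv_tperm n (s : {perm 'I_n}) (i j : 'I_n) : j = i.+1 :> nat ->
  ninv (s * tperm i j)%g <= (ninv s).+1.
Proof.
move=> E; apply: leq_trans (subset_leq_card (invset_tperm s E)) _.
by rewrite cardsU1; case: (_ \notin _); rewrite ?add0n ?add1n.
Qed.

(** At a descent, the only pair that [invset_tperm] allows to be new is in the wrong order to be an
    inversion, and the reversed pair [p] is the one inversion that disappears. *)
Lemma inv_tperm_desc n (s : {perm 'I_n}) (i j : 'I_n) : j = i.+1 :> nat ->
  ((s^-1)%g j < (s^-1)%g i) -> ninv s = (ninv (s * tperm i j)%g).+1.
Proof.
move=> E d; set p := ((s^-1)%g j, (s^-1)%g i).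
have pI : p \in ninvs s by rewrite inE /= d !permKV E /=.
have pN : p \notin ninvs (s * tperm i j)%g.
  rewrite inE /= d !permM !permKV !(tperm_adj _ E) E !eqxx /=.
  by case: eqP => ?; lia.
have sub : ninvs (s * tperm i j)%g \subset ninvs s.
  apply/subsetP => q qI; have := subsetP (invset_tperm s E) q qI.
  rewrite 2!inE => /orP [/eqP Eq|//].
  by move: qI; rewrite Eq inE /= ltnNge (ltnW d).
apply/eqP; rewrite eqn_leq; apply/andP; split; last first.
  by apply: proper_card; apply/properP; split=> //; exists p.
rewrite -[X in _ <= X]add1n /ninv; have -> : 1 = (p \notin ninvs (s * tperm i j)%g) by rewrite pN.
rewrite -cardsU1; apply: subset_leq_card; apply/subsetP => -[x y] xyI.
rewrite 2!inE; case: eqP => //= ne; move: xyI; rewrite !inE /= => /andP [-> lt].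
rewrite !permM !(tperm_adj _ E).
have n1 : ~ (s y = i :> nat /\ s x = i.+1 :> nat).
  move=> [/val_inj e1 e2]; apply: ne; rewrite /p -e1.
  have -> : j = s x by apply: val_inj; rewrite /= E -e2.
  by rewrite !permK.
by move: n1 lt; do ?[case: eqP => ?]; move=> *; lia.
Qed.

Lemma inv1 n : ninv (1%g : {perm 'I_n}) = 0.
Proof. by apply/eqP; rewrite cards_eq0; apply/eqP/setP => -[x y]; rewrite !inE /= !perm1; lia. Qed.

(** Without a descent the inverse of [s] is strictly increasing. An increasing self-map of ['I_n]
    satisfies [x <= t x] by induction from below and [t x <= x] by induction from above, hence is
    the identity. *)
Lemma perm_desc n (s : {perm 'I_n}) : s != 1%g ->
  exists i j : 'I_n, j = i.+1 :> nat /\ (s^-1)%g j < (s^-1)%g i.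
Proof.
case: (boolP [exists i : 'I_n, exists j : 'I_n, (j == i.+1 :> nat) && ((s^-1)%g j < (s^-1)%g i)]).
  by move=> /existsP [i /existsP [j /andP [/eqP h1 h2]]] _; exists i, j.
move=> H /eqP []; set t := (s^-1)%g in H.
have inc k : forall x y : 'I_n, y = x + k.+1 :> nat -> t x < t y.
  have st (x y : 'I_n) : y = x.+1 :> nat -> t x < t y.
    move=> E; rewrite ltn_neqAle; apply/andP; split.
      by apply/eqP => /val_inj /perm_inj E'; rewrite E' in E; lia.
    rewrite leqNgt; apply: contra H => h; apply/existsP; exists x; apply/existsP; exists y.
    by rewrite E eqxx.
  elim: k => [|k IH] x y E; first by apply: st; lia.
  have lz : x + k.+1 < n by have := ltn_ord y; lia.
  by apply: ltn_trans (IH x (Ordinal lz) erefl) _; apply: st => /=; lia.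
have ge (x : 'I_n) : x <= t x.
  case: x => x; elim: x => [|x IH] lx //=.
  have l' : x < n by apply: ltnW.
  by apply: leq_ltn_trans (IH l') _; apply: (inc 0) => /=; lia.
have le k : forall x : 'I_n, x + k.+1 = n -> t x <= x.
  elim: k => [|k IH] x E; first by have := ltn_ord (t x); lia.
  have l' : x.+1 < n by lia.
  have h1 : t x < t (Ordinal l') by apply: (inc 0) => /=; lia.
  have h2 : t (Ordinal l') <= x.+1 by apply: (IH (Ordinal l')) => /=; lia.
  by rewrite -ltnS; apply: leq_trans h1 h2.
apply/permP => x; rewrite perm1 -{1}[x](permK t) /t invgK permKV.
apply: (@perm_inj _ t); rewrite permK; apply: val_inj; apply/eqP; rewrite eqn_leq ge /=.
by apply: (le (n - x.+1)); have := ltn_ord x; lia.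
Qed.

Definition tinv m n (P Q : profile m n) : nat :=
  \sum_u ninv (P.1 u * (Q.1 u)^-1)%g + \sum_w ninv (P.2 w * (Q.2 w)^-1)%g.

Lemma inv_swap n (p s : {perm 'I_n}) i j :
  (p * (tperm i j * s)^-1)%g = (p * s^-1 * tperm i j)%g.
Proof. by rewrite invMg tpermV mulgA. Qed.

Lemma sum_change (I : finType) (f g : I -> nat) u : (forall v, v != u -> f v = g v) ->
  \sum_v f v + g u = \sum_v g v + f u.
Proof.
move=> E; rewrite (bigD1 u) //= [\sum_v g v](bigD1 u) //= (eq_bigr g) //; lia.
Qed.

Section Family.
Variables (I : finType) (k : nat).
Implicit Types p q r : {ffun I -> {perm 'I_k}}.
Let swapat r u i j := [ffun v => if v == u then (tperm i j * r u)%g else r v].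
Let sinv p q := \sum_v ninv (p v * (q v)^-1)%g.

(** Only the summand of agent [u] changes; the equation is kept free of subtraction. One statement
    serves the family of men and that of women. *)
Lemma sinv_swap p r u i j :
  sinv p (swapat r u i j) + ninv (p u * (r u)^-1)%g = sinv p r + ninv (p u * (r u)^-1 * tperm i j)%g.
Proof.
have := @sum_change _ (fun v => ninv (p v * (swapat r u i j v)^-1)%g) (fun v => ninv (p v * (r v)^-1)%g) u.
by rewrite /= ffunE eqxx inv_swap; apply => v /negbTE nv; rewrite ffunE nv.
Qed.

Lemma sinv_step p r u (i j : 'I_k) : j = i.+1 :> nat -> sinv p (swapat r u i j) <= (sinv p r).+1.
Proof.
have H a b c d : a + b = c + d -> d <= b.+1 -> a <= c.+1 by lia.
by move=> E; apply: H (sinv_swap p r u i j) (inv_tperm _ E).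
Qed.

Lemma sinv_desc p q u : p u != q u -> exists r (i j : 'I_k),
  [/\ j = i.+1 :> nat, q = swapat r u i j & sinv p q = (sinv p r).+1].
Proof.
rewrite eq_mulgV1 => /perm_desc [i [j [E d]]]; exists (swapat q u i j), i, j; split=> //.
  by apply/ffunP => v; rewrite !ffunE; case: eqP => // ->; rewrite eqxx mulgA tperm2 mul1g.
have H a b c e : a + b = c + e -> b = e.+1 -> c = a.+1 by lia.
exact: H (sinv_swap p q u i j) (inv_tperm_desc E d).
Qed.
End Family.

Lemma tinv_step m n (P R Q : profile m n) : swap_step R Q -> tinv P Q <= (tinv P R).+1.
Proof.
rewrite /tinv => /orP [] /existsP [u /existsP [i /existsP [j /andP [/andP [/eqP E /eqP E1] /eqP ->]]]].
  by rewrite E1 -addSn leq_add2r; apply: (sinv_step P.1 R.1 u E).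
by rewrite E1 -addnS leq_add2l; apply: (sinv_step P.2 R.2 u E).
Qed.

Lemma tinv_refl m n (P : profile m n) : tinv P P = 0.
Proof. by rewrite /tinv !big1 // => u _; rewrite mulgV inv1. Qed.

Lemma tinv_desc m n (P Q : profile m n) : P != Q ->
  exists2 R, swap_step R Q & tinv P Q = (tinv P R).+1.
Proof.
move=> ne.
have [[u hu]|[w hw]] : (exists u, P.1 u != Q.1 u) \/ (exists w, P.2 w != Q.2 w).
  case: (boolP [exists u, P.1 u != Q.1 u]) => [/existsP h|h1]; first by left.
  case: (boolP [exists w, P.2 w != Q.2 w]) => [/existsP h|h2]; first by right.
  case/eqP: ne; case: P Q h1 h2 => [P1 P2] [Q1 Q2] /= h1 h2; congr pair; apply/ffunP => v.
    by apply/eqP; apply: contraNT h1 => h; apply/existsP; exists v.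
  by apply/eqP; apply: contraNT h2 => h; apply/existsP; exists v.
- have [r [i [j [E Eq Es]]]] := sinv_desc hu; exists (r, Q.2); last by rewrite /tinv Es.
  apply/orP; left; apply/existsP; exists u; apply/existsP; exists i; apply/existsP; exists j.
  by apply/andP; split=> //=; apply/andP; split; apply/eqP.
have [r [i [j [E Eq Es]]]] := sinv_desc hw; exists (Q.1, r); last by rewrite /tinv Es addnS.
apply/orP; right; apply/existsP; exists w; apply/existsP; exists i; apply/existsP; exists j.
by apply/andP; split=> //=; apply/andP; split; apply/eqP.
Qed.

Lemma reach_tinv m n (P : profile m n) k : forall Q, reach k P Q -> tinv P Q <= k.
Proof.
elim: k => [|k IH] Q /=; first by move=> /eqP <-; rewrite tinv_refl.
by move=> /existsP [R /andP [/IH h /(tinv_step P) h2]]; lia.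
Qed.

Lemma tinv_reach m n (P : profile m n) k : forall Q, tinv P Q = k -> reach k P Q.
Proof.
elim: k => [|k IH] Q E /=.
  by apply: contraT => /tinv_desc [R _]; rewrite E.
have /tinv_desc [R st E2] : P != Q.
  by apply: contra_eq_neq E => ->; rewrite tinv_refl.
by apply/existsP; exists R; rewrite st IH //; lia.
Qed.

(** A swap raises [tinv] by at most one, so no shorter path exists. Conversely [tinv_desc] always
    provides a last swap with one inversion less before it, which builds a path of exactly this
    length. *)
Lemma swap_dist_eqE m n (P Q : profile m n) l : swap_dist_eq P Q l = (tinv P Q == l).
Proof.
apply/andP/eqP => [[/reach_tinv h /forallP H]|<-].
  apply/eqP; rewrite eqn_leq h leqNgt; apply/negP => lt.
  by have /negP := H (Ordinal lt); apply; apply: tinv_reach.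
split; first exact: tinv_reach.
apply/forallP => k; apply/negP => /reach_tinv; have := ltn_ord k; lia.
Qed.

Lemma tinv_le m n (P Q : profile m n) : tinv P Q <= m * (n * n) + n * (m * m).
Proof.
have H (I : finType) k (f : I -> {perm 'I_k}) : \sum_v ninv (f v) <= #|I| * (k * k).
  rewrite -sum_nat_const; apply: leq_sum => u _.
  by apply: leq_trans (max_card _) _; rewrite card_prod card_ord.
by rewrite /tinv; apply: leq_add; apply: leq_trans (H _ _ _) _; rewrite card_ord.
Qed.

(** * Preference lists and profiles *)

Definition okl (cs : nat -> option2) (prefs Q : seq (seq nat)) : bool :=
  (size Q == size prefs) && all (fun i => perm_eq (nth [::] Q i) (nth [::] prefs i)
     && Cc (cs i) (nth [::] Q i)) (iota 0 (size prefs)).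
Definition lcost (prefs Q : seq (seq nat)) : nat :=
  \sum_(0 <= i < size prefs) invl (nth [::] prefs i) (nth [::] Q i).

Lemma okl_rcons cs prefs L Q t : size Q = size prefs ->
  okl cs (rcons prefs L) (rcons Q t) =
  [&& okl cs prefs Q, perm_eq t L & Cc (cs (size prefs)) t].
Proof.
move=> sQ; rewrite /okl !size_rcons sQ !eqxx !andTb -[(size prefs).+1]addn1.
rewrite iotaD all_cat add0n /= andbT !nth_rcons sQ ltnn eqxx; congr andb.
apply: eq_in_all => i; rewrite mem_iota add0n => /andP [_ li].
by rewrite !nth_rcons sQ li.
Qed.

Lemma cost_rcons prefs L Q t : size Q = size prefs ->
  lcost (rcons prefs L) (rcons Q t) = lcost prefs Q + invl L t.
Proof.
move=> sQ; rewrite /lcost size_rcons big_nat_recr //= !nth_rcons sQ ltnn eqxx; congr addn.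
by apply: eq_big_nat => i /andP [_ li]; rewrite !nth_rcons sQ li.
Qed.

Definition conok (c : option2) (L : seq nat) : bool :=
  if c is Some (w, w') then (w \in L) && (w' \in L) else true.

(** Induction on the last agent: [AR_agent] combines the enumeration for the earlier agents with all
    admissible lists of this one. New lists are consed in front, so a generated profile is in
    reverse order. *)
Lemma layersP prefs mw u w pw pu : let cs i := con i mw u w pw pu in
  all uniq prefs -> (forall i, i < size prefs -> conok (cs i) (nth [::] prefs i)) ->
  uniq (genr (layers prefs mw u w pw pu)) /\
  forall c q, ((c, q) \in genr (layers prefs mw u w pw pu)) =
    okl cs prefs (rev q) && (c == lcost prefs (rev q)).
Proof.
move=> cs; rewrite /layers; set f := (fun st L => _).
have s1 s : (foldl f (0, [::]) s).1 = size s.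
  by elim/last_ind: s => // s x; rewrite foldl_rcons size_rcons /f /= => ->.
elim/last_ind: prefs => [|prefs L IH].
  move=> _ _ /=; split=> // c q; rewrite /okl /lcost inE xpair_eqE /= big_nil andbT.
  by rewrite andbC -size_eq0 size_rev.
rewrite all_rcons foldl_rcons => /andP [uL up] ok.
have [|u0 m0] := IH up.
  by move=> i li; have := ok i; rewrite size_rcons nth_rcons li; apply; apply: ltnW.
have okL : conok (cs (size prefs)) L.
  by have := ok (size prefs); rewrite size_rcons nth_rcons ltnn eqxx; apply.
have [u1 m1] := AR_agent u0 uL okL.
rewrite {1 3}/f s1; split=> // c q; rewrite m1.
case: q => [|t p]; first by rewrite /okl size_rcons.
rewrite m0 rev_cons; case: (eqVneq (size (rev p)) (size prefs)) => sp; last first.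
  by rewrite {1 2}/okl !size_rcons (negbTE sp) eqSS (negbTE sp) /= !andbF.
rewrite okl_rcons // cost_rcons //.
case: (perm_eq t L) => /=; last by rewrite !andbF.
case: (Cc _ t) => /=; last by rewrite !andbF.
rewrite !andbT; case: (okl _ _ _) => /=; last by rewrite andbF.
by rewrite -/cs; case: leqP => h; lia.
Qed.

Definition plist n (s : {perm 'I_n}) : seq nat := [seq (s i : nat) | i <- enum 'I_n].
Definition prefl m n (P : profile m n) : seq (seq nat) :=
  [seq plist (P.1 u) | u <- enum 'I_m] ++ [seq plist (P.2 w) | w <- enum 'I_n].

Lemma size_plist n (s : {perm 'I_n}) : size (plist s) = n.
Proof. by rewrite size_map size_enum_ord. Qed.
Lemma plist_uniq n (s : {perm 'I_n}) : uniq (plist s).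
Proof. by rewrite map_inj_uniq ?enum_uniq // => x y /val_inj /perm_inj. Qed.
Lemma nth_plist n (s : {perm 'I_n}) (i : 'I_n) : nth 0 (plist s) i = s i.
Proof. by rewrite (nth_map i) ?size_enum_ord // nth_ord_enum. Qed.
Lemma mem_plist n (s : {perm 'I_n}) k : (k \in plist s) = (k < n).
Proof.
apply/mapP/idP => [[i _ ->] //|lk]; exists ((s^-1)%g (Ordinal lk)); first by rewrite mem_enum.
by rewrite permKV.
Qed.
Lemma plist_perm n (s t : {perm 'I_n}) : perm_eq (plist s) (plist t).
Proof. by apply: uniq_perm; rewrite ?plist_uniq // => k; rewrite !mem_plist. Qed.
Lemma index_plist n (s : {perm 'I_n}) (k : 'I_n) : index (k : nat) (plist s) = (s^-1)%g k.
Proof.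
have {1}-> : (k : nat) = nth 0 (plist s) ((s^-1)%g k) by rewrite nth_plist permKV.
by rewrite index_uniq ?plist_uniq // size_plist.
Qed.
Lemma plist_inj n : injective (@plist n).
Proof. by move=> s t E; apply/permP => i; apply: val_inj; rewrite /= -!nth_plist E. Qed.

Lemma plist_onto n (s : {perm 'I_n}) t : perm_eq t (plist s) -> exists r : {perm 'I_n}, t = plist r.
Proof.
move=> pt; have st : size t = n by rewrite (perm_size pt) size_plist.
have ut : uniq t by rewrite (perm_uniq pt) plist_uniq.
have lt i : i < n -> nth 0 t i < n.
  by move=> li; rewrite -(mem_plist s) -(perm_mem pt) mem_nth // st.
pose f (i : 'I_n) := Ordinal (lt i (ltn_ord i)).
have fi : injective f.
  move=> i j [] /eqP; rewrite nth_uniq ?st // => /eqP; exact: val_inj.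
exists (perm fi); apply: (@eq_from_nth _ 0); rewrite ?size_plist // => i; rewrite st => li.
by rewrite -[i]/(nat_of_ord (Ordinal li)) nth_plist permE.
Qed.

(** Both sides count pairs of positions [i < j] in the list of [p]; the recursion [invl] is first
    turned into a double sum over positions. *)
Lemma invl_inv n (p s : {perm 'I_n}) : invl (plist p) (plist s) = ninv (p * s^-1)%g.
Proof.
have invlE L t : invl L t = \sum_(0 <= j < size L) \sum_(0 <= i < j)
    (index (nth 0 L j) t < index (nth 0 L i) t).
  elim/last_ind: L => [|L x IH]; first by rewrite big_nil.
  rewrite invl_rcons size_rcons big_nat_recr //= IH; congr addn.
    apply: eq_big_nat => j /andP [_ lj]; apply: eq_big_nat => i /andP [_ li].
    by rewrite !nth_rcons lj (ltn_trans li lj).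
  rewrite nth_rcons ltnn eqxx -sum1_count big_mkcond (big_nth 0) /=.
  by apply: eq_big_nat => i /andP [_ li]; rewrite nth_rcons li; case: (_ < _).
rewrite invlE size_plist big_mkord /ninv /ninvs -sum1_card.
rewrite (eq_bigl (fun q : 'I_n * 'I_n => true && ((q.1 < q.2) &&
   ((p * s^-1)%g q.2 < (p * s^-1)%g q.1)))); last by move=> q; rewrite inE.
rewrite -(pair_big_dep xpredT (fun i j : 'I_n => (i < j) && ((p * s^-1)%g j < (p * s^-1)%g i))
   (fun _ _ => 1)) /= (exchange_big_dep xpredT) //=; apply: eq_bigr => j _.
rewrite big_mkord (big_ord_widen n (fun i => index (nth 0 (plist p) j) (plist s) <
   index (nth 0 (plist p) i) (plist s) : nat)) 1?ltnW // [RHS]big_mkcondr /=.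
apply: eq_bigr => i _; rewrite !nth_plist !index_plist !permM.
by case: (_ < _).
Qed.

Lemma size_prefl m n (P : profile m n) : size (prefl P) = m + n.
Proof. by rewrite size_cat size_map size_enum_ord size_map size_enum_ord. Qed.
Lemma nth_prefl_m m n (P : profile m n) (u : 'I_m) : nth [::] (prefl P) u = plist (P.1 u).
Proof.
rewrite nth_cat size_map size_enum_ord ltn_ord (nth_map u) ?size_enum_ord //.
by rewrite nth_ord_enum.
Qed.
Lemma nth_prefl_w m n (P : profile m n) (w : 'I_n) : nth [::] (prefl P) (m + w) = plist (P.2 w).
Proof.
rewrite nth_cat size_map size_enum_ord ltnNge leq_addr /= addKn (nth_map w) ?size_enum_ord //.
by rewrite nth_ord_enum.
Qed.
Lemma prefl_uniq m n (P : profile m n) : all uniq (prefl P).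
Proof.
by rewrite all_cat; apply/andP; split; apply/allP => _ /mapP [x _ ->]; apply: plist_uniq.
Qed.

Lemma iota_ind m n (Pr : nat -> Prop) : (forall u : 'I_m, Pr u) -> (forall w : 'I_n, Pr (m + w)) ->
  forall i, i < m + n -> Pr i.
Proof.
move=> H1 H2 i li; case: (ltnP i m) => lm; first exact: (H1 (Ordinal lm)).
have lw : i - m < n by lia.
by have := H2 (Ordinal lw); rewrite /= subnKC.
Qed.

Lemma prefl_inj m n : injective (@prefl m n).
Proof.
move=> [P1 P2] [Q1 Q2] E; congr pair; apply/ffunP => v; apply: plist_inj.
  by rewrite -[P1]/((P1, P2).1) -nth_prefl_m E nth_prefl_m.
by rewrite -[P2]/((P1, P2).2) -nth_prefl_w E nth_prefl_w.
Qed.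

Lemma prefl_onto cs m n (P : profile m n) Q : okl cs (prefl P) Q -> exists R : profile m n, Q = prefl R.
Proof.
move=> /andP [/eqP sQ /allP H]; rewrite size_prefl in sQ.
have {}H i : i < m + n -> perm_eq (nth [::] Q i) (nth [::] (prefl P) i).
  by move=> li; have /andP [] := H i ltac:(by rewrite mem_iota size_prefl).
have [f Hf] : exists f : 'I_m -> {perm 'I_n}, forall u : 'I_m, nth [::] Q u = plist (f u).
  apply: (@fin_all_exists _ _ (fun (u : 'I_m) r => nth [::] Q u = plist r)) => u.
  have lu : u < m + n := leq_trans (ltn_ord u) (leq_addr n m).
  by apply: (@plist_onto _ (P.1 u)); rewrite -nth_prefl_m; apply: H.
have [g Hg] : exists g : 'I_n -> {perm 'I_m}, forall w : 'I_n, nth [::] Q (m + w) = plist (g w).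
  apply: (@fin_all_exists _ _ (fun (w : 'I_n) r => nth [::] Q (m + w) = plist r)) => w.
  have lw : m + w < m + n by rewrite ltn_add2l.
  by apply: (@plist_onto _ (P.2 w)); rewrite -nth_prefl_w; apply: H.
exists ([ffun u => f u], [ffun w => g w]).
apply: (@eq_from_nth _ [::]); rewrite ?size_prefl // sQ.
apply: iota_ind => v; first by rewrite nth_prefl_m /= ffunE Hf.
by rewrite nth_prefl_w /= ffunE Hg.
Qed.

Lemma cost_prefl m n (P R : profile m n) : lcost (prefl P) (prefl R) = tinv P R.
Proof.
rewrite /lcost size_prefl big_mkord big_split_ord /tinv; congr addn; apply: eq_bigr => v _.
  by rewrite !nth_prefl_m invl_inv.
by rewrite !nth_prefl_w invl_inv.
Qed.

Lemma okl_prefl cs m n (P R : profile m n) : okl cs (prefl P) (prefl R) =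
  [forall u : 'I_m, Cc (cs u) (plist (R.1 u))] && [forall w : 'I_n, Cc (cs (m + w)) (plist (R.2 w))].
Proof.
rewrite /okl !size_prefl eqxx /=; apply/allP/andP => [H|[/forallP H1 /forallP H2] i].
  split; apply/forallP => v.
    have lu : v < m + n := leq_trans (ltn_ord v) (leq_addr n m).
    by have /andP [_] := H v ltac:(by rewrite mem_iota); rewrite nth_prefl_m.
  have lw : m + v < m + n by rewrite ltn_add2l.
  by have /andP [_] := H (m + v) ltac:(by rewrite mem_iota); rewrite nth_prefl_w.
rewrite mem_iota add0n => /andP [_]; move: i; apply: iota_ind => v.
  by rewrite !nth_prefl_m plist_perm H1.
by rewrite !nth_prefl_w plist_perm H2.
Qed.

(** The enumeration has no repetitions, [prefl] is injective, and every admissible family of lists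
    comes from a profile, so a sum over choices is a sum over profiles. *)
Lemma sum_layers m n (P : profile m n) l mw u w pw pu (F : seq (seq nat) -> nat) :
  let cs i := con i mw u w pw pu in
  (forall i, i < m + n -> conok (cs i) (nth [::] (prefl P) i)) ->
  \sum_(x <- genr (layers (prefl P) mw u w pw pu) | x.1 == l) F (rev x.2) =
  \sum_(R : profile m n | (tinv P R == l) && okl cs (prefl P) (prefl R)) F (prefl R).
Proof.
move=> cs ok; have [||uG mG] := @layersP (prefl P) mw u w pw pu; first exact: prefl_uniq.
  by rewrite size_prefl.
set G := genr _ in uG mG *.
transitivity (\sum_(q <- [seq rev x.2 | x <- G & x.1 == l]) F q).
  by rewrite big_map big_filter.
transitivity (\sum_(q <- [seq prefl R | R <- enum (profile m n) &
    (tinv P R == l) && okl cs (prefl P) (prefl R)]) F q); last first.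
  by rewrite big_map big_filter big_enum_cond.
apply: perm_big; apply: uniq_perm.
- rewrite map_inj_in_uniq ?filter_uniq // => -[c q] [c' q']; rewrite !mem_filter /=.
  move=> /andP [/eqP -> _] /andP [/eqP -> _] /(congr1 rev); by rewrite !revK => ->.
- rewrite map_inj_uniq; last exact: prefl_inj.
  by apply: filter_uniq; apply: enum_uniq.
move=> q; apply/mapP/mapP => -[].
  move=> [c q']; rewrite mem_filter mG /= => /and3P [/eqP -> ok' /eqP El] ->.
  have [R ER] := prefl_onto ok'; exists R => //.
  by rewrite mem_filter mem_enum -cost_prefl -ER El eqxx ok'.
move=> R; rewrite mem_filter mem_enum => /andP [/andP [/eqP h1 h2] _] ->.
exists (l, rev (prefl R)); last by rewrite revK.
by rewrite mem_filter mG /= revK h2 cost_prefl h1 !eqxx.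
Qed.

(** * The hits are the profiles to be counted *)

Lemma scanE L w w' : scan L w w' = (index w L < index w' L).
Proof.
rewrite /scan; elim: L => //= x L IH; case: (x == w') => /=; last case: (x == w) => //=.
  by elim: L {IH}.
by elim: L {IH}.
Qed.

Lemma prefersE L w ps : prefers L w ps = Cc (mkcon w ps) L.
Proof. by case: ps => //= w' _; rewrite scanE. Qed.

Lemma partwE M u : partw M u = rev [seq p.2 | p <- M & p.1 == u].
Proof.
rewrite /partw -[RHS]cats0; elim: M [::] => //= p M IH s; case: ifP => _; rewrite IH //=.
by rewrite rev_cons cat_rcons.
Qed.
Lemma partuE M w : partu M w = rev [seq p.1 | p <- M & p.2 == w].
Proof.
rewrite /partu -[RHS]cats0; elim: M [::] => //= p M IH s; case: ifP => _; rewrite IH //=.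
by rewrite rev_cons cat_rcons.
Qed.

Section Instance.
Variables (m n : nat) (P : profile m n) (M : {set 'I_m * 'I_n}).
Hypothesis matM : is_matching M.
(** Reversed because [pairup] returns the pairs of the input in reverse order. *)
Let ML := rev [seq (p.1 : nat, p.2 : nat) | p : 'I_m * 'I_n <- enum M].

Lemma partwP (u : 'I_m) (w' : nat) : reflect (exists2 w1 : 'I_n, w' = w1 & (u, w1) \in M) (w' \in partw ML u).
Proof.
rewrite partwE mem_rev; apply: (iffP mapP) => [[[a b]]|[w1 -> uM]].
  rewrite mem_filter mem_rev /= => /andP [/eqP -> /mapP [[u1 w1]]]; rewrite mem_enum => uM [/val_inj -> ->].
  by move=> ->; exists w1.
exists (u : nat, w1 : nat) => //; rewrite mem_filter eqxx mem_rev; apply/mapP.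
by exists (u, w1); rewrite ?mem_enum.
Qed.
Lemma partuP (w : 'I_n) (u' : nat) : reflect (exists2 u1 : 'I_m, u' = u1 & (u1, w) \in M) (u' \in partu ML w).
Proof.
rewrite partuE mem_rev; apply: (iffP mapP) => [[[a b]]|[u1 -> uM]].
  rewrite mem_filter mem_rev /= => /andP [/eqP -> /mapP [[u1 w1]]]; rewrite mem_enum => uM [-> /val_inj ->].
  by move=> ->; exists u1.
exists (u1 : nat, w : nat) => //; rewrite mem_filter eqxx mem_rev; apply/mapP.
by exists (u1, w); rewrite ?mem_enum.
Qed.

(** In a matching the first partner found is the only one, and an agent without partner satisfies
    the quantification in [blocking] vacuously. *)
Lemma Cc_blocking (R : profile m n) (u : 'I_m) (w : 'I_n) :
  Cc (mkcon w (partw ML u)) (plist (R.1 u)) && Cc (mkcon u (partu ML w)) (plist (R.2 w)) =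
  blocking R M u w.
Proof.
rewrite /blocking; congr andb.
  have := partwP u; case: (partw ML u) => [|w1 ps] H.
    by apply/esym/forallP => w'; apply/implyP => uM; have : (w' : nat) \in [::] by apply/H; exists w'.
  have [w2 -> uM] : exists2 w2 : 'I_n, w1 = w2 & (u, w2) \in M by apply/H; apply: mem_head.
  rewrite /= !index_plist; apply/idP/forallP => [lt w'|/(_ w2)]; last by rewrite uM.
  by apply/implyP => uM'; have [<-] := matM uM uM' (or_introl erefl).
have := partuP w; case: (partu ML w) => [|u1 ps] H.
  by apply/esym/forallP => u'; apply/implyP => uM; have : (u' : nat) \in [::] by apply/H; exists u'.
have [u2 -> uM] : exists2 u2 : 'I_m, u1 = u2 & (u2, w) \in M by apply/H; apply: mem_head.
rewrite /= !index_plist; apply/idP/forallP => [lt u'|/(_ u2)]; last by rewrite uM.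
by apply/implyP => uM'; have [<-] := matM uM uM' (or_intror erefl).
Qed.

Lemma blocksE (R : profile m n) (u : 'I_m) (w : 'I_n) :
  blocks (prefl R) ML m u w = blocking R M u w.
Proof.
rewrite -Cc_blocking /blocks !head_drop nth_prefl_m nth_prefl_w !prefersE.
by case: (Cc _ _).
Qed.

Let cs (u : 'I_m) (w : 'I_n) i := con i (m + w) u w (partw ML u) (partu ML w).

Lemma okl_blocking (R : profile m n) u w :
  okl (cs u w) (prefl P) (prefl R) = blocking R M u w.
Proof.
rewrite okl_prefl -Cc_blocking; congr andb.
  apply/forallP/idP => [/(_ u)|h v]; first by rewrite /cs /con eqxx.
  rewrite /cs /con; case: eqP => [/val_inj -> //|_].
  by case: eqP => // E; have := ltn_ord v; lia.
apply/forallP/idP => [/(_ w)|h v].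
  by rewrite /cs /con eqxx; case: eqP => // E; have := ltn_ord u; lia.
rewrite /cs /con; case: eqP => [E|_]; first by have := ltn_ord u; lia.
by rewrite eqn_add2l; case: eqP => // /val_inj ->.
Qed.

Lemma cs_conok u w i : i < m + n -> conok (cs u w i) (nth [::] (prefl P) i).
Proof.
move: i; apply: iota_ind => v; rewrite ?nth_prefl_m ?nth_prefl_w /cs /con.
  case: eqP => [E|_]; last by case: eqP => // E; have := ltn_ord v; lia.
  have := partwP u; case: (partw _ _) => [|w1 ps] //= H; rewrite !mem_plist ltn_ord /=.
  by have /H [w2 -> _] := mem_head w1 ps.
case: eqP => [E|_]; first by have := ltn_ord u; lia.
rewrite eqn_add2l; case: eqP => // _.
have := partuP w; case: (partu _ _) => [|u1 ps] //= H; rewrite !mem_plist ltn_ord /=.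
by have /H [u2 -> _] := mem_head u1 ps.
Qed.

Definition lay (p : nat * nat) : seq layer :=
  layers (prefl P) (m + p.2) p.1 p.2 (partw ML p.1) (partu ML p.2).

Definition ncnt (l : nat) (u : 'I_m) (w : 'I_n) : nat :=
  #|[set R : profile m n | (tinv P R == l) && blocking R M u w]|.

Lemma sum_lay l (u : 'I_m) (w : 'I_n) (F : seq (seq nat) -> nat) :
  \sum_(x <- gen (rev (lay (u : nat, w : nat))) 0 [::] | x.1 == l) F (rev x.2) =
  \sum_(R : profile m n | (tinv P R == l) && blocking R M u w) F (prefl R).
Proof.
rewrite gen_genr (@sum_layers m n P l (m + w) u w (partw ML u) (partu ML w) F); last first.
  by move=> i; apply: cs_conok.
by apply: eq_bigl => R; rewrite -/(cs u w) okl_blocking.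
Qed.

Lemma firstbE (q : seq (seq nat)) (s : seq (nat * nat)) :
  firstb q ML m s = take 1 [seq p <- s | blocks q ML m p.1 p.2].
Proof.
rewrite /firstb; elim: s => //= p s IH; case: ifP => _ //=; rewrite take0.
by elim: s {IH}.
Qed.

(** Among the elements satisfying [a], if there are any, exactly one comes first. *)
Lemma sum_first (T : eqType) (a : pred T) (s : seq T) : uniq s ->
  \sum_(p <- s | a p) (take 1 [seq q <- s | a q] == [:: p]) = has a s.
Proof.
elim: s => [|x s IH] /=; first by rewrite big_nil.
move=> /andP [nx us]; rewrite big_cons; case ax: (a x) => /=; last exact: IH.
rewrite take0 eqxx big_seq_cond big1 // => p /andP [ps _].
by rewrite eqseq_cons andbT; case: eqP => // E; rewrite E ps in nx.
Qed.

Section Table.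
Variables (W l : nat).
Hypothesis bd : forall p, p \in pairsr m n -> forall k e, cntc l (drop k (rev (lay p))) e < 2 ^ W.
Let z := pad W [::].
Let one := pad W [:: true].
Let base := iter l (cons z) [:: one].
Let ii := insts (prefl P) ML m z base (pairsr m n).
Hypothesis W0 : 0 < W.

Lemma base_rep : rowrep W l [::] base.
Proof.
have sz1 : size one = W by rewrite size_pad.
have sz0 : size z = W by rewrite size_pad.
have E : base = nseq l z ++ [:: one] by rewrite /base; elim: l => //= k ->.
rewrite E; split.
- by rewrite size_cat size_nseq addn1.
- by rewrite all_cat all_nseq /= sz0 sz1 eqxx orbT.
move=> e le /=; rewrite nth_cat size_nseq; case: ltnP => h.
  by rewrite nth_nseq h pad_val //; case: eqP => //; lia.
have -> : e = l by lia.
by rewrite subnn eqxx /= pad_val.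
Qed.

Let tb (p : nat * nat) := table z (lay p) base.
Lemma instsE : ii = rev [seq (head [::] (tb p).1, (p, (tb p).2)) | p <- pairsr m n].
Proof.
rewrite /ii /insts foldl_rev_map cats0; congr rev; apply: eq_map => p.
by rewrite /mkinst -/(lay p) /tb; case: (table _ _ _).
Qed.

Lemma tb_rep p : p \in pairsr m n -> rowrep W l (rev (lay p)) (tb p).1 /\ tabrep W l (rev (lay p)) (tb p).2.
Proof.
move=> pp; rewrite /tb -{2 4}[lay p]revK; apply: table_rep; rewrite ?size_pad ?pad_val //.
  exact: base_rep.
exact: bd.
Qed.

Lemma tb_val p : p \in pairsr m n -> bval (head [::] (tb p).1) = cntc l (rev (lay p)) 0 /\
  size (head [::] (tb p).1) <= W.
Proof. by move=> /tb_rep [h _]; rewrite -nth0; apply: rowrep_nth h. Qed.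

Lemma cntc_ncnt (u : 'I_m) (w : 'I_n) : cntc l (rev (lay (u : nat, w : nat))) 0 = ncnt l u w.
Proof.
rewrite (cntc_gen _ _ _ [::]) (@sum_lay l u w (fun _ => 1)) sum1_card /ncnt.
by apply: eq_card => R; rewrite !inE.
Qed.

Lemma sum_pairsr (F : nat * nat -> nat) :
  \sum_(p <- pairsr m n) F p = \sum_(u < m) \sum_(w < n) F (u : nat, w : nat).
Proof.
rewrite pairsrE (perm_big _ (permEl (perm_rev _))) /= big_allpairs !iotarE.
rewrite (perm_big _ (permEl (perm_rev _))) -{1}[m]subn0 big_mkord /=; apply: eq_bigr => u _.
by rewrite (perm_big _ (permEl (perm_rev _))) -{1}[n]subn0 big_mkord.
Qed.

Definition Sigma : nat := \sum_(u < m) \sum_(w < n) ncnt l u w.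
Hypothesis SW : Sigma < 2 ^ W.

Lemma sum_ii (G : inst -> nat) : \sum_(i <- ii) G i =
  \sum_(u < m) \sum_(w < n) let p := (u : nat, w : nat) in G (head [::] (tb p).1, (p, (tb p).2)).
Proof.
rewrite instsE (perm_big _ (permEl (perm_rev _))) /= big_map.
by rewrite (sum_pairsr (fun p => G (head [::] (tb p).1, (p, (tb p).2)))).
Qed.

Lemma sum_ii_val : \sum_(i <- ii) bval i.1 = Sigma.
Proof.
rewrite (sum_ii (fun i => bval i.1)); apply: eq_bigr => u _; apply: eq_bigr => w _ /=.
by rewrite (proj1 (tb_val _)) ?cntc_ncnt // mem_pairsr /= !ltn_ord.
Qed.

Lemma ii_size : all (fun i : inst => size i.1 <= W) ii.
Proof.
rewrite instsE all_rev all_map; apply/allP => p pp /=.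
by have [] := tb_val pp.
Qed.

Lemma sumcount_val : size (sumcount z ii) = W /\ bval (sumcount z ii) = Sigma.
Proof.
have SW' := SW; rewrite -sum_ii_val in SW' *; rewrite /sumcount.
have H s t : ii = s ++ t -> let u := foldl (fun u (i : inst) => badd u i.1) z s in
    size u = W /\ bval u = \sum_(i <- s) bval i.1.
  elim/last_ind: s t => [|s i IH] t E /=; first by rewrite big_nil size_pad pad_val.
  rewrite cat_rcons in E; have [su vu] := IH _ E; rewrite foldl_rcons.
  set u := foldl _ _ _ in su vu *; rewrite size_badd su; split=> //.
  have si : size i.1 <= W.
    by have /allP := ii_size; apply; rewrite E mem_cat mem_head orbT.
  rewrite -cats1 big_cat big_seq1 badd_val ?su //= ?vu //.
  by apply: leq_ltn_trans SW'; rewrite E big_cat big_cons /= addnA leq_addr.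
by apply: (H ii [::]); rewrite cats0.
Qed.

(** Ranks below [Sigma] correspond to a pair together with a profile that it blocks. Exchanging the
    sums leaves, for each profile at distance [l], the number of its blocking pairs that are first:
    1 if it is unstable and 0 otherwise. *)
Lemma sum_hit : \sum_(r < Sigma) hit ii ML m (pairsr m n) (bits W r) = Sstar P l M.
Proof.
pose G (fr : seq (nat * nat * seq entry) * seq bool) : nat :=
  if fr.1 is (p, tab) :: _ then
    firstb (rev (unrank tab fr.2)) ML m (pairsr m n) == [:: p] else false.
transitivity (\sum_(r < Sigma) G (select ii (bits W r))).
  apply: eq_bigr => r _; rewrite /hit /G; case: (select _ _) => [[|[p tab] f] r'] //=.
  have : size (firstb (rev (unrank tab r')) ML m (pairsr m n)) <= 1.
    by rewrite firstbE size_take; case: ltnP.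
  case: (firstb _ _ _ _) => [|p' [|? ?]] //= _.
  by rewrite eqseq_cons eqxx andbT [p' == p]eq_sym; case: (p) (p') => [? ?] [? ?].
have := @select_sum W _ ii G ii_size; rewrite sum_ii_val => /(_ (ltnW SW)) ->.
rewrite (sum_ii (fun i => \sum_(r < bval i.1) G ([:: i.2], bits W r))).
transitivity (\sum_(u < m) \sum_(w < n) \sum_(R : profile m n | (tinv P R == l) && blocking R M u w)
   (firstb (prefl R) ML m (pairsr m n) == [:: (u : nat, w : nat)] : nat)).
  apply: eq_bigr => u _; apply: eq_bigr => w _.
  have pp : (u : nat, w : nat) \in pairsr m n by rewrite mem_pairsr /= !ltn_ord.
  rewrite /= (proj1 (tb_val pp)) /G /=.
  have [_ tr] := tb_rep pp.
  rewrite -(@sum_lay l u w (fun q => firstb q ML m (pairsr m n) == [:: (u : nat, w : nat)])).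
  rewrite /unrank (@unrank_sum W l _ _ 0 [::] (fun q => firstb (rev q) ML m (pairsr m n) ==
     [:: (u : nat, w : nat)]) tr) //.
  by move=> k e; apply: ltnW; apply: bd.
transitivity (\sum_(R : profile m n | tinv P R == l) \sum_(p <- pairsr m n | blocks (prefl R) ML m p.1 p.2)
   (firstb (prefl R) ML m (pairsr m n) == [:: p])).
  transitivity (\sum_(u < m) \sum_(R : profile m n | tinv P R == l) \sum_(w < n | blocking R M u w)
     (firstb (prefl R) ML m (pairsr m n) == [:: (u : nat, w : nat)] : nat)).
    apply: eq_bigr => u _; rewrite (exchange_big_dep (fun R : profile m n => tinv P R == l)) //=; last first.
      by move=> w R _ /andP [].
    by apply: eq_bigr => R h; apply: eq_bigl => w; rewrite h.
  rewrite exchange_big; apply: eq_bigr => R _; rewrite [RHS]big_mkcond.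
  rewrite (sum_pairsr (fun p => if blocks (prefl R) ML m p.1 p.2 then
     firstb (prefl R) ML m (pairsr m n) == [:: p] : nat else 0)).
  by apply: eq_bigr => u _; rewrite big_mkcond; apply: eq_bigr => w _ /=; rewrite blocksE.
rewrite /Sstar -sum1_card big_mkcond [RHS]big_mkcond; apply: eq_bigr => R _.
rewrite inE swap_dist_eqE; case: eqP => //= _; rewrite firstbE.
rewrite (sum_first (fun p => blocks (prefl R) ML m p.1 p.2)) ?pairsr_uniq //.
have -> : has (fun p => blocks (prefl R) ML m p.1 p.2) (pairsr m n) = unstable R M; last by case: unstable.
apply/hasP/existsP => [[[u w]]|[u /existsP [w b]]].
  rewrite mem_pairsr /= => /andP [lu lw] b; exists (Ordinal lu); apply/existsP; exists (Ordinal lw).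
  by rewrite -blocksE.
by exists (u : nat, w : nat); rewrite ?mem_pairsr /= ?ltn_ord // blocksE.
Qed.
End Table.

(** An unstable profile enters [Sigma] once for each pair that blocks it. This bounds the rejection
    rate of the sampler. *)
Lemma Sigma_le l : Sigma l <= m * n * Sstar P l M.
Proof.
apply: (@leq_trans (\sum_(u < m) \sum_(w < n) Sstar P l M)); last first.
  by rewrite !sum_nat_const !card_ord mulnA.
apply: leq_sum => u _; apply: leq_sum => w _; apply: subset_leq_card; apply/subsetP => R.
rewrite !inE swap_dist_eqE => /andP [-> b] /=; apply/existsP; exists u; apply/existsP; exists w.
exact: b.
Qed.
End Instance.

(** * Number of options in the layers and the resulting bounds on the counts *)

Definition nopts (ls : seq layer) : nat := sumn (map size ls).

Lemma size_splits k : size (splits k) = k.+1.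
Proof. by rewrite splitsE size_rev size_map size_iota. Qed.

Lemma size_merged k x1 x2 first : size (merged k x1 x2 first) <= k.+1 * k.+2.
Proof.
rewrite mergedE size_rev size_allpairs_dep sumnE big_map.
apply: (@leq_trans (\sum_(pr <- splits k) k.+2)).
  by apply: leq_sum => pr _; rewrite size_filter (leq_trans (count_size _ _)) ?size_splits.
by rewrite big_const_seq count_predT iter_addn_0 size_splits mulnC.
Qed.

Lemma nopts_addlayers N hi items : forall k ls, k + size items <= N ->
  nopts (addlayers hi items (k, ls)).2 <= nopts ls + size items * N.
Proof.
rewrite /addlayers; elim: items => [|x items IH] k ls /= le; first by rewrite addn0.
apply: leq_trans (IH _ _ _) _; first by lia.
rewrite /nopts /= /mklayer foldl_rev_map cats0 size_rev size_map size_splits mulSn; lia.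
Qed.

(** Ordinary layers have at most [size L] options each. The joint layer over [k] middle elements has
    at most [k.+1 * k.+2], and [k.+2 <= size L]. *)
Lemma nopts_agentlay ls L c : nopts (agentlay ls L c) <= nopts ls + 2 * (size L * size L).
Proof.
case: c => [[w w']|]; last first.
  apply: leq_trans (@nopts_addlayers (size L) true L 0 ls (leqnn _)) _.
  by rewrite leq_add2l leq_pmull.
rewrite /agentlay; case: eqP => _; first by rewrite /nopts /= leq_addr.
have [EL _ _] := cutP w w' L; case: (cut w w' L) EL => pre rest /= EL.
case: rest EL => [//|x1 rest1] EL.
have [ER _ _] := cutP w w' rest1; case: (cut w w' rest1) ER => mid rest2 /= ER.
case: rest2 ER => [//|x2 post] ER.
have sL : size L = size pre + size mid + size post + 2.
  by rewrite EL size_cat size_rev /= ER size_cat size_rev /=; lia.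
have h1 := @nopts_addlayers (size L) true (rev mid) 0 ls.
have := size_addlayers1 true (rev mid) 0 ls.
rewrite size_rev in h1 *; case: addlayers h1 => k1 lay2 /= h1 E1.
have h2 := @nopts_addlayers (size L) true post k1.+2 (merged k1 x1 x2 (x1 == w) :: lay2).
have := size_addlayers1 true post k1.+2 (merged k1 x1 x2 (x1 == w) :: lay2).
case: addlayers h2 => k2 lay3 /= h2 E2.
have h3 := @nopts_addlayers (size L) false pre k2 lay3.
apply: leq_trans (h3 _) _; first by lia.
have {}h2 := h2 ltac:(lia); have {h3}h1 := h1 ltac:(lia).
have h4 := size_merged k1 x1 x2 (x1 == w).
have h2' : nopts lay3 <= size (merged k1 x1 x2 (x1 == w)) + nopts lay2 + size post * size L by exact: h2.
move: h1 h2' h4; move: (nopts lay3) (nopts lay2) (nopts ls) (size (merged _ _ _ _)) sL E1.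
move: (size L) (size pre) (size mid) (size post) => a b c d e f g h -> ->.
rewrite add0n; nia.
Qed.

Lemma nopts_layers (prefs : seq (seq nat)) mw u w pw pu :
  nopts (layers prefs mw u w pw pu) <= \sum_(L <- prefs) (1 + 2 * (size L * size L)).
Proof.
rewrite /layers; set f := (fun st L => _).
elim/last_ind: prefs => [|prefs L IH]; first by rewrite big_nil.
rewrite foldl_rcons -cats1 big_cat big_seq1 {1}/f /=.
apply: leq_trans (nopts_agentlay _ _ _) _; rewrite /nopts /= -/(nopts _); lia.
Qed.

Lemma sumn_drop k (s : seq nat) : sumn (drop k s) <= sumn s.
Proof. by rewrite -{2}(cat_take_drop k s) sumn_cat leq_addl. Qed.

Lemma nopts_lay m n (P : profile m n) M (p : nat * nat) :
  nopts (lay P M p) <= m * (1 + 2 * (n * n)) + n * (1 + 2 * (m * m)).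
Proof.
have H (T : Type) (f : T -> seq nat) s k : (forall v, size (f v) = k) ->
    \sum_(L <- map f s) (1 + 2 * (size L * size L)) = size s * (1 + 2 * (k * k)).
  move=> E; rewrite big_map (eq_bigr (fun _ => 1 + 2 * (k * k))) => [|v _]; last by rewrite E.
  by rewrite big_const_seq count_predT iter_addn_0 mulnC.
apply: leq_trans (nopts_layers _ _ _ _ _ _) _; rewrite big_cat /=.
rewrite (H _ _ _ n) => [|v]; last exact: size_plist.
rewrite (H _ _ _ m) => [|v]; last exact: size_plist.
by rewrite size_enum_ord size_enum_ord.
Qed.

Lemma cntc_lay m n (P : profile m n) M l p k e :
  cntc l (drop k (rev (lay P M p))) e <= 2 ^ (m * (1 + 2 * (n * n)) + n * (1 + 2 * (m * m))).
Proof.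
apply: leq_trans (cntc_le _ _ _) _; rewrite leq_exp2l // map_drop.
apply: leq_trans (sumn_drop _ _) _; rewrite map_rev sumn_rev; exact: nopts_lay.
Qed.

Lemma Sigma_bound m n (P : profile m n) (M : {set 'I_m * 'I_n}) l : is_matching M -> 
  Sigma P M l <= m * n * 2 ^ (m * (1 + 2 * (n * n)) + n * (1 + 2 * (m * m))).
Proof.
move=> mat; set B := 2 ^ _.
apply: (@leq_trans (\sum_(u < m) \sum_(w < n) B)).
  apply: leq_sum => u _; apply: leq_sum => w _; rewrite -cntc_ncnt //.
  by rewrite -[rev _]drop0; apply: cntc_lay.
by rewrite !sum_nat_const !card_ord mulnA.
Qed.

(** * Sampling *)

(** An expectation over uniform bit strings multiplied by [2 ^ n], which keeps the probabilistic
    estimates in the integers. *)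
Fixpoint sumB (n : nat) (g : seq bool -> int) : int :=
  if n is n'.+1 then (sumB n' (fun s => g (false :: s)) + sumB n' (fun s => g (true :: s)))%R
  else g [::].

Section SumB.
Local Open Scope ring_scope.
Implicit Types g h : seq bool -> int.

Lemma eq_sumB n g h : (forall s, size s = n -> g s = h s) -> sumB n g = sumB n h.
Proof. by elim: n g h => [|n IH] g h E /=; [apply: E|congr +%R; apply: IH => s sn; apply: E; rewrite /= sn]. Qed.
Lemma sumB_le n g h : (forall s, size s = n -> g s <= h s) -> sumB n g <= sumB n h.
Proof. by elim: n g h => [|n IH] g h E /=; [apply: E|apply: lerD; apply: IH => s sn; apply: E; rewrite /= sn]. Qed.
Lemma sumBD n g h : sumB n (fun s => g s + h s) = sumB n g + sumB n h.
Proof. by elim: n g h => [|n IH] g h //=; rewrite !IH; ring. Qed.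
Lemma sumBZ n c g : sumB n (fun s => c * g s) = c * sumB n g.
Proof. by elim: n g => [|n IH] g //=; rewrite !IH; ring. Qed.
Lemma sumBc n c : sumB n (fun _ => c) = c * (2 ^ n)%N%:Z.
Proof. by elim: n => [|n IH] /=; rewrite ?mulr1 // IH expnS mul2n -addnn PoszD; ring. Qed.
Lemma sumB_cat a b g : sumB (a + b) g = sumB a (fun s => sumB b (fun t => g (s ++ t))).
Proof. by elim: a g => [|a IH] g //=; rewrite !IH. Qed.
Lemma sumB_sum (I : finType) n (g : I -> seq bool -> int) :
  sumB n (fun s => \sum_i g i s) = \sum_i sumB n (g i).
Proof. by elim: n g => [|n IH] g //=; rewrite !IH -big_split. Qed.
Lemma sumB_pick n s0 (F : seq bool -> int) : size s0 = n ->
  sumB n (fun s => (s0 == s)%:R * F s) = F s0.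
Proof.
elim: n s0 F => [|n IH] [|b s0] F //=; first by rewrite mul1r.
move=> /eqP; rewrite eqSS => /eqP sn.
have C c : c != b -> sumB n (fun s => (b :: s0 == c :: s)%:R * F (c :: s)) = 0.
  move=> nc; rewrite (@eq_sumB _ _ (fun _ => 0)) ?sumBc ?mul0r // => s _.
  by rewrite eqseq_cons eq_sym (negbTE nc) mul0r.
have D : sumB n (fun s => (b :: s0 == b :: s)%:R * F (b :: s)) = F (b :: s0).
  by rewrite -(IH _ (fun s => F (b :: s)) sn); apply: eq_sumB => s _; rewrite eqseq_cons eqxx.
by case: b C D => C ->; rewrite C ?add0r ?addr0.
Qed.
End SumB.

Definition msb (v : nat) (s : seq bool) : nat := foldl (fun a (b : bool) => 2 * a + b) v s.

Lemma msbE v s : msb v s = v * 2 ^ size s + msb 0 s.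
Proof.
rewrite /msb; elim: s v => [|b s IH] v /=; first by rewrite muln1 addn0.
by rewrite IH [in RHS]IH expnS; nia.
Qed.

Lemma sumB_val W (F : nat -> int) : sumB W (fun s => F (msb 0 s)) = (\sum_(v < 2 ^ W) F v)%R.
Proof.
elim: W F => [|W IH] F; first by rewrite big_ord1.
have E (b : bool) s : msb 0 (b :: s) = b * 2 ^ size s + msb 0 s by rewrite -msbE.
rewrite expnS mul2n -addnn big_split_ord [LHS]/=; congr +%R.
  by rewrite -IH; apply: eq_sumB => s sn; congr F; apply: (E false s).
apply: etrans (IH (fun v => F (2 ^ W + v))); apply: eq_sumB => s sn; congr F; rewrite -sn -[2 ^ _]mul1n; apply: (E true s).
Qed.

Section Blocks.
Variables (W : nat) (h : seq bool -> bool).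
Let V : int := (2 ^ W)%N%:Z.
Fixpoint nhits (N : nat) (rho : seq bool) : nat :=
  if N is N'.+1 then h (take W rho) + nhits N' (drop W rho) else 0.
Definition hcount : int := sumB W (fun s => (h s)%:R%R).
Local Open Scope ring_scope.

Lemma hcount_ge0 : 0 <= hcount.
Proof.
rewrite /hcount; have := @sumB_le W (fun _ => 0) (fun s => (h s)%:R).
by rewrite sumBc mul0r; apply => s _; case: (h s).
Qed.

(** The terms [V * h - hcount] of the samples are centred and independent, so their second moments
    add without cross terms. The offset [c] carries the contribution of earlier samples through the
    induction. *)
Lemma second_moment N (c : int) :
  sumB (N * W) (fun rho => (c + V * (nhits N rho)%:Z - N%:Z * hcount) ^+ 2) =
  V ^+ N * (c ^+ 2 + N%:Z * (V * hcount - hcount ^+ 2)).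
Proof.
elim: N c => [|N IH] c; first by rewrite /= expr0; ring.
rewrite mulSn sumB_cat.
rewrite (@eq_sumB _ _ (fun s => V ^+ N * ((c + N%:Z * 0 + (V * (h s)%:R - hcount)) ^+ 2 + N%:Z * (V * hcount - hcount ^+ 2)))); last first.
  move=> s sW; rewrite mulr0 addr0 -IH; apply: eq_sumB => t _.
  rewrite /= take_size_cat // drop_size_cat // PoszD -[N.+1]addn1 PoszD.
  by case: (h s) => /=; ring.
rewrite (@eq_sumB _ _ (fun s => V ^+ N * (c ^+ 2 - 2 * c * hcount + hcount ^+ 2 + N%:Z * (V * hcount - hcount ^+ 2))
    + (V ^+ N * (2 * c * V + V ^+ 2 - 2 * V * hcount)) * (h s)%:R)); last first.
  by move=> s _; case: (h s) => /=; rewrite ?mulr1n ?mulr0n; ring.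
rewrite sumBD sumBc sumBZ -/hcount -/V -[N.+1]addn1 PoszD exprD.
by rewrite expr1; ring.
Qed.

(** Markov's inequality for the squared deviation, with [V * hcount - hcount ^+ 2] bounded by
    [V * hcount]. *)
Lemma chebyshev N (t c : int) (bad : seq bool -> bool) : 0 <= t -> 0 <= c ->
  (forall rho, bad rho -> t <= c * (V * (nhits N rho)%:Z - N%:Z * hcount) ^+ 2) ->
  t * sumB (N * W) (fun rho => (bad rho)%:R) <= c * (N%:Z * V ^+ N * (V * hcount)).
Proof.
move=> t0 c0 H; rewrite -sumBZ.
apply: (@le_trans _ _ (sumB (N * W) (fun rho => c * (0 + V * (nhits N rho)%:Z - N%:Z * hcount) ^+ 2))).
  apply: sumB_le => rho _; rewrite add0r.
  by case Eb: (bad rho); rewrite ?mulr1n ?mulr0n ?mulr1 ?mulr0 ?H // mulr_ge0 ?sqr_ge0.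
rewrite sumBZ second_moment expr0n /= add0r; apply: ler_wpM2l => //.
have -> : N%:Z * V ^+ N * (V * hcount) = V ^+ N * (N%:Z * (V * hcount)) by ring.
apply: ler_wpM2l; first by apply: exprn_ge0.
by apply: ler_wpM2l => //; rewrite lerBlDr lerDl sqr_ge0.
Qed.
End Blocks.

(** The [V] values lie between [V %/ g] and [V %/ g + 1] full periods, each of which contributes
    [S]. *)
Lemma sum_mod (f : nat -> nat) g V : 0 < g -> let S := \sum_(r < g) f r in
  (V * S <= g * S + g * \sum_(v < V) f (v %% g)) /\ (g * \sum_(v < V) f (v %% g) <= (V + g) * S).
Proof.
move=> g0 S.
have H q : \sum_(v < q * g) f (v %% g) = q * S.
  elim: q => [|q IH]; first by rewrite mul0n big_ord0.
  rewrite mulSn big_split_ord mulSn -IH; congr addn; apply: eq_bigr => r _ /=.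
    by rewrite modn_small.
  by rewrite modnDl.
have mono a b : a <= b -> \sum_(v < a) f (v %% g) <= \sum_(v < b) f (v %% g).
  move=> le; rewrite -!(big_mkord xpredT (fun v => f (v %% g))) [X in _ <= X](big_cat_nat _ _ (n := a)) //=.
  exact: leq_addr.
have dm := divn_eq V g; have lm := ltn_pmod V g0.
have h1 := mono (V %/ g * g) V ltac:(lia); have h2 := mono V ((V %/ g).+1 * g) ltac:(lia).
rewrite !H in h1 h2; move: h1 h2 dm lm; clear; clearbody S; move: (V %/ g) (V %% g) (\sum_(v < V) _).
by move=> q r A; split; nia.
Qed.

Section Sampling.
Variables (W sg : nat) (sig : seq bool).
Hypothesis ssig : size sig = W.
Hypothesis vsig : bval sig = sg.
Let z := pad W [::].

Lemma sample_take rho : W <= size rho ->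
  sample W sig z rho = (drop W rho, (sample W sig z (take W rho)).2).
Proof.
have H k : forall (r y : seq bool), k <= size r -> iter k (sampstep sig) (r, y) =
    (drop k r, (iter k (sampstep sig) (take k r, y)).2).
  elim: k => [|k IH] r y le; first by rewrite drop0.
  by case: r le => // b r le; rewrite !iterSr [sampstep sig (b :: r, y)]/= IH.
exact: H.
Qed.

Lemma sample_val s : 0 < sg -> 2 * sg <= 2 ^ W -> size s = W ->
  (sample W sig z s).2 = bits W (msb 0 s %% sg).
Proof.
move=> s0 sW sz1; rewrite /sample.
have H k : forall t v, k <= size t -> v < sg ->
    iter k (sampstep sig) (t, bits W v) = (drop k t, bits W (msb v (take k t) %% sg)).
  elim: k => [|k IH] t v le lv; first by rewrite drop0 take0 /= modn_small.
  case: t le => // b t le; rewrite iterSr.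
  have -> : sampstep sig (b :: t, bits W v) = (t, reduce (adder (bits W v) (bits W v) false b).2 sig) by [].
  have v1 : bval (bits W v) = v by rewrite bval_bits //; lia.
  have := @double_val (bits W v) b; rewrite size_bits v1 => h; have {}h := h ltac:(lia).
  set y := (adder _ _ _ _).2 in h *; have sy : size y = W by rewrite size_adder size_bits.
  (* From [v < sg] follows [2 * v + b < 2 * sg], so a single conditional subtraction reduces fully;
     [2 * sg <= 2 ^ W] keeps the doubled number within [W] bits. *)
  have -> : reduce y sig = bits W ((2 * v + b) %% sg).
    have [e1 e2] := @bsubP y sig ltac:(by rewrite sy ssig).
    have := size_bsub y sig; rewrite /reduce; case: (bsub y sig) e1 e2 => c d /= -> e2 sd.
    rewrite h vsig in e2 *; case: leqP => hh.
      have -> : (2 * v + b) %% sg = bval d.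
        by rewrite e2 // -{1}(subnK hh) modnDr modn_small //; lia.
      by rewrite -sy -sd bits_bval.
    by rewrite modn_small // -h -sy bits_bval.
  rewrite IH ?ltn_mod //=; congr (_, bits W _); rewrite msbE [in RHS]/msb /= -/(msb _ _) [in RHS]msbE.
  by rewrite -modnDml modnMml modnDml.
have -> : z = bits W 0 by rewrite -[z]bits_bval pad_val // size_pad.
by rewrite H ?sz1 //= -sz1 take_size.
Qed.

Variable h : seq bool -> bool.
Let one := pad W [:: true].
Let hh s := h (sample W sig z s).2.

Lemma loopP N : forall rho p q, 0 < W -> N * W <= size rho -> size p = W -> size q = W ->
  bval p + N * sg < 2 ^ W -> bval q + N < 2 ^ W ->
  let st := iter N (loopstep W sig z one h) (rho, (p, q)) in
  [/\ size st.2.1 = W, size st.2.2 = W, bval st.2.1 = bval p + sg * nhits W hh N rho &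
      bval st.2.2 = bval q + N].
Proof.
elim: N => [|N IH] rho p q W0 le sp sq bp bq; first by rewrite /= muln0 !addn0.
rewrite iterSr [loopstep _ _ _ _ _ _]/= sample_take; last by rewrite mulSn in le; lia.
have so : size one = W by rewrite size_pad.
have vo : bval one = 1 by rewrite pad_val.
have vq : bval (badd q one) = (bval q).+1 by rewrite badd_val ?so ?sq ?vo ?addn1 //; lia.
have sq' : size (badd q one) = W by rewrite size_badd.
have [||||s1 s2 v1 v2] := IH (drop W rho) (if hh (take W rho) then badd p sig else p) (badd q one) W0 _ _ sq'.
- by rewrite size_drop mulSn in le *; lia.
- by case: ifP => // _; rewrite size_badd.
- case: ifP => _; last by rewrite mulSn in bp; lia.
  by rewrite badd_val ?sp ?ssig ?vsig //; rewrite mulSn in bp; lia.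
- by rewrite vq; lia.
rewrite /hh in s1 s2 v1 v2 *; split=> //.
  rewrite v1 /=; case: (h _); rewrite ?add0n // badd_val ?sp ?ssig ?vsig //; rewrite mulSn in bp; lia.
by rewrite v2 vq; lia.
Qed.
End Sampling.

(* The sampler reduces a uniform [W]-bit number modulo [sg], so it is only nearly
   uniform: [|sg * hcount - 2^W * S| <= sg * S] accounts for the bias. *)
Lemma approx_count W N h (sg S x a b K s : nat) :
  let A := hcount W h in let V : int := (2 ^ W)%N in
  0 < a -> 0 < b -> 0 < s -> (sg%:Z * A <= V * S%:Z + sg%:Z * S%:Z)%R -> (V * S%:Z <= sg%:Z * A + sg%:Z * S%:Z)%R ->
  sg <= x * S -> 2 * (b * sg) <= 2 ^ W -> b <= a * K -> N = 64 * (s * (K * K)) -> 4 * x <= s -> 0 < K ->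
  (3 * (2 ^ (N * W))%N%:Z <= 4 * sumB (N * W) (fun rho =>
     ((b%:Z * `|sg%:Z * (nhits W h N rho)%:Z - N%:Z * S%:Z| <= a%:Z * (N%:Z * S%:Z))%R)%:R))%R.
Proof.
move=> A V a0 b0 s0 u1 u2 sx bs bK EN xs K0.
pose good (rho : seq bool) :=
  (b%:Z * `|sg%:Z * (nhits W h N rho)%:Z - N%:Z * S%:Z| <= a%:Z * (N%:Z * S%:Z))%R.
have A0 : (0 <= A)%R by apply: hcount_ge0.
have V0 : (0 < V)%R by rewrite /V ltz_nat expn_gt0.
have N0 : 0 < N by rewrite EN; lia.
have VN : ((2 ^ (N * W))%N%:Z = V ^+ N)%R by rewrite mulnC expnM /V -!natz natrX.
pose bad := sumB (N * W) (fun rho => ((~~ good rho)%:R)%R).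
have gb : (sumB (N * W) (fun rho => (good rho)%:R)%R + bad = V ^+ N)%R.
  rewrite /bad -sumBD (@eq_sumB _ _ (fun _ => 1%R)) ?sumBc ?mul1r ?VN // => rho _.
  by case: (good rho).
suff Hb : (32 * bad <= V ^+ N)%R.
  have : (3 * V ^+ N <= 4 * sumB (N * W) (fun rho => (good rho)%:R))%R.
    have V1 : (0 <= V ^+ N)%R by apply: exprn_ge0; apply: ltW.
    by move: gb Hb V1; clear; lia.
  by rewrite VN.
(* For [S = 0] the bound [sg <= x * S] forces [sg = 0], and the estimate is exact. Otherwise [S] can
   be cancelled below. *)
have [S0|S0] := posnP S.
  have -> : bad = 0%R; last by rewrite mulr0; apply: exprn_ge0; apply: ltW.
  rewrite /bad (@eq_sumB _ _ (fun _ => 0%R)) ?sumBc ?mul0r // => rho _.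
  have -> : good rho; last by [].
  rewrite /good; have sg0 : sg = 0 by move: sx; rewrite S0; lia.
  by rewrite S0 sg0 -[Posz 0]/(0%R : int) !mulr0 ?mul0r ?subrr ?normr0 ?mulr0.
have bad0 : (0 <= bad)%R.
  have := @sumB_le (N * W) (fun _ => 0%R) (fun rho => ((~~ good rho)%:R)%R).
  by rewrite sumBc mul0r; apply => rho _; case: (good rho).
have sgV : (2 * (b%:Z * sg%:Z) <= V)%R by rewrite /V -!PoszM lez_nat.
(* With [H] hits, error [E = sg * H - N * S] and bias [F = sg * A - V * S], the centred quantity
   [2 * b * sg * (V * H - N * A)] equals [2 * b * V * E - 2 * b * N * F]. In a bad outcome the first
   term exceeds [2 * a * N * V * S]; the second is at most half of that, by [|F| <= sg * S] and
   [2 * b * sg <= V]. Hence its square is at least [t]. *)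
set t := ((a%:Z * (N%:Z * (V * S%:Z))) ^+ 2)%R; set c := ((2 * (b%:Z * sg%:Z)) ^+ 2)%R.
have := @chebyshev W h N t c (fun rho => ~~ good rho) (sqr_ge0 _) (sqr_ge0 _).
rewrite -/bad -/A -/V => ch; have {}ch : (t * bad <= c * (N%:Z * V ^+ N * (V * A)))%R.
  apply: ch => rho; rewrite /good -ltNge /t /c -exprMn => lt.
  set H : int := ((nhits W h N rho)%:Z)%R in lt *.
  set y := (_ * (_ - _))%R; rewrite -[X in (_ <= X)%R]real_normK ?num_real //.
  set E := (sg%:Z * H - N%:Z * S%:Z)%R in lt; pose F := (sg%:Z * A - V * S%:Z)%R.
  have nF : (`|F| <= sg%:Z * S%:Z)%R by rewrite ler_norml /F; apply/andP; split; lra.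
  have yE : y = (2 * b%:Z * V * E - 2 * b%:Z * N%:Z * F)%R by rewrite /y /E /F; ring.
  have P0 (k : nat) : (0 <= k%:Z)%R by [].
  have n1 : (`|2 * b%:Z * V * E| = 2 * (V * (b%:Z * `|E|)))%R.
    by rewrite normrM ger0_norm ?mulr_ge0 // ?(ltW V0) //; ring.
  have n2 : (`|2 * b%:Z * N%:Z * F| = 2 * b%:Z * N%:Z * `|F|)%R.
    by rewrite normrM ger0_norm ?mulr_ge0.
  have tri := lerB_dist (2 * b%:Z * V * E)%R (2 * b%:Z * N%:Z * F)%R.
  rewrite -yE n1 n2 in tri.
  have m1 : (V * (a%:Z * (N%:Z * S%:Z)) <= V * (b%:Z * `|E|))%R.
    by apply: ler_wpM2l; [apply: ltW|apply: ltW].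
  have m2 : (2 * b%:Z * N%:Z * `|F| <= N%:Z * S%:Z * V)%R.
    apply: (@le_trans _ _ (2 * b%:Z * N%:Z * (sg%:Z * S%:Z))%R).
      by apply: ler_wpM2l; rewrite ?mulr_ge0.
    have -> : (2 * b%:Z * N%:Z * (sg%:Z * S%:Z) = N%:Z * S%:Z * (2 * (b%:Z * sg%:Z)))%R by ring.
    by apply: ler_wpM2l; rewrite ?mulr_ge0.
  have m3 : (N%:Z * S%:Z * V <= a%:Z * (N%:Z * (V * S%:Z)))%R.
    have -> : (a%:Z * (N%:Z * (V * S%:Z)) = a%:Z * (N%:Z * S%:Z * V))%R by ring.
    by rewrite ler_peMl ?mulr_ge0 // ?(ltW V0) // lez_nat.
  rewrite ler_pXn2r ?nnegrE ?mulr_ge0 ?(ltW V0) //.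
  have -> : (a%:Z * (N%:Z * (V * S%:Z)) = V * (a%:Z * (N%:Z * S%:Z)))%R by ring.
  move: tri m1 m2 m3.
  have -> : (a%:Z * (N%:Z * (V * S%:Z)) = V * (a%:Z * (N%:Z * S%:Z)))%R by ring.
  by clear; lra.
have P0 (k : nat) : (0 <= k%:Z)%R by [].
have Q0 (k : nat) : 0 < k -> (0 < k%:Z)%R by rewrite ltz_nat.
have VNp : (0 < V ^+ N)%R by apply: exprn_gt0.
(* The bias of the sampler costs at most a factor of two in the variance. *)
have sgA : (sg%:Z * A <= 2 * (V * S%:Z))%R.
  have : (sg%:Z * S%:Z <= V * S%:Z)%R.
    apply: ler_wpM2r => //; apply: le_trans sgV.
    by rewrite mulrA ler_peMl // -(PoszM 2) lez_nat; lia.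
  lra.
have r1 : (t * bad <= (N%:Z * (V ^+ 2 * S%:Z)) * (8 * (b%:Z ^+ 2 * (sg%:Z * V ^+ N))))%R.
  apply: le_trans ch _; rewrite /c.
  have -> : ((2 * (b%:Z * sg%:Z)) ^+ 2 * (N%:Z * V ^+ N * (V * A)) =
     (4 * b%:Z ^+ 2 * sg%:Z * N%:Z * V ^+ N * V) * (sg%:Z * A))%R by ring.
  apply: (@le_trans _ _ ((4 * b%:Z ^+ 2 * sg%:Z * N%:Z * V ^+ N * V) * (2 * (V * S%:Z)))%R).
    by apply: ler_wpM2l; rewrite // !mulr_ge0 // ?sqr_ge0 // ltW.
  by rewrite le_eqVlt; apply/orP; left; apply/eqP; ring.
have {r1}r2 : (a%:Z ^+ 2 * (N%:Z * S%:Z) * bad <= 8 * (b%:Z ^+ 2 * (sg%:Z * V ^+ N)))%R.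
  have p1 : (0 < N%:Z * (V ^+ 2 * S%:Z))%R by rewrite !mulr_gt0 ?exprn_gt0 ?Q0.
  rewrite -(ler_pM2l p1); apply: le_trans r1; rewrite /t.
  by rewrite le_eqVlt; apply/orP; left; apply/eqP; ring.
have r3 : (b%:Z ^+ 2 * (sg%:Z * V ^+ N) <= (a%:Z * K%:Z) ^+ 2 * ((x%:Z * S%:Z) * V ^+ N))%R.
  apply: ler_pM; rewrite ?sqr_ge0 ?mulr_ge0 // ?(ltW VNp) //.
    by rewrite ler_pXn2r ?nnegrE ?mulr_ge0 // -PoszM lez_nat.
  by apply: ler_wpM2r; rewrite ?(ltW VNp) // -PoszM lez_nat.
have p2 : (0 < a%:Z ^+ 2 * S%:Z * K%:Z ^+ 2)%R by rewrite !mulr_gt0 ?exprn_gt0 ?Q0.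
(* The frequency of bad outcomes is thus at most [x / (8 * s)], which [4 * x <= s] brings down to
   [1 / 32]. *)
have r4 : (64 * (s%:Z * bad) <= 8 * (x%:Z * V ^+ N))%R.
  rewrite -(ler_pM2l p2).
  have -> : (a%:Z ^+ 2 * S%:Z * K%:Z ^+ 2 * (64 * (s%:Z * bad)) = a%:Z ^+ 2 * (N%:Z * S%:Z) * bad)%R.
    by rewrite EN !PoszM; ring.
  apply: le_trans r2 _.
  have -> : (a%:Z ^+ 2 * S%:Z * K%:Z ^+ 2 * (8 * (x%:Z * V ^+ N)) =
     8 * ((a%:Z * K%:Z) ^+ 2 * ((x%:Z * S%:Z) * V ^+ N)))%R by ring.
  by apply: ler_wpM2l.
have r5 : (4 * x%:Z * V ^+ N <= s%:Z * V ^+ N)%R.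
  by apply: ler_wpM2r; [apply: ltW|rewrite -(PoszM 4) lez_nat].
rewrite -(ler_pM2l (Q0 _ s0)); move: r4 r5.
have -> : (s%:Z * (32 * bad) = 32 * (s%:Z * bad))%R by ring.
have -> : (4 * x%:Z * V ^+ N = 4 * (x%:Z * V ^+ N))%R by ring.
by clear; lra.
Qed.

(** The condition fixes [R] distinct coordinates and leaves the other [T - R] free; the tapes form a
    product family with one choice or two per coordinate. *)
Lemma card_rext T R (tau : nat -> nat) rho : injective tau -> (forall i, i < R -> tau i < T) ->
  size rho = R ->
  #|[set r : {ffun 'I_T -> bool} | [seq rext r (tau i) | i <- iota 0 R] == rho]| * 2 ^ R = 2 ^ T.
Proof.
move=> ti tT sr; set ts := map tau (iota 0 R).
have uts : uniq ts by rewrite map_inj_uniq // iota_uniq.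
have sts : size ts = R by rewrite size_map size_iota.
pose f (x : 'I_T) : pred bool := [pred b | (val x \in ts) ==> (b == nth false rho (index (val x) ts))].
have -> : #|[set r : {ffun 'I_T -> bool} | [seq rext r (tau i) | i <- iota 0 R] == rho]| = #|family f|.
  apply: eq_card => r; rewrite inE; apply/eqP/familyP => [E x|E].
    rewrite inE; apply/implyP => xt; have li : index (val x) ts < R by rewrite -sts index_mem.
    rewrite -E (nth_map 0) ?size_iota // nth_iota // add0n.
    have -> : tau (index (val x) ts) = val x.
      by rewrite -[RHS](nth_index 0 xt) (nth_map 0) ?size_iota // nth_iota.
    by rewrite /rext valK.
  apply: (@eq_from_nth _ false); rewrite size_map size_iota // => i li.
  rewrite (nth_map 0) ?size_iota // nth_iota // add0n /rext insubT ?tT // => l'.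
  have := E (Sub (tau i) l'); rewrite inE SubK => /implyP h.
  have ni : nth 0 ts i = tau i by rewrite (nth_map 0) ?size_iota // nth_iota.
  have /eqP -> := h ltac:(by rewrite -ni mem_nth ?sts).
  by rewrite -ni index_uniq ?sts.
rewrite card_family.
have -> : foldr muln 1 [seq #|f x| | x : 'I_T] = \prod_(x < T) (if val x \in ts then 1 else 2).
  rewrite foldrE big_image /=; apply: eq_bigr => x _.
  case: ifP => h; last by rewrite -card_bool; apply: eq_card => b; rewrite !inE h.
  by rewrite -(card1 (nth false rho (index (val x) ts))); apply: eq_card => b; rewrite !inE h.
rewrite -(big_mkord xpredT (fun x => if x \in ts then 1 else 2)) /index_iota subn0.
have -> s : \prod_(x <- s) (if x \in ts then 1 else 2) = 2 ^ count (fun x => x \notin ts) s.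
  by elim: s => [|y s IH]; rewrite ?big_nil // big_cons IH /=; case: (y \in ts); rewrite ?mul1n // -expnS.
rewrite -expnD; congr expn.
have := count_predC (mem ts) (iota 0 T); rewrite size_iota => Hc.
suff Hm : count (mem ts) (iota 0 T) = R by rewrite -[RHS]Hc Hm addnC.
rewrite -size_filter -sts; apply: perm_size; apply: uniq_perm => //.
  by rewrite filter_uniq ?iota_uniq.
move=> y; rewrite mem_filter mem_iota add0n /=; case yt: (y \in ts) => //=.
by move/mapP: yt => [i]; rewrite mem_iota => li ->; rewrite tT.
Qed.

(** Every string of [R] bits is read off equally many tapes, so probabilities over tapes and over
    the drawn bits agree. *)
Lemma ffun_count T R (tau : nat -> nat) (F : seq bool -> bool) : injective tau ->
  (forall i, i < R -> tau i < T) ->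
  (#|[set r : {ffun 'I_T -> bool} | F [seq rext r (tau i) | i <- iota 0 R]]|%:Z * (2 ^ R)%N%:Z =
   (2 ^ T)%N%:Z * sumB R (fun rho => (F rho)%:R))%R.
Proof.
move=> ti tT.
pose g (r : {ffun 'I_T -> bool}) := [seq rext r (tau i) | i <- iota 0 R].
have -> : (#|[set r | F (g r)]|%:Z = \sum_(r : {ffun 'I_T -> bool}) (F (g r))%:R)%R.
  rewrite -sum1_card -natr_sum natz; congr Posz; rewrite big_mkcond; apply: eq_bigr => r _.
  by rewrite inE; case: (F _).
rewrite (eq_bigr (fun r => sumB R (fun s => (g r == s)%:R * (F s)%:R)%R)) => [|r _]; last first.
  by rewrite sumB_pick // size_map size_iota.
rewrite -sumB_sum -sumBZ mulrC -sumBZ; apply: eq_sumB => s ss.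
rewrite -mulr_suml mulrA; congr *%R; rewrite -natr_sum -(card_rext ti tT ss) mulrC PoszM; congr *%R.
rewrite natz -sum1_card; congr Posz; rewrite [RHS]big_mkcond; apply: eq_bigr => r _.
by rewrite inE -/(g r); case: eqP.
Qed.

(** * Reading the input and writing the output *)

Lemma bitsE k x : bits k x = [seq odd (x %/ 2 ^ i) | i <- iota 0 k].
Proof.
elim: k x => //= k IH x; rewrite expn0 divn1 IH -[1]/(1 + 0) iotaDl -map_comp; congr cons.
by apply: eq_map => i /=; rewrite -divn2 -divnMA expnS.
Qed.

Definition nbits (x : nat) : seq bool := bits (trunc_log 2 x).+1 x.

Lemma nbits_val x : bval (nbits x) = x.
Proof. by rewrite bval_bits // trunc_log_ltn. Qed.

Lemma binE x : bin x = rev (map bsym (nbits x)).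
Proof.
rewrite /bin /nbits; set k := _.+1; apply: (@eq_from_nth _ s0).
  by rewrite size_rev !size_map size_iota size_bits.
rewrite size_map size_iota => i li; rewrite (nth_map 0) ?size_iota // nth_iota // add0n.
rewrite nth_rev ?size_map ?size_bits // (nth_map false) ?size_bits; last by lia.
rewrite bitsE (nth_map 0) ?size_iota; last by lia.
rewrite nth_iota; last by lia.
by rewrite add0n /bsym; congr (if odd (x %/ 2 ^ _) then _ else _); rewrite /k; lia.
Qed.

Lemma parse_bits t cur acc : foldl parsestep (cur, acc) (map bsym t) = (rev t ++ cur, acc).
Proof.
have [e0 [e1 _]] := symE.
elim: t cur => //= b t IH cur; rewrite rev_cons cat_rcons -IH /parsestep /bsym.
by case: b; rewrite ?e0 ?e1.
Qed.

Lemma parse_enc s : parse_nums (enc_nats s) = map nbits s.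
Proof.
have [_ [_ [e2 _]]] := symE.
rewrite /parse_nums /enc_nats.
have H acc : foldl parsestep ([::], acc) (flatten (map enc_nat s)) = ([::], rev (map nbits s) ++ acc).
  elim: s acc => // k s IH acc; rewrite map_cons -[flatten _]/(enc_nat k ++ flatten (map enc_nat s)).
  rewrite foldl_cat /enc_nat foldl_cat binE.
  rewrite -map_rev parse_bits revK cats0 [foldl _ _ [:: _]]/= {2}/parsestep e2 IH.
  by rewrite map_cons rev_cons cat_rcons.
by rewrite H cats0 revK.
Qed.

Lemma size_enc_nats s : size (enc_nats s) = \sum_(k <- s) (size (nbits k)).+1.
Proof.
rewrite /enc_nats size_flatten sumnE !big_map; apply: eq_bigr => k _.
by rewrite /enc_nat size_cat binE size_rev size_map addn1.
Qed.

Lemma size_nbits_le k (s : seq nat) : k \in s -> size (nbits k) < size (enc_nats s).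
Proof. by move=> ks; rewrite size_enc_nats (big_rem k) //= leq_addr. Qed.

Lemma enc_nats_ge s : 2 * size s <= size (enc_nats s).
Proof.
rewrite size_enc_nats -[X in X <= _]iter_addn_0 -count_predT -big_const_seq; apply: leq_sum => k _.
by rewrite /nbits size_bits.
Qed.

Lemma enc_nats_ne s : sblank \notin enc_nats s.
Proof.
have [e0 [e1 [e2 e3]]] := symE.
apply/flattenP => -[_ /mapP [k _ ->]]; rewrite mem_cat binE mem_rev mem_seq1 => /orP [/mapP [[] _]|/eqP] /(congr1 (@nat_of_ord 4)).
all: by rewrite ?e0 ?e1 ?e2 e3.
Qed.

Lemma tounaryE cap x : tounary cap x = minn cap (bval x).
Proof.
rewrite /tounary; elim: x => [|b x IH] /=; first by rewrite minn0.
by rewrite rev_cons foldl_rcons IH; lia.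
Qed.

Section Kfac.
Variables (W a b : nat) (aa bb : seq bool).
Hypotheses (sa : size aa = W) (sb : size bb = W) (va : bval aa = a) (vb : bval bb = b).
Hypotheses (a0 : 0 < a) (bW : 2 * b < 2 ^ W).

(** The factor doubles only while [a * K <= b], so once it has left 1 it satisfies [a * K <= 2 * b];
    if doubling has not stopped, it is still [2 ^ n]. The bound [2 * b < 2 ^ W] excludes
    overflow. *)
Lemma kiterP n : let st := iter n (kstep bb) (aa, 1) in
  [/\ size st.1 = W, bval st.1 = a * st.2, 0 < st.2, (st.2 == 1) || (a * st.2 <= 2 * b) &
      (b < a * st.2) || (st.2 == 2 ^ n)].
Proof.
elim: n => [|n [s1 v1 p1 h1 h2]]; first by rewrite /= muln1 orbT.
rewrite iterS; move: (iter n _ _) s1 v1 p1 h1 h2 => [y k] /= s1 v1 p1 h1 h2.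
have Eb : (bsub bb y).1 = (a * k <= b).
  by have [-> _] := @bsubP bb y ltac:(by rewrite sb s1); rewrite v1 vb.
have -> : kstep bb (y, k) = if a * k <= b then (badd y y, k + k) else (y, k) by rewrite /kstep /= Eb.
case: (leqP (a * k) b) => h /=; last by split=> //; rewrite h.
have h2' : k = 2 ^ n by move: h2; rewrite ltnNge h => /eqP.
rewrite size_badd badd_val ?s1 ?v1 //; last by lia.
split=> //; first by lia.
- by lia.
- by apply/orP; right; lia.
by apply/orP; right; rewrite h2' expnS; lia.
Qed.

Lemma kfacP s : b < 2 ^ s -> let K := kfac s aa bb in [/\ 0 < K, b < a * K & K <= 2 * (b %/ a) + 1].
Proof.
move=> bs; rewrite /kfac; have [_ _ p1 h1 h2] := kiterP s.
move: (iter s _ _).2 p1 h1 h2 => K p1 h1 h2; split=> //.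
  by case/orP: h2 => // /eqP ->; apply: leq_trans bs _; rewrite leq_pmull.
case/orP: h1 => [/eqP ->|h1]; first by rewrite leq_addl.
have dm := divn_eq b a; have lm := ltn_pmod b a0; nia.
Qed.

Lemma kiter_le n : (iter n (kstep bb) (aa, 1)).2 <= 2 * (b %/ a) + 1.
Proof.
have [_ _ p1 h1 _] := kiterP n; move: (iter n _ _).2 p1 h1 => K p1 h1.
case/orP: h1 => [/eqP ->|h1]; first by rewrite leq_addl.
have dm := divn_eq b a; have lm := ltn_pmod b a0; nia.
Qed.
End Kfac.

Lemma iter_groupstep n (gs : seq (seq nat)) (rest : seq nat) acc : all (fun g => size g == n) gs ->
  iter (size gs) (groupstep n) (flatten gs ++ rest, acc) = (rest, rev gs ++ acc).
Proof.
elim: gs acc => //= g gs IH acc /andP [/eqP sg ag]; rewrite -iterS iterSr /groupstep /= -catA.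
by rewrite take_size_cat // drop_size_cat // IH // rev_cons cat_rcons.
Qed.

Lemma pairupE (s : seq (nat * nat)) : pairup (flatten [seq [:: p.1; p.2] | p <- s]) = rev s.
Proof.
rewrite /pairup; set f := (fun st x => _).
have H acc : (foldl f ([::], acc) (flatten [seq [:: p.1; p.2] | p <- s])).2 = rev s ++ acc.
  by elim: s acc => //= -[u w] s IH acc; rewrite IH rev_cons cat_rcons.
by rewrite H cats0.
Qed.

Lemma outword_ne p q : sblank \notin outword p q.
Proof.
have [e0 [e1 [e2 e3]]] := symE.
have H t : sblank \notin rev (map bsym t).
  by rewrite mem_rev; apply/mapP => -[[] _ /(congr1 (@nat_of_ord 4))]; rewrite ?e0 ?e1 e3.
have ne : sblank != ssep by apply/eqP => /(congr1 (@nat_of_ord 4)); rewrite e2 e3.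
by rewrite /outword mem_cat inE mem_cat inE !negb_or !H ne.
Qed.

Lemma bits_val_rev t : bits_val (rev (map bsym t)) = bval t.
Proof.
have [e0 [e1 _]] := symE.
rewrite /bits_val; elim: t => //= b t IH; rewrite rev_cons foldl_rcons IH /bsym.
by case: b; rewrite ?e0 ?e1; lia.
Qed.

Lemma decode_outword p q : decode (outword p q) = Some (bval p, bval q).
Proof.
have [e0 [e1 [e2 e3]]] := symE.
have H t : ssep \notin rev (map bsym t).
  by rewrite mem_rev; apply/mapP => -[[] _ /(congr1 (@nat_of_ord 4))]; rewrite ?e0 ?e1 e2.
have I t u : index ssep (rev (map bsym t) ++ ssep :: u) = size t.
  by rewrite index_cat (negbTE (H t)) /= eqxx addn0 size_rev size_map.
have B t : is_bits (rev (map bsym t)).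
  by rewrite /is_bits all_rev all_map; apply/allP => -[] _ /=; rewrite ?e0 ?e1.
have st t : size (rev (map bsym t)) = size t by rewrite size_rev size_map.
rewrite /decode /outword I -cat_rcons.
rewrite (drop_size_cat _ (_ : size (rcons _ _) = (size p).+1)); last by rewrite size_rcons st.
rewrite I cat_rcons !take_size_cat ?st // !B !bits_val_rev !size_cat /= !size_cat !st addn1 eqxx.
by rewrite -[size p < _]/(_ <= _) addnS ltnS leq_addr.
Qed.

(** * The algorithm approximates the count *)

Lemma runalg_spec W N m l prefs M rho pairs sg : let z := pad W [::] in
  let ii := insts prefs M m z (iter l (cons z) [:: pad W [:: true]]) pairs in
  let sig := sumcount z ii in
  let h s := hit ii M m pairs (sample W sig z s).2 in
  0 < W -> size sig = W -> bval sig = sg -> N * sg < 2 ^ W -> N < 2 ^ W -> N * W <= size rho ->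
  exists p q, [/\ runalg W N m l prefs M rho pairs = outword p q, size p = W, size q = W,
    bval p = sg * nhits W h N rho & bval q = N].
Proof.
move=> z ii sig h W0 ss vs b1 b2 sr.
have vz : bval z = 0 by rewrite pad_val.
have sz0 : size z = W by rewrite size_pad.
have [||||s1 s2 v1 v2] := @loopP W sg sig ss vs (hit ii M m pairs) N rho z z W0 sr.
- exact: sz0.
- exact: sz0.
- by rewrite vz.
- by rewrite vz.
by rewrite vz !add0n in v1 v2; exists (iter N (loopstep W sig z (pad W [:: true]) (hit ii M m pairs)) (rho, (z, z))).2.1,
  (iter N (loopstep W sig z (pad W [:: true]) (hit ii M m pairs)) (rho, (z, z))).2.2.
Qed.

Lemma hcount_mod W sg (f : nat -> bool) h : (forall s, size s = W -> h s = f (msb 0 s %% sg)) -> 0 < sg ->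
  let S : int := (\sum_(r < sg) f r)%N in let V : int := (2 ^ W)%N in
  (sg%:Z * hcount W h <= V * S + sg%:Z * S)%R /\ (V * S <= sg%:Z * hcount W h + sg%:Z * S)%R.
Proof.
move=> E s0 S V.
have -> : hcount W h = (\sum_(v < 2 ^ W) f (v %% sg))%N.
  rewrite /hcount (@eq_sumB _ _ (fun s => ((f (msb 0 s %% sg)%N)%:R)%R)) => [|s ss]; last by rewrite E.
  by rewrite (sumB_val W (fun v => ((f (v %% sg)%N)%:R)%R)) -natr_sum natz.
have [h1 h2] := @sum_mod (fun r => f r) sg (2 ^ W) s0.
by rewrite /V /S -!PoszM -!PoszD !lez_nat -mulnDl addnC; split=> //; rewrite addnC.
Qed.

Lemma Sstar_nil m n (P : profile m n) l M : m * n = 0 -> Sstar P l M = 0.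
Proof.
move=> mn; apply/eqP; rewrite cards_eq0; apply/eqP/setP => R; rewrite !inE.
apply/negP => /andP [_ /existsP [u /existsP [w _]]].
have : 0 < m * n by rewrite muln_gt0 (leq_ltn_trans _ (ltn_ord u)) ?(leq_ltn_trans _ (ltn_ord w)).
by rewrite mn.
Qed.

(** * The parameters derived from an encoded instance and the correctness of the algorithm *)

Section Encoded.
Variables (m n : nat) (P : profile m n) (l : nat) (M : {set 'I_m * 'I_n}) (a b : nat).
Hypotheses (matM : is_matching M) (a0 : 0 < a) (b0 : 0 < b).
Let x := encode P l M a b.
Let s := size x.
Let W := getW x.
Let N := getN x.
Let K := kof s W (parse_nums x).
Let ML := [seq (p.1 : nat, p.2 : nat) | p : 'I_m * 'I_n <- enum M].
Let rest := flatten [seq plist (P.1 u) | u <- enum 'I_m] ++ flatten [seq plist (P.2 w) | w <- enum 'I_n]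
  ++ #|M| :: flatten [seq [:: p.1; p.2] | p <- ML].
Let nums := [:: m, n, l, a, b & rest].

Lemma encodeE : x = enc_nats nums.
Proof.
rewrite /x /encode; congr enc_nats; rewrite /nums /rest /=; do ?[congr cons].
by rewrite /ML -map_comp.
Qed.

Lemma parseE : parse_nums x = map nbits nums.
Proof. by rewrite encodeE parse_enc. Qed.

Lemma size_flat (T : Type) k (f : T -> seq nat) t : (forall v, size (f v) = k) ->
  size (flatten (map f t)) = size t * k.
Proof. by move=> E; elim: t => //= v t IH; rewrite size_cat E IH. Qed.

(** The input holds at least [6 + 2 * (m * n)] numbers, each written with at least one bit and a
    separator. This yields the inequality [4 * x <= s] of [approx_count] for [x = m * n]. *)
Lemma s_ge : 12 + 4 * (m * n) <= s.
Proof.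
rewrite /s encodeE; apply: leq_trans (enc_nats_ge _); rewrite /nums /= /rest !size_cat /=.
rewrite (size_flat _ (fun u => size_plist (P.1 u))) (size_flat _ (fun w => size_plist (P.2 w))).
by rewrite size_enum_ord size_enum_ord; lia.
Qed.

Lemma K_facts : [/\ 0 < K, b < a * K & K <= 2 * (b %/ a) + 1] /\ 2 * b < 2 ^ s /\
  forall k, (iter k (kstep (pad W (nth [::] (parse_nums x) 4)))
     (pad W (nth [::] (parse_nums x) 3), 1)).2 <= 2 * (b %/ a) + 1.
Proof.
have sg := s_ge; have sW : s <= W by rewrite /W /getW -/s leq_pmull //; lia.
rewrite /K /kof parseE /=.
have la : size (nbits a) < s by rewrite /s encodeE; apply: size_nbits_le; rewrite !inE eqxx !orbT.
have lb : size (nbits b) < s by rewrite /s encodeE; apply: size_nbits_le; rewrite !inE eqxx !orbT.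
have lb2 : 2 * b < 2 ^ s.
  have := bval_lt (nbits b); rewrite nbits_val => h.
  apply: (@leq_trans (2 * 2 ^ size (nbits b))); first by rewrite ltn_mul2l.
  by rewrite -expnS leq_exp2l.
have lbW : 2 * b < 2 ^ W by apply: leq_trans lb2 _; rewrite leq_exp2l.
have sa : size (nbits a) <= W by lia.
have sb : size (nbits b) <= W by lia.
have va : bval (pad W (nbits a)) = a by rewrite pad_val // nbits_val.
have vb : bval (pad W (nbits b)) = b by rewrite pad_val // nbits_val.
split; last split=> // k; last exact: (kiter_le (size_pad _ _) (size_pad _ _) va vb).
by apply: (kfacP (size_pad _ _) (size_pad _ _) va vb) => //; lia.
Qed.

Lemma NE : N = 64 * (s * (K * K)). Proof. by []. Qed.

Lemma N_lt : N <= 2 ^ (6 + 3 * s).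
Proof.
have [[K0 _ K1] [b2 _]] := K_facts.
have sg := s_ge; have s2 : s < 2 ^ s by apply: ltn_expl.
have K2 : K <= 2 ^ s.
  apply: leq_trans K1 _; have : b %/ a <= b by apply: leq_div.
  lia.
rewrite NE expnD -[3]/(1 + 1 + 1) !mulnDl !mul1n !expnD leq_mul // -mulnA.
by apply: leq_mul; [apply: ltnW|apply: leq_mul].
Qed.

(** The first factor bounds the number of samples by [N_lt], and [2 ^ e] is used to bound [Sigma].
    With [12 + 4 * (m * n) <= s], the square [s * s] exceeds the sum of the exponents. *)
Lemma pow_split e : e <= 2 * (m * n) * (m * n) + 4 * (m * n) + 1 -> 2 ^ (6 + 3 * s) * 2 ^ e < 2 ^ W.
Proof.
move=> le; rewrite -expnD ltn_exp2l // /W /getW -/s.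
have := s_ge; move: (m * n) le => y le sg; nia.
Qed.

Let l' := tounary W (nbits l).

(** All distances are at most [m * n * (m + n)], which is below [W] for nonempty sides; so if the
    cap takes effect, both counts vanish. *)
Lemma Sstar_l' : Sstar P l' M = Sstar P l M.
Proof.
rewrite /l' tounaryE nbits_val; case: (leqP W l) => h; last by [].
have H k : W <= k -> Sstar P k M = 0.
  move=> lk; have [y0|y0] := posnP (m * n); first exact: Sstar_nil.
  apply/eqP; rewrite cards_eq0; apply/eqP/setP => R; rewrite !inE swap_dist_eqE.
  case: eqP => // E; have := tinv_le P R; rewrite E => lt.
  have : W <= m * (n * n) + n * (m * m) by apply: leq_trans lk lt.
  rewrite /W /getW -/s; have := s_ge.
  have : m + n <= m * n + 1 by move: y0; rewrite muln_gt0 => /andP []; clear; nia.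
  have -> : m * (n * n) + n * (m * m) = (m * n) * (m + n) by lia.
  by move: (m * n) (m + n) => y k'; clear; nia.
by rewrite !H.
Qed.

Lemma alg_correct : exists (sg : nat) (h : seq bool -> bool),
  [/\ 0 < N, (forall rho, size rho = N * W -> exists p q,
        [/\ alg x rho = outword p q, bval p = sg * nhits W h N rho & bval q = N]) &
      (3 * (2 ^ (N * W))%N%:Z <= 4 * sumB (N * W) (fun rho =>
        ((b%:Z * `|sg%:Z * (nhits W h N rho)%:Z - N%:Z * (Sstar P l M)%:Z| <=
          a%:Z * (N%:Z * (Sstar P l M)%:Z))%R)%:R))%R].
Proof.
have sge := s_ge; have [[K0 bK K1] [b2 _]] := K_facts.
have W0 : 0 < W by rewrite /W /getW -/s muln_gt0; lia.
have N0 : 0 < N by rewrite NE !muln_gt0 /= K0; lia.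
have NW : N < 2 ^ W.
  by apply: leq_ltn_trans N_lt _; have := @pow_split 0 isT; rewrite muln1.
have us0 : map (tounary s) (parse_nums x) = map (minn s) nums.
  by rewrite parseE -map_comp; apply: eq_map => k; rewrite /= tounaryE nbits_val.
have El : tounary (getW x) (nth [::] (parse_nums x) 2) = l' by rewrite parseE.
(* If one side is empty, the input lists no preferences and the other side may be larger than the
   input is long, so that its capped size is wrong. There is then no pair at all, and estimate and
   count are both 0. *)
have [y0|y0] := posnP (m * n).
  pose z := pad W [::].
  have pn : pairsr (minn s m) (minn s n) = [::].
    apply: size0nil; apply/eqP; rewrite size_eq0; apply/eqP.
    case E: (pairsr _ _) => [//|p t]; have := mem_head p t; rewrite -E mem_pairsr.
    by move: y0 => /eqP; rewrite muln_eq0 => /orP [] /eqP ->; rewrite minn0 ltn0 ?andbF.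
  exists 0, (fun s => false); split=> //; last first.
    rewrite Sstar_nil //; apply: (@approx_count W N _ 0 0 0 a b K s) => //; rewrite ?mulr0 ?mul0r ?addr0 ?muln0 //; lia.
  move=> rho sr; rewrite /alg us0 El pn.
  set m' := nth 0 _ 0; set pr := rev _; set Mx := pairup _.
  have [|||||p [q [E _ _ vp vq]]] := @runalg_spec W N m' l' pr Mx rho [::] 0 W0.
  - by rewrite /= size_pad.
  - by rewrite /= pad_val.
  - by rewrite muln0 expn_gt0.
  - exact: NW.
  - by rewrite sr.
  by exists p, q; split=> //; rewrite vp mul0n.
have [m0 n0] : 0 < m /\ 0 < n by move: y0; rewrite muln_gt0 => /andP.
have mn1 : m + n <= m * n + 1 by move: m0 n0; clear; nia.
set e := m * (1 + 2 * (n * n)) + n * (1 + 2 * (m * m)).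
have le : e + m * n <= 2 * (m * n) * (m * n) + 4 * (m * n) + 1.
  have -> : e = (m + n) + 2 * (m * n) * (m + n) by rewrite /e; lia.
  by move: (m * n) (m + n) mn1; clear => y k; nia.
pose sg := Sigma P M l'.
have sg_e : sg <= 2 ^ (e + m * n).
  apply: leq_trans (Sigma_bound _ _ matM) _; rewrite -/e expnD mulnC leq_mul2l.
  by rewrite (ltnW (ltn_expl _ _)) // orbT.
have psg k : k <= 2 ^ (6 + 3 * s) -> k * sg < 2 ^ W.
  by move=> kl; apply: leq_ltn_trans (pow_split le); apply: leq_mul.
have bd p : p \in pairsr m n -> forall k e', cntc l' (drop k (rev (lay P M p))) e' < 2 ^ W.
  move=> _ k e'; apply: leq_ltn_trans (cntc_lay _ _ _ _ _ _) _; rewrite -/e.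
  apply: leq_ltn_trans (pow_split le); rewrite -[X in X <= _]mul1n leq_mul ?expn_gt0 //.
  by rewrite leq_exp2l // leq_addr.
have sgW : sg < 2 ^ W by have := psg 1; rewrite mul1n; apply; rewrite expn_gt0.
pose z := pad W [::].
pose ii := insts (prefl P) (rev ML) m z (iter l' (cons z) [:: pad W [:: true]]) (pairsr m n).
pose sig := sumcount z ii.
have [ssig vsig] : size sig = W /\ bval sig = sg := sumcount_val matM bd W0 sgW.
have shit := sum_hit matM bd W0 sgW.
pose h t := hit ii (rev ML) m (pairsr m n) (sample W sig z t).2.
exists sg, h; split=> //; last first.
  rewrite -Sstar_l'; have [hc1 hc2] : (sg%:Z * hcount W h <= (2 ^ W)%N%:Z * (Sstar P l' M)%:Z + sg%:Z * (Sstar P l' M)%:Z)%R /\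
      ((2 ^ W)%N%:Z * (Sstar P l' M)%:Z <= sg%:Z * hcount W h + sg%:Z * (Sstar P l' M)%:Z)%R.
    have [sg0|sg0] := posnP sg.
      have -> : Sstar P l' M = 0 by rewrite -shit -/sg sg0 big_ord0.
      by rewrite sg0 !mul0r !mulr0.
    rewrite -shit; apply: (@hcount_mod W sg (fun r => hit ii (rev ML) m (pairsr m n) (bits W r)) h) => // t st; rewrite /h (sample_val ssig vsig) //.
    by apply: ltnW; apply: (psg 2); rewrite -[2]/(2 ^ 1) leq_exp2l.
  apply: (@approx_count W N h sg (Sstar P l' M) (m * n) a b K s) => //; try by lia.
  - exact: Sigma_le.
  - rewrite mulnA; apply: ltnW; apply: psg; apply: leq_trans (ltnW b2) _; rewrite leq_exp2l //; lia.
move=> rho sr; rewrite /alg us0 El.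
have lm : m <= s by have := leq_pmulr m n0; lia.
have ln : n <= s by have := leq_pmull n m0; lia.
(* With both sides nonempty, [m], [n] and [m * n] are at most [s], so the cap changes no preference,
   no pair and not the number of pairs. *)
have Er : map (minn s) rest = rest.
  apply: map_id_in => k; rewrite /rest !mem_cat inE => hk; apply/minn_idPr.
  have {hk} [hk|[hk|[->|hk]]] : k \in flatten [seq plist (P.1 u) | u <- enum 'I_m] \/
      k \in flatten [seq plist (P.2 w) | w <- enum 'I_n] \/ k = #|M| \/
      k \in flatten [seq [:: p.1; p.2] | p <- ML].
    by case/or4P: hk => [hk|hk|/eqP hk|hk]; tauto.
  - by move/flattenP: hk => [_ /mapP [u _ ->]]; rewrite mem_plist; lia.
  - by move/flattenP: hk => [_ /mapP [w _ ->]]; rewrite mem_plist; lia.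
  - by apply: leq_trans (max_card _) _; rewrite card_prod !card_ord; lia.
  move/flattenP: hk => [_ /mapP [_ /mapP [[u w] _ ->] ->]] /=.
  by rewrite !inE => /orP [] /eqP ->; have := ltn_ord u; have := ltn_ord w; lia.
rewrite [nth 0 _ 0]/= [nth 0 _ 1]/= (minn_idPr lm) (minn_idPr ln) [drop 5 _]/= drop0 Er.
have [|||p [q [E _ _ vp vq]]] := @runalg_spec W N m l' (prefl P) (rev ML) rho (pairsr m n) sg W0 ssig vsig.
- by apply: psg; apply: N_lt.
- exact: NW.
- by rewrite sr.
exists p, q; split=> //; rewrite -E.
have g1 := @iter_groupstep n [seq plist (P.1 u) | u <- enum 'I_m]
  (flatten [seq plist (P.2 w) | w <- enum 'I_n] ++ #|M| :: flatten [seq [:: p.1; p.2] | p <- ML]) [::].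
have g2 := @iter_groupstep m [seq plist (P.2 w) | w <- enum 'I_n]
  (#|M| :: flatten [seq [:: p.1; p.2] | p <- ML]) (rev [seq plist (P.1 u) | u <- enum 'I_m]).
rewrite size_map size_enum_ord cats0 in g1; rewrite size_map size_enum_ord in g2.
rewrite /rest g1; last by apply/allP => _ /mapP [u _ ->]; rewrite size_plist.
rewrite g2; last by apply/allP => _ /mapP [u _ ->]; rewrite size_plist.
by rewrite [behead _]/= pairupE rev_cat !revK.
Qed.
End Encoded.

Lemma ratio_le (p q S a b : nat) : 0 < q -> 0 < b ->
  (b%:Z * `|p%:Z - q%:Z * S%:Z| <= a%:Z * (q%:Z * S%:Z))%R ->
  (`|p%:Q / q%:Q - S%:Q| <= a%:Q / b%:Q * S%:Q)%R.
Proof.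
move=> q0 b0 le.
have q1 : (0 < q%:Q)%R by rewrite ltr0z ltz_nat.
have b1 : (0 < b%:Q)%R by rewrite ltr0z ltz_nat.
have -> : (p%:Q / q%:Q - S%:Q = (p%:Q - q%:Q * S%:Q) / q%:Q)%R by field; rewrite lt0r_neq0.
rewrite normrM normfV (gtr0_norm q1) ler_pdivrMr //.
have -> : (a%:Q / b%:Q * S%:Q * q%:Q = a%:Q * (q%:Q * S%:Q) / b%:Q)%R by field; rewrite lt0r_neq0.
rewrite ler_pdivlMr // mulrC.
by rewrite -(ler_int rat) !intrM intr_norm intrB !intrM in le.
Qed.

Lemma read_out_word (A : RTM) (st : 'I_(nstates A).+1) (tp : int -> sym) (w : seq sym) L :
  sblank \notin w -> size w < L -> (forall i : nat, tp (Posz i) = nth sblank w i) ->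
  read_out (@Config A st 0%R tp) L = w.
Proof.
move=> nw lt H; rewrite /read_out /=.
have -> : [seq tp (0 + i%:Z)%R | i <- iota 0 L] = w ++ nseq (L - size w) sblank.
  apply: (@eq_from_nth _ sblank); rewrite size_map size_iota ?size_cat ?size_nseq; first by lia.
  move=> i li; rewrite (nth_map 0) ?size_iota // nth_iota // !add0n add0r H nth_cat nth_nseq.
  by case: (ltnP i (size w)) => // h; rewrite nth_default //; case: ifP.
have -> : index sblank (w ++ nseq (L - size w) sblank) = size w.
  rewrite index_cat (negbTE nw) -[L - size w]prednK ?subn_gt0 //=.
  by rewrite eqxx addn0.
by rewrite take_size_cat.
Qed.

(** The number of random bits is at most [256 * v ^ 5], and [300 <= v ^ 9] leads to [Y = v ^ 14].
    Then [100 <= v ^ 7] gives [B = v ^ 7 * Y ^ 4 = v ^ 63], and one more factor [v] absorbs the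
    remaining summands. *)
Lemma pow_bounds v s N K : 1 < s -> s + 2 <= v -> K <= 2 * v -> N = 64 * (s * (K * K)) ->
  let Y := v ^ 14 in let B := v ^ 63 in
  [/\ 100 * (Y * Y * Y * Y) <= B, 9 < Y, N * (s * s) < Y & 2 * v < Y] /\
  [/\ 4 * (s * (s + 2)) + s + 10 < Y, s * s + 1 < Y & s + B + 2 <= v ^ 64].
Proof.
move=> s1' sv Kv -> Y B; have v4 : 4 <= v by lia.
have v2 : 2 <= v by lia.
have c9 : 300 <= v ^ 9 by apply: (@leq_trans (2 ^ 9)) => //; rewrite leq_exp2r.
have c7 : 100 <= v ^ 7 by apply: (@leq_trans (2 ^ 7)) => //; rewrite leq_exp2r.
have EY : Y = v ^ 9 * v ^ 5 by rewrite -expnD.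
have LY : 300 * v ^ 5 <= Y by rewrite EY leq_mul2r c9 orbT.
have EB : B = v ^ 7 * (Y * Y * Y * Y) by rewrite /B /Y -!expnD.
have h8 : v ^ 64 = v * B by rewrite expnS.
have h9 : v <= B by rewrite -{1}[v]expn1 leq_exp2l.
have E5 : v ^ 5 = v * (v * v) * (v * v) by rewrite !expnS expn0 muln1 !mulnA.
have h2 : v * v <= v ^ 5 by rewrite E5 leq_pmull // !muln_gt0; clear -v2; lia.
rewrite h8; clearbody Y B; move: (v ^ 5) (v ^ 7) LY c7 EB E5 h2 => u w LY c7 EB E5 h2 {c9 EY h8}.
have h3 : 4 * v <= v * v by rewrite leq_mul2r v4 orbT.
have h4 : s * (s + 2) <= v * v by apply: leq_mul; clear -sv; lia.
have h5 : s * (K * K) * (s * s) <= 4 * u.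
  apply: (@leq_trans (v * ((2 * v) * (2 * v)) * (v * v))); last by rewrite E5; clear; lia.
  have ls : s <= v by clear -sv; lia.
  by apply: leq_mul; apply: leq_mul; rewrite ?leq_mul.
have h6 : s * s <= s * (s + 2) by rewrite leq_mul2l leq_addr orbT.
have h7 : 64 * (s * (K * K)) * (s * s) <= 256 * u.
  by rewrite -mulnA; move: (_ * (s * s)) h5 => y; clear; lia.
have hB : 4 * B <= v * B by rewrite leq_mul2r v4 orbT.
have hE : 100 * (Y * Y * Y * Y) <= B by rewrite EB leq_mul2r c7 orbT.
split; split=> //.
- by clear -LY h2 h3 v4; lia.
- by clear -LY h7 h2 h3 v4; lia.
- by clear -LY h2 h3 v4; lia.
- by clear -LY h2 h3 h4 sv v4; lia.
- by clear -LY h2 h3 h4 h6 v4; lia.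
by clear -hB h9 sv; lia.
Qed.

(** Hides the two large expressions behind an existential, and extends the run to every later time,
    a halted configuration being stationary. *)
Lemma fpras_machine : exists (A : RTM) (k : nat), forall (x : seq sym) R B (outf : seq bool -> seq sym),
  sblank \notin x -> E B [:: encs x] eBits (encn R) ->
  (forall rho, size rho = R ->
     sblank \notin outf rho /\ E B [:: encB rho; encs x] eMain (encs (outf rho))) ->
  let T' := (size x + B + 2) ^ k in
  exists tau : nat -> nat, [/\ injective tau, forall i, i < R -> tau i < T' &
    forall r T, T' <= T -> let out := outf [seq r (tau i) | i <- iota 0 R] in
    exists tp, [/\ run T r (init_config A x) = @Config A ord_max 0%R tp, size out <= T &
      forall i : nat, tp (Posz i) = nth sblank out i]].
Proof.
have w1 : wf 1 eBits by vm_compute.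
have w2 : wf 2 eMain by vm_compute.
have [k Hk] := machine_spec w1 w2.
exists (machine (prog eBits eMain)), k => x R B outf xb H1 H2 T'.
have [tau [ti tT Hr]] := Hk x R B outf xb H1 H2; exists tau; split=> // r T TT out.
have [t [tp [lt lo Htp Er]]] := Hr r; exists tp; split=> //; last exact: leq_trans TT.
by rewrite -(subnKC (leq_trans lt TT)) run_halted Er.
Qed.

Theorem theorem4p5 :
  exists (A : RTM) (c : nat),
    forall (m n : nat) (P : profile m n) (l : nat) (M : {set 'I_m * 'I_n}),
      is_matching M ->
      forall a b : nat, (0 < a)%N -> (0 < b)%N ->
        let x := encode P l M a b in
        let T := (c * (size x + b %/ a + 2) ^ c)%N in
        (forall r : {ffun 'I_T -> bool}, halts_within A x T (rext r)) /\
        (3 * 2 ^ T <= 4 * #|[set r : {ffun 'I_T -> bool} |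
                             good_run A x r (a%:Q / b%:Q)%R (Sstar P l M)]|)%N.
Proof.
(* The machine needs at most [(size x + B + 2) ^ k] steps, and the base is at most [v ^ 64]. The
   successor makes the constant positive, as it is a factor as well as an exponent. *)
have [A [k Hk]] := fpras_machine; exists A, (64 * k).+1 => m n P l M matM a b a0 b0 x T.
pose v := (size x + b %/ a + 2)%N.
have sge := s_ge P l M a0 b0; rewrite -/x in sge.
have [[K0 _ K1] [_ K2]] := K_facts P l M a0 b0; rewrite -/x in K0 K1 K2.
have [sg [h [N0 Halg Hcnt]]] := alg_correct P l matM a0 b0; rewrite -/x in N0 Halg Hcnt.
have v1 : 1 < v by rewrite /v; lia.
have K1' : kof (size x) (getW x) (parse_nums x) <= 2 * v by apply: leq_trans K1 _; rewrite /v; lia.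
have sv : size x + 2 <= v by rewrite /v -addnA addnCA leq_addl.
have s1' : 1 < size x by lia.
have [[HB Y1 lNW lv] [ls lW lB]] := pow_bounds s1' sv K1' (erefl (getN x)); set Y := v ^ 14 in HB Y1 lNW lv ls lW; set B := v ^ 63 in HB lB.
have lx : size x < Y by apply: leq_ltn_trans lv; rewrite /v; lia.
have lW1 : getW x < Y by apply: ltn_trans lW; rewrite /getW addn1.
have x0 : 0 < size x by lia.
have kb : forall n, n <= size x -> (iter n (kstep (pad (getW x) (nth [::] (parse_nums x) 4)))
     (pad (getW x) (nth [::] (parse_nums x) 3), 1)).2 < Y.
  by move=> j _; apply: leq_ltn_trans (K2 j) _; apply: leq_ltn_trans lv; rewrite /v; lia.
have H1 := E_bits HB Y1 x0 lx lW1 lNW kb.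
have xb : sblank \notin x by rewrite /x encodeE enc_nats_ne.
have [|tau [ti tT Hrun]] := Hk x _ B (alg x) xb H1.
  move=> rho sr; have [p [q [E _ _]]] := Halg rho sr; split; first by rewrite E outword_ne.
  by apply: (E_main HB Y1 x0 lx lW1 lNW kb ls lW); rewrite /bbits sr.
set T' := (size x + B + 2) ^ k in tT Hrun.
have TT : T' <= T.
  rewrite /T -/v; apply: (@leq_trans (v ^ (64 * k).+1)); last by rewrite leq_pmull.
  apply: (@leq_trans (v ^ (64 * k))); last by rewrite leq_exp2l.
  have pj j : (size x + B + 2) ^ j <= (v ^ 64) ^ j by case: j => // j; rewrite leq_exp2r.
  by rewrite expnM; apply: pj.
have {}tT i : i < getN x * getW x -> tau i < T by move=> /tT h'; apply: leq_trans h' TT.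
have run_end r := Hrun r T TT.
split=> [r|]; first by have [tp [E _ _]] := run_end (rext r); rewrite /halts_within E.
set R := getN x * getW x in tT Hcnt.
(* Accuracy of the output, cleared of denominators, as a property of the drawn bits alone. *)
pose F rho := (b%:Z * `|sg%:Z * (nhits (getW x) h (getN x) rho)%:Z - (getN x)%:Z * (Sstar P l M)%:Z| <=
          a%:Z * ((getN x)%:Z * (Sstar P l M)%:Z))%R.
have fc := @ffun_count T R tau F ti tT.
have sub : #|[set r : {ffun 'I_T -> bool} | F [seq rext r (tau i) | i <- iota 0 R]]| <=
  #|[set r : {ffun 'I_T -> bool} | good_run A x r (a%:Q / b%:Q)%R (Sstar P l M)]|.
  apply: subset_leq_card; apply/subsetP => r; rewrite !inE => Fr.
  have [tp [E so Htp]] := run_end (rext r); rewrite /good_run E /= eqxx /=.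
  have [|p [q [Ea vp vq]]] := Halg [seq rext r (tau i) | i <- iota 0 R]; first by rewrite size_map size_iota.
  rewrite (@read_out_word _ _ tp (alg x [seq rext r (tau i) | i <- iota 0 R])) //; first last.
  - by apply: leq_ltn_trans so _; rewrite addn1 ltnS mul2n -addnn addnA leq_addl.
  - by rewrite Ea outword_ne.
  rewrite Ea decode_outword vp vq N0 /=; apply: ratio_le => //.
apply: leq_trans (_ : _ <= 4 * #|[set r : {ffun 'I_T -> bool} | F [seq rext r (tau i) | i <- iota 0 R]]|) _.
  have R2 : 0 < 2 ^ R by rewrite expn_gt0.
  (* Multiplying by [2 ^ R] turns the count of tapes into the sum over drawn bits, where the bound
     from [alg_correct] applies. *)
  rewrite -(leq_pmul2r R2) -lez_nat !PoszM -[X in (_ <= X)%R]mulrA fc.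
  have := ler_wpM2l (isT : (0 <= (2 ^ T)%N%:Z)%R) Hcnt.
  rewrite -/F; set A1 := sumB _ _; rewrite !mulrA ![((2 ^ T)%N%:Z * _)%R]mulrC.
  by [].
by rewrite leq_mul2l sub.
Qed.
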